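(* Let $\theta\in(0,\pi/2)$ and $\alpha>0$. For each $d\ge 3$ let $\mathcal{C}=\mathcal{C}_{d,\theta}\subset\mathbb{R}^d$ be the conical hypersurface and $\mathsf{H}_{\alpha,\mathcal{C}}$ the self-adjoint Schrödinger operator in $L^2(\mathbb{R}^d)$ with $\delta$-interaction of strength $\alpha$ supported on $\mathcal{C}$. Then: (i) for any dimension $d\ge 3$, $\sigma_{\rm ess}(\mathsf{H}_{\alpha,\mathcal{C}})=[-\alpha^2/4,+\infty)$; (ii) for $d=3$, $\#\sigma_{\rm dis}(\mathsf{H}_{\alpha,\mathcal{C}})=\infty$; (iii) for $d\ge 4$, $\#\sigma_{\rm dis}(\mathsf{H}_{\alpha,\mathcal{C}})=0$.
   Context: For $d\ge3$ and $\theta\in(0,\pi/2)$, $\mathcal{C}_{d,\theta}:=\{x=(x_1,\dots,x_d)\in\mathbb{R}^d : x_d=(\cot\theta)\sqrt{x_1^2+\dots+x_{d-1}^2}\}$, equipped with its surface measure; $L^2(\mathcal{C})$ is the corresponding $L^2$-space with inner product $(\cdot,\cdot)_{\mathcal{C}}$. For $\alpha>0$, $\mathsf{H}_{\alpha,\mathcal{C}}$ is the self-adjoint operator in $L^2(\mathbb{R}^d)$ associated, via the first representation theorem, with the closed, densely defined, symmetric, semibounded sesquilinear form $Q_{\alpha,\mathcal{C}}[u,v]:=(\nabla u,\nabla v)_{\mathbb{R}^d}-\alpha(u|_{\mathcal{C}},v|_{\mathcal{C}})_{\mathcal{C}}$, $\mathrm{dom}\,Q_{\alpha,\mathcal{C}}:=H^1(\mathbb{R}^d)$,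 where $u|_{\mathcal{C}}$ denotes the trace. $\sigma_{\rm dis}$ denotes the discrete spectrum (isolated eigenvalues of finite multiplicity) and $\sigma_{\rm ess}$ the essential spectrum (the rest of the spectrum). *)

(* Defs.v *)
From HB Require Import structures.
From mathcomp Require Import all_boot all_order all_algebra.
From mathcomp Require Import all_classical all_reals all_analysis.
From mathcomp Require Import complex ring measurable_realfun.

Set Implicit Arguments.
Unset Strict Implicit.
Unset Printing Implicit Defensive.
Import Order.TTheory GRing.Theory Num.Theory.
Import numFieldNormedType.Exports.

Local Open Scope classical_set_scope.
Local Open Scope ring_scope.
Local Open Scope complex_scope.

Definition rV_display : measure_display.
Proof. exact: (measure_tuple_display default_measure_display). Qed.

(* 'rV[R]_n carries the product sigma-algebra generated by the coordinates,
   which is its Borel sigma-algebra; its topology is the library's. *)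
Section rV_measurable.
Context {R : realType} (n : nat).

Definition rV_coord (i : 'I_n) (x : 'rV[R]_n) : measurableTypeR R := x 0 i.

Let rV_set0 : g_sigma_preimage rV_coord set0.
Proof. exact: sigma_algebra0. Qed.

Let rV_setC A : g_sigma_preimage rV_coord A -> g_sigma_preimage rV_coord (~` A).
Proof. exact: sigma_algebraC. Qed.

Let rV_bigcup (F : _^nat) : (forall i, g_sigma_preimage rV_coord (F i)) ->
  g_sigma_preimage rV_coord (\bigcup_i (F i)).
Proof. exact: sigma_algebra_bigcup. Qed.

HB.instance Definition _ := @isMeasurable.Build rV_display
  'rV[R]_n (g_sigma_preimage rV_coord) rV_set0 rV_setC rV_bigcup.

End rV_measurable.
Lemma measurable_rV_coord (R : realType) n (i : 'I_n) :
  measurable_fun [set: 'rV[R]_n] (@rV_coord R n i).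
Proof.
move=> _ Y mY; rewrite setTI; apply: sub_sigma_algebra => /=.
rewrite -bigcup_seq/=; exists i => /=; first by rewrite mem_index_enum.
by exists Y => //; rewrite setTI.
Qed.

Lemma measurable_fun_rVP d (T : measurableType d) (R : realType) n
    (f : T -> 'rV[R]_n) :
  (forall i, measurable_fun setT (@rV_coord R n i \o f)) ->
  measurable_fun setT f.
Proof.
move=> mf.
suff prefS : g_sigma_preimage (fun i => @rV_coord R n i \o f) `<=` measurable.
  move=> _ A mA; rewrite setTI; apply: prefS.
  by rewrite g_sigma_preimage_comp; exists A => //; rewrite setTI.
apply: smallest_sub; first exact: sigma_algebra_measurable.
case: n => [|n] in f mf *; first by rewrite big_ord0.
rewrite -bigcup_mkord_ord; apply: bigcup_sub => i Ii.
by move=> A [B mB <-]; exact: mf.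
Qed.

Definition rV_rcons (R : realType) n (p : 'rV[R]_n * measurableTypeR R) :
  'rV[R]_n.+1 := \row_i oapp (p.1 0) p.2 (unlift ord_max i).

Lemma measurable_rV_rcons (R : realType) n :
  measurable_fun [set: 'rV[R]_n * measurableTypeR R] (@rV_rcons R n).
Proof.
apply: measurable_fun_rVP => i.
case: (unliftP ord_max i) => [j|] ->.
- rewrite (_ : _ \o _ = rV_coord j \o fst); last first.
    by apply/funext => p; rewrite /rV_coord/= mxE liftK.
  exact: measurableT_comp (measurable_rV_coord j) _.
- rewrite (_ : _ \o _ = snd)//.
  by apply/funext => p; rewrite /rV_coord/= mxE unlift_none.
Qed.

Definition rV_unrcons (R : realType) n (x : 'rV[R]_n.+1) :
  'rV[R]_n * measurableTypeR R :=
  (\row_j x 0 (lift ord_max j), x 0 ord_max).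

Lemma rV_rconsK (R : realType) n : cancel (@rV_rcons R n) (@rV_unrcons R n).
Proof.
move=> [x t]; congr pair; last by rewrite mxE unlift_none.
by apply/rowP => j; rewrite !mxE liftK.
Qed.

Lemma rV_unrconsK (R : realType) n : cancel (@rV_unrcons R n) (@rV_rcons R n).
Proof.
move=> x; apply/rowP => i; rewrite mxE.
by case: (unliftP ord_max i) => [j|] -> //=; rewrite mxE.
Qed.

Lemma measurable_rV_unrcons (R : realType) n :
  measurable_fun setT (@rV_unrcons R n).
Proof.
apply/measurable_fun_pairP; split; last exact: (measurable_rV_coord ord_max).
apply: measurable_fun_rVP => j.
rewrite (_ : _ \o _ = rV_coord (lift ord_max j)).
  exact: measurable_rV_coord.
by apply/funext => x; rewrite /rV_coord/= mxE.
Qed.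

Section lebesgue_succ.
Context {R : realType} (n : nat).
Variable mu : {sigma_finite_measure set 'rV[R]_n -> \bar R}.

Definition lebesgue_rV_succ :=
  pushforward (mu \x (@lebesgue_measure R))%E (@rV_rcons R n).

Let lebesgue_rV_succ0 : lebesgue_rV_succ set0 = 0%E.
Proof. by rewrite /lebesgue_rV_succ /pushforward preimage_set0 measure0. Qed.

Let lebesgue_rV_succ_ge0 A : (0 <= lebesgue_rV_succ A)%E.
Proof. by rewrite /lebesgue_rV_succ /pushforward; exact: measure_ge0. Qed.

Let lebesgue_rV_succ_sigma_additive : semi_sigma_additive lebesgue_rV_succ.
Proof.
move=> F mF tF mUF; rewrite /lebesgue_rV_succ /pushforward preimage_bigcup.
apply: measure_semi_sigma_additive.
- by move=> k; rewrite -[X in measurable X]setTI; exact: measurable_rV_rcons.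
- apply/trivIsetP => /= i j _ _ ij; rewrite -preimage_setI.
  by move/trivIsetP : tF => /(_ _ _ _ _ ij) ->//; rewrite preimage_set0.
- rewrite -preimage_bigcup -[X in measurable X]setTI.
  exact: measurable_rV_rcons.
Qed.

HB.instance Definition _ := isMeasure.Build _ _ _ lebesgue_rV_succ
  lebesgue_rV_succ0 lebesgue_rV_succ_ge0 lebesgue_rV_succ_sigma_additive.

Let lebesgue_rV_succ_sigma_finite : sigma_finite setT lebesgue_rV_succ.
Proof.
have /sigma_finiteP[F [TF ndF Foo]] := sigma_finiteT mu.
have /sigma_finiteP[G [TG ndG Goo]] := sigma_finiteT (@lebesgue_measure R).
exists (fun k => @rV_unrcons R n @^-1` (F k `*` G k)).
  rewrite -preimage_bigcup; apply/esym/seteqP; split=> // x _ /=.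
  have [k _ Fk] : (\bigcup_k F k) (rV_unrcons x).1 by rewrite -TF.
  have [l _ Gl] : (\bigcup_k G k) (rV_unrcons x).2 by rewrite -TG.
  exists (maxn k l) => //; split.
  - by move: Fk; exact/subsetPset/ndF/leq_maxl.
  - by move: Gl; exact/subsetPset/ndG/leq_maxr.
move=> k; have [mF Fkoo] := Foo k; have [mG Gkoo] := Goo k; split.
  rewrite -[X in measurable X]setTI; apply: measurable_rV_unrcons => //.
  exact: measurableX.
rewrite /lebesgue_rV_succ /pushforward -comp_preimage.
rewrite (_ : _ \o _ = id) ?preimage_id; last first.
  by apply/funext => p; rewrite /= rV_rconsK.
by rewrite product_measure1E// lte_mul_pinfty// ge0_fin_numE.
Qed.

HB.instance Definition _ := Measure_isSigmaFinite.Build _ _ _ lebesgue_rV_succ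
  lebesgue_rV_succ_sigma_finite.

End lebesgue_succ.

(* Lebesgue measure on R^n as the n-fold product of the one-dimensional one;
   lebesgue_rV_box gives its values on measurable rectangles. *)
Fixpoint lebesgue_rV (R : realType) n :
    {sigma_finite_measure set 'rV[R]_n -> \bar R} :=
  if n is m.+1 then lebesgue_rV_succ (lebesgue_rV R m) else \d_(0 : 'rV[R]_0).

Lemma lebesgue_rV_box (R : realType) n (A : 'I_n -> set (measurableTypeR R)) :
  (forall i, measurable (A i)) ->
  lebesgue_rV R n [set x : 'rV[R]_n | forall i, A i (x 0 i)] =
  (\prod_(i < n) lebesgue_measure (A i))%E.
Proof.
elim: n A => [A _|n IH A mA].
  rewrite big_ord0 /= diracE mem_set//; by move=> [].
have mB : measurable [set x : 'rV[R]_n | forall i, A (widen_ord (leqnSn n) i) (x 0 i)].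
  have -> : [set x : 'rV[R]_n | forall i, A (widen_ord (leqnSn n) i) (x 0 i)] =
      \bigcap_(i in [set: 'I_n]) (@rV_coord R n i @^-1` A (widen_ord (leqnSn n) i)).
    by apply/seteqP; split=> x /= Ax i => [_|]; exact: Ax.
  apply: fin_bigcap_measurable => // i _.
  by rewrite -[X in measurable X]setTI; exact: measurable_rV_coord.
have -> : [set x : 'rV[R]_n.+1 | forall i, A i (x 0 i)] = rV_unrcons (n:=n) @^-1`
    ([set x : 'rV[R]_n | forall i, A (widen_ord (leqnSn n) i) (x 0 i)] `*` A ord_max).
  have lE (i : 'I_n) : lift ord_max i = widen_ord (leqnSn n) i.
    by apply: val_inj; exact: lift_max.
  apply/seteqP; split=> x /=.
    by move=> Ax; split=> // i; rewrite mxE lE.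
  move=> [/= Ax Am] i; case: (unliftP ord_max i) => [j ->|->]//.
  by have := Ax j; rewrite mxE lE.
rewrite big_ord_recr [in LHS]/= /lebesgue_rV_succ /pushforward.
rewrite -comp_preimage (_ : _ \o _ = id) ?preimage_id; last first.
  by apply/funext => p; rewrite /= rV_rconsK.
rewrite product_measure1E//; congr (_ * _)%E.
by apply: IH => i; exact: mA.
Qed.

Section surface.
Context {R : realType} (n : nat).

Definition enorm (x : 'rV[R]_n) : R := Num.sqrt (\sum_i (x 0 i) ^+ 2).

Definition graph_map (h : 'rV[R]_n -> R) (x : 'rV[R]_n) : 'rV[R]_n.+1 :=
  rV_rcons (x, h x).

Definition area_element (h : 'rV[R]_n -> R) (x : 'rV[R]_n) : R :=
  Num.sqrt (1 + \sum_i ('D_('e_i) h x) ^+ 2).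

(* Surface measure of the hypersurface y = h x in R^(n+1), as a measure on
   R^(n+1) concentrated on the graph:
   sigma(A) = int_{x : (x, h x) in A} sqrt(1 + |grad h|^2) dx. *)
Definition graph_measure (h : 'rV[R]_n -> R) (A : set 'rV[R]_n.+1) : \bar R :=
  (\int[lebesgue_rV R n]_(x in graph_map h @^-1` A) (area_element h x)%:E)%E.

Definition cot (theta : R) : R := cos theta / sin theta.

Definition cone_height (theta : R) (x : 'rV[R]_n) : R := cot theta * enorm x.

(* In R^(n+1), i.e. d = n + 1; ord_max indexes the axial coordinate x_d. *)
Definition cone (theta : R) : set 'rV[R]_n.+1 :=
  [set x | x 0 ord_max =
           cot theta * Num.sqrt (\sum_(i < n) (x 0 (lift ord_max i)) ^+ 2)].

Lemma cone_graph (theta : R) : cone theta = range (graph_map (cone_height theta)).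
Proof.
apply/seteqP; split=> x.
  move=> cx; exists (rV_unrcons x).1 => //.
  rewrite /graph_map -[RHS]rV_unrconsK; congr rV_rcons; congr pair.
  rewrite [RHS]/= cx /cone_height /enorm; congr (_ * Num.sqrt _).
  by apply: eq_bigr => i _; rewrite mxE.
move=> [y _ <-]; rewrite /cone /= /graph_map mxE unlift_none/=.
rewrite /cone_height /enorm; congr (_ * Num.sqrt _).
by apply: eq_bigr => i _; rewrite mxE liftK.
Qed.

Lemma enorm_gt0 (x : 'rV[R]_n) : x != 0 -> 0 < enorm x.
Proof.
move=> x0; rewrite /enorm sqrtr_gt0 lt_neqAle eq_sym sumr_ge0 ?andbT; last first.
  by move=> i _; exact: sqr_ge0.
apply: contra x0; rewrite psumr_eq0 => [/allP x0|i _]; last exact: sqr_ge0.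
apply/eqP/rowP => i; rewrite mxE; apply/eqP; rewrite -sqrf_eq0.
by have := x0 i (mem_index_enum i).
Qed.

Lemma derive_cone_height (theta : R) (x : 'rV[R]_n) i : x != 0 ->
  'D_('e_i) (cone_height theta) x = cot theta * (x 0 i / enorm x).
Proof.
move=> x0.
pose q (t : R) := enorm x ^+ 2 + 2 * x 0 i * t + t ^+ 2.
have hE t : enorm (t *: 'e_i + x) = Num.sqrt (q t).
  congr Num.sqrt; rewrite /q sqr_sqrtr; last first.
    by apply: sumr_ge0 => j _; exact: sqr_ge0.
  rewrite (bigD1 i)//= [in RHS](bigD1 i)//= !mxE !eqxx/=.
  rewrite (eq_bigr (fun j => x 0 j ^+ 2)); last first.
    by move=> j ji; rewrite !mxE (negbTE ji) eqxx/= mulr0 add0r.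
  by rewrite mulr1 sqrrD -mulr_natl; ring.
have -> : 'D_('e_i) (cone_height theta) x =
    'D_1 (fun t => cot theta * Num.sqrt (q t)) 0.
  rewrite /derive; set d := (fun _ : R => _); set d' := (fun _ : R => _).
  suff -> : d = d' by [].
  apply/funext => h; rewrite /d /d' /=.
  by rewrite /cone_height hE addr0 [h%:A]mulr1 -(hE 0) scale0r add0r.
have q0 : q 0 = enorm x ^+ 2 by rewrite /q mulr0 expr0n /= !addr0.
have q0_gt0 : 0 < q 0 by rewrite q0 exprn_gt0// enorm_gt0.
have dq : is_derive (0 : R) 1 q (2 * x 0 i).
  by rewrite /q; apply: is_derive_eq; rewrite /= /GRing.scale/=; ring.
have dS := is_derive1_sqrt q0_gt0.
have dSq := @is_derive1_comp _ Num.sqrt q _ _ _ dS dq.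
have dcSq := @is_deriveZ _ _ _ _ (cot theta) _ _ _ dSq.
rewrite (_ : (fun _ => _) = cot theta \*: (Num.sqrt \o q)) ?derive_val; last first.
  by apply/funext.
rewrite q0 sqrtr_sqr gtr0_norm ?enorm_gt0//= /GRing.scale/=.
have := enorm_gt0 x0; set e := enorm x => e0.
by field; rewrite gt_eqF.
Qed.

Lemma area_element_cone (theta : R) (x : 'rV[R]_n) : x != 0 ->
  area_element (cone_height theta) x = Num.sqrt (1 + cot theta ^+ 2).
Proof.
move=> x0; congr (Num.sqrt (1 + _)).
under eq_bigr => i _ do rewrite derive_cone_height// exprMn (expr_div_n (x 0 i)).
rewrite -mulr_sumr -mulr_suml -[X in X / _]sqr_sqrtr; last first.
  by apply: sumr_ge0 => i _; exact: sqr_ge0.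
by rewrite divff ?mulr1// sqrf_eq0 gt_eqF// enorm_gt0.
Qed.

Lemma measurable_rV_set1 (x : 'rV[R]_n) : measurable [set x].
Proof.
have -> : [set x] = \bigcap_(i in [set: 'I_n]) (@rV_coord R n i @^-1` [set x 0 i]).
  apply/seteqP; split=> y /=; first by move=> ->.
  by move=> yx; apply/rowP => i; exact: yx.
apply: fin_bigcap_measurable => // i _.
rewrite -[X in measurable X]setTI; apply: measurable_rV_coord => //.
Qed.

Lemma measurable_enorm : measurable_fun setT enorm.
Proof.
apply: measurableT_comp.
  by apply: continuous_measurable_fun; exact: sqrt_continuous.
apply: measurable_sum => i; apply: measurable_funX.
exact: (measurable_rV_coord i).
Qed.

Lemma measurable_cone_height (theta : R) : measurable_fun setT (cone_height theta).
Proof. by apply: measurable_funM => //; exact: measurable_enorm. Qed.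

Lemma measurable_graph_map (h : 'rV[R]_n -> R) :
  measurable_fun setT h -> measurable_fun setT (graph_map h).
Proof.
move=> mh; apply: (measurableT_comp (@measurable_rV_rcons R n)).
exact: measurable_fun_pair.
Qed.

Lemma measurable_area_element_cone (theta : R) :
  measurable_fun setT (area_element (cone_height theta)).
Proof.
pose c := Num.sqrt (1 + cot theta ^+ 2).
pose c0 := area_element (cone_height theta) 0.
rewrite (_ : area_element _ = fun x => c + (c0 - c) * \1_[set 0] x).
  apply: measurable_funD => //; apply: measurable_funM => //.
  apply: measurable_indic; exact: measurable_rV_set1.
apply/funext => x; have [->|x0] := eqVneq x 0.
  by rewrite indicE mem_set//= mulr1 addrC subrK.
rewrite area_element_cone// indicE memNset ?mulr0 ?addr0//=.
by move/eqP; exact/negP.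
Qed.

Definition cone_measure (theta : R) : set 'rV[R]_n.+1 -> \bar R :=
  graph_measure (cone_height theta).

Section cone_measure_instance.
Variable theta : R.
Let gamma := graph_map (cone_height theta).

Let mgamma (A : set 'rV[R]_n.+1) : measurable A -> measurable (gamma @^-1` A).
Proof.
move=> mA; rewrite -[X in measurable X]setTI.
by apply: measurable_graph_map => //; exact: measurable_cone_height.
Qed.

Let cone_measure0 : cone_measure theta set0 = 0%E.
Proof. by rewrite /cone_measure /graph_measure preimage_set0 integral_set0. Qed.

Let cone_measure_ge0 A : (0 <= cone_measure theta A)%E.
Proof. by apply: integral_ge0 => x _; rewrite lee_fin sqrtr_ge0. Qed.

Let cone_measure_sigma_additive : semi_sigma_additive (cone_measure theta).
Proof.
move=> F mF tF mUF; rewrite /cone_measure /graph_measure.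
rewrite preimage_bigcup ge0_integral_bigcup//=; first last.
- apply/trivIsetP => /= i j _ _ ij; rewrite -preimage_setI.
  by move/trivIsetP : tF => /(_ _ _ _ _ ij) ->//; rewrite preimage_set0.
- by move=> x _; rewrite lee_fin sqrtr_ge0.
- apply/measurable_EFinP; apply: measurable_funTS.
  exact: measurable_area_element_cone.
- by move=> k; exact: mgamma.
by apply: is_cvg_nneseries => k _ _; exact: cone_measure_ge0.
Qed.

HB.instance Definition _ := isMeasure.Build _ _ _ (cone_measure theta)
  cone_measure0 cone_measure_ge0 cone_measure_sigma_additive.

End cone_measure_instance.

End surface.

(* Elements of L^2(mu; C) are represented by measurable square-integrable
   functions and identified when mu-a.e. equal, so operators are relations
   "A u f" (u in the domain and A u = f) between representatives, and
   injectivity, surjectivity and eigenvalue equations are read mu-a.e. *)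
Section L2_operators.
Context d (T : measurableType d) (R : realType).
Variable mu : {measure set T -> \bar R}.
Implicit Types (f g u v : T -> R[i]) (z : R[i]).

Definition L2 : set (T -> R[i]) :=
  [set f | (fun x => complex.Re (f x)) \in Lfun mu 2%:E /\
           (fun x => complex.Im (f x)) \in Lfun mu 2%:E].

Definition cintegral f : R[i] :=
  (\int[mu]_x complex.Re (f x)) +i* (\int[mu]_x complex.Im (f x)).

Definition inner f g : R[i] := cintegral (fun x => f x * (g x)^*).

Definition sqnorm f : R := complex.Re (inner f f).

Definition operator := (T -> R[i]) -> (T -> R[i]) -> Prop.

(* Operator of the first representation theorem: u is in the domain iff u is in
   D and Q u is represented on D by some f in L^2, and then A u = f. *)
Definition form_operator (D : set (T -> R[i]))
    (Q : (T -> R[i]) -> (T -> R[i]) -> R[i]) : operator :=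
  fun u f => [/\ D u, L2 f & forall v, D v -> Q u v = inner f v].

Definition shift_op (A : operator) z : operator :=
  fun u g => exists2 f, A u f & g = (fun x => f x - z * u x).

(* A - z is a bijection from dom A onto L^2 with bounded inverse. *)
Definition resolvent_set (A : operator) : set R[i] :=
  [set z |
    [/\ forall u g, shift_op A z u g ->
          g = (fun=> 0) %[ae mu] -> u = (fun=> 0) %[ae mu],
        forall h, L2 h ->
          exists u g, shift_op A z u g /\ g = h %[ae mu] &
        exists M : R, forall u g, shift_op A z u g ->
          sqnorm u <= M * sqnorm g]].

Definition spectrum (A : operator) : set R[i] := ~` resolvent_set A.

Definition eigenspace (A : operator) z : set (T -> R[i]) :=
  [set u | exists2 f, A u f & f = (fun x => z * u x) %[ae mu]].

Definition eigenvalue (A : operator) z :=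
  exists2 u, eigenspace A z u & ~ (u = (fun=> 0) %[ae mu]).

Definition finite_multiplicity (A : operator) z :=
  exists (m : nat) (e : 'I_m -> T -> R[i]), forall u, eigenspace A z u ->
    exists c : 'I_m -> R[i], u = (fun x => \sum_i c i * e i x) %[ae mu].

Definition discrete_spectrum (A : operator) : set R[i] :=
  [set z | [/\ isolated (spectrum A : set R[i]^o) z, eigenvalue A z &
               finite_multiplicity A z]].

Definition essential_spectrum (A : operator) : set R[i] :=
  spectrum A `\` discrete_spectrum A.

End L2_operators.

Section sobolev.
Context {R : realType} (n : nat).
Implicit Types (u v g : 'rV[R]_n -> R[i]) (phi : 'rV[R]_n -> R).

Local Notation leb := (lebesgue_rV R n).

(* All iterated partial derivatives exist and are continuous. *)
Definition smooth phi := forall s : seq 'I_n,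
  let psi := foldr (fun i h => 'D_('e_i) h) phi s in
  continuous psi /\ forall i x, derivable psi x 'e_i.

Definition test_function phi :=
  smooth phi /\ compact (closure [set x | phi x != 0]).

Definition ctest_function u :=
  test_function (fun x => complex.Re (u x)) /\
  test_function (fun x => complex.Im (u x)).

Definition weak_partial (i : 'I_n) u g := forall phi, test_function phi ->
  cintegral leb (fun x => u x * ('D_('e_i) phi x)%:C) =
  - cintegral leb (fun x => g x * (phi x)%:C).

Definition H1 : set ('rV[R]_n -> R[i]) :=
  [set u | L2 leb u /\ forall i, exists2 g, L2 leb g & weak_partial i u g].

(* A representative of the i-th weak derivative (unique a.e.). *)
Definition wgrad (i : 'I_n) u : 'rV[R]_n -> R[i] :=
  xget (fun=> 0) [set g | L2 leb g /\ weak_partial i u g].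

Definition sqnormH1 u : R := sqnorm leb u + \sum_i sqnorm leb (wgrad i u).

(* The trace is the continuous extension, in the H^1 norm, of the restriction
   map from C_c^infty(R^n) to L^2(sigma). With sigma a surface measure, L^2(sigma)
   is the L^2 space of the hypersurface on which sigma is concentrated. *)
Definition is_trace (sigma : {measure set 'rV[R]_n -> \bar R}) u g :=
  L2 sigma g /\
  exists phi : nat -> 'rV[R]_n -> R[i],
    [/\ forall k, ctest_function (phi k),
        sqnormH1 (fun x => phi k x - u x) @[k --> \oo] --> (0 : R) &
        sqnorm sigma (fun x => phi k x - g x) @[k --> \oo] --> (0 : R)].

Definition trace (sigma : {measure set 'rV[R]_n -> \bar R}) u :
  'rV[R]_n -> R[i] := xget (fun=> 0) (is_trace sigma u).

End sobolev.

Definition delta_form (R : realType) n (alpha theta : R)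
    (u v : 'rV[R]_n.+1 -> R[i]) : R[i] :=
  \sum_i inner (lebesgue_rV R n.+1) (wgrad i u) (wgrad i v) -
  alpha%:C * inner (cone_measure theta)
               (trace (cone_measure theta) u) (trace (cone_measure theta) v).

(* The ambient space is R^(n+1): the dimension d is n.+1. *)
Definition delta_operator (R : realType) n (alpha theta : R) :
    operator 'rV[R]_n.+1 R :=
  form_operator (lebesgue_rV R n.+1) (@H1 R n.+1) (delta_form alpha theta).

Arguments delta_operator : clear implicits.

(* Main.v *)
(* With beta = alpha / (2 sin theta) and sgn = 1 above the cone, -1 below it, the
   divergence theorem turns the trace term into a volume term: the form is
     q(u, v) = (grad u, grad v) + beta (sgn, D_d (u v)).
   Write r = |x'|, let nu be the unit normal, t and s the distance to the cone and
   the arclength along its generators, and a = alpha / 2.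
   Lower bounds come from 0 <= |grad u + F u|^2 with F = c grad (ln r) + a sgn nu.
   For c = (d - 2) / 2 the mean curvature of the cone cancels and there remains
   q + a^2 >= c (d - 3 - c) / r^2, which is nonnegative for d >= 4; with c = 0 and a
   cutoff near the axis q >= - a^2 - e up to a form compact with respect to q.
   Upper bounds use the ground state psi = r^(- c) exp (- a |t|) of F: on psi g(s)
   the form q + a^2 acts as - g'' + c (d - 3 - c) / r^2. Plane waves g give singular
   sequences at every energy above - a^2. For d = 3 the potential is
   - 1 / (4 r^2) ~ - 1 / (4 (s sin theta)^2), which beats the Hardy constant 1 / 4,
   so that g = sqrt s times bumps in ln s span negative subspaces of any
   dimension. *)
Require Import Defs.
From HB Require Import structures.
From mathcomp Require Import all_boot all_order all_algebra.
From mathcomp Require Import all_classical all_reals all_analysis.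
From mathcomp Require Import complex ring lra measurable_realfun.

Set Implicit Arguments.
Unset Strict Implicit.
Unset Printing Implicit Defensive.
Import Order.TTheory GRing.Theory Num.Theory.
Import numFieldNormedType.Exports.

Local Open Scope classical_set_scope.
Local Open Scope ring_scope.
Local Open Scope complex_scope.

(** * Semi-inner product spaces *)

Section semi_inner_product.
Context (R : realType).

(** As a volume term the interaction makes sense on all of H^1 without a trace theorem, and the same
    identity proves that traces exist. The form is real, so the complex operator acts separately on
    real and imaginary parts and the analysis stays in real function spaces. Two facts replace the
    spectral theorem. The operator is self-adjoint, by Riesz representation alone. Below the
    threshold the form is bounded below up to finitely many squared functionals, which turns
    approximate eigenvectors into eigenvectors and bounds the number of orthonormal ones. The
    obstacle to the estimates is regularity: F jumps across the cone and is singular on the axis,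
    whereas the divergence theorem is at hand only for C1 fields of compact support. So sgn is
    replaced by smooth signs and |x'| by smooth radii, and the fields are shaped so that the
    derivative of the sharpening sign cancels. In lower bounds the smoothing parameter goes to its
    limit; in upper bounds it is fixed last, for a profile already chosen. *)

Lemma quad_disc (a b c : R) : 0 <= a -> 0 <= c ->
  (forall t, 0 <= a - 2 * t * b + t ^+ 2 * c) -> b ^+ 2 <= a * c.
Proof.
move=> a0 c0 H; have [c00|cn0] := eqVneq c 0.
  rewrite c00 mulr0; have [->|bn0] := eqVneq b 0; first by rewrite expr0n.
  have := H ((a + 1) / (2 * b)); rewrite c00.
  have -> : a - 2 * ((a + 1) / (2 * b)) * b + ((a + 1) / (2 * b)) ^+ 2 * 0 = -1.
    by field.
  by rewrite ler0N1.
have cp : 0 < c by rewrite lt_neqAle eq_sym cn0.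
have := H (b / c).
have -> : a - 2 * (b / c) * b + (b / c) ^+ 2 * c = (a * c - b ^+ 2) / c by field.
by rewrite pmulr_lge0 ?invr_gt0// subr_ge0.
Qed.

Lemma sqr_small_eq0 (x : R) : (forall e : R, 0 < e -> x ^+ 2 <= e) -> x = 0.
Proof.
move=> H; apply/eqP; rewrite -sqrf_eq0 eq_le sqr_ge0 andbT.
by apply/ler_addgt0Pr => e e0; rewrite add0r H.
Qed.

Lemma sqrD_le2 (a b : R) : (a + b) ^+ 2 <= 2 * a ^+ 2 + 2 * b ^+ 2.
Proof. by have := sqr_ge0 (a - b); nra. Qed.

Context (X : lmodType R).
Implicit Types (D S : X -> Prop) (B : X -> X -> R) (u v w : X).

Record subspace D : Prop := Subspace {
  ss0 : D 0;
  ssD : forall u v, D u -> D v -> D (u + v);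
  ssZ : forall a u, D u -> D (a *: u) }.

Lemma ssN D u : subspace D -> D u -> D (- u).
Proof. by move=> sD Du; rewrite -scaleN1r; exact: ssZ. Qed.

Lemma ssB D u v : subspace D -> D u -> D v -> D (u - v).
Proof. by move=> sD Du Dv; apply: ssD => //; exact: ssN. Qed.

(** Positivity is not strict: functions that agree almost everywhere are distinct vectors at
    distance 0, so limits and representing vectors are determined only up to null vectors. The
    domain is a predicate because L^2, H^1 and the test functions are nested in one module of
    functions. *)
Record sip D B : Prop := Sip {
  sip_ss : subspace D;
  sipDl : forall u v w, D u -> D v -> D w -> B (u + v) w = B u w + B v w;
  sipZl : forall a u v, D u -> D v -> B (a *: u) v = a * B u v;
  sipC : forall u v, D u -> D v -> B u v = B v u;
  sip_ge0 : forall u, D u -> 0 <= B u u }.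

Definition sip_cvg B (u : nat -> X) l :=
  forall e : R, 0 < e -> exists N : nat, forall i, (N <= i)%N -> B (u i - l) (u i - l) < e.

Definition sip_cauchy B (u : nat -> X) :=
  forall e : R, 0 < e -> exists N : nat, forall i j, (N <= i)%N -> (N <= j)%N ->
    B (u i - u j) (u i - u j) < e.

Definition sip_complete D B := forall u : nat -> X, (forall k, D (u k)) -> sip_cauchy B u ->
  exists2 l, D l & sip_cvg B u l.

Section theory.
Variables (D : X -> Prop) (B : X -> X -> R).
Hypothesis sB : sip D B.
Let sD := sip_ss sB.

Lemma sipDr u v w : D u -> D v -> D w -> B u (v + w) = B u v + B u w.
Proof.
move=> Du Dv Dw; rewrite (sipC sB) ?(sipDl sB)//; last exact: ssD.
by rewrite !(sipC sB _ Du).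
Qed.

Lemma sipZr a u v : D u -> D v -> B u (a *: v) = a * B u v.
Proof.
move=> Du Dv; rewrite (sipC sB)// ?(sipZl sB)//; last exact: ssZ.
by rewrite (sipC sB).
Qed.

Lemma sipNl u v : D u -> D v -> B (- u) v = - B u v.
Proof. by move=> Du Dv; rewrite -scaleN1r (sipZl sB)// mulN1r. Qed.

Lemma sipNr u v : D u -> D v -> B u (- v) = - B u v.
Proof. by move=> Du Dv; rewrite -scaleN1r sipZr// mulN1r. Qed.

Lemma sipBl u v w : D u -> D v -> D w -> B (u - v) w = B u w - B v w.
Proof. by move=> Du Dv Dw; rewrite (sipDl sB)// ?sipNl//; exact: ssN. Qed.

Lemma sipBr u v w : D u -> D v -> D w -> B u (v - w) = B u v - B u w.
Proof. by move=> Du Dv Dw; rewrite sipDr// ?sipNr//; exact: ssN. Qed.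

Lemma sip0l u : D u -> B 0 u = 0.
Proof. by move=> Du; rewrite -(scale0r u) (sipZl sB)// mul0r. Qed.

Lemma sip_sqrD u v : D u -> D v -> B (u + v) (u + v) = B u u + 2 * B u v + B v v.
Proof.
move=> Du Dv; rewrite (sipDl sB) ?sipDr//; try exact: ssD.
by rewrite (sipC sB Dv Du); ring.
Qed.

Lemma sip_sqrB u v : D u -> D v -> B (u - v) (u - v) = B u u - 2 * B u v + B v v.
Proof.
move=> Du Dv; rewrite sip_sqrD//; last exact: ssN.
by rewrite !sipNr// ?sipNl//; [ring|exact: ssN].
Qed.

Lemma sip_sqrZ a u : D u -> B (a *: u) (a *: u) = a ^+ 2 * B u u.
Proof. by move=> Du; rewrite (sipZl sB)// ?sipZr//; [ring|exact: ssZ]. Qed.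

Lemma sip_CS u v : D u -> D v -> (B u v) ^+ 2 <= B u u * B v v.
Proof.
move=> Du Dv; apply: quad_disc; [exact: (sip_ge0 sB)|exact: (sip_ge0 sB)|move=> t].
have Dtv := ssZ sD t Dv.
have := sip_ge0 sB (ssB sD Du Dtv); rewrite sip_sqrB// sip_sqrZ// sipZr//.
by rewrite mulrA.
Qed.

Lemma sip_sqrD_le u v : D u -> D v ->
  B (u + v) (u + v) <= 2 * B u u + 2 * B v v.
Proof.
move=> Du Dv; have := sip_ge0 sB (ssB sD Du Dv).
by rewrite sip_sqrB// sip_sqrD//; lra.
Qed.

Lemma sip_null u v : D u -> D v -> B u u = 0 -> B u v = 0.
Proof.
move=> Du Dv u0; apply: sqr_small_eq0 => e e0.
by rewrite (le_trans (sip_CS Du Dv))// u0 mul0r ltW.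
Qed.

Lemma sip_cvg_cauchy (u : nat -> X) l : (forall k, D (u k)) -> D l -> sip_cvg B u l ->
  sip_cauchy B u.
Proof.
move=> Du Dl ul e e0; have [|N HN] := ul (e / 4); first by rewrite divr_gt0.
exists N => i j Ni Nj; have := HN _ Ni; have := HN _ Nj.
have -> : u i - u j = (u i - l) + - (u j - l) by rewrite opprB addrA subrK.
have Di := ssB sD (Du i) Dl; have Dj := ssB sD (Du j) Dl.
have := sip_sqrD_le Di (ssN sD Dj).
by rewrite sipNr ?sipNl ?opprK//; [lra|exact: ssN].
Qed.

Hypothesis cB : sip_complete D B.

(** Minimise [J u = B u u - 2 f u]. The parallelogram law makes a minimising sequence Cauchy, and
    the variation of [J] along the sequence gives the representation in the limit. *)
Lemma riesz (f : X -> R) (C : R) :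
  (forall u v, D u -> D v -> f (u + v) = f u + f v) ->
  (forall a u, D u -> f (a *: u) = a * f u) ->
  (forall u, D u -> (f u) ^+ 2 <= C * B u u) ->
  exists2 w, D w & forall v, D v -> B w v = f v.
Proof.
move=> fD fZ fC.
wlog C0 : C fC / 0 < C.
  move=> H; apply: (H (`|C| + 1)); last by rewrite ltr_wpDl.
  move=> u Du; apply: (le_trans (fC u Du)); apply: ler_wpM2r; first exact: (sip_ge0 sB).
  by rewrite (le_trans (ler_norm C))// lerDl.
pose J u := B u u - 2 * f u.
have JC u : D u -> - C <= J u.
  move=> Du; have := fC u Du; have := sqr_ge0 (f u - C); rewrite /J => h1 h2.
  rewrite -(ler_pM2l C0); nra.
pose E := [set J u | u in [set u | D u]].
have infE : has_inf E.
  split; first by exists (J 0); exists 0 => //=; exact: ss0.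
  by exists (- C) => _ [u Du <-]; exact: JC.
pose m := inf E.
have mJ u : D u -> m <= J u.
  by move=> Du; apply: ge_inf; [exact: (proj2 infE)|exists u].
have [r r0 kinv] : exists2 r : nat -> R, forall k, 0 < r k &
    forall e : R, 0 < e -> exists N : nat, forall i, (N <= i)%N -> r i < e.
  exists (fun k => k.+1%:R^-1) => [k|e e0]; first by rewrite invr_gt0.
  have [N _ HN] := near_infty_natSinv_lt (PosNum e0).
  by exists N => i Ni; exact: HN.
have /choice [u uP] : forall k : nat, exists u, D u /\ J u < m + r k.
  move=> k; have k0 := r0 k.
  have [_ [u Du <-] Ju] := inf_adherent k0 infE.
  by exists u.
have Du k := (uP k).1.
(* Parallelogram law, with [J] at least [m] at the midpoint of [v] and [w]. *)
have Jhalf v w : D v -> D w -> B (v - w) (v - w) <= 2 * (J v - m) + 2 * (J w - m).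
  move=> Dv Dw; have Dvw := ssD sD Dv Dw; have := mJ _ (ssZ sD 2^-1 Dvw).
  rewrite /J sip_sqrZ// sip_sqrD// fZ// fD// sip_sqrB//.
  lra.
have [|w Dw uw] := cB Du.
  move=> e e0; have [|N HN] := kinv (e / 4); first by rewrite divr_gt0.
  exists N => i j Ni Nj.
  have := Jhalf _ _ (Du i) (Du j); have := (uP i).2; have := (uP j).2.
  by have := HN _ Ni; have := HN _ Nj; lra.
exists w => // v Dv; apply/eqP; rewrite -subr_eq0; apply/eqP.
apply: sqr_small_eq0 => e e0.
have v0 := sip_ge0 sB Dv.
pose e' := e / (4 * (B v v + 1)).
have e'0 : 0 < e' by rewrite divr_gt0// mulr_gt0// ltr_wpDl.
have e'v : e' * B v v <= e / 4.
  by rewrite /e' mulrAC ler_pdivrMr ?mulr_gt0 ?ltr_wpDl//; nra.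
have [N1 HN1] := uw _ e'0; have [N2 HN2] := kinv _ e'0.
pose k := maxn N1 N2.
have h1 := HN1 k (leq_maxl _ _); have h2 := HN2 k (leq_maxr _ _).
(* For every [t], [J (u k - t v)] is at least [m], hence exceeds [J (u k) - r k]. This is a
   nonnegative quadratic polynomial in [t], whose discriminant yields the bound [r k * B v v]. *)
have a1 : (B (u k) v - f v) ^+ 2 <= e / 4.
  apply: le_trans e'v.
  apply: (@le_trans _ _ (r k * B v v)); last by apply: ler_wpM2r => //; exact: ltW.
  apply: quad_disc => //; first exact: ltW.
  move=> t; have Dtv := ssZ sD (- t) Dv.
  have := mJ _ (ssD sD (Du k) Dtv); have := (uP k).2.
  rewrite /J sip_sqrD// sipZr// sip_sqrZ// fD// fZ//; nra.
have a2 : (B (u k) v - B w v) ^+ 2 <= e / 4.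
  rewrite -sipBl//; apply: (le_trans (sip_CS (ssB sD (Du k) Dw) Dv)).
  by apply: le_trans e'v; apply: ler_wpM2r => //; exact: ltW.
have := sqrD_le2 (B (u k) v - f v) (- (B (u k) v - B w v)).
rewrite sqrrN; have -> : B (u k) v - f v + - (B (u k) v - B w v) = B w v - f v by ring.
lra.
Qed.

End theory.

Definition sip_closure D B S u :=
  D u /\ forall e : R, 0 < e -> exists2 s, S s & B (u - s) (u - s) < e.

(* The orthogonal complement of S decides density: project onto the closure. *)
Lemma sip_dense D B S : sip D B -> sip_complete D B -> subspace S ->
  (forall s, S s -> D s) ->
  (forall u, D u -> (forall s, S s -> B u s = 0) -> B u u = 0) ->
  forall u, D u -> sip_closure D B S u.
Proof.
move=> sB cB sS SD orth u Du; have sD := sip_ss sB.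
pose D0 := sip_closure D B S.
have sD0 : subspace D0.
  split.
  - split=> [|e e0]; first exact: ss0.
    by exists 0; [exact: ss0|rewrite subr0 (sip0l sB)//; exact: ss0].
  - move=> v w [Dv Hv] [Dw Hw]; split=> [|e e0]; first exact: ssD.
    have [|s Ss sv] := Hv (e / 4); first by rewrite divr_gt0.
    have [|r Sr rw] := Hw (e / 4); first by rewrite divr_gt0.
    exists (s + r); first exact: ssD.
    rewrite opprD addrACA.
    have := sip_sqrD_le sB (ssB sD Dv (SD _ Ss)) (ssB sD Dw (SD _ Sr)).
    lra.
  - move=> a v [Dv Hv]; split=> [|e e0]; first exact: ssZ.
    have a0 : 0 < a ^+ 2 + 1 by rewrite ltr_wpDl// sqr_ge0.
    have [|s Ss sv] := Hv (e / (a ^+ 2 + 1)); first by rewrite divr_gt0.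
    exists (a *: s); first exact: ssZ.
    have Dvs := ssB sD Dv (SD _ Ss).
    rewrite -scalerBr (sip_sqrZ sB)//; move: sv; rewrite ltr_pdivlMr//.
    have := sip_ge0 sB Dvs; nra.
have D0D v : D0 v -> D v by case.
have sB0 : sip D0 B.
  split=> //.
  - by move=> ? ? ? *; apply: (sipDl sB); exact: D0D.
  - by move=> ? ? ? *; apply: (sipZl sB); exact: D0D.
  - by move=> ? ? *; apply: (sipC sB); exact: D0D.
  - by move=> ? *; apply: (sip_ge0 sB); exact: D0D.
have cB0 : sip_complete D0 B.
  move=> v Dv cv; have [l Dl vl] := cB v (fun k => D0D _ (Dv k)) cv.
  exists l => //; split=> // e e0.
  have [|N HN] := vl (e / 4); first by rewrite divr_gt0.
  have [|s Ss sv] := (Dv N).2 (e / 4); first by rewrite divr_gt0.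
  exists s => //; have := HN N (leqnn _).
  have DvN := D0D _ (Dv N).
  have Dvl := ssB sD DvN Dl.
  have := sip_sqrD_le sB (ssN sD Dvl) (ssB sD DvN (SD _ Ss)).
  rewrite (sipNr sB) ?(sipNl sB) ?opprK//; last exact: ssN.
  by rewrite opprB addrA subrK; lra.
(* [w] is the projection of [u] onto the closure, obtained by representing [B u] there; the
   difference [u - w] is orthogonal to [S], hence null. *)
have [w D0w wP] : exists2 w, D0 w & forall v, D0 v -> B w v = B u v.
  apply: (riesz sB0 cB0 (C := B u u)) => [a b Da Db|a b Db|a Da].
  - by rewrite (sipDr sB)//; exact: D0D.
  - by rewrite (sipZr sB)//; exact: D0D.
  - by apply: (sip_CS sB) => //; exact: D0D.
have SD0 s : S s -> D0 s.
  move=> Ss; split=> [|e e0]; first exact: SD.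
  by exists s => //; rewrite subrr (sip0l sB)//; exact: ss0.
have Dw := D0D _ D0w.
have uw0 : B (u - w) (u - w) = 0.
  apply: orth => [|s Ss]; first exact: ssB.
  by rewrite (sipBl sB)// ?wP ?subrr//; [exact: SD0|exact: SD].
split=> // e e0; have [|s Ss sw] := D0w.2 (e / 2); first by rewrite divr_gt0.
exists s => //; rewrite -(subrK w u) -addrA.
have := sip_sqrD_le sB (ssB sD Du Dw) (ssB sD Dw (SD _ Ss)).
by rewrite uw0; lra.
Qed.

End semi_inner_product.

(** * Square-integrable functions *)

HB.lock Definition rint d (T : measurableType d) (R : realType)
  (mu : {measure set T -> \bar R}) (f : T -> R) : R := \int[mu]_x f x.

Section L2_real.
Context d (T : measurableType d) (R : realType) (mu : {measure set T -> \bar R}).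
Implicit Types (f g h u v : T -> R).

Local Notation ri := (rint mu).

Definition intg f : bool := mu.-integrable setT (EFin \o f).

Lemma rintE f : ri f = \int[mu]_x f x.
Proof. by rewrite rint.unlock. Qed.

Lemma intg_meas f : intg f -> measurable_fun setT f.
Proof. by move=> /integrableP[/measurable_EFinP]. Qed.

Lemma intg_dom f g : measurable_fun setT f -> (forall x, `|f x| <= g x) ->
  intg g -> intg f.
Proof.
move=> mf fg ig; apply: (le_integrable _ _ _ ig) => //.
  exact/measurable_EFinP.
by move=> x _ /=; rewrite lee_fin (le_trans (fg x))// ler_norm.
Qed.

Lemma intgD f g : intg f -> intg g -> intg (fun x => f x + g x).
Proof. by move=> If Ig; have := integrableD measurableT If Ig. Qed.

Lemma intgZ a f : intg f -> intg (fun x => a * f x).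
Proof. by move=> If; have := integrableZl measurableT a If. Qed.

Lemma intgN f : intg f -> intg (fun x => - f x).
Proof.
move=> /(intgZ (-1)); congr (is_true (intg _)).
by apply/funext => x; rewrite mulN1r.
Qed.

Lemma intgB f g : intg f -> intg g -> intg (fun x => f x - g x).
Proof. by move=> If /intgN; exact: intgD. Qed.

Lemma intg0 : intg (fun=> 0).
Proof. exact: integrable0. Qed.

Lemma intg_norm f : intg f -> intg (fun x => `|f x|).
Proof. by move=> /integrable_norm. Qed.

Lemma intg_sum (I : Type) (s : seq I) (F : I -> T -> R) :
  (forall i, intg (F i)) -> intg (fun x => \sum_(i <- s) F i x).
Proof.
move=> IF; elim: s => [|i s IH].
  by under eq_fun do rewrite big_nil; exact: intg0.
by under eq_fun do rewrite big_cons; exact: intgD.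
Qed.

Lemma rint_ext f g : f =1 g -> ri f = ri g.
Proof. by move=> fg; congr ri; exact/funext. Qed.

Lemma rintD f g : intg f -> intg g -> ri (fun x => f x + g x) = ri f + ri g.
Proof. by move=> If Ig; rewrite !rintE RintegralD. Qed.

Lemma rintZ a f : intg f -> ri (fun x => a * f x) = a * ri f.
Proof. by move=> If; rewrite !rintE RintegralZl. Qed.

Lemma rintN f : intg f -> ri (fun x => - f x) = - ri f.
Proof.
move=> If; rewrite -mulN1r -rintZ//; apply: rint_ext => x.
by rewrite mulN1r.
Qed.

Lemma rintB f g : intg f -> intg g -> ri (fun x => f x - g x) = ri f - ri g.
Proof. by move=> If Ig; rewrite rintD ?rintN//; exact: intgN. Qed.

Lemma rint0 : ri (fun=> 0) = 0.
Proof. by rewrite rintE /Rintegral integral0. Qed.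

Lemma rint_sum (I : Type) (s : seq I) (F : I -> T -> R) :
  (forall i, intg (F i)) ->
  ri (fun x => \sum_(i <- s) F i x) = \sum_(i <- s) ri (F i).
Proof.
move=> IF; elim: s => [|i s IH].
  by rewrite big_nil -[RHS]rint0; apply: rint_ext => x; rewrite big_nil.
rewrite big_cons -IH -rintD//; last exact: intg_sum.
by apply: rint_ext => x; rewrite big_cons.
Qed.

Lemma rint_ge0 f : (forall x, 0 <= f x) -> 0 <= ri f.
Proof. by move=> f0; rewrite rintE; apply: Rintegral_ge0. Qed.

Lemma rint_le f g : intg f -> intg g -> (forall x, f x <= g x) -> ri f <= ri g.
Proof. by move=> If Ig fg; rewrite !rintE; apply: le_Rintegral. Qed.

Lemma rint_abs f : intg f -> `|ri f| <= ri (fun x => `|f x|).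
Proof. by move=> If; rewrite !rintE; apply: le_normr_Rintegral. Qed.

Lemma EFin_rint f : intg f -> (\int[mu]_x (f x)%:E)%E = (ri f)%:E.
Proof.
move=> If; rewrite rintE /Rintegral fineK//.
exact: integrable_fin_num.
Qed.

Lemma rint_dct (F : nat -> T -> R) f g :
  (forall k, measurable_fun setT (F k)) ->
  (forall x, F k x @[k --> \oo] --> f x) -> intg g ->
  (forall k x, `|F k x| <= g x) ->
  intg f /\ ri (F k) @[k --> \oo] --> ri f.
Proof.
move=> mF Ff Ig Fg.
have mf : measurable_fun setT f by apply: (measurable_fun_cvg mF) => x _; exact: Ff.
have fg x : `|f x| <= g x.
  have /cvg_norm cn := Ff x; rewrite -(cvg_lim _ cn)//.
  by apply: limr_le; [apply/cvg_ex; eexists; exact: cn|exact: nearW].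
have If : intg f by exact: intg_dom fg Ig.
split=> //; have IF k : intg (F k) by exact: intg_dom (Fg k) Ig.
have := @dominated_cvg _ _ _ mu setT measurableT (fun k => EFin \o F k)
  (EFin \o f) (EFin \o g).
move=> /(_ (fun k => (measurable_EFinP _ _).2 (mF k))) H.
have {}H : (\int[mu]_x (F k x)%:E)%E @[k --> \oo] --> (\int[mu]_x (f x)%:E)%E.
  apply: H => //.
  - by move=> x _; apply: cvg_EFin; [exact: nearW|exact: Ff].
  - by move=> k x _ /=; rewrite lee_fin.
move: H; rewrite EFin_rint//.
under eq_cvg do rewrite EFin_rint//.
by move/fine_cvg.
Qed.

Lemma rint_ae f g : intg f -> measurable_fun setT g -> f = g %[ae mu] ->
  intg g /\ ri g = ri f.
Proof.
move=> If mg fg; have mf := intg_meas If.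
have fg' : ae_eq mu setT (EFin \o f) (EFin \o g).
  by apply: filterS fg => x /= H /H ->.
split; last first.
  rewrite !rintE /Rintegral; congr fine; apply: ae_eq_integral => //.
  - exact/measurable_EFinP.
  - exact/measurable_EFinP.
  - by apply: filterS fg' => x /= H /H ->.
apply/integrableP; split; first exact/measurable_EFinP.
move/integrableP : If => [_]; congr (_ < _)%E.
apply: ae_eq_integral => //.
- by apply: measurableT_comp => //; exact/measurable_EFinP.
- by apply: measurableT_comp => //; exact/measurable_EFinP.
- by apply: filterS fg' => x /= H /H [->].
Qed.

Lemma rint_eq0 f : (forall x, 0 <= f x) -> intg f -> ri f = 0 ->
  f = (fun=> 0) %[ae mu].
Proof.
move=> f0 If rf; have mf := intg_meas If.
have : ae_eq mu setT (EFin \o f) (cst 0%E).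
  apply/(ae_eq_integral_abs _ measurableT); first exact/measurable_EFinP.
  rewrite -[RHS]/(0%:E) -rf -EFin_rint//; apply: eq_integral => x _ /=.
  by rewrite ger0_norm.
by apply: filterS => x /= H /H[].
Qed.

Lemma rint_fatou (F : nat -> T -> R) f C :
  (forall k x, 0 <= F k x) -> (forall k, intg (F k)) ->
  (forall k, ri (F k) <= C) -> (forall x, F k x @[k --> \oo] --> f x) ->
  intg f /\ ri f <= C.
Proof.
move=> F0 IF FC Ff.
have mf : measurable_fun setT f.
  by apply: (measurable_fun_cvg (fun k => intg_meas (IF k))) => x _; exact: Ff.
have f0 x : 0 <= f x.
  rewrite -(cvg_lim _ (Ff x))//.
  by apply: limr_ge; [apply/cvg_ex; eexists; exact: Ff|exact: nearW].
have H : (\int[mu]_x (f x)%:E <= C%:E)%E.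
  have := @fatou _ _ _ mu setT measurableT (fun k => EFin \o F k).
  move=> /(_ (fun k => (measurable_EFinP _ _).2 (intg_meas (IF k)))).
  move=> /(_ (fun k x _ => F0 k x)) /=.
  under eq_integral => x _.
    rewrite (_ : limn_einf _ = (f x)%:E); last first.
      apply: (cvg_limn_einf_sup _).1.
      by apply: cvg_EFin; [exact: nearW|exact: Ff].
    over.
  move=> /le_trans; apply.
  rewrite (_ : (fun k => _) = (fun k => (ri (F k))%:E)); last first.
    by apply/funext => k; rewrite EFin_rint.
  rewrite limn_einf_lim (cvg_lim _ (@cvg_einfs_sup _ _))//.
  apply: ge_ereal_sup => _ [k _ <-].
  apply: (@le_trans _ _ (ri (F k))%:E); last by rewrite lee_fin.
  by apply: ereal_inf_lbound; exists k => /=.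
have If : intg f.
  apply/integrableP; split; first exact/measurable_EFinP.
  under eq_integral => x _ do rewrite /= ger0_norm//.
  by rewrite (le_lt_trans H)// ltry.
by split=> //; rewrite -lee_fin -EFin_rint.
Qed.

Definition sq f := measurable_fun setT f /\ intg (fun x => f x ^+ 2).

Definition dot f g := ri (fun x => f x * g x).

Lemma sq_mul f g : sq f -> sq g -> intg (fun x => f x * g x).
Proof.
move=> [mf If] [mg Ig]; apply: (intg_dom _ _ (intgD If Ig)).
  exact: measurable_funM.
by move=> x; rewrite ler_norml; apply/andP; split;
  have := sqr_ge0 (f x + g x); have := sqr_ge0 (f x - g x); nra.
Qed.

Lemma sq_ae f g : sq f -> measurable_fun setT g -> f = g %[ae mu] -> sq g.
Proof.
move=> [mf If] mg fg; split=> //.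
apply: (rint_ae If _ _).1; first exact: measurable_funX.
by apply: filterS fg => x /= H /H ->.
Qed.

Lemma sq_subspace : subspace sq.
Proof.
split.
- split; first exact: measurable_cst.
  by rewrite (_ : (fun _ => _) = fun=> 0) ?intg0//; apply/funext => x; rewrite expr0n.
- move=> f g [mf If] [mg Ig]; split; first exact: measurable_funD.
  apply: (intg_dom _ _ (intgZ 2 (intgD If Ig))).
    by apply: measurable_funX; exact: measurable_funD.
  move=> x /=; rewrite ger0_norm ?sqr_ge0// mulrDr.
  exact: sqrD_le2.
- move=> a f [mf If]; split; first exact: measurable_funM.
  have := intgZ (a ^+ 2) If; congr (is_true (intg _)); apply/funext => x.
  by rewrite /= -exprMn.
Qed.

Lemma sq_meas f : sq f -> measurable_fun setT f. Proof. by case. Qed.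

Lemma sq_sip : sip sq dot.
Proof.
split.
- exact: sq_subspace.
- move=> f g h sf sg sh; rewrite /dot -rintD; try exact: sq_mul.
  by apply: rint_ext => x; rewrite /= mulrDl.
- move=> a f g sf sg; rewrite /dot -rintZ; last exact: sq_mul.
  by apply: rint_ext => x; rewrite /= mulrA.
- by move=> f g _ _; apply: rint_ext => x; rewrite mulrC.
- by move=> f _; apply: rint_ge0 => x; rewrite -expr2 sqr_ge0.
Qed.

Lemma dotC f g : dot f g = dot g f.
Proof. by apply: rint_ext => x; rewrite mulrC. Qed.

Lemma dot_ge0 f : 0 <= dot f f.
Proof. by apply: rint_ge0 => x; rewrite -expr2 sqr_ge0. Qed.

Lemma dot_eq0 f : sq f -> dot f f = 0 -> f = (fun=> 0) %[ae mu].
Proof.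
move=> sf f0.
have := rint_eq0 (fun x => _ : 0 <= f x * f x) (sq_mul sf sf) f0.
move=> /(_ (fun x => sqr_ge0 (f x))).
apply: filterS => x /= H /H /eqP.
by rewrite mulf_eq0 orbb => /eqP.
Qed.

Lemma dot_ae f g h : sq f -> sq g -> sq h -> f = g %[ae mu] -> dot f h = dot g h.
Proof.
move=> sf sg sh fg; apply/esym; apply: (rint_ae (sq_mul sf sh) _ _).2.
  by apply: measurable_funM; exact: sq_meas.
by apply: filterS fg => x /= H /H ->.
Qed.

Lemma geometric_cauchy (v : nat -> R) (C : R) :
  (forall k, `|v k.+1 - v k| <= C * 2^-1 ^+ k) -> cvgn v.
Proof.
move=> H.
have C0 : 0 <= C by have := le_trans (normr_ge0 _) (H 0%N); rewrite expr0 mulr1.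
have h : cvgn (series (telescope v)).
  apply: normed_cvg; apply: (series_le_cvg (v_ := geometric C 2^-1)).
  - by move=> k; exact: normr_ge0.
  - by move=> k; rewrite /geometric /= mulr_ge0// exprn_ge0.
  - by move=> k; exact: H.
  - by apply: is_cvg_geometric_series; rewrite ger0_norm// invf_lt1// ltr1n.
rewrite (_ : v = (fun k => v 0%N + series (telescope v) k)); last first.
  by apply/funext => k; exact: eq_sum_telescope.
by apply: is_cvgD => //; exact: is_cvg_cst.
Qed.

(** The series of the [4 ^ k (v (k+1) - v k) ^ 2] has a finite integral, because its terms integrate
    to at most [4 ^ - k]. Where its sum G is finite, the increments are at most [sqrt G * 2 ^ - k],
    which is summable. *)
Lemma ae_geometric_cvg (v : nat -> T -> R) : (forall k, sq (v k)) ->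
  (forall k, dot (v k.+1 - v k) (v k.+1 - v k) <= 16^-1 ^+ k) ->
  exists2 E, measurable E /\ {ae mu, forall x, E x} &
    forall x, E x -> cvgn (fun k => v k x).
Proof.
move=> sv Hv.
pose dv k x := v k.+1 x - v k x.
have sd k : sq (dv k) by apply: (ssB sq_subspace); exact: sv.
pose g k x := ((4 ^+ k * dv k x ^+ 2)%:E : \bar R).
have g0 k x : (0 <= g k x)%E by rewrite lee_fin mulr_ge0 ?sqr_ge0// exprn_ge0.
have mg k : measurable_fun setT (g k).
  apply/measurable_EFinP; apply: measurable_funM => //.
  by apply: measurable_funX; exact: sq_meas.
pose G x := (\sum_(0 <= k <oo) g k x)%E.
have G0 x : (0 <= G x)%E by apply: nneseries_ge0.
have mG : measurable_fun setT G by apply: ge0_emeasurable_sum.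
have IG : (\int[mu]_x G x < +oo)%E.
  rewrite integral_nneseries//.
  apply: (@le_lt_trans _ _ (\sum_(0 <= k <oo) (geometric 1 4^-1 k)%:E)%E).
    apply: lee_nneseries => [k _ _|k _]; first exact: integral_ge0.
    rewrite EFin_rint; last by apply: intgZ; case: (sd k).
    rewrite lee_fin rintZ; last by case: (sd k).
    rewrite (_ : ri _ = dot (v k.+1 - v k) (v k.+1 - v k)); last first.
      by apply: rint_ext => x; rewrite expr2.
    rewrite /geometric /= mul1r; apply: (le_trans (ler_wpM2l _ (Hv k))).
      by rewrite exprn_ge0.
    by rewrite -exprMn (_ : 4 * 16^-1 = 4^-1 :> R)//; field.
  have cg : cvgn (series (geometric (1 : R) 4^-1)).
    by apply: is_cvg_geometric_series; rewrite ger0_norm// invf_lt1// ltr1n.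
  rewrite (_ : limn _ = (limn (series (geometric (1:R) 4^-1)))%:E) ?ltry//.
  rewrite -EFin_lim//; congr (limn _); apply/funext => k /=.
  by rewrite -sumEFin /=.
exists [set x | (G x < +oo)%E].
  split; first by rewrite -[X in measurable X]setTI; exact: emeasurable_fun_infty_o.
  have /integrable_ae : mu.-integrable setT G.
    apply/integrableP; split=> //.
    by under eq_integral => x _ do rewrite gee0_abs//.
  move=> /(_ measurableT); apply: filterS => x /(_ I) /=.
  by rewrite ge0_fin_numE.
move=> x /= Gx.
apply: (@geometric_cauchy _ (Num.sqrt (fine (G x)))) => k.
have gx0 : 0 <= fine (G x) by exact: fine_ge0.
rewrite -[X in X <= _]ger0_norm// -(ger0_norm (_ : 0 <= Num.sqrt _ * _)); last first.
  by rewrite mulr_ge0 ?sqrtr_ge0// exprn_ge0.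
rewrite normr_id -ler_sqr ?nnegrE// [X in X <= _]real_normK ?num_real//.
rewrite [X in _ <= X]real_normK ?num_real// exprMn sqr_sqrtr// -exprM mulnC exprM.
rewrite (_ : 2^-1 ^+ 2 = 4^-1 :> R); last by field.
rewrite exprVn ler_pdivlMr ?exprn_gt0// mulrC -lee_fin fineK; last by rewrite ge0_fin_numE.
have := @nneseries_lim_ge _ (fun j => g j x) xpredT 0%N k.+1 (fun j _ _ => g0 j x).
apply: le_trans; rewrite big_nat_recr//=.
by apply: leeDr; exact: sume_ge0.
Qed.

(** Riesz-Fischer: a fast subsequence converges almost everywhere, and Fatou's lemma compares its
    pointwise limit with the whole sequence. *)
Lemma sq_complete : sip_complete sq dot.
Proof.
move=> u su cu.
have /choice [n0 Hn0] : forall k, exists N : nat, forall i j, (N <= i)%N ->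
    (N <= j)%N -> dot (u i - u j) (u i - u j) < 16^-1 ^+ k.
  by move=> k; apply: cu; rewrite exprn_gt0.
(* Both [n k] and [n k.+1] lie beyond [n0 k], so consecutive terms of the subsequence are within
   [16 ^ - k]. *)
pose n k := ((\sum_(j < k.+1) n0 j) + k)%N.
have n0n k : (n0 k <= n k)%N by rewrite /n big_ord_recr/= -addnA addnCA leq_addr.
have n0n1 k : (n0 k <= n k.+1)%N.
  by rewrite /n 2!big_ord_recr/= -!addnA addnCA leq_addr.
have kn k : (k <= n k)%N by rewrite /n leq_addl.
pose v k := u (n k).
have sv k : sq (v k) by exact: su.
have [|E [mE aE] cE] := ae_geometric_cvg sv.
  by move=> k; apply/ltW/Hn0.
(* Multiplying by the indicator of the convergence set gives a sequence that converges everywhere,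
   so that its limit is measurable. *)
pose w k x := v k x * \1_E x.
pose l x := limn (fun k => w k x).
have wl x : w k x @[k --> \oo] --> l x.
  suff : cvgn (fun k => w k x) by [].
  rewrite /w indicE; have [/set_mem Ex|_] := boolP (x \in E).
    rewrite (_ : (fun k => _) = (fun k => v k x)); first exact: cE.
    by apply/funext => k; rewrite mulr1.
  rewrite (_ : (fun k => _) = (fun k => 0)); first exact: is_cvg_cst.
  by apply/funext => k; rewrite mulr0.
have mw k : measurable_fun setT (w k).
  by apply: measurable_funM; [exact: sq_meas|exact: measurable_indic].
have ml : measurable_fun setT l by apply: (measurable_fun_cvg mw) => x _; exact: wl.
have aEm f : f = (fun x => f x * \1_E x) %[ae mu].
  by apply: filterS aE => x Ex _; rewrite indicE mem_set// mulr1.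
have sE f : sq f -> sq (fun x => f x * \1_E x).
  move=> sf; apply: (sq_ae sf); last exact: aEm.
  by apply: measurable_funM; [exact: sq_meas|exact: measurable_indic].
have key (e : R) : 0 < e -> exists N : nat, forall i, (N <= i)%N ->
    sq (l - u i) /\ dot (l - u i) (l - u i) <= e.
  move=> e0; have [N HN] := cu _ e0; exists N => i Ni.
  have sE1 : sq (fun x => u i x * \1_E x) by exact: sE.
  have := @rint_fatou (fun k x => (w (k + N)%N x - u i x * \1_E x) ^+ 2)
    (fun x => (l x - u i x * \1_E x) ^+ 2) e.
  case.
  - by move=> k x; exact: sqr_ge0.
  - by move=> k; have [_] := ssB sq_subspace (sE _ (sv (k + N)%N)) sE1.
  - move=> k; apply: le_trans (ltW (HN (n (k + N)%N) i _ Ni)); last first.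
      exact: leq_trans (leq_addl _ _) (kn _).
    have sd : sq (v (k + N)%N - u i) by apply: (ssB sq_subspace).
    rewrite le_eqVlt; apply/orP; left; apply/eqP.
    apply: (rint_ae (sq_mul sd sd) _ _).2.
      apply: measurable_funX; apply: measurable_funB; first exact: mw.
      exact: sq_meas.
    apply: filterS aE => x Ex _; rewrite /w indicE mem_set// !mulr1.
    by rewrite expr2.
  - move=> x; have h : w (k + N)%N x @[k --> \oo] --> l x.
      by rewrite (cvg_shiftn N (fun k => w k x)); exact: wl.
    rewrite expr2; under eq_cvg do rewrite expr2.
    by apply: cvgM; apply: cvgB => //; exact: cvg_cst.
  - move=> I1 I2.
    have s1 : sq (fun x => l x - u i x * \1_E x).
      by split=> //; apply: measurable_funB => //; exact: sq_meas.
    have ea : (fun x => l x - u i x * \1_E x) = l - u i %[ae mu].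
      by apply: filterS aE => x Ex _; rewrite indicE mem_set// mulr1.
    have s2 : sq (l - u i).
      by apply: (sq_ae s1) => //; apply: measurable_funB => //; exact: sq_meas.
    split=> //; rewrite -(dot_ae s1 s2 s2 ea) dotC -(dot_ae s1 s2 s1 ea).
    by apply: le_trans I2; rewrite le_eqVlt; apply/orP; left; apply/eqP;
      apply: rint_ext => x; rewrite expr2.
exists l.
  have [N /(_ N (leqnn _)) [s _]] := key _ ltr01.
  by rewrite -(subrK (u N) l); apply: (ssD sq_subspace).
move=> e e0; have [|N HN] := key (e / 2); first by rewrite divr_gt0.
exists N => i Ni; have [s h] := HN i Ni.
rewrite -(opprB l) (sipNl sq_sip) ?(sipNr sq_sip) ?opprK//; last first.
  exact: (ssN sq_subspace).
lra.
Qed.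

Lemma LfunP2 f : f \in Lfun mu 2%:E <-> sq f.
Proof.
split=> [Lf|[mf If]].
  split; last exact: Lfun2_integrable_sqr.
  by have /sub_Lfun_mfun := Lf; rewrite inE.
rewrite inE; apply/andP; split; first by rewrite inE.
rewrite inE /finite_norm unlock /Lnorm.body /=.
apply: poweR_lty.
move/integrableP : If => [_]; congr (_ < _)%E.
apply: eq_integral => x _ /=.
by rewrite powR_mulrn ?normr_ge0// normrX.
Qed.

End L2_real.

(** * Lebesgue measure on row vectors *)

Section rV_base.
Context {R : realType}.
Local Notation leb n := (lebesgue_rV R n).
Local Notation leb1 := (@lebesgue_measure R).

Lemma cvg_rV (T : Type) (F : set_system T) (FF : Filter F) n
    (g : T -> 'rV[R]_n) (l : 'rV[R]_n) :
  (forall i, (fun k => g k 0 i) @ F --> l 0 i) -> g @ F --> l.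
Proof.
move=> H; apply/cvg_ballP => e e0.
have : \forall k \near F, forall i, ball (l 0 i) e (g k 0 i).
  by apply: filter_forall => i; move: (H i) => /cvg_ballP; apply.
by apply: filterS => k Hk; split=> // i j; rewrite (ord1 i).
Qed.

Lemma continuous_rV (T : topologicalType) n (g : T -> 'rV[R]_n) :
  (forall i, continuous (fun x => g x 0 i)) -> continuous g.
Proof. by move=> H x; apply: cvg_rV => i; exact: H. Qed.

(** The sigma-algebra is generated by the coordinates and not, by definition, by the open sets. So
    [f] is written as the limit of its values at the grid points [floor (x_i (k+1)) / (k+1)], each a
    countable step function on boxes. *)
Lemma continuous_meas n (f : 'rV[R]_n -> R) : continuous f ->
  measurable_fun setT f.
Proof.
move=> cf.
pose q (k : nat) (z : 'rV[int]_n) : 'rV[R]_n := \row_i ((z 0 i)%:~R / k.+1%:R).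
pose fl (k : nat) (x : 'rV[R]_n) : 'rV[int]_n := \row_i Num.floor (x 0 i * k.+1%:R).
apply: (@measurable_fun_cvg _ _ _ setT (fun k x => f (q k (fl k x)))).
  move=> k _ Y mY; rewrite setTI.
  have -> : (fun x => f (q k (fl k x))) @^-1` Y =
      \bigcup_z ((fl k @^-1` [set z]) `&` [set x | Y (f (q k z))]).
    apply/seteqP; split=> [x /= Yx|x [z _ [/= <-]]//].
    by exists (fl k x).
  apply: countable_bigcupT_measurable => [|z]; first exact: countableP.
  have [Yz|nYz] := pselect (Y (f (q k z))); last first.
    rewrite (_ : _ `&` _ = set0)//.
    by apply/seteqP; split=> // x [].
  rewrite (_ : _ `&` _ = \bigcap_(i in [set: 'I_n])
    (@rV_coord R n i @^-1`
      [set` `[(z 0 i)%:~R / k.+1%:R, (z 0 i + 1)%:~R / k.+1%:R[ ])).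
    apply: fin_bigcap_measurable => // i _.
    rewrite -[X in measurable X]setTI; apply: measurable_rV_coord => //.
  have E (x : 'rV[R]_n) i : (fl k x 0 i == z 0 i) =
      (x 0 i \in `[(z 0 i)%:~R / k.+1%:R, (z 0 i + 1)%:~R / k.+1%:R[).
    by rewrite mxE floor_eq in_itv /= ler_pdivrMr ?ltr0Sn// ltr_pdivlMr ?ltr0Sn.
  apply/seteqP; split=> [x [/= e0 _] i _ /=|x H].
    by rewrite /rV_coord -E e0.
  split=> //=; apply/rowP => i; apply/eqP; rewrite E.
  exact: H.
move=> x _; apply: continuous_cvg; first exact: cf.
apply: cvg_rV => i.
apply/cvgrPdist_le => e e0.
have [N _ HN] := near_infty_natSinv_lt (PosNum e0).
exists N => // k /= Nk; rewrite !mxE.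
have k0 : (0 : R) < k.+1%:R by rewrite ltr0Sn.
have /andP[h1 h2] := floor_itv (x 0 i * k.+1%:R).
apply: le_trans (ltW (HN k Nk)).
rewrite -[X in `|X - _|](mulfK (lt0r_neq0 k0)) -mulrBl normrM.
rewrite [X in _ * X]ger0_norm ?invr_ge0 ?(ltW k0)//.
rewrite ler_piMl ?invr_ge0 ?(ltW k0)// ger0_norm ?subr_ge0//.
by rewrite lerBlDl; move: h2; rewrite intrD; move/ltW.
Qed.

Definition cube n (c : 'rV[R]_n) (h : R) : set 'rV[R]_n :=
  [set x : 'rV[R]_n | forall i, `|x 0 i - c 0 i| <= h].

Lemma cube_box n (c : 'rV[R]_n) h :
  cube c h = [set x : 'rV[R]_n | forall i, (`[c 0 i - h, c 0 i + h]%classic) (x 0 i)].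
Proof.
by apply/seteqP; split=> x H i; have := H i; rewrite /= in_itv/= ler_distl.
Qed.

Lemma measurable_cube n (c : 'rV[R]_n) h : measurable (cube c h).
Proof.
rewrite cube_box; have -> : [set x : 'rV[R]_n | forall i,
      (`[c 0 i - h, c 0 i + h]%classic) (x 0 i)] = \bigcap_(i in [set: 'I_n])
    (@rV_coord R n i @^-1` `[c 0 i - h, c 0 i + h]%classic).
  by apply/seteqP; split=> [x H i _|x H i]; [exact: H|exact: (H i I)].
apply: fin_bigcap_measurable => // i _.
by rewrite -[X in measurable X]setTI; apply: measurable_rV_coord.
Qed.

Lemma leb_cube n (c : 'rV[R]_n) h : 0 <= h -> leb n (cube c h) = ((2 * h) ^+ n)%:E.
Proof.
move=> h0; rewrite cube_box (@lebesgue_rV_box R n (fun i => `[c 0 i - h, c 0 i + h]%classic)); last first.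
  by move=> i; exact: measurable_itv.
rewrite (eq_bigr (fun=> (2 * h)%:E)) => [|i _].
  elim: n {c} => [|n IH]; first by rewrite big_ord0.
  by rewrite big_ord_recr /= IH -EFinM exprSr.
rewrite lebesgue_measure_itv /= lte_fin; case: ltP => H.
  by rewrite -EFinB; congr EFin; ring.
by congr EFin; lra.
Qed.

Definition csupp n (f : 'rV[R]_n -> R) :=
  exists M : R, forall (x : 'rV[R]_n) i, M < `|x 0 i| -> f x = 0.

(** Unlike integrability, these conditions pass to every section, so Fubini can be applied
    coordinate by coordinate without exceptional sets. *)
Definition bm n (f : 'rV[R]_n -> R) := [/\ measurable_fun setT f,
  exists B : R, forall x, `|f x| <= B & csupp f].

Lemma intg_indic_cube n (c : 'rV[R]_n) h : intg (leb n) (\1_(cube c h)).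
Proof.
apply/integrableP; split.
  by apply/measurable_EFinP/measurable_indic; exact: measurable_cube.
under eq_integral => x _ do rewrite /= ger0_norm// .
rewrite integral_indic ?setIT//; last exact: measurable_cube.
apply: (@le_lt_trans _ _ (leb n (cube c `|h|))); last by rewrite leb_cube ?ltry.
apply: le_measure; rewrite ?inE; try exact: measurable_cube.
by move=> x H i; rewrite (le_trans (H i))// ler_norm.
Qed.

Lemma csupp_cube n (f : 'rV[R]_n -> R) : csupp f ->
  exists2 M, 0 <= M & forall x, ~ cube 0 M x -> f x = 0.
Proof.
move=> [M HM]; exists `|M| => // x /existsNP[i /negP].
rewrite mxE subr0 -ltNge => H; apply: (HM x i).
by rewrite (le_lt_trans _ H)// ler_norm.
Qed.

Lemma intg_bm n (f : 'rV[R]_n -> R) : bm f -> intg (leb n) f.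
Proof.
move=> [mf [B fB] /csupp_cube[M M0 fM]].
apply: (intg_dom mf _ (intgZ `|B| (intg_indic_cube 0 M))) => x.
rewrite indicE; have [|/negP] := boolP (x \in cube 0 M).
  by rewrite mulr1 (le_trans (fB x))// ler_norm.
by rewrite inE => /fM ->; rewrite normr0 mulr0.
Qed.

Lemma bm_cont n (f : 'rV[R]_n -> R) : continuous f -> csupp f -> bm f.
Proof.
move=> cf sf; split=> //; first exact: continuous_meas.
have [M M0 fM] := csupp_cube sf.
have cc : compact (cube (0 : 'rV[R]_n) M).
  rewrite cube_box; apply: (@rV_compact _ _ (fun i => _)) => i.
  exact: segment_compact.
have : compact (f @` cube 0 M).
  by apply: continuous_compact => //; apply: continuous_subspaceT.
move=> /compact_bounded[B [_ HB]].
exists (`|B| + 1) => x; have [xM|/fM ->] := pselect (cube 0 M x).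
  by apply: HB; [rewrite ltr_pwDr// ler_norm|exists x].
by rewrite normr0 addr_ge0.
Qed.

Lemma csuppM n (f g : 'rV[R]_n -> R) : csupp f -> csupp (fun x => f x * g x).
Proof. by move=> [M H]; exists M => x i /H ->; rewrite mul0r. Qed.

Lemma csuppMr n (f g : 'rV[R]_n -> R) : csupp g -> csupp (fun x => f x * g x).
Proof. by move=> [M H]; exists M => x i /H ->; rewrite mulr0. Qed.

Lemma csuppD n (f g : 'rV[R]_n -> R) : csupp f -> csupp g ->
  csupp (fun x => f x + g x).
Proof.
move=> [M H] [N K]; exists (Num.max M N) => x i; rewrite gt_max => /andP[a b].
by rewrite (H x i)// (K x i)// addr0.
Qed.

Lemma bmM n (f g : 'rV[R]_n -> R) : bm f -> measurable_fun setT g ->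
  (exists B : R, forall x, `|g x| <= B) -> bm (fun x => f x * g x).
Proof.
move=> [mf [B fB] sf] mg [C gC]; split; last exact: csuppM.
  exact: measurable_funM.
by exists (B * C) => x; rewrite normrM ler_pM.
Qed.

Lemma bmMr n (f g : 'rV[R]_n -> R) : bm g -> measurable_fun setT f ->
  (exists B : R, forall x, `|f x| <= B) -> bm (fun x => f x * g x).
Proof.
move=> bg mf bf; rewrite (_ : (fun x => _) = (fun x => g x * f x)).
  exact: bmM.
by apply/funext => x; rewrite mulrC.
Qed.

Definition bm1 (g : R -> R) := [/\ measurable_fun setT (g : measurableTypeR R -> R),
  exists B : R, forall x, `|g x| <= B &
  exists M : R, forall t, M < `|t| -> g t = 0].

Lemma intg_bm1 g : bm1 g -> intg leb1 g.
Proof.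
move=> [mg [B gB] [M gM]].
have I1 : intg leb1 (\1_(`[- M, M]%classic)) by exact: integrable_indic_itv.
apply: (intg_dom mg _ (intgZ `|B| I1)) => x.
rewrite indicE mem_setE; have [_|] := boolP (x \in `[- M, M]).
  by rewrite mulr1 (le_trans (gB x))// ler_norm.
by rewrite in_itv /= -ler_norml -ltNge => /gM ->; rewrite normr0 mulr0.
Qed.

Lemma rcons_lift n (x : 'rV[R]_n) (t : R) i : rV_rcons (x, t) 0 (lift ord_max i) = x 0 i.
Proof. by rewrite mxE liftK. Qed.

Lemma rcons_max n (x : 'rV[R]_n) (t : R) : rV_rcons (x, t) 0 ord_max = t.
Proof. by rewrite mxE unlift_none. Qed.

Lemma measurable_section n (f : 'rV[R]_n.+1 -> R) : measurable_fun setT f ->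
  measurable_fun setT (fun p : 'rV[R]_n * measurableTypeR R => f (rV_rcons p)).
Proof.
by move=> mf; apply: (measurableT_comp mf); exact: measurable_rV_rcons.
Qed.

Lemma bm_section1 n (f : 'rV[R]_n.+1 -> R) x : bm f -> bm1 (fun t => f (rV_rcons (x, t))).
Proof.
move=> [mf [B fB] [M fM]]; split.
- apply: (measurableT_comp (measurable_section mf)).
  exact: measurable_pair1.
- by exists B.
- by exists M => t tM; apply: (fM _ ord_max); rewrite rcons_max.
Qed.

Lemma bm_section n (f : 'rV[R]_n.+1 -> R) t : bm f -> bm (fun x => f (rV_rcons (x, t))).
Proof.
move=> [mf [B fB] [M fM]]; split.
- apply: (measurableT_comp (measurable_section mf)).
  exact: (measurable_pair2 (t : measurableTypeR R)).
- by exists B.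
- by exists M => x i tM; apply: (fM _ (lift ord_max i)); rewrite rcons_lift.
Qed.

Lemma integrable_rcons n (f : 'rV[R]_n.+1 -> R) : intg (leb n.+1) f ->
  (leb n \x leb1)%E.-integrable setT (fun p => (f (rV_rcons p))%:E) /\
  (\int[leb n.+1]_x (f x)%:E = \int[leb n \x leb1]_p (f (rV_rcons p))%:E)%E.
Proof.
move=> If; have mf := intg_meas If.
have I1 : (leb n \x leb1)%E.-integrable setT (fun p => (f (rV_rcons p))%:E).
  apply/integrableP; split.
    by apply/measurable_EFinP; exact: measurable_section.
  move/integrableP : If => [_]; rewrite /= /lebesgue_rV_succ.
  rewrite ge0_integral_pushforward//; first exact: measurable_rV_rcons.
  by apply/measurable_EFinP; apply: measurableT_comp mf => //.
split=> //; rewrite [LHS]integral_pushforward//.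
- exact: measurable_rV_rcons.
- exact/measurable_EFinP.
Qed.

Lemma rint_rcons n (f : 'rV[R]_n.+1 -> R) : bm f ->
  intg (leb n) (fun x => rint leb1 (fun t => f (rV_rcons (x, t)))) /\
  rint (leb n.+1) f =
    rint (leb n) (fun x => rint leb1 (fun t => f (rV_rcons (x, t)))).
Proof.
move=> bf; have [I1 E1] := integrable_rcons (intg_bm bf).
have FE : fubini_F leb1 (fun p => (f (rV_rcons p))%:E) =
    EFin \o (fun x : 'rV[R]_n => rint leb1 (fun t => f (rV_rcons (x, t)))).
  by apply/funext => x; rewrite /fubini_F EFin_rint//; apply/intg_bm1/bm_section1.
have I2 : intg (leb n) (fun x => rint leb1 (fun t => f (rV_rcons (x, t)))).
  by rewrite /intg -FE; exact: integrable_fubini_F.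
split=> //; apply: EFin_inj.
by rewrite -!EFin_rint// ?E1 -?integral12_prod_meas1 ?FE//; exact: intg_bm.
Qed.

Lemma rint_rcons_sym n (f : 'rV[R]_n.+1 -> R) : bm f ->
  intg leb1 (fun t => rint (leb n) (fun x => f (rV_rcons (x, t)))) /\
  rint (leb n.+1) f =
    rint leb1 (fun t => rint (leb n) (fun x => f (rV_rcons (x, t)))).
Proof.
move=> bf; have [I1 E1] := integrable_rcons (intg_bm bf).
have FE : fubini_G (leb n) (fun p => (f (rV_rcons p))%:E) =
    EFin \o (fun t => rint (leb n) (fun x => f (rV_rcons (x, t)))).
  by apply/funext => x; rewrite /fubini_G EFin_rint//; apply/intg_bm/bm_section.
have I2 : intg leb1 (fun t => rint (leb n) (fun x => f (rV_rcons (x, t)))).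
  have [_ [B fB] /csupp_cube[M M0 fM]] := bf.
  apply: intg_bm1; split.
  - by have := measurable_fubini_G I1; rewrite FE => /measurable_EFinP.
  - exists (B * (2 * M) ^+ n) => t; apply: (le_trans (rint_abs (intg_bm (bm_section t bf)))).
    rewrite -[X in _ * X]/(fine ((2 * M) ^+ n)%:E) -(leb_cube (0 : 'rV[R]_n) M0).
    have -> : fine (leb n (cube 0 M)) = rint (leb n) (\1_(cube 0 M)).
      by rewrite rintE /Rintegral integral_indic ?setIT//; exact: measurable_cube.
    rewrite -rintZ; last exact: intg_indic_cube.
    apply: rint_le.
    + exact/intg_norm/intg_bm/bm_section.
    + exact/intgZ/intg_indic_cube.
    move=> x; rewrite indicE; have [|/negP] := boolP (x \in cube 0 M).
      by rewrite mulr1.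
    rewrite inE mulr0 => H; rewrite fM ?normr0// => H1; apply: H => i.
    by have := H1 (lift ord_max i); rewrite rcons_lift !mxE.
  - exists M => t tM; rewrite -[RHS](rint0 (leb n)); apply: rint_ext => x.
    apply: fM => /(_ ord_max); rewrite rcons_max mxE subr0.
    by rewrite leNgt tM.
split=> //; apply: EFin_inj.
by rewrite -!EFin_rint// ?E1 -?integral21_prod_meas1 ?FE//; exact: intg_bm.
Qed.

Lemma rint_FTC (g g' : R -> R) : (forall t : R, is_derive t 1 g (g' t)) ->
  continuous g' -> (exists M : R, forall t, M < `|t| -> g t = 0) ->
  rint leb1 g' = 0.
Proof.
move=> dg cg [M0 gM0]; pose M := `|M0| + 1.
have gM t : M <= `|t| -> g t = 0.
  by move=> h; apply: gM0; rewrite (lt_le_trans _ h)// ltr_pwDr// ler_norm.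
have M0' : 0 < M by rewrite ltr_wpDl.
have g'M t : M < `|t| -> g' t = 0.
  move=> tM; have d0 : is_derive t 1 g 0.
    apply: (near_eq_is_derive _ (is_derive_cst (0 : R) t (1 : R))).
    have : \forall s \near t, M < `|s|.
      have h : `|s| @[s --> t] --> `|t| by apply: cvg_norm; exact: cvg_id.
      exact: cvgr_gt h _ tM.
    by apply: filterS => s /ltW/gM ->.
  by rewrite -(@derive_val _ _ _ _ _ _ _ d0) (@derive_val _ _ _ _ _ _ _ (dg t)).
have MM : - M < M by lra.
have dR x : derivable g x 1 by exact: ex_derive.
have cvg_g : continuous g.
  by move=> x; apply: differentiable_continuous; exact/derivable1_diffP.
have := @continuous_FTC2 R g' g (- M) M MM.
rewrite !gM ?normrN ?ger0_norm ?(ltW M0')// subee// rintE.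
move=> FTC.
have E : (\int[leb1]_x (g' x)%:E = \int[leb1]_(x in `[(- M)%R, M]) (g' x)%:E)%E.
  rewrite [RHS]integral_mkcond; apply: eq_integral => x _.
  rewrite patchE mem_setE; case: ifPn => //.
  by rewrite in_itv /= -ler_norml -ltNge => /g'M ->.
rewrite /Rintegral E FTC//.
- by apply: continuous_subspaceT.
- split=> [x _//||].
  + by apply: cvg_at_right_filter; exact: cvg_g.
  + by apply: cvg_at_left_filter; exact: cvg_g.
- by move=> x _; rewrite derive1E (@derive_val _ _ _ _ _ _ _ (dg x)).
Qed.

End rV_base.

(** * Differential calculus *)

Section rV_calculus.
Context {R : realType}.
Local Notation leb n := (lebesgue_rV R n).
Local Notation leb1 := (@lebesgue_measure R).

Lemma is_derive_line n (f : 'rV[R]_n -> R) x v a :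
  is_derive x v f a <-> is_derive (0 : R) (1 : R) (fun t : R => f (t *: v + x)) a.
Proof.
have E : (fun h : R => h^-1 *: ((f \o shift x) (h *: v) - f x)) =
    (fun h : R => h^-1 *: (((fun t : R => f (t *: v + x)) \o shift 0) (h *: 1) -
      f (0 *: v + x))).
  by apply/funext => h; rewrite /= addr0 [h *: 1]mulr1 scale0r add0r.
split=> -[dh vh]; split.
- by rewrite /derivable -E.
- by rewrite -vh /derive E.
- by rewrite /derivable E.
- by rewrite -vh /derive E.
Qed.

Lemma is_derive_add n (f g : 'rV[R]_n -> R) x v a b : is_derive x v f a ->
  is_derive x v g b -> is_derive x v (fun y => f y + g y) (a + b).
Proof. by move=> df dg; exact: is_deriveD. Qed.

Lemma is_derive_mul n (f g : 'rV[R]_n -> R) x v a b : is_derive x v f a ->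
  is_derive x v g b -> is_derive x v (fun y => f y * g y) (a * g x + f x * b).
Proof.
move=> df dg; have := is_deriveM df dg.
by congr is_derive; rewrite /GRing.scale/=; ring.
Qed.

Lemma is_derive_phi n (f : 'rV[R]_n -> R) (p : R -> R) x v a b :
  is_derive x v f a -> is_derive (f x) (1 : R) p b ->
  is_derive x v (fun y => p (f y)) (b * a).
Proof.
move=> /is_derive_line df dp; apply/is_derive_line.
by apply: (is_derive1_comp (f := p)) => //; rewrite scale0r add0r.
Qed.

Lemma is_derive_coord n (x : 'rV[R]_n) i j :
  is_derive x 'e_i (fun y : 'rV[R]_n => y 0 j) (i == j)%:R.
Proof.
apply/is_derive_line.
rewrite (_ : (fun t : R => _) = (fun t : R => (i == j)%:R * t + x 0 j)).
  apply: is_derive_eq; rewrite /GRing.scale/=; ring.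
apply/funext => t; rewrite !mxE eqxx/= eq_sym mulrC.
by case: (j == i).
Qed.

Lemma is_derive_unique n (f : 'rV[R]_n -> R) x v a : is_derive x v f a -> 'D_v f x = a.
Proof. by move=> h; exact: derive_val. Qed.

Definition C1 n (f : 'rV[R]_n -> R) := continuous f /\
  forall i, (forall x, derivable f x 'e_i) /\ continuous (fun x => 'D_('e_i) f x).

Lemma C1_cont n (f : 'rV[R]_n -> R) : C1 f -> continuous f. Proof. by case. Qed.

Lemma C1_dcont n (f : 'rV[R]_n -> R) i : C1 f -> continuous (fun x => 'D_('e_i) f x).
Proof. by case=> _ /(_ i)[]. Qed.

Lemma C1_der n (f : 'rV[R]_n -> R) i x : C1 f -> is_derive x 'e_i f ('D_('e_i) f x).
Proof. by case=> _ /(_ i)[H _]; exact: derivableP. Qed.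

Lemma C1_intro n (f : 'rV[R]_n -> R) (d : 'I_n -> 'rV[R]_n -> R) : continuous f ->
  (forall i x, is_derive x 'e_i f (d i x)) -> (forall i, continuous (d i)) ->
  C1 f /\ forall i x, 'D_('e_i) f x = d i x.
Proof.
move=> cf df cd; have E i : (fun x => 'D_('e_i) f x) = d i.
  by apply/funext => x; exact: is_derive_unique.
by split=> [|i x]; [split=> // i; split=> [x|]; rewrite ?E//; exact: ex_derive|
  exact: is_derive_unique].
Qed.

Lemma C1I n (f : 'rV[R]_n -> R) (d : 'I_n -> 'rV[R]_n -> R) : continuous f ->
  (forall i x, is_derive x 'e_i f (d i x)) -> (forall i, continuous (d i)) -> C1 f.
Proof. by move=> a b c; have [] := C1_intro a b c. Qed.

Lemma C1_meas n (f : 'rV[R]_n -> R) : C1 f -> measurable_fun setT f.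
Proof. by move=> /C1_cont/continuous_meas. Qed.

Lemma contD (T : topologicalType) (f g : T -> R) : continuous f -> continuous g ->
  continuous (fun x => f x + g x).
Proof. by move=> cf cg x; apply: cvgD; [exact: cf|exact: cg]. Qed.

Lemma contM (T : topologicalType) (f g : T -> R) : continuous f -> continuous g ->
  continuous (fun x => f x * g x).
Proof. by move=> cf cg x; apply: cvgM; [exact: cf|exact: cg]. Qed.

Lemma contN (T : topologicalType) (f : T -> R) : continuous f ->
  continuous (fun x => - f x).
Proof. by move=> cf x; apply: cvgN; exact: cf. Qed.

Lemma cont_cst (T : topologicalType) (c : R) : continuous (fun _ : T => c).
Proof. by move=> x; exact: cvg_cst. Qed.

Lemma cont_comp (T : topologicalType) (p : R -> R) (f : T -> R) : continuous f ->
  (forall x, {for f x, continuous p}) -> continuous (fun x => p (f x)).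
Proof. by move=> cf cp x; apply: continuous_comp; [exact: cf|exact: cp]. Qed.

Lemma cont_coord n (i : 'I_n) : continuous (fun x : 'rV[R]_n => x 0 i).
Proof. exact: coord_continuous. Qed.

Lemma cont_sum n (I : Type) (s : seq I) (F : I -> 'rV[R]_n -> R) :
  (forall i, continuous (F i)) -> continuous (fun x => \sum_(i <- s) F i x).
Proof.
move=> cF; elim: s => [|i s IH].
  by under eq_fun do rewrite big_nil; exact: cont_cst.
by under eq_fun do rewrite big_cons; exact: contD.
Qed.

Lemma C1_cst n (c : R) : C1 (fun _ : 'rV[R]_n => c).
Proof.
apply: (C1I (d := fun _ _ => 0)) => *; exact: cont_cst.
Qed.

Lemma dcst n (c : R) i (x : 'rV[R]_n) : 'D_('e_i) (fun _ : 'rV[R]_n => c) x = 0.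
Proof. by apply: is_derive_unique; exact: is_derive_cst. Qed.

Lemma C1_coord n (j : 'I_n) : C1 (fun x : 'rV[R]_n => x 0 j).
Proof.
apply: (C1I (d := fun i _ => (i == j)%:R)) => [|i x|i].
- exact: cont_coord.
- exact: is_derive_coord.
- exact: cont_cst.
Qed.

Lemma dcoord n (j : 'I_n) i (x : 'rV[R]_n) :
  'D_('e_i) (fun y : 'rV[R]_n => y 0 j) x = (i == j)%:R.
Proof. exact/is_derive_unique/is_derive_coord. Qed.

Lemma dD n (f g : 'rV[R]_n -> R) i x : C1 f -> C1 g ->
  'D_('e_i) (fun y => f y + g y) x = 'D_('e_i) f x + 'D_('e_i) g x.
Proof. by move=> cf cg; apply: is_derive_unique; apply: is_derive_add; exact: C1_der. Qed.

Lemma dM n (f g : 'rV[R]_n -> R) i x : C1 f -> C1 g ->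
  'D_('e_i) (fun y => f y * g y) x = 'D_('e_i) f x * g x + f x * 'D_('e_i) g x.
Proof. by move=> cf cg; apply: is_derive_unique; apply: is_derive_mul; exact: C1_der. Qed.

Lemma C1D n (f g : 'rV[R]_n -> R) : C1 f -> C1 g -> C1 (fun x => f x + g x).
Proof.
move=> cf cg; apply: (C1I (d := fun i x => 'D_('e_i) f x + 'D_('e_i) g x)).
- by apply: contD; exact: C1_cont.
- by move=> i x; apply: is_derive_add; exact: C1_der.
- by move=> i; apply: contD; exact: C1_dcont.
Qed.

Lemma C1M n (f g : 'rV[R]_n -> R) : C1 f -> C1 g -> C1 (fun x => f x * g x).
Proof.
move=> cf cg.
apply: (C1I (d := fun i x => 'D_('e_i) f x * g x + f x * 'D_('e_i) g x)).
- by apply: contM; exact: C1_cont.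
- by move=> i x; apply: is_derive_mul; exact: C1_der.
- move=> i; apply: contD.
    exact: contM (C1_dcont cf) (C1_cont cg).
  exact: contM (C1_cont cf) (C1_dcont cg).
Qed.

Lemma C1Z n (a : R) (f : 'rV[R]_n -> R) : C1 f -> C1 (fun x => a * f x).
Proof. exact: C1M (@C1_cst n a). Qed.

Lemma dZ n (a : R) (f : 'rV[R]_n -> R) i x : C1 f ->
  'D_('e_i) (fun y => a * f y) x = a * 'D_('e_i) f x.
Proof. by move=> cf; rewrite (dM i x (@C1_cst n a) cf) dcst mul0r add0r. Qed.

Lemma C1N n (f : 'rV[R]_n -> R) : C1 f -> C1 (fun x => - f x).
Proof.
move=> cf; rewrite (_ : (fun x => _) = (fun x => -1 * f x)); first exact: C1Z.
by apply/funext => x; rewrite mulN1r.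
Qed.

Lemma dN n (f : 'rV[R]_n -> R) i x : C1 f ->
  'D_('e_i) (fun y => - f y) x = - 'D_('e_i) f x.
Proof.
move=> cf; rewrite -mulN1r -(dZ (-1) i x cf) (_ : (fun y => - f y) = fun y => -1 * f y)//.
by apply/funext => y; rewrite mulN1r.
Qed.

Lemma C1B n (f g : 'rV[R]_n -> R) : C1 f -> C1 g -> C1 (fun x => f x - g x).
Proof. by move=> cf cg; exact: C1D cf (C1N cg). Qed.

Lemma dB n (f g : 'rV[R]_n -> R) i x : C1 f -> C1 g ->
  'D_('e_i) (fun y => f y - g y) x = 'D_('e_i) f x - 'D_('e_i) g x.
Proof. by move=> cf cg; rewrite (dD i x cf (C1N cg)) (dN i x cg). Qed.

Lemma C1_sum n (I : Type) (s : seq I) (F : I -> 'rV[R]_n -> R) :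
  (forall i, C1 (F i)) -> C1 (fun x => \sum_(i <- s) F i x).
Proof.
move=> cF; elim: s => [|i s IH].
  by under eq_fun do rewrite big_nil; exact: C1_cst.
by under eq_fun do rewrite big_cons; exact: C1D.
Qed.

Lemma dsum n (I : Type) (s : seq I) (F : I -> 'rV[R]_n -> R) j x :
  (forall i, C1 (F i)) ->
  'D_('e_j) (fun x => \sum_(i <- s) F i x) x = \sum_(i <- s) 'D_('e_j) (F i) x.
Proof.
move=> cF; elim: s => [|i s IH].
  by under eq_fun do rewrite big_nil; rewrite dcst big_nil.
under eq_fun do rewrite big_cons.
by rewrite dD// ?IH ?big_cons//; exact: C1_sum.
Qed.

Lemma C1_comp n (p p' : R -> R) (f : 'rV[R]_n -> R) : C1 f ->
  (forall x, is_derive (f x) (1 : R) p (p' (f x))) ->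
  (forall x, {for f x, continuous p'}) ->
  C1 (fun x => p (f x)) /\
  forall i x, 'D_('e_i) (fun x => p (f x)) x = p' (f x) * 'D_('e_i) f x.
Proof.
move=> cf dp cp'; apply: C1_intro => [|i x|i].
- apply: cont_comp; first exact: C1_cont.
  move=> x; apply: differentiable_continuous; apply/derivable1_diffP.
  by have := dp x => -[].
- exact: is_derive_phi (C1_der i x cf) (dp x).
- by apply: contM; [apply: cont_comp => //; exact: C1_cont|exact: C1_dcont].
Qed.

Lemma d_local0 n (f : 'rV[R]_n -> R) (A : set 'rV[R]_n) i x : open A -> A x ->
  (forall y, A y -> f y = 0) -> 'D_('e_i) f x = 0.
Proof.
move=> oA Ax f0; apply: is_derive_unique.
apply: (near_eq_is_derive _ (is_derive_cst (0 : R) x ('e_i : 'rV[R]_n))).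
have : \forall y \near x, A y by apply: open_nbhs_nbhs.
by apply: filterS => y /f0 ->.
Qed.

Lemma open_gt_cont (T : topologicalType) (g : T -> R) M : continuous g ->
  open [set x | M < g x].
Proof.
move=> cg; rewrite (_ : [set x | M < g x] = g @^-1` [set y | M < y])//.
by apply: open_comp => [x _|]; [exact: cg|exact: open_gt].
Qed.

Lemma cont_compT (T U V : topologicalType) (g : U -> V) (f : T -> U) :
  continuous f -> continuous g -> continuous (fun x => g (f x)).
Proof. by move=> cf cg x; apply: continuous_comp; [exact: cf|exact: cg]. Qed.

Lemma csupp_d n (f : 'rV[R]_n -> R) i : csupp f -> csupp (fun x => 'D_('e_i) f x).
Proof.
move=> [M H]; exists M => x j xM.
apply: (@d_local0 _ _ [set x | M < `|x 0 j|]) => //; last by move=> y /H.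
apply: open_gt_cont; apply: (@cont_comp _ Num.norm); first exact: cont_coord.
by move=> y; exact: norm_continuous.
Qed.

Lemma bm_d n (f : 'rV[R]_n -> R) i : C1 f -> csupp f -> bm (fun x => 'D_('e_i) f x).
Proof. by move=> cf sf; apply: bm_cont; [exact: C1_dcont|exact: csupp_d]. Qed.

Lemma rcons_contl n t : continuous (fun x : 'rV[R]_n => rV_rcons (x, t) : 'rV[R]_n.+1).
Proof.
apply: continuous_rV => i; case: (unliftP ord_max i) => [j|] ->.
  rewrite (_ : (fun x => _) = fun x : 'rV[R]_n => x 0 j); first exact: cont_coord.
  by apply/funext => x; rewrite rcons_lift.
rewrite (_ : (fun x => _) = fun x : 'rV[R]_n => t); first exact: cont_cst.
by apply/funext => x; rewrite rcons_max.
Qed.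

Lemma rcons_contr n (x : 'rV[R]_n) :
  continuous (fun t : R => rV_rcons (x, t) : 'rV[R]_n.+1).
Proof.
apply: continuous_rV => i; case: (unliftP ord_max i) => [j|] ->.
  rewrite (_ : (fun t => _) = fun t : R => x 0 j); first by move=> y; exact: cvg_cst.
  by apply/funext => t; rewrite rcons_lift.
rewrite (_ : (fun x => _) = id); last by apply/funext => t; rewrite rcons_max.
by move=> y; exact: cvg_id.
Qed.

Lemma C1_section n (f : 'rV[R]_n.+1 -> R) t : C1 f ->
  C1 (fun x => f (rV_rcons (x, t))) /\ forall j x,
    'D_('e_j) (fun x => f (rV_rcons (x, t))) x =
    'D_('e_(lift ord_max j)) f (rV_rcons (x, t)).
Proof.
move=> cf; apply: C1_intro => [x|j x|j].
- by apply: continuous_comp; [exact: rcons_contl|exact: C1_cont].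
- apply/is_derive_line.
  have /is_derive_line := C1_der (lift ord_max j) (rV_rcons (x, t)) cf.
  congr is_derive; apply/funext => s; congr f; apply/rowP => i.
  case: (unliftP ord_max i) => [k|] ->; rewrite !(rcons_lift, rcons_max, mxE) ?liftK ?unlift_none/=.
    by rewrite (inj_eq lift_inj).
  by rewrite (negbTE (neq_lift _ _)) mulr0 add0r.
- apply: (@cont_compT _ _ _ (fun y : 'rV[R]_n.+1 => 'D_('e_(lift ord_max j)) f y)).
    exact: rcons_contl.
  exact: C1_dcont.
Qed.

Lemma C1_section1 n (f : 'rV[R]_n.+1 -> R) x (t : R) : C1 f ->
  is_derive t (1 : R) (fun t : R => f (rV_rcons (x, t))) ('D_('e_ord_max) f (rV_rcons (x, t))).
Proof.
move=> cf; have /is_derive_line h := C1_der ord_max (rV_rcons (x, t)) cf.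
pose F s := f (s *: 'e_ord_max + rV_rcons (x, t)).
rewrite (_ : (fun t : R => _) = F \o (fun s => s - t)); last first.
  apply/funext => s; rewrite /F /=; congr f; apply/rowP => i.
  case: (unliftP ord_max i) => [k|] ->; rewrite !(rcons_lift, rcons_max, mxE)/=.
    by rewrite eq_sym (negbTE (neq_lift _ _)) mulr0 add0r.
  by rewrite eqxx mulr1 subrK.
rewrite -[X in is_derive _ _ _ X]mulr1.
apply: (is_derive1_comp (f := F)); first by rewrite subrr.
by apply: is_derive_eq; rewrite subr0.
Qed.

(* Induction on the dimension: slice along the last coordinate, where the
   derivative is either tangential (induction) or integrates to zero (FTC). *)
Lemma rint_derive n (f : 'rV[R]_n -> R) i : C1 f -> csupp f ->
  rint (leb n) (fun x => 'D_('e_i) f x) = 0.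
Proof.
elim: n f i => [|n IH] f i cf sf; first by case: i.
have bd := bm_d i cf sf.
case: (unliftP ord_max i) bd => [j|] -> bd.
  rewrite (rint_rcons_sym bd).2 -[RHS](rint0 leb1); apply: rint_ext => t.
  have [cs ds] := C1_section t cf.
  rewrite -(IH (fun x => f (rV_rcons (x, t))) j)//.
    by apply: rint_ext => x; rewrite ds.
  by have [_ _] := bm_section t (bm_cont (C1_cont cf) sf).
rewrite (rint_rcons bd).2 -[RHS](rint0 (leb n)); apply: rint_ext => x.
apply: (@rint_FTC _ (fun t => f (rV_rcons (x, t)))).
- by move=> t; exact: C1_section1.
- apply: (@cont_compT R _ _ (fun y : 'rV[R]_n.+1 => 'D_('e_ord_max) f y)
    (fun t : R => rV_rcons (x, t))); first exact: rcons_contr.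
  exact: C1_dcont.
- by have [_ _] := bm_section1 x (bm_cont (C1_cont cf) sf).
Qed.

Lemma rint_ibp n (f g : 'rV[R]_n -> R) i : C1 f -> C1 g -> csupp g ->
  rint (leb n) (fun x => f x * 'D_('e_i) g x) =
  - rint (leb n) (fun x => 'D_('e_i) f x * g x).
Proof.
move=> cf cg sg; apply/eqP; rewrite -addr_eq0 addrC; apply/eqP.
rewrite -rintD; last 2 first.
- by apply/intg_bm/bm_cont; [apply: contM; [exact: C1_dcont|exact: C1_cont]|exact: csuppMr].
- by apply/intg_bm/bm_cont; [apply: contM; [exact: C1_cont|exact: C1_dcont]|
    apply: csuppMr; exact: csupp_d].
rewrite -[RHS](@rint_derive _ (fun x => f x * g x) i); [|exact: C1M|exact: csuppMr].
by apply: rint_ext => x; rewrite dM// addrC.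
Qed.

End rV_calculus.

(** * Test functions *)

Section flat.
Context {R : realType}.

(* Functions p(1/x) exp(-1/x) (x > 0), extended by 0: a class stable under
   derivation, hence made of smooth functions. *)
Definition flat (p : {poly R}) (x : R) : R :=
  if 0 < x then p.[x^-1] * expR (- x^-1) else 0.

(** [exp y] is the [(m+1)]-st power of [exp (y / (m+1))], which is at least [y / (m+1)]. *)
Lemma pow_expR_bound (m : nat) (y : R) : 0 < y ->
  y ^+ m * expR (- y) <= m.+1%:R ^+ m.+1 / y.
Proof.
move=> y0; have m0 : (0 : R) < m.+1%:R by rewrite ltr0Sn.
rewrite expRN ler_pdivlMr// mulrAC ler_pdivrMr ?expR_gt0// -exprSr.
have -> : y = m.+1%:R * (y / m.+1%:R) by rewrite mulrC divfK ?gt_eqF.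
rewrite expRM_natl exprMn ler_pM2l ?exprn_gt0//.
apply: lerXn2r; rewrite ?nnegrE ?expR_ge0//; first exact/ltW/divr_gt0.
apply: le_trans (ltW (expR_gt1Dx (lt0r_neq0 (divr_gt0 y0 m0)))).
by rewrite lerDr.
Qed.

(** The difference quotient of [flat p] at 0 is [flat ('X * p)]; a linear bound valid for every
    polynomial therefore gives derivative 0 there. *)
Lemma flat_bound p : exists C : R, forall x, `|flat p x| <= C * `|x|.
Proof.
exists (\sum_(i < size p) `|p`_i| * i.+1%:R ^+ i.+1) => x.
have C0 : 0 <= \sum_(i < size p) `|p`_i| * (i.+1%:R : R) ^+ i.+1.
  by apply: sumr_ge0 => i _; rewrite mulr_ge0// exprn_ge0.
rewrite /flat; case: ltP => [x0|_]; last by rewrite normr0 mulr_ge0.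
rewrite horner_coef normrM (ger0_norm (expR_ge0 _)).
apply: (le_trans (ler_wpM2r (expR_ge0 _) (ler_norm_sum _ _ _))).
rewrite !mulr_suml; apply: ler_sum => i _.
rewrite normrM -!mulrA; apply: ler_wpM2l => //.
have y0 : 0 < x^-1 by rewrite invr_gt0.
rewrite ger0_norm ?exprn_ge0 ?(ltW y0)// (gtr0_norm x0).
by have := pow_expR_bound i y0; rewrite invrK.
Qed.

(** With y = 1/x one has dy/dx = - y^2, and both p(y) and exp(- y) are differentiated. *)
Definition flat_d (p : {poly R}) := 'X^2 * (p - p^`()).

Lemma is_derive_flat p (x : R) : is_derive x 1 (flat p) (flat (flat_d p) x).
Proof.
have [x0|x0|->] := ltgtP x 0.
- rewrite {2}/flat ltNge (ltW x0)/=.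
  apply: (near_eq_is_derive _ (is_derive_cst (0 : R) x (1 : R))).
  near=> y; rewrite /flat ltNge (_ : y <= 0)//.
  by apply/ltW; near: y; exact: lt_nbhsl.
- have h : is_derive x 1 (fun y : R => p.[y^-1] * expR (- y^-1)) (flat (flat_d p) x).
    have xn0 : x != 0 by rewrite gt_eqF.
    have dV : is_derive x 1 (fun y : R => y^-1) (- x ^- 2 *: 1).
      exact: (@is_deriveV _ id x 1 1 xn0 (is_derive_id _ _)).
    have dp : is_derive x 1 (fun y : R => p.[y^-1]) (p^`().[x^-1] * (- x ^- 2 *: 1)).
      apply: (is_derive1_comp (f := fun y => p.[y]) (g := fun y : R => y^-1)).
      exact: is_derive_poly.
    have dN := is_deriveN dV.
    have dE : is_derive x 1 (fun y : R => expR (- y^-1))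
        (expR (- x^-1) * (- (- x ^- 2 *: 1))).
      exact: (is_derive1_comp (f := expR) (g := fun y : R => - y^-1) (is_derive_expR _) dN).
    have := is_deriveM dp dE; congr is_derive.
    rewrite /flat x0 /flat_d hornerM hornerXn hornerD hornerN /GRing.scale/=.
    by rewrite exprVn; ring.
  apply: near_eq_is_derive h.
  near=> y; rewrite /flat (_ : 0 < y)//.
  by near: y; exact: lt_nbhsr.
rewrite {2}/flat ltxx.
have [C HC] := flat_bound ('X * p).
have E (h : R) : h^-1 *: (flat p (h *: 1 + 0) - flat p 0) = flat ('X * p) h.
  rewrite addr0 [h *: 1]mulr1 {2}/flat ltxx subr0 /flat /GRing.scale/=.
  by case: ifP => _; rewrite ?mulr0// hornerM hornerX mulrA.
have L : (fun h : R => h^-1 *: ((flat p \o shift 0) (h *: 1) - flat p 0)) @ 0^' --> (0 : R).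
  rewrite (_ : (fun h : R => _) = flat ('X * p)); last by apply/funext.
  apply/cvgrPdist_le => e e0; near=> h.
  rewrite sub0r normrN (le_trans (HC h))//.
  apply: (@le_trans _ _ ((`|C| + 1) * `|h|)).
    by apply: ler_wpM2r => //; rewrite (le_trans (ler_norm C))// lerDl.
  rewrite -ler_pdivlMl ?ltr_wpDl//; near: h.
  apply: dnbhs0_le; rewrite mulr_gt0// invr_gt0 ltr_wpDl//.
split; first by apply/cvg_ex; exists 0.
by apply: cvg_lim.
Unshelve. all: by end_near. Qed.

Lemma cont_flat p : continuous (flat p).
Proof.
move=> x; apply: differentiable_continuous; apply/derivable1_diffP.
by have [] := is_derive_flat p x.
Qed.

Definition step := flat 1.

Lemma stepE x : step x = if 0 < x then expR (- x^-1) else 0.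
Proof. by rewrite /step /flat hornerC mul1r. Qed.

Lemma step_ge0 x : 0 <= step x.
Proof. by rewrite stepE; case: ifP => // _; exact: expR_ge0. Qed.

Lemma step_le1 x : step x <= 1.
Proof.
rewrite stepE; case: ifP => // x0.
by rewrite -expR0 ler_expR oppr_le0 invr_ge0 ltW.
Qed.

Lemma step_cvg (x : R) : step (k.+1%:R * x) @[k --> \oo] --> ((0 < x)%R%:R : R).
Proof.
case: ltP => x0; last first.
  rewrite (_ : (fun k => _) = fun=> 0); first exact: cvg_cst.
  by apply/funext => k; rewrite stepE ltNge mulr_ge0_le0.
rewrite (_ : (fun k => _) = (fun k : nat => expR (- (harmonic k * x^-1)))); last first.
  by apply/funext => k; rewrite stepE mulr_gt0 ?ltr0Sn// invfM.
rewrite -expR0; apply: continuous_cvg; first exact: continuous_expR.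
rewrite -[X in _ --> X]oppr0; apply: cvgN; rewrite -[X in _ --> X](mul0r x^-1).
by apply: cvgM; [exact: cvg_harmonic|exact: cvg_cst].
Qed.

End flat.

(** * Smooth functions, test functions and the du Bois-Reymond lemma *)

Section smooth.
Context {R : realType} (n : nat).
Local Notation leb := (lebesgue_rV R n).
Implicit Types f g : 'rV[R]_n -> R.

Lemma smooth_C1 f : smooth f -> C1 f.
Proof.
move=> sf; have [cf df] := sf [::]; split=> // i; split=> [x|]; first exact: df.
by have [] := sf [:: i].
Qed.

Lemma smooth_d f i : smooth f -> smooth (fun x => 'D_('e_i) f x).
Proof. by move=> sf s; have := sf (rcons s i); rewrite foldr_rcons. Qed.

(** A coinduction principle: smoothness of [f] follows from any class of C1 functions that contains
    [f] and is stable under partial derivatives. *)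
Lemma smooth_coind (P : ('rV[R]_n -> R) -> Prop) f :
  (forall g, P g -> C1 g /\ forall i, P (fun x => 'D_('e_i) g x)) -> P f -> smooth f.
Proof.
move=> H Pf s.
have : P (foldr (fun i h => 'D_('e_i) h) f s).
  by elim: s => // i s IH /=; exact: (H _ IH).2.
move=> /H[[cg dg] _]; split=> // i x.
by have [] := dg i.
Qed.

(** A derivative of a product is a sum of products, so products alone are not a stable class; the
    algebra generated by the smooth functions is one. *)
Inductive smooth_alg : ('rV[R]_n -> R) -> Prop :=
| smooth_alg_gen f of smooth f : smooth_alg f
| smooth_algD f g of smooth_alg f & smooth_alg g : smooth_alg (fun x => f x + g x)
| smooth_algM f g of smooth_alg f & smooth_alg g : smooth_alg (fun x => f x * g x).

Lemma smooth_algP f : smooth_alg f -> smooth f.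
Proof.
apply: smooth_coind => {}f; elim=> {f} [f sf|f g _ [cf df] _ [cg dg]|
    f g af [cf df] ag [cg dg]].
- by split; [exact: smooth_C1|move=> i; apply: smooth_alg_gen; exact: smooth_d].
- split; [exact: C1D|move=> i].
  rewrite (_ : (fun x => _) = (fun x => 'D_('e_i) f x + 'D_('e_i) g x)).
    exact: smooth_algD.
  by apply/funext => x; rewrite dD.
- split; [exact: C1M|move=> i].
  rewrite (_ : (fun x => _) =
    (fun x => 'D_('e_i) f x * g x + f x * 'D_('e_i) g x)).
    by apply: smooth_algD; exact: smooth_algM.
  by apply/funext => x; rewrite dM.
Qed.

Lemma smoothD f g : smooth f -> smooth g -> smooth (fun x => f x + g x).
Proof. by move=> sf sg; apply: smooth_algP; apply: smooth_algD; exact: smooth_alg_gen. Qed.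

Lemma smoothM f g : smooth f -> smooth g -> smooth (fun x => f x * g x).
Proof. by move=> sf sg; apply: smooth_algP; apply: smooth_algM; exact: smooth_alg_gen. Qed.

Lemma smooth_cst (c : R) : smooth (fun _ : 'rV[R]_n => c).
Proof.
apply: (smooth_coind (P := fun g => exists c : R, g = fun=> c)); last by exists c.
move=> _ [a ->]; split; first exact: C1_cst.
by move=> i; exists 0; apply/funext => x; rewrite dcst.
Qed.

Lemma smooth_prod (I : Type) (s : seq I) (F : I -> 'rV[R]_n -> R) :
  (forall i, smooth (F i)) -> smooth (fun x => \prod_(i <- s) F i x).
Proof.
move=> sF; elim: s => [|i s IH].
  rewrite (_ : (fun x => _) = fun=> 1); first exact: smooth_cst.
  by apply/funext => x; rewrite big_nil.
rewrite (_ : (fun x => _) = fun x => F i x * \prod_(j <- s) F j x).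
  exact: (smoothM (sF i) IH).
by apply/funext => x; rewrite big_cons.
Qed.

Lemma smooth_flat p (a b : R) j : smooth (fun x : 'rV[R]_n => flat p (a * x 0 j + b)).
Proof.
apply: (smooth_coind (P := fun g => exists p : {poly R},
  g = fun x : 'rV[R]_n => flat p (a * x 0 j + b))); last by exists p.
move=> _ [q ->].
have c1 : C1 (fun x : 'rV[R]_n => a * x 0 j + b).
  by apply: C1D; [apply: C1Z; exact: C1_coord|exact: C1_cst].
have [C dC] := C1_comp c1 (fun x => is_derive_flat q (a * x 0 j + b))
  (fun x => @cont_flat _ (flat_d q) (a * x 0 j + b)).
split=> // i; exists ((a * (i == j)%:R) *: flat_d q).
apply/funext => x; rewrite dC dD ?dcst ?dZ ?dcoord ?addr0.
- by rewrite /flat hornerZ; case: ifP => _; rewrite ?mul0r//; ring.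
- exact: C1_coord.
- by apply: C1Z; exact: C1_coord.
- exact: C1_cst.
Qed.

Lemma test_csupp (phi : 'rV[R]_n -> R) : test_function phi <-> smooth phi /\ csupp phi.
Proof.
split=> [[sp cp]|[sp /csupp_cube[M M0 HM]]]; split=> //.
  have bc (j : 'I_n) : exists M : R, forall x, phi x != 0 -> `|x 0 j| <= M.
    have : compact ((fun x : 'rV[R]_n => x 0 j) @` closure [set x | phi x != 0]).
      apply: continuous_compact => //; apply: continuous_subspaceT.
      exact: cont_coord.
    move=> /compact_bounded[B [_ HB]]; exists (`|B| + 1) => x px.
    apply: HB; first by rewrite ltr_pwDr// ler_norm.
    by exists x => //; exact: subset_closure.
  have [M HM] := choice bc.
  exists (\sum_j `|M j|) => x i xi; apply/eqP; apply: contraTT xi => px.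
  rewrite -leNgt (le_trans (HM i x px))// (le_trans (ler_norm _))//.
  by rewrite (bigD1 i)//= lerDl sumr_ge0.
have cc : compact (cube (0 : 'rV[R]_n) M).
  rewrite cube_box; apply: (@rV_compact _ _ (fun i => _)) => i.
  exact: segment_compact.
apply: (subclosed_compact _ cc); first exact: closed_closure.
have clc : closed (cube (0 : 'rV[R]_n) M).
  by apply: compact_closed => //; exact: norm_hausdorff.
rewrite [X in _ `<=` X]((closure_id _).1 clc); apply: closure_subset => x /=.
by apply: contra_neqP => /HM.
Qed.

Lemma test_C1 phi : @test_function R n phi -> C1 phi.
Proof. by move=> /test_csupp[/smooth_C1]. Qed.

Lemma test_supp phi : @test_function R n phi -> csupp phi.
Proof. by move=> /test_csupp[]. Qed.

Lemma test_bm phi : @test_function R n phi -> bm phi.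
Proof. by move=> /test_csupp[/smooth_C1/C1_cont c s]; exact: bm_cont. Qed.

Lemma test_d phi i : @test_function R n phi -> test_function (fun x => 'D_('e_i) phi x).
Proof.
move=> /test_csupp[s c]; apply/test_csupp; split; first exact: smooth_d.
exact: csupp_d.
Qed.

Lemma test_mul f phi : smooth f -> @test_function R n phi ->
  test_function (fun x => f x * phi x).
Proof.
move=> sf /test_csupp[s c]; apply/test_csupp; split; first exact: smoothM.
exact: csuppMr.
Qed.

Lemma testZ (a : R) phi : @test_function R n phi -> test_function (fun x => a * phi x).
Proof. by move=> tp; apply: test_mul => //; exact: smooth_cst. Qed.

Lemma testD phi psi : @test_function R n phi -> @test_function R n psi ->
  test_function (fun x => phi x + psi x).
Proof.
move=> /test_csupp[s c] /test_csupp[s' c']; apply/test_csupp; split.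
  exact: smoothD.
exact: csuppD.
Qed.

Lemma test0 : @test_function R n (fun=> 0).
Proof. by apply/test_csupp; split; [exact: smooth_cst|exists 0]. Qed.

Lemma bm_sq f : bm f -> sq leb f.
Proof.
move=> bf; have [mf Bf _] := bf; split=> //; apply: intg_bm.
have := bmM bf mf Bf; congr bm.
Qed.

Lemma test_sq phi : @test_function R n phi -> sq leb phi.
Proof. by move=> /test_bm/bm_sq. Qed.

(** Finite intersections of open half-spaces form a generating pi-system: concatenating lists
    intersects corners. *)
Definition corner (s : seq ('I_n * R)) : set 'rV[R]_n :=
  [set x | all (fun p => p.2 < x 0 p.1) s].

Lemma measurable_coord_gt (i : 'I_n) (a : R) : measurable [set x : 'rV[R]_n | a < x 0 i].
Proof.
rewrite (_ : [set x | _] = @rV_coord R n i @^-1` `]a, +oo[%classic).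
  by rewrite -[X in measurable X]setTI; apply: measurable_rV_coord.
by apply/seteqP; split=> x /=; rewrite in_itv/= andbT.
Qed.

Lemma measurable_coord_ge (i : 'I_n) (a : R) : measurable [set x : 'rV[R]_n | a <= x 0 i].
Proof.
rewrite (_ : [set x | _] = @rV_coord R n i @^-1` `[a, +oo[%classic).
  by rewrite -[X in measurable X]setTI; apply: measurable_rV_coord.
by apply/seteqP; split=> x /=; rewrite in_itv/= andbT.
Qed.

Lemma measurable_corner s : measurable (corner s).
Proof.
elim: s => [|p s IH].
  rewrite (_ : corner [::] = setT); first exact: (@measurableT _ 'rV[R]_n).
  by apply/seteqP; split.
rewrite (_ : corner (p :: s) = [set x : 'rV[R]_n | p.2 < x 0 p.1] `&` corner s).
  by apply: measurableI => //; exact: measurable_coord_gt.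
by apply/seteqP; split=> x /=; [move=> /andP[]|move=> [a b]; apply/andP].
Qed.

Lemma corner_generates : measurable `<=` <<s range corner >>.
Proof.
apply: smallest_sub; first exact: smallest_sigma_algebra.
rewrite -bigcup_seq => A [i /= _ [B mB <-]]; rewrite setTI.
have sub : @measurable _ (measurableTypeR R) `<=`
    [set B | <<s range corner >> (@rV_coord R n i @^-1` B)].
  rewrite RGenOInfty.measurableE; apply: smallest_sub.
    split.
    - by rewrite /= preimage_set0; exact: sigma_algebra0.
    - by move=> C /= HC; rewrite setTD preimage_setC -setTD; exact: sigma_algebraCD.
    - by move=> F HF /=; rewrite preimage_bigcup; exact: sigma_algebra_bigcup.
  move=> _ [a ->] /=; apply: sub_sigma_algebra; exists [:: (i, a)] => //.
exact: sub.
Qed.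

(** Increasingly steep smooth approximations of the corner; the second product restricts it to the
    open cube of half-width [N], for compact support. *)
Definition corner_approx (N : R) (s : seq ('I_n * R)) (k : nat) (x : 'rV[R]_n) : R :=
  (\prod_(p <- s) step (k.+1%:R * (x 0 p.1 - p.2))) *
  \prod_(i < n) (step (k.+1%:R * (N - x 0 i)) * step (k.+1%:R * (x 0 i + N))).

Lemma corner_approx0 N s k (x : 'rV[R]_n) i : N < `|x 0 i| -> corner_approx N s k x = 0.
Proof.
move=> xi; rewrite /corner_approx [X in _ * X](bigD1 i)//=.
move: xi; rewrite ltr_normr => /orP[xi|xi].
  rewrite (_ : step (_ * (N - _)) = 0) ?(mul0r, mulr0)//.
  by rewrite stepE ltNge mulr_ge0_le0// subr_le0 ltW.
rewrite [X in _ * X * _](_ : step _ = 0) ?(mul0r, mulr0)//.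
by rewrite stepE ltNge mulr_ge0_le0//; lra.
Qed.

Lemma test_corner_approx N s k : test_function (corner_approx N s k).
Proof.
apply/test_csupp; split.
  apply: smoothM; apply: smooth_prod => i.
    rewrite (_ : (fun x => _) = (fun x : 'rV[R]_n =>
      flat 1 (k.+1%:R * x 0 i.1 + - (k.+1%:R * i.2)))); first exact: smooth_flat.
    by apply/funext => x; rewrite mulrBr.
  apply: smoothM.
    rewrite (_ : (fun x => _) = (fun x : 'rV[R]_n =>
      flat 1 (- k.+1%:R * x 0 i + k.+1%:R * N))); first exact: smooth_flat.
    by apply/funext => x; congr flat; ring.
  rewrite (_ : (fun x => _) = (fun x : 'rV[R]_n =>
    flat 1 (k.+1%:R * x 0 i + k.+1%:R * N))); first exact: smooth_flat.
  by apply/funext => x; congr flat; ring.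
by exists N; exact: corner_approx0.
Qed.

Lemma prod_01 (I : Type) (s : seq I) (F : I -> R) :
  (forall i, 0 <= F i <= 1) -> 0 <= \prod_(i <- s) F i <= 1.
Proof.
move=> H; elim: s => [|i s /andP[a b]]; first by rewrite big_nil ler01 lexx.
have /andP[c e] := H i; rewrite big_cons mulr_ge0//=.
by rewrite -[X in _ <= X]mulr1 ler_pM.
Qed.

Lemma corner_approx_01 N s k x : 0 <= corner_approx N s k x <= 1.
Proof.
have H (y : R) : 0 <= step y <= 1 by rewrite step_ge0 step_le1.
have H2 (y z : R) : 0 <= step y * step z <= 1.
  by rewrite mulr_ge0 ?step_ge0//= -[X in _ <= X]mulr1 ler_pM ?step_ge0 ?step_le1.
have /andP[a b] := prod_01 s (fun p => H (k.+1%:R * (x 0 p.1 - p.2))).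
have /andP[c e] := @prod_01 _ (index_enum 'I_n)
  (fun i => step (k.+1%:R * (N - x 0 i)) * step (k.+1%:R * (x 0 i + N)))
  (fun i => H2 _ _).
rewrite /corner_approx mulr_ge0//=.
by rewrite -[X in _ <= X]mulr1 ler_pM.
Qed.

Lemma cvg_prod (I : Type) (s : seq I) (F : nat -> I -> R) (l : I -> R) :
  (forall i, F k i @[k --> \oo] --> l i) ->
  \prod_(i <- s) F k i @[k --> \oo] --> \prod_(i <- s) l i.
Proof.
move=> H; elim: s => [|i s IH].
  by rewrite big_nil; under eq_cvg do rewrite big_nil; exact: cvg_cst.
by rewrite big_cons; under eq_cvg do rewrite big_cons; apply: cvgM.
Qed.

Lemma corner_approx_cvg N s x : corner_approx N s k x @[k --> \oo] -->
  (\1_(corner s) x * \1_[set x : 'rV[R]_n | forall i, `|x 0 i| < N] x : R).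
Proof.
apply: cvgM.
  rewrite (_ : \1_(corner s) x = \prod_(p <- s) (0 < x 0 p.1 - p.2)%R%:R).
    by apply: cvg_prod => p; exact: step_cvg.
  rewrite indicE (_ : x \in corner s = all (fun p => p.2 < x 0 p.1) s); last first.
    by apply/idP/idP; rewrite inE.
  elim: s => [|p s IH]; rewrite ?big_nil// big_cons -IH /= subr_gt0.
  by case: (p.2 < _); rewrite ?mul1r ?mul0r.
rewrite (_ : \1_ _ x = \prod_(i < n) ((0 < N - x 0 i)%R%:R * (0 < x 0 i + N)%R%:R)).
  by apply: cvg_prod => i; apply: cvgM; exact: step_cvg.
have E i : ((0 < N - x 0 i)%R%:R * (0 < x 0 i + N)%R%:R : R) = (`|x 0 i| < N)%R%:R.
  rewrite ltr_norml subr_gt0 -ltrBlDr sub0r andbC.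
  by case: (x 0 i < N); rewrite ?mul1r ?mul0r ?andbF.
under eq_bigr do rewrite E.
rewrite indicE; have [/set_mem/= H|/negP] := boolP (x \in _).
  by rewrite big1// => i _; rewrite H.
rewrite inE => /existsNP[i /negP/negbTE h].
by rewrite (bigD1 i)//= h mul0r.
Qed.

(** Test functions approximate indicators of corners in a cube, and the pi-lambda theorem passes
    from corners to all measurable sets. The sets where [u] is positive and where it is not then
    show that the integral of |u| over every cube vanishes. *)
Lemma du_bois_reymond u : sq leb u ->
  (forall phi, test_function phi -> rint leb (fun x => u x * phi x) = 0) ->
  dot leb u u = 0.
Proof.
move=> su H.
have mu_ := sq_meas su.
pose Q (N : nat) := [set x : 'rV[R]_n | forall i, `|x 0 i| < N%:R].
have mQ N : measurable (Q N).
  rewrite (_ : Q N = \bigcap_(i in [set: 'I_n])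
      ([set x | - N%:R < x 0 i] `&` ~` [set x | N%:R <= x 0 i])); last first.
    apply/seteqP; split=> x /= h i.
      by move=> _; have := h i; rewrite ltr_norml => /andP[a b]; split=> //; apply/negP; rewrite -ltNge.
    by have [a /negP b] := h i I; rewrite ltr_norml a ltNge.
  apply: fin_bigcap_measurable => // i _; apply: measurableI.
    exact: measurable_coord_gt.
  by apply: measurableC; exact: measurable_coord_ge.
have QE N x : \1_(Q N) x <= \1_(cube (0 : 'rV[R]_n) N%:R) x :> R.
  rewrite !indicE; have [/set_mem h|_] := boolP (x \in Q N); last by rewrite ler0n.
  by rewrite mem_set// => i; rewrite mxE subr0 ltW.
have Iu N : intg leb (fun x => u x * \1_(Q N) x).
  apply: (intg_dom _ _ (intgD (intg_indic_cube 0 N%:R) su.2)).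
    by apply: measurable_funM => //; exact: measurable_indic.
  move=> x; rewrite normrM [X in _ * X]ger0_norm ?indicE//.
  have := QE N x; rewrite !indicE; case: (x \in Q N) => /=.
    rewrite mulr1; case: (x \in cube _ _) => /=; last by rewrite ler10.
    by rewrite ler_norml => _; apply/andP; split; nra.
  by rewrite mulr0 => _; rewrite addr_ge0 ?ler0n ?sqr_ge0.
have IuA N A : measurable A -> intg leb (fun x => u x * \1_(Q N) x * \1_A x).
  move=> mA; apply: (intg_dom _ _ (intg_norm (Iu N))).
    apply: measurable_funM; first exact: intg_meas.
    exact: measurable_indic.
  by move=> x; rewrite normrM ler_piMr// indicE; case: (x \in A); rewrite ?normr1 ?normr0.
have cornerQ N s : rint leb (fun x => u x * \1_(Q N) x * \1_(corner s) x) = 0.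
  have [||||_ h] := @rint_dct _ _ _ leb (fun k x => u x * corner_approx N%:R s k x)
    (fun x => u x * \1_(Q N) x * \1_(corner s) x)
    (fun x => 2 * (\1_(cube (0 : 'rV[R]_n) N%:R) x + u x ^+ 2)).
  - by move=> k; apply: measurable_funM => //; have [] := test_bm (test_corner_approx N%:R s k).
  - move=> x; rewrite -mulrA [X in _ * X]mulrC; apply: cvgM; first exact: cvg_cst.
    exact: corner_approx_cvg.
  - by apply: intgZ; apply: intgD; [exact: intg_indic_cube|exact: su.2].
  - move=> k x; rewrite normrM indicE; have /andP[a b] := corner_approx_01 N%:R s k x.
    have [_|/negP] := boolP (x \in cube _ _).
      rewrite (ger0_norm a) (le_trans (ler_wpM2l (normr_ge0 _) b))// mulr1.
      by rewrite ler_norml /=; have := sqr_ge0 (u x - 1); have := sqr_ge0 (u x + 1);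
        move=> ? ?; apply/andP; split; nra.
    rewrite inE => /existsNP[i /negP]; rewrite mxE subr0 -ltNge => /corner_approx0 ->.
    by rewrite normr0 mulr0 mulr_ge0// addr_ge0 ?sqr_ge0.
  apply: (cvg_unique _ h) => //.
  rewrite (_ : (fun k => _) = fun=> 0); first exact: cvg_cst.
  by apply/funext => k; apply: H; exact: test_corner_approx.
(* The cube [Q N] makes [u] integrable, as monotone unions and differences in the lambda-system
   require. *)
have key N A : measurable A -> rint leb (fun x => u x * \1_(Q N) x * \1_A x) = 0.
  suff HA : <<s range corner >> `<=` [set A | measurable A /\
      rint leb (fun x => u x * \1_(Q N) x * \1_A x) = 0].
    by move=> mA; exact: (HA _ (corner_generates mA)).2.
  apply: lambda_system_subset => //.
  - move=> _ _ [s _ <-] [r _ <-]; exists (s ++ r) => //.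
    by apply/seteqP; split=> x /=; rewrite /corner /= all_cat; [move=> /andP[]|
      move=> [a b]; apply/andP].
  - split=> //.
    + split; first exact: (@measurableT _ 'rV[R]_n).
      have cT : corner [::] = setT by apply/seteqP; split.
      by have := cornerQ N [::]; rewrite cT.
    + move=> A' B BA [mA' HA] [mB HB]; split; first exact: measurableD.
      apply: (@etrans _ _ (rint leb (fun x => u x * \1_(Q N) x * \1_A' x) -
        rint leb (fun x => u x * \1_(Q N) x * \1_B x))); last by rewrite HA HB subrr.
      rewrite -rintB; try exact: IuA.
      apply: rint_ext => x; rewrite -mulrBr; congr (_ * _).
      rewrite !indicE; have [/set_mem xB|/negP] := boolP (x \in B).
        by rewrite (mem_set (BA _ xB)) memNset ?subrr// => -[].
      rewrite inE => xB; rewrite subr0; congr (_ %:R); congr nat_of_bool.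
      by apply/idP/idP; rewrite !inE; [case|move=> ?; split].
    + move=> F ndF HF; have mF k := (HF k).1.
      split; first exact: bigcupT_measurable.
      have [||||_] := @rint_dct _ _ _ leb (fun k x => u x * \1_(Q N) x * \1_(F k) x)
        (fun x => u x * \1_(Q N) x * \1_(\bigcup_i F i) x)
        (fun x => `|u x * \1_(Q N) x|).
      * by move=> k; apply/intg_meas/IuA.
      * move=> x; apply: cvgM; first exact: cvg_cst.
        rewrite indicE; have [/set_mem[k _ Fk]|/negP] := boolP (x \in _).
          apply: cvg_near_cst; exists k => // j /= kj; rewrite indicE mem_set//.
          by have /subsetPset := ndF _ _ kj; apply.
        rewrite inE => nF; apply: cvg_near_cst; near=> j.
        by rewrite indicE memNset// => Fj; apply: nF; exists j.
      * exact: intg_norm (Iu N).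
      * move=> k x; rewrite normrM ler_piMr// indicE.
        by case: (x \in F k); rewrite ?normr1 ?normr0.
      * move=> h; apply: (cvg_unique _ h) => //.
        rewrite (_ : (fun k => _) = fun=> 0); first exact: cvg_cst.
        by apply/funext => k; exact: (HF k).2.
  - by move=> _ [s _ <-]; split; [exact: measurable_corner|exact: cornerQ].
pose A := [set x | 0 < u x].
have mA : measurable A.
  rewrite (_ : A = u @^-1` `]0, +oo[%classic).
    by rewrite -[X in measurable X]setTI; apply: mu_.
  by apply/seteqP; split=> x /=; rewrite in_itv/= andbT.
have mAC := measurableC mA.
have absu N : rint leb (fun x => `|u x * \1_(Q N) x|) = 0.
  apply: (@etrans _ _ (rint leb (fun x => u x * \1_(Q N) x * \1_A x) -
    rint leb (fun x => u x * \1_(Q N) x * \1_(~` A) x))); last by rewrite !key ?subrr.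
  rewrite -rintB; try exact: IuA.
  apply: rint_ext => x; have q0 : (0 : R) <= \1_(Q N) x by rewrite indicE.
  rewrite normrM (ger0_norm q0) !indicE.
  have [/set_mem Ax|/negP] := boolP (x \in A).
    have nAx : ~ (~` A) x by move=> /(_ Ax).
    by rewrite (memNset nAx) mulr1 mulr0 subr0 gtr0_norm.
  rewrite inE => Ax; rewrite (mem_set (Ax : (~` A) x)) mulr1 mulr0 sub0r.
  rewrite ler0_norm ?mulNr//.
  by rewrite leNgt; apply/negP.
have sq0 N : rint leb (fun x => u x * (u x * \1_(Q N) x)) = 0.
  rewrite -(rint0 leb); apply: (rint_ae (intg0 leb) _ _).2.
    by apply: measurable_funM => //; apply: measurable_funM => //; exact: measurable_indic.
  have := rint_eq0 (fun x => normr_ge0 _) (intg_norm (Iu N)) (absu N).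
  by apply: filterS => x /= h /h /normr0_eq0 ->; rewrite mulr0.
have [||||_ h] := @rint_dct _ _ _ leb (fun N x => u x * (u x * \1_(Q N) x))
  (fun x => u x * u x) (fun x => u x * u x).
- by move=> k; apply: measurable_funM => //; apply: measurable_funM => //; exact: measurable_indic.
- move=> x; apply: cvgM; first exact: cvg_cst.
  rewrite -[X in _ --> X]mulr1; apply: cvgM; first exact: cvg_cst.
  apply: cvg_near_cst; pose M := \sum_i `|x 0 i|.
  near=> k; rewrite indicE mem_set// => i.
  apply: (@le_lt_trans _ _ M); first by rewrite /M (bigD1 i)//= lerDl sumr_ge0.
  near: k; exact: nbhs_infty_gtr.
- exact: sq_mul.
- move=> k x; rewrite mulrA normrM ger0_norm ?sqr_ge0 -?expr2 ?sqr_ge0//.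
  by rewrite ler_piMr ?sqr_ge0// indicE; case: (x \in _); rewrite ?normr1 ?normr0.
apply: (cvg_unique _ h) => //.
rewrite (_ : (fun k => _) = fun=> 0); first exact: cvg_cst.
by apply/funext.
Unshelve. all: by end_near. Qed.

End smooth.

(** * Closed forms *)

Lemma subr_split (V : zmodType) (x w y z : V) : x - (w + y) = (x - z - w) + (z - y).
Proof. by rewrite opprD addrA [X in X + (z - y)]addrAC -(addrA (x - w)) addKr. Qed.

Lemma subr_cross (V : zmodType) (x w y z : V) : x - (w + y) - (z - y) = x - z - w.
Proof. by rewrite opprB opprD [x + _]addrA -[LHS]addrA addKr addrAC. Qed.

Lemma kernel_row (R : realType) k j (A : 'M[R]_(k, j)) : (j < k)%N ->
  exists2 t : 'rV[R]_k, t != 0 & t *m A = 0.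
Proof.
move=> jk; have : (kermx A != 0)%MS.
  rewrite -mxrank_eq0 mxrank_ker -lt0n subn_gt0.
  exact: leq_ltn_trans (rank_leq_col A) jk.
move=> /matrix0Pn[i [i' h]]; exists (row i (kermx A)).
  by apply: contraNneq h => /rowP/(_ i'); rewrite [LHS]mxE [RHS]mxE => ->.
by apply/sub_kermxP; exact: row_sub.
Qed.

Section closed_forms.
Context (R : realType) (X : lmodType R).
Implicit Types (L D : X -> Prop) (ip q : X -> X -> R) (u v w f g h : X).

Definition form_norm ip q (c : R) u v := q u v + (c + 1) * ip u v.

(* L carries a semi-inner product (vectors at distance 0 are identified);
   D and q do not distinguish identified vectors. *)
Record closed_form L ip D q (c : R) : Prop := ClosedForm {
  cf_ip : sip L ip;
  cf_Lcomplete : sip_complete L ip;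
  cf_D : subspace D;
  cf_DL : forall u, D u -> L u;
  cf_dense : forall u, L u -> (forall v, D v -> ip u v = 0) -> ip u u = 0;
  cf_qD : forall u v w, D u -> D v -> D w -> q (u + v) w = q u w + q v w;
  cf_qZ : forall a u v, D u -> D v -> q (a *: u) v = a * q u v;
  cf_qC : forall u v, D u -> D v -> q u v = q v u;
  cf_c0 : 0 <= c;
  cf_lb : forall u, D u -> 0 <= q u u + c * ip u u;
  cf_complete : sip_complete D (form_norm ip q c);
  cf_ae : forall u v, D u -> L v -> ip (u - v) (u - v) = 0 -> D v;
  cf_null : forall u, D u -> ip u u = 0 -> q u u = 0 }.

Definition opr L ip D q u f := [/\ D u, L f & forall v, D v -> q u v = ip f v].

(** For real [u] the right-hand side is the squared norm of [(A - a - i b) u] in the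
    complexification: the operator minus a complex number is bounded below. *)
Definition lower_at L ip D q (a b : R) := exists2 c : R, 0 < c &
  forall u f, opr L ip D q u f ->
    c * ip u u <= ip (f - a *: u) (f - a *: u) + b ^+ 2 * ip u u.

(** The form is at least [E] up to a form of finite rank. This is the quantitative substitute for
    having no essential spectrum below [E], and [m] bounds the number of eigenvalues there. *)
Definition comp_below L ip D q (E : R) (m : nat) := exists (K : R) (l : 'I_m -> X),
  [/\ 0 <= K, forall i, L (l i) &
  forall u, D u -> E * ip u u <= q u u + K * \sum_i (ip (l i) u) ^+ 2].

Definition eigvec L ip D q (a : R) u := opr L ip D q u (a *: u).

Section theory.
Variables (L D : X -> Prop) (ip q : X -> X -> R) (c : R).
Hypothesis cf : closed_form L ip D q c.
Let sL := cf_ip cf.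
Let LL := sip_ss sL.
Let DD := cf_D cf.
Let N := form_norm ip q c.
Notation oprq := (opr L ip D q).

Local Ltac inL := repeat first [assumption | apply: (cf_DL cf); assumption |
  apply: (ssB LL) | apply: (ssD LL) | apply: (ssN LL) | apply: (ssZ LL) |
  apply: (cf_DL cf) | apply: (ssB DD) | apply: (ssD DD) | apply: (ssZ DD)].
Local Ltac inD := repeat first [assumption |
  apply: (ssB DD) | apply: (ssD DD) | apply: (ssN DD) | apply: (ssZ DD)].

Lemma cf_norm : sip D N.
Proof.
split; rewrite /N /form_norm.
- exact: DD.
- by move=> u v w Du Dv Dw; rewrite (cf_qD cf)// (sipDl sL); inL; ring.
- by move=> a u v Du Dv; rewrite (cf_qZ cf)// (sipZl sL); inL; ring.
- by move=> u v Du Dv; rewrite (cf_qC cf)// (sipC sL); inL.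
- move=> u Du; have := cf_lb cf Du; have := sip_ge0 sL (cf_DL cf Du).
  by rewrite mulrDl mul1r; lra.
Qed.

Lemma ip_le_norm u : D u -> ip u u <= N u u.
Proof. by move=> Du; have := cf_lb cf Du; rewrite /N /form_norm mulrDl mul1r; lra. Qed.

Lemma cf_qZr a u v : D u -> D v -> q u (a *: v) = a * q u v.
Proof. by move=> Du Dv; rewrite (cf_qC cf) ?(cf_qZ cf)// ?(cf_qC cf Du)//; inD. Qed.

Lemma cf_qB u v w : D u -> D v -> D w -> q (u - v) w = q u w - q v w.
Proof.
by move=> Du Dv Dw; rewrite -scaleN1r (cf_qD cf) ?(cf_qZ cf) ?mulN1r//; inD.
Qed.

Lemma cf_nullq u v : D u -> D v -> ip u u = 0 -> q u v = 0.
Proof.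
move=> Du Dv u0; have Lu := cf_DL cf Du; have Lv := cf_DL cf Dv.
have N0 : N u u = 0 by rewrite /N /form_norm (cf_null cf)// u0 mulr0 addr0.
have := sip_null cf_norm Du Dv N0.
by rewrite /N /form_norm (sip_null sL Lu Lv u0) mulr0 addr0.
Qed.

(** This solves [(A + c + 1) w = h]: the shifted form is an inner product for which the form domain
    is complete. *)
Lemma norm_solve h : L h -> exists2 w, D w & forall v, D v -> N w v = ip h v.
Proof.
move=> Lh; apply: (riesz cf_norm (cf_complete cf) (C := ip h h)).
- by move=> u v Du Dv; rewrite (sipDr sL); inL.
- by move=> a u Du; rewrite (sipZr sL); inL.
- move=> u Du; apply: (le_trans (sip_CS sL Lh (cf_DL cf Du))).
  by apply: ler_wpM2l; [exact: (sip_ge0 sL)|exact: ip_le_norm].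
Qed.

Lemma oprD u f v g : oprq u f -> oprq v g -> oprq (u + v) (f + g).
Proof.
move=> [Du Lf Hf] [Dv Lg Hg]; split; [inD|inL|move=> w Dw].
by rewrite (cf_qD cf)// Hf// Hg// (sipDl sL); inL.
Qed.

Lemma oprZ a u f : oprq u f -> oprq (a *: u) (a *: f).
Proof.
move=> [Du Lf Hf]; split; [inD|inL|move=> w Dw].
by rewrite (cf_qZ cf)// Hf// (sipZl sL); inL.
Qed.

Lemma oprB u f v g : oprq u f -> oprq v g -> oprq (u - v) (f - g).
Proof.
by move=> A B; rewrite -(scaleN1r v) -(scaleN1r g); apply: oprD => //; exact: oprZ.
Qed.

Lemma opr_sym u f v g : oprq u f -> oprq v g -> ip u g = ip f v.
Proof.
move=> [Du Lf Hf] [Dv Lg Hg]; rewrite -Hf// (sipC sL) -?Hg//; last by inL.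
exact: (cf_qC cf).
Qed.

(** Self-adjointness. Solve [(A + c + 1) w = f + (c + 1) u]; testing the hypothesis on the solution
    of [(A + c + 1) v = w - u] shows that [w - u] is null, so that [u] inherits the equation of
    [w]. *)
Lemma opr_selfadj u f : L u -> L f ->
  (forall v g, oprq v g -> ip u g = ip f v) -> oprq u f.
Proof.
move=> Lu Lf H.
have [|w Dw Hw] := @norm_solve (f + (c + 1) *: u); first by inL.
have Lw := cf_DL cf Dw.
have z0 : ip (w - u) (w - u) = 0.
  pose h := w - u; have Lh : L h by rewrite /h; inL.
  have [v Dv Hv] := norm_solve Lh; have Lv := cf_DL cf Dv.
  have Ov : oprq v (h - (c + 1) *: v).
    split=> //; first by inL.
    move=> y Dy; have Ly := cf_DL cf Dy; have := Hv y Dy.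
    rewrite (sipBl sL) ?(sipZl sL)//; last by inL.
    by rewrite /N /form_norm => <-; ring.
  have e1 := H _ _ Ov; have e2 := Hv w Dw; have e3 := Hw v Dv.
  rewrite (sipC cf_norm)// e3 in e2.
  rewrite (sipDl sL) ?(sipZl sL) in e2; try by inL.
  rewrite (sipBr sL) ?(sipZr sL) in e1; try by inL.
  rewrite -/h {1}/h (sipBl sL)// (sipC sL Lw Lh) -e2.
  have -> : ip u h = ip f v + (c + 1) * ip u v by rewrite -e1; ring.
  by ring.
have Du : D u by apply: (cf_ae cf Dw).
split=> // v Dv; have Lv := cf_DL cf Dv.
have n0 := sip_null sL (ssB LL Lw Lu) Lv z0.
have q0 := cf_nullq (ssB DD Dw Du) Dv z0.
have := Hw v Dv; rewrite /N /form_norm (sipDl sL) ?(sipZl sL)//; last by inL.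
move: n0 q0; rewrite (sipBl sL)// cf_qB// => /eqP; rewrite subr_eq0 => /eqP ->.
by move=> /eqP; rewrite subr_eq0 => /eqP ->; lra.
Qed.

(** The description by the adjoint, [ip u g = ip f v] for all pairs in the graph, passes to limits
    by Cauchy-Schwarz. *)
Lemma opr_closed (u f : nat -> X) (u0 f0 : X) : (forall k, oprq (u k) (f k)) ->
  L u0 -> L f0 -> sip_cvg ip u u0 -> sip_cvg ip f f0 -> oprq u0 f0.
Proof.
move=> uf Lu Lf cu cf'; apply: opr_selfadj => // v g Ovg.
have [Dv Lg _] := Ovg; have Lv := cf_DL cf Dv.
apply/eqP; rewrite -subr_eq0; apply/eqP; apply: sqr_small_eq0 => e e0.
have g0 := sip_ge0 sL Lg; have v0 := sip_ge0 sL Lv.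
pose d := e / (2 * (ip g g + ip v v + 1)).
have p0 : 0 < 2 * (ip g g + ip v v + 1) by lra.
have d0 : 0 < d by rewrite divr_gt0.
have [N1 H1] := cu _ d0; have [N2 H2] := cf' _ d0.
have h1 := H1 _ (leq_maxl N1 N2); have h2 := H2 _ (leq_maxr N1 N2).
set k := maxn N1 N2 in h1 h2.
have [Dk Lk _] := uf k; have Lu' := cf_DL cf Dk.
have E : ip u0 g - ip f0 v = ip (f k - f0) v + - ip (u k - u0) g.
  by rewrite !(sipBl sL)// (opr_sym (uf k) Ovg); ring.
have a1 := sip_CS sL (ssB LL Lk Lf) Lv; have a2 := sip_CS sL (ssB LL Lu' Lu) Lg.
have b1 : (ip (f k - f0) v) ^+ 2 <= d * ip v v.
  by apply: (le_trans a1); apply: ler_wpM2r => //; exact: ltW.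
have b2 : (ip (u k - u0) g) ^+ 2 <= d * ip g g.
  by apply: (le_trans a2); apply: ler_wpM2r => //; exact: ltW.
have de : d * (2 * (ip g g + ip v v + 1)) = e by rewrite /d divfK ?gt_eqF.
rewrite E; apply: (le_trans (sqrD_le2 _ _)); rewrite sqrrN -de.
nra.
Qed.

(* Riesz on the graph, with the form ((A-a)u, (A-a)v) + b^2 (u, v). *)
Lemma opr_square_surj (a b : R) : lower_at L ip D q a b -> forall h, L h ->
  exists w f, oprq w f /\
    oprq (f - a *: w) (h - b ^+ 2 *: w + a *: (f - a *: w)).
Proof.
move=> [r r0 Hr] h Lh.
pose G (p : X * X) := oprq p.1 p.2.
pose B (p s : X * X) := ip (p.2 - a *: p.1) (s.2 - a *: s.1) + b ^+ 2 * ip p.1 s.1.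
have GL1 p : G p -> L p.1 by move=> [Du _ _]; inL.
have GL2 p : G p -> L p.2 by case.
have GL p : G p -> L (p.2 - a *: p.1).
  by move=> Gp; have := GL1 _ Gp; have := GL2 _ Gp => *; inL.
have ssG : subspace G.
  split.
  - split; [exact: (ss0 DD)|exact: (ss0 LL)|move=> v Dv].
    have Lv := cf_DL cf Dv.
    by rewrite -[X in q X _](scale0r 0) (cf_qZ cf) ?(sip0l sL)// ?mul0r//; exact: (ss0 DD).
  - by move=> [u f] [v g]; exact: oprD.
  - by move=> t [u f]; exact: oprZ.
have sB : sip G B.
  split=> //.
  - move=> p s t Gp Gs Gt; have Lp := GL1 _ Gp; have Ls := GL1 _ Gs; have Lt := GL1 _ Gt.
    have Lp' := GL _ Gp; have Ls' := GL _ Gs; have Lt' := GL _ Gt; rewrite /B /=.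
    have -> : p.2 + s.2 - a *: (p.1 + s.1) = (p.2 - a *: p.1) + (s.2 - a *: s.1).
      by rewrite scalerDr opprD addrACA.
    by rewrite (sipDl sL Lp' Ls' Lt') (sipDl sL Lp Ls Lt); ring.
  - move=> t p s Gp Gs; have Lp := GL1 _ Gp; have Ls := GL1 _ Gs.
    have Lp' := GL _ Gp; have Ls' := GL _ Gs; rewrite /B /=.
    have -> : t *: p.2 - a *: (t *: p.1) = t *: (p.2 - a *: p.1).
      by rewrite scalerBr !scalerA mulrC.
    by rewrite (sipZl sL _ Lp' Ls') (sipZl sL _ Lp Ls); ring.
  - move=> p s Gp Gs; rewrite /B; congr (_ + _ * _); apply: (sipC sL).
    + exact: GL. + exact: GL. + exact: GL1. + exact: GL1.
  - move=> p Gp; rewrite /B; apply: addr_ge0; first exact/(sip_ge0 sL)/GL.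
    by apply: mulr_ge0; [exact: sqr_ge0|exact/(sip_ge0 sL)/GL1].
have rB p : G p -> r * ip p.1 p.1 <= B p p by exact: Hr.
have cB : sip_complete G B.
  move=> p Gp cp.
  have c1 : sip_cauchy ip (fun k => (p k).1).
    move=> e e0; have [|M HM] := cp (r * e); first exact: mulr_gt0.
    exists M => i j Mi Mj; rewrite -(ltr_pM2l r0).
    by apply: le_lt_trans (HM i j Mi Mj); exact: (rB _ (ssB ssG (Gp i) (Gp j))).
  have c2 : sip_cauchy ip (fun k => (p k).2 - a *: (p k).1).
    move=> e e0; have [M HM] := cp _ e0.
    exists M => i j Mi Mj; apply: le_lt_trans (HM i j Mi Mj); rewrite /B /=.
    have -> : (p i).2 - a *: (p i).1 - ((p j).2 - a *: (p j).1) =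
        (p i).2 - (p j).2 - a *: ((p i).1 - (p j).1).
      by rewrite scalerBr !opprB addrACA [RHS]addrACA; congr (_ + _); rewrite addrC.
    rewrite lerDl mulr_ge0 ?sqr_ge0//; apply: (sip_ge0 sL).
    by have := GL1 _ (Gp i); have := GL1 _ (Gp j) => *; inL.
  have [u Lu cu] := cf_Lcomplete cf (fun k => GL1 _ (Gp k)) c1.
  have [w Lw cw] := cf_Lcomplete cf (fun k => GL _ (Gp k)) c2.
  have cf2 : sip_cvg ip (fun k => (p k).2) (w + a *: u).
    move=> e e0; pose t := 4 * (1 + a ^+ 2).
    have t0 : 0 < t by have := sqr_ge0 a; rewrite /t; lra.
    have [|M1 H1] := cu (e / t); first by rewrite divr_gt0.
    have [|M2 H2] := cw (e / t); first by rewrite divr_gt0.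
    exists (maxn M1 M2) => i; rewrite geq_max => /andP[i1 i2].
    have h1 := H1 _ i1; have h2 := H2 _ i2.
    have Lp := GL1 _ (Gp i); have Lp' := GL _ (Gp i).
    have Lpu := ssB LL Lp Lu; have Lpw := ssB LL Lp' Lw.
    have -> : (p i).2 - (w + a *: u) =
        ((p i).2 - a *: (p i).1 - w) + a *: ((p i).1 - u).
      by rewrite scalerBr; exact: subr_split.
    apply: (le_lt_trans (sip_sqrD_le sL Lpw (ssZ LL a Lpu))).
    rewrite (sip_sqrZ sL)//; move: h1 h2; rewrite !ltr_pdivlMr// /t.
    by have := sip_ge0 sL Lpu; have := sip_ge0 sL Lpw; have := sqr_ge0 a; nra.
  exists (u, w + a *: u).
    by apply: (@opr_closed (fun k => (p k).1) (fun k => (p k).2)) => //; inL.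
  move=> e e0; pose t := 1 + b ^+ 2.
  have t0 : 0 < t by have := sqr_ge0 b; rewrite /t; lra.
  have [|M1 H1] := cu (e / t / 2); first by rewrite !divr_gt0.
  have [|M2 H2] := cw (e / 2); first by rewrite divr_gt0.
  exists (maxn M1 M2) => i; rewrite geq_max => /andP[i1 i2].
  have h1 := H1 _ i1; have h2 := H2 _ i2; rewrite /B /=.
  have -> : (p i).2 - (w + a *: u) - a *: ((p i).1 - u) = (p i).2 - a *: (p i).1 - w.
    by rewrite scalerBr; exact: subr_cross.
  move: h1 h2; set A1 := ip _ _; set A2 := ip _ _ => h1 h2.
  have A10 : 0 <= A1 by apply: (sip_ge0 sL); have := GL1 _ (Gp i) => *; inL.
  have h3 : A1 * t < e / 2 by rewrite -ltr_pdivlMr// mulrAC.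
  by move: h3; rewrite /t; nra.
have [[w f] Gw Hw] : exists2 p, G p & forall s, G s -> B p s = ip h s.1.
  apply: (riesz sB cB (C := ip h h / r)) => [p s Gp Gs|t p Gp|p Gp].
  - by rewrite (sipDr sL)//; exact: GL1.
  - by rewrite (sipZr sL)//; exact: GL1.
  - apply: (le_trans (sip_CS sL Lh (GL1 _ Gp))).
    rewrite -mulrA; apply: ler_wpM2l; first exact: (sip_ge0 sL).
    by rewrite ler_pdivlMl// rB.
have Lw := GL1 _ Gw; have Lf := GL2 _ Gw; have Lfw := GL _ Gw.
rewrite /= in Lw Lf Lfw.
(* The Riesz identity on the graph says that [f - a w] lies in the domain of the adjoint, with the
   announced image. *)
exists w, f; split=> //; apply: opr_selfadj => //; first by inL.
move=> v g Ovg; have := Hw (v, g) Ovg; have [Dv Lg _] := Ovg.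
have Lv := cf_DL cf Dv; rewrite /B /=.
rewrite (sipBr sL Lfw Lg (ssZ LL a Lv)) (sipZr sL _ Lfw Lv).
rewrite (sipDl sL (ssB LL Lh (ssZ LL _ Lw)) (ssZ LL a Lfw) Lv).
rewrite (sipBl sL Lh (ssZ LL _ Lw) Lv) (sipZl sL _ Lw Lv) (sipZl sL _ Lfw Lv).
by lra.
Qed.

(** Take [v = (A - a)^-1 u]: then [q u v - a ip u v] is [ip u u], while the form norm of [v] is
    bounded by that of [u] in L. Since the defect of [u] is measured in the dual of the form norm,
    approximate eigenvectors may be taken from the form domain. *)
Lemma weyl_bound (a : R) : lower_at L ip D q a 0 -> exists2 C : R, 0 <= C &
  forall u (e : R), D u -> 0 <= e ->
    (forall v, D v -> (q u v - a * ip u v) ^+ 2 <= e * N v v) -> ip u u <= C * e.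
Proof.
move=> Hl; have [r r0 Hr] := Hl.
pose C := 1 + r^-1 + (`|a| + c + 1) * r^-1.
have c0 := cf_c0 cf; have ri : 0 <= r^-1 by rewrite invr_ge0 ltW.
have C0 : 0 <= C by rewrite /C !addr_ge0// mulr_ge0// !addr_ge0.
exists C => // u e Du e0 H; have Lu := cf_DL cf Du.
have [w [f [Owf]]] := opr_square_surj Hl Lu.
set v := f - a *: w; rewrite expr0n /= scale0r subr0 => Ov.
have [Dv _ Hv] := Ov; have Lv := cf_DL cf Dv.
have := Hr _ _ Ov; rewrite addrK expr0n/= mul0r addr0 => vu.
have v0 := sip_ge0 sL Lv; have u0 := sip_ge0 sL Lu.
have E u' : D u' -> q v u' = ip u u' + a * ip v u'.
  by move=> Du'; rewrite Hv// (sipDl sL) ?(sipZl sL)//; inL.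
have e1 : q u v - a * ip u v = ip u u.
  by rewrite (cf_qC cf)// E// (sipC sL Lv Lu); ring.
have vr : ip v v <= r^-1 * ip u u by rewrite ler_pdivlMl.
have NC : N v v <= C * ip u u.
  rewrite /N /form_norm E//.
  have : ip u v <= ip u u + ip v v.
    by have := sip_ge0 sL (ssB LL Lu Lv); rewrite (sip_sqrB sL)//; lra.
  have : a * ip v v <= `|a| * ip v v by apply: ler_wpM2r => //; exact: ler_norm.
  have : (`|a| + c + 1) * ip v v <= (`|a| + c + 1) * r^-1 * ip u u.
    by rewrite -mulrA; apply: ler_wpM2l => //; rewrite !addr_ge0.
  rewrite /C !mulrDl mul1r; lra.
have := H v Dv; rewrite e1 => h.
have [->|un0] := eqVneq (ip u u) 0; first by rewrite mulr_ge0.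
have up : 0 < ip u u by rewrite lt_neqAle eq_sym un0.
rewrite -(ler_pM2r up) -expr2 (le_trans h)//.
by rewrite [C * e]mulrC -mulrA; apply: ler_wpM2l.
Qed.

Lemma coercive_lower (a E : R) : a < E -> (forall u, D u -> E * ip u u <= q u u) ->
  lower_at L ip D q a 0.
Proof.
move=> aE H; exists ((E - a) ^+ 2); first by rewrite exprn_gt0// subr_gt0.
move=> u f [Du Lf Hf]; rewrite expr0n/= mul0r addr0; have Lu := cf_DL cf Du.
have Lfa : L (f - a *: u) by inL.
have := sip_CS sL Lfa Lu; have := H u Du; rewrite Hf//.
have E1 : ip (f - a *: u) u = ip f u - a * ip u u.
  by rewrite (sipBl sL) ?(sipZl sL)//; inL.
have E0 : 0 < E - a by rewrite subr_gt0.
set t := ip (f - a *: u) u in E1 *; set s := ip u u in E1 *.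
have s0 : 0 <= s by exact: (sip_ge0 sL).
move=> h1 h2; have h3 : (E - a) * s <= t by rewrite E1; lra.
have [->|sn0] := eqVneq s 0; first by rewrite mulr0; exact: (sip_ge0 sL).
have sp : 0 < s by rewrite lt_neqAle eq_sym sn0.
rewrite -(ler_pM2r sp); apply: le_trans h2.
by rewrite -mulrA -expr2 -exprMn; apply: lerXn2r; rewrite ?nnegrE ?mulr_ge0 ?(ltW E0)//;
  apply: le_trans h3; rewrite mulr_ge0 ?(ltW E0).
Qed.

Lemma eig_normalize (a : R) u : eigvec L ip D q a u -> ip u u != 0 ->
  exists2 w, eigvec L ip D q a w & ip w w = 1.
Proof.
move=> eu un0; have [Du _ _] := eu; have Lu := cf_DL cf Du.
have up : 0 < ip u u by rewrite lt_neqAle eq_sym un0 (sip_ge0 sL).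
exists ((Num.sqrt (ip u u))^-1 *: u).
  rewrite /eigvec scalerA mulrC -scalerA; exact: oprZ.
by rewrite (sip_sqrZ sL)// exprVn sqr_sqrtr ?mulVf// ltW.
Qed.

(** If [A - a] is not bounded below, there are unit vectors with [(A - a) u] tending to 0. Along a
    subsequence the finitely many functionals converge, and the lower bound applied to differences
    makes the vectors Cauchy; closedness gives an eigenvector. *)
Lemma comp_eigen (a E : R) m : comp_below L ip D q E m -> a < E ->
  lower_at L ip D q a 0 \/ exists2 u, eigvec L ip D q a u & ip u u = 1.
Proof.
move=> [K [l [K0 Ll Hl]]] aE.
have [|nl] := pselect (lower_at L ip D q a 0); [by left|right].
have Ea : 0 < E - a by rewrite subr_gt0.
pose r (k : nat) : R := k.+1%:R^-1.
have r0 k : 0 < r k by rewrite invr_gt0.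
have r1 k : r k <= 1 by rewrite invf_le1// ler1n.
have rsmall (e : R) : 0 < e -> exists M : nat, forall i, (M <= i)%N -> r i < e.
  move=> e0; have [M _ HM] := near_infty_natSinv_lt (PosNum e0).
  by exists M => i Mi; exact: HM.
have /choice [u /choice [f uf]] : forall k : nat, exists u f, [/\ oprq u f,
    ip u u = 1 & ip (f - a *: u) (f - a *: u) < r k].
  move=> k; apply: contrapT => H; apply: nl; exists (r k) => // u f Ouf.
  have [Du Lf _] := Ouf; have Lu := cf_DL cf Du.
  rewrite expr0n/= mul0r addr0 leNgt; apply/negP => h.
  have Lfu : L (f - a *: u) by inL.
  have f0 := sip_ge0 sL Lfu; have u0 := sip_ge0 sL Lu.
  have up : 0 < ip u u.
    by rewrite lt_neqAle u0 andbT eq_sym; apply: contraTneq h => ->; rewrite mulr0 -leNgt.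
  apply: H; exists ((Num.sqrt (ip u u))^-1 *: u), ((Num.sqrt (ip u u))^-1 *: f); split.
  - exact: oprZ.
  - by rewrite (sip_sqrZ sL)// exprVn sqr_sqrtr ?mulVf// ?ltW// gt_eqF.
  - rewrite scalerA mulrC -scalerA -scalerBr (sip_sqrZ sL)// exprVn sqr_sqrtr//.
    by rewrite ltr_pdivrMl// mulrC.
have Du k : D (u k) by case: (uf k) => -[].
have Lu k : L (u k) by exact: (cf_DL cf).
have Lf k : L (f k) by case: (uf k) => -[].
pose lv k : 'rV[R]_m := \row_i ip (l i) (u k).
pose C := \sum_i (1 + ip (l i) (l i)).
have lC k i : `|lv k 0 i| <= C.
  have li0 j : 0 <= 1 + ip (l j) (l j) by rewrite addr_ge0// (sip_ge0 sL).
  apply: (@le_trans _ _ (1 + ip (l i) (l i))); last first.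
    by rewrite /C (bigD1 i)//= lerDl sumr_ge0.
  have := sip_CS sL (Ll i) (Lu k); have [_ -> _] := uf k; rewrite mulr1 mxE => h.
  rewrite -ler_sqr ?nnegrE// real_normK ?num_real//; apply: (le_trans h).
  by have := sip_ge0 sL (Ll i); nra.
have cc : compact (cube (0 : 'rV[R]_m) C).
  rewrite cube_box; apply: (@rV_compact _ _ (fun i => _)) => i.
  exact: segment_compact.
(* The values of the functionals on unit vectors stay in a compact cube. *)
have [p [_ clp]] : cube 0 C `&` cluster (lv @ \oo) !=set0.
  by apply: cc; exists 0%N => // k _ i /=; rewrite [X in _ - X]mxE subr0.
have /choice [kk kkP] : forall j : nat, exists k, (j <= k)%N /\
    forall i, `|ip (l i) (u k) - p 0 i| < r j.
  move=> j.
  have A : (lv @ \oo) [set lv k | k in [set k | (j <= k)%N]].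
    by exists j => // k /= jk; exists k.
  have [_ [[k jk <-] [_ H]]] := clp _ _ A (nbhsx_ballx p (r j) (r0 j)).
  by exists k; split=> // i; have := H 0 i; rewrite /ball /= mxE distrC.
pose v j := u (kk j); pose g j := f (kk j).
have Ov j : oprq (v j) (g j) by case: (uf (kk j)).
have Dv j : D (v j) by exact: Du.
have Lv j : L (v j) by exact: Lu.
have Lg j : L (g j) by exact: Lf.
have gv j : ip (g j - a *: v j) (g j - a *: v j) <= r j.
  have [_ _ h] := uf (kk j); apply: (le_trans (ltW h)).
  by rewrite /r lef_pV2 ?posrE// ler_nat ltnS (kkP j).1.
(* [(E - a) |w|^2 <= ip z w + K * (functionals)], where half of the left-hand side absorbs [ip z w]
   by Young's inequality; dividing by [(E - a) / 2] gives this constant. *)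
pose C2 := 2 / (E - a) * ((E - a)^-1 + 2 * K * m%:R).
have C20 : 0 <= C2.
  apply: mulr_ge0; first by rewrite divr_ge0// ltW.
  by rewrite addr_ge0 ?invr_ge0 ?(ltW Ea)// !mulr_ge0.
have cauchy i j : ip (v i - v j) (v i - v j) <= C2 * (r i + r j).
  set w := v i - v j; pose z := (g i - a *: v i) - (g j - a *: v j).
  have Dw : D w by rewrite /w; inD.
  have Lw := cf_DL cf Dw.
  have Lz1 : L (g i - a *: v i) by exact: (ssB LL (Lg i) (ssZ LL a (Lv i))).
  have Lz2 : L (g j - a *: v j) by exact: (ssB LL (Lg j) (ssZ LL a (Lv j))).
  have Lz : L z by rewrite /z; inL.
  have zE : z = g i - g j - a *: w.
    by rewrite /z /w scalerBr !opprB addrACA [RHS]addrACA; congr (_ + _); rewrite addrC.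
  have zz : ip z z <= 2 * (r i + r j).
    have := sip_sqrD_le sL Lz1 (ssN LL Lz2).
    rewrite (sipNl sL) ?(sipNr sL)// ?opprK; try by inL.
    by have := gv i; have := gv j; rewrite -/z; lra.
  have qw : q w w = ip z w + a * ip w w.
    have [_ _ ->//] := oprB (Ov i) (Ov j).
    have Lgg : L (g i - g j) by exact: (ssB LL (Lg i) (Lg j)).
    by rewrite zE (sipBl sL Lgg (ssZ LL a Lw) Lw) (sipZl sL _ Lw Lw); ring.
  have sl : \sum_i (ip (l i) w) ^+ 2 <= m%:R * (2 * (r i + r j)).
    rewrite -[X in X%:R * _](card_ord m) -sum1_card natr_sum mulr_suml.
    apply: ler_sum => s _; rewrite mul1r (sipBr sL)//.
    have h1 := (kkP i).2 s; have h2 := (kkP j).2 s.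
    move: h1 h2; rewrite !ltr_norml => /andP[h1 h2] /andP[h3 h4].
    rewrite -/(v i) -/(v j) in h1 h2 h3 h4.
    have := r0 i; have := r0 j; have := r1 i; have := r1 j.
    set x := ip _ _ in h1 h2 *; set y := ip _ _ in h3 h4 * => *.
    nra.
  have zw : ip z w <= (E - a) / 2 * ip w w + (E - a)^-1 / 2 * ip z z.
    have := sip_ge0 sL (ssB LL (ssZ LL (E - a) Lw) Lz).
    rewrite (sip_sqrB sL) ?(sip_sqrZ sL) ?(sipZl sL)//; last by inL.
    rewrite (sipC sL Lw Lz) -(pmulr_rge0 _ (_ : 0 < (E - a)^-1 / 2)); last first.
      by rewrite divr_gt0// invr_gt0.
    have -> : (E - a)^-1 / 2 * ((E - a) ^+ 2 * ip w w - 2 * ((E - a) * ip z w) + ip z z)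
      = (E - a) / 2 * ip w w + (E - a)^-1 / 2 * ip z z - ip z w.
      by field; rewrite gt_eqF.
    by rewrite subr_ge0.
  have h1 := Hl w Dw; rewrite qw in h1.
  have h2 : K * \sum_i ip (l i) w ^+ 2 <= K * (m%:R * (2 * (r i + r j))).
    exact: ler_wpM2l.
  have h3 : (E - a)^-1 / 2 * ip z z <= (E - a)^-1 / 2 * (2 * (r i + r j)).
    by apply: ler_wpM2l => //; rewrite divr_ge0// invr_ge0 ltW.
  have h4 : (E - a) / 2 * ip w w <=
      (E - a) / 2 * (C2 * (r i + r j)).
    have -> : (E - a) / 2 * (C2 * (r i + r j)) =
      (E - a)^-1 / 2 * (2 * (r i + r j)) + K * (m%:R * (2 * (r i + r j))).
      by rewrite /C2; field; rewrite gt_eqF.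
    lra.
  by move: h4; rewrite ler_pM2l// divr_gt0.
have cv : sip_cauchy ip v.
  move=> e e0; have [|M HM] := rsmall (e / (2 * (C2 + 1))).
    by rewrite divr_gt0// mulr_gt0// ltr_wpDl.
  exists M => i j Mi Mj; apply: (le_lt_trans (cauchy i j)).
  have := HM _ Mi; have := HM _ Mj; rewrite !ltr_pdivlMr ?mulr_gt0 ?ltr_wpDl//.
  by have := r0 i; have := r0 j; nra.
have [u0 Lu0 cu0] := cf_Lcomplete cf Lv cv.
have cg : sip_cvg ip g (a *: u0).
  move=> e e0; have a0 : 0 < 4 * (1 + a ^+ 2) by have := sqr_ge0 a; lra.
  have [|M1 H1] := cu0 (e / (4 * (1 + a ^+ 2))); first by rewrite divr_gt0.
  have [|M2 H2] := rsmall (e / 4); first by rewrite divr_gt0.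
  exists (maxn M1 M2) => i; rewrite geq_max => /andP[i1 i2].
  have h1 := H1 _ i1; have h2 := H2 _ i2; have h3 := gv i.
  have Lvu := ssB LL (Lv i) Lu0.
  have -> : g i - a *: u0 = (g i - a *: v i) + a *: (v i - u0).
    by rewrite scalerBr addrA subrK.
  have Lgv : L (g i - a *: v i) by have := Lv i; have := Lg i => *; inL.
  apply: (le_lt_trans (sip_sqrD_le sL Lgv (ssZ LL a Lvu))).
  rewrite (sip_sqrZ sL)//; move: h1; rewrite ltr_pdivlMr//.
  by have := sip_ge0 sL Lvu; have := sqr_ge0 a; nra.
have eu0 : eigvec L ip D q a u0.
  by apply: (@opr_closed v g) => //; inL.
apply: eig_normalize eu0 _; apply/negP => /eqP u00.
have [|M HM] := cu0 4^-1; first by rewrite invr_gt0.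
have := HM M (leqnn _); have [_ uu _] := uf (kk M).
have := sip_sqrD_le sL (ssB LL (Lv M) Lu0) Lu0.
by rewrite subrK u00 /v uu; lra.
Qed.

Lemma ss_sum (P : X -> Prop) (I : Type) (s : seq I) (F : I -> X) : subspace P ->
  (forall i, P (F i)) -> P (\sum_(i <- s) F i).
Proof.
move=> sP PF; elim: s => [|i s IH]; first by rewrite big_nil; exact: ss0.
by rewrite big_cons; exact: ssD.
Qed.

Lemma sip_suml P B (I : Type) (s : seq I) (F : I -> X) v : sip P B ->
  (forall i, P (F i)) -> P v -> B (\sum_(i <- s) F i) v = \sum_(i <- s) B (F i) v.
Proof.
move=> sB PF Pv; elim: s => [|i s IH]; first by rewrite !big_nil (sip0l sB).
rewrite !big_cons (sipDl sB) ?IH//.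
by apply: ss_sum => //; exact: sip_ss sB.
Qed.

Lemma oprq0 : oprq 0 0.
Proof.
have := oprZ 0 (_ : oprq 0 0); rewrite scaler0; apply.
split; [exact: (ss0 DD)|exact: (ss0 LL)|move=> v Dv].
have Lv := cf_DL cf Dv.
by rewrite -[X in q X _](scale0r 0) (cf_qZ cf) ?(sip0l sL)// ?mul0r//; exact: (ss0 DD).
Qed.

Lemma opr_sum (I : Type) (s : seq I) (u f : I -> X) : (forall i, oprq (u i) (f i)) ->
  oprq (\sum_(i <- s) u i) (\sum_(i <- s) f i).
Proof.
move=> H; elim: s => [|i s IH]; first by rewrite !big_nil; exact: oprq0.
by rewrite !big_cons; exact: oprD.
Qed.

Definition eigfam E k (e : nat -> X) (a : nat -> R) :=
  (forall i, (i < k)%N -> a i < E /\ eigvec L ip D q (a i) (e i)) /\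
  forall i j, (i < k)%N -> (j < k)%N -> ip (e i) (e j) = (i == j)%:R.

(* An eigenvector combination killed by all the functionals contradicts the
   lower bound. *)
Lemma eigen_count E m k e a : comp_below L ip D q E m -> eigfam E k e a -> (k <= m)%N.
Proof.
move=> [K [l [K0 Ll Hl]]] [He Hij]; rewrite leqNgt; apply/negP => mk.
have [t tn0 tA] := kernel_row (\matrix_(i < k, j < m) ip (l j) (e i)) mk.
have Oe (i : 'I_k) : oprq (t 0 i *: e i) (t 0 i *: (a i *: e i)).
  by apply: oprZ; case: (He _ (ltn_ord i)).
have De (i : 'I_k) : D (e i) by case: (He _ (ltn_ord i)) => _ [].
have Le (i : 'I_k) : L (e i) by exact: (cf_DL cf).
have [Du Lf Hu] := opr_sum (index_enum 'I_k) Oe.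
set u := \sum_i _ in Du Hu; have Lu := cf_DL cf Du.
have ipe (i : 'I_k) : ip (e i) u = t 0 i.
  rewrite (sipC sL)// /u (sip_suml _ sL)//; last by move=> j; inL.
  rewrite (bigD1 i)//= big1 ?addr0 => [|j ji].
    by rewrite (sipZl sL)// Hij// eqxx mulr1.
  by rewrite (sipZl sL)// Hij// (_ : (_ == _ :> nat) = false) ?mulr0//; exact: negbTE.
have lu j : ip (l j) u = 0.
  have /rowP/(_ j) := tA; rewrite !mxE => <-.
  rewrite (sipC sL)// /u (sip_suml _ sL)//; last by move=> i; inL.
  by apply: eq_bigr => i _; rewrite (sipZl sL)// mxE (sipC sL).
have uu : ip u u = \sum_i (t 0 i) ^+ 2.
  rewrite {1}/u (sip_suml _ sL)//; last by move=> i; inL.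
  by apply: eq_bigr => i _; rewrite (sipZl sL)// ipe.
have qu : q u u = \sum_(i < k) a i * (t 0 i) ^+ 2.
  rewrite Hu// (sip_suml _ sL)//; last by move=> i; have := Le i => *; inL.
  apply: eq_bigr => i _; rewrite (sipZl sL) ?(sipZl sL) ?ipe//; last by have := Le i => *; inL.
  by rewrite expr2 mulrCA mulrA.
have := Hl u Du; rewrite [X in K * X]big1 => [|j _]; last by rewrite lu expr0n.
rewrite mulr0 addr0 uu qu mulr_sumr leNgt => /negP; apply.
have /rV0Pn[i0 ti0] := tn0.
rewrite [X in X < _](bigD1 i0)//= [X in _ < X](bigD1 i0)//=.
apply: ltr_leD; last first.
  by apply: ler_sum => i _; rewrite ler_wpM2r ?sqr_ge0// ltW//; case: (He _ (ltn_ord i)).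
by rewrite ltr_pM2r ?exprn_even_gt0//; case: (He _ (ltn_ord i0)).
Qed.

(** The infimum [a] of the Rayleigh quotient lies below [E], so either it is an eigenvalue or
    [A - a] is invertible. In the second case the nonnegative form [q - a ip] would be bounded away
    from 0 on unit vectors, against the choice of [a]. *)
Lemma inf_eigen (E : R) m (u0 : X) : comp_below L ip D q E m -> D u0 ->
  q u0 u0 < E * ip u0 u0 ->
  exists a w, [/\ a < E, eigvec L ip D q a w & ip w w = 1].
Proof.
move=> Hc Du0 qu0; have Lu0 := cf_DL cf Du0.
pose S := [set t | exists u, [/\ D u, ip u u = 1 & t = q u u]].
have nrm u : D u -> ip u u != 0 -> S (q u u / ip u u).
  move=> Du un0; have Lu := cf_DL cf Du.
  have up : 0 < ip u u by rewrite lt_neqAle eq_sym un0 (sip_ge0 sL).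
  exists ((Num.sqrt (ip u u))^-1 *: u); split; first by inD.
    by rewrite (sip_sqrZ sL)// exprVn sqr_sqrtr ?mulVf// ltW.
  rewrite (cf_qZ cf) ?cf_qZr//; last by inD.
  by rewrite mulrA -expr2 exprVn sqr_sqrtr 1?mulrC// ltW.
have u0n : ip u0 u0 != 0.
  apply: contraTneq qu0 => h; rewrite h mulr0 -leNgt.
  by have := cf_lb cf Du0; rewrite h mulr0 addr0.
have infS : has_inf S.
  split; first by exists (q u0 u0 / ip u0 u0); exact: nrm.
  exists (- c) => _ [u [Du u1 ->]].
  by have := cf_lb cf Du; rewrite u1 mulr1; lra.
pose a := inf S.
have aS t : S t -> a <= t by move=> St; apply: ge_inf => //; exact: (proj2 infS).
have aq u : D u -> a * ip u u <= q u u.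
  move=> Du; have [u00|un0] := eqVneq (ip u u) 0.
    by have := cf_lb cf Du; rewrite u00 !mulr0 addr0.
  have up : 0 < ip u u by rewrite lt_neqAle eq_sym un0 (sip_ge0 sL) //; exact: (cf_DL cf).
  by rewrite -ler_pdivlMr//; apply/aS/nrm.
have aE : a < E.
  apply: le_lt_trans (aS _ (nrm _ Du0 u0n)) _.
  by rewrite ltr_pdivrMr// lt_neqAle eq_sym u0n (sip_ge0 sL).
have [[r r0 Hr]|[w ew w1]] := comp_eigen Hc aE; last by exists a, w.
exfalso.
pose p u v := q u v - a * ip u v.
have sp : sip D p.
  split=> //; rewrite /p.
  - by move=> u v w Du Dv Dw; rewrite (cf_qD cf)// (sipDl sL); inL; ring.
  - by move=> t u v Du Dv; rewrite (cf_qZ cf)// (sipZl sL); inL; ring.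
  - by move=> u v Du Dv; rewrite (cf_qC cf)// (sipC sL); inL.
  - by move=> u Du; rewrite subr_ge0 aq.
have ri : 0 < r^-1 by rewrite invr_gt0.
pose C := 1 + r^-1.
(* With [v = (A - a)^-1 u] one has [p v u = 1] and [p v v = ip u v <= C]; Cauchy-Schwarz for [p]
   concludes. *)
have key u : D u -> ip u u = 1 -> C^-1 <= p u u.
  move=> Du u1; have Lu := cf_DL cf Du.
  have [w [f [Owf]]] := opr_square_surj (ex_intro2 _ _ r r0 Hr) Lu.
  set v := f - a *: w; rewrite expr0n /= scale0r subr0 => Ov.
  have [Dv _ Hv] := Ov; have Lv := cf_DL cf Dv.
  have := Hr _ _ Ov; rewrite addrK expr0n/= mul0r addr0 u1 => vu.
  have E1 u' : D u' -> p v u' = ip u u'.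
    move=> Du'; have Lu' := cf_DL cf Du'.
    by rewrite /p Hv// (sipDl sL Lu (ssZ LL a Lv) Lu') (sipZl sL _ Lv Lu'); ring.
  have := sip_CS sp Dv Du; rewrite !E1// u1 expr1n => h.
  have uv : ip u v <= C.
    have := sip_ge0 sL (ssB LL Lu Lv); rewrite (sip_sqrB sL)// u1 => h2.
    have : ip v v <= r^-1 by rewrite -[r^-1]mulr1 ler_pdivlMl.
    by rewrite /C; lra.
  rewrite -[C^-1]mulr1 ler_pdivrMl ?addr_gt0//; apply: (le_trans h).
  by apply: ler_wpM2r => //; exact: (sip_ge0 sp).
have Ci : 0 < C^-1 by rewrite invr_gt0 addr_gt0.
have [_ [u [Du u1 ->]]] := inf_adherent Ci infS.
by rewrite -/a ltNge => /negP; apply; have := key u Du u1; rewrite /p u1 mulr1; lra.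
Qed.

End theory.

Lemma perturb_form L ip D q c (k : nat) (e : nat -> X) (M : R) :
  closed_form L ip D q c -> (forall i, (i < k)%N -> L (e i)) -> 0 <= M ->
  closed_form L ip D (fun u v => q u v + M * \sum_(i < k) ip (e i) u * ip (e i) v) c.
Proof.
move=> cf Le M0; have sL := cf_ip cf; have DL := cf_DL cf.
have {}Le (i : 'I_k) : L (e i) by exact: Le.
set q' := fun u v => _.
have sN := cf_norm cf.
have s0 u : 0 <= \sum_(i < k) ip (e i) u * ip (e i) u.
  by apply: sumr_ge0 => i _; rewrite -expr2 sqr_ge0.
split; try by [case: cf].
- move=> u v w Du Dv Dw; have Lu := DL _ Du; have Lv := DL _ Dv.
  rewrite /q' (cf_qD cf)// addrACA -mulrDr -big_split/=; congr (_ + _ * _).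
  by apply: eq_bigr => i _; rewrite (sipDr sL)// mulrDl.
- move=> a u v Du Dv; have Lu := DL _ Du.
  rewrite /q' (cf_qZ cf)// mulrDr; congr (_ + _).
  rewrite mulrCA; congr (_ * _); rewrite mulr_sumr.
  by apply: eq_bigr => i _; rewrite (sipZr sL)// mulrA.
- move=> u v Du Dv; rewrite /q' (cf_qC cf)//; congr (_ + _ * _).
  by apply: eq_bigr => i _; rewrite mulrC.
- move=> u Du; have := cf_lb cf Du; have := mulr_ge0 M0 (s0 u).
  by rewrite /q'; lra.
- pose S := \sum_(i < k) ip (e i) (e i).
  have S0 : 0 <= S by apply: sumr_ge0 => i _; exact: (sip_ge0 sL).
  have lo u : D u -> form_norm ip q c u u <= form_norm ip q' c u u.
    by move=> Du; rewrite /form_norm /q' lerD2r lerDl mulr_ge0.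
  have up u : D u -> form_norm ip q' c u u <= (1 + M * S) * form_norm ip q c u u.
    move=> Du; have Lu := DL _ Du.
    have n0 := ip_le_norm cf Du; have i0 := sip_ge0 sL Lu.
    have h : \sum_(i < k) ip (e i) u * ip (e i) u <= S * ip u u.
      rewrite mulr_suml; apply: ler_sum => i _; rewrite -expr2.
      exact: (sip_CS sL (Le i) Lu).
    have := ler_wpM2l M0 h; have := ler_wpM2l (mulr_ge0 M0 S0) n0.
    move: n0; rewrite /form_norm /q'; nra.
  move=> u Du cu; have [|l Dl ul] := cf_complete cf Du.
    move=> t t0; have [K HK] := cu _ t0; exists K => i j Ki Kj.
    apply: le_lt_trans (HK i j Ki Kj); apply: lo.
    by apply: (ssB (cf_D cf)).
  exists l => // t t0; have p0 : 0 < 1 + M * S by rewrite ltr_wpDr// mulr_ge0.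
  have [|K HK] := ul (t / (1 + M * S)); first by rewrite divr_gt0.
  exists K => i Ki; have := HK i Ki; rewrite ltr_pdivlMr// mulrC.
  by apply: le_lt_trans; apply: up; apply: (ssB (cf_D cf)).
- move=> u Du u0; have Lu := DL _ Du; rewrite /q' (cf_null cf)// add0r big1 ?mulr0// => i _.
  by rewrite (sipC sL)// (sip_null sL)// mul0r.
Qed.

(* Adding M |e_i><e_i| with M large removes the known eigenvalues, so that the
   bottom of the perturbed form is a new eigenvector orthogonal to them. *)
Lemma next_eigen L ip D q c (E : R) m k e a u0 : closed_form L ip D q c ->
  comp_below L ip D q E m -> eigfam L D ip q E k e a -> D u0 ->
  (forall i, (i < k)%N -> ip (e i) u0 = 0) -> q u0 u0 < E * ip u0 u0 ->
  exists e' a', eigfam L D ip q E k.+1 e' a'.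
Proof.
move=> cf [K [l [K0 Ll Hl]]] [He Hij] Du0 eu0 qu0; have sL := cf_ip cf.
have DL := cf_DL cf.
have De i : (i < k)%N -> D (e i) by move=> /He[_ []].
have Le i : (i < k)%N -> L (e i) by move=> /De/DL.
(* Every known eigenvalue is at least [- c], so the perturbation lifts it to at least [E], hence
   above the new eigenvalue [b]; this forces [w] to be orthogonal to the known eigenvectors. *)
pose M := `|E| + c.
have M0 : 0 <= M by rewrite addr_ge0// (cf_c0 cf).
have cf' := perturb_form cf Le M0.
set q' := fun u v => _ in cf'.
have q'e (i : 'I_k) v : D v -> q' (e i) v = q (e i) v + M * ip (e i) v.
  move=> Dv; rewrite /q' (bigD1 i)//= Hij// eqxx mul1r big1 ?addr0// => j ji.
  by rewrite Hij// (_ : (_ == _ :> nat) = false) ?mul0r//; exact: negbTE.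
have Hc' : comp_below L ip D q' E m.
  exists K, l; split=> // u Du; apply: (le_trans (Hl u Du)).
  rewrite lerD2r /q' lerDl mulr_ge0//.
  by apply: sumr_ge0 => i _; rewrite -expr2 sqr_ge0.
have [||b [w [bE [Dw Lw Hw] w1]]] := @inf_eigen _ _ _ _ _ cf' E m u0 Hc' => //.
  rewrite /q' big1 ?mulr0 ?addr0// => i _.
  by rewrite eu0 ?mul0r.
have Lw' := DL _ Dw.
have ew (i : 'I_k) : ip (e i) w = 0.
  have [aE [_ _ Hei]] := He _ (ltn_ord i); have Dei := De _ (ltn_ord i).
  have Lei := DL _ Dei.
  have h1 := Hw _ Dei; rewrite (cf_qC cf')// q'e// Hei// in h1.
  rewrite !(sipZl sL)// (sipC sL Lw') // in h1.
  have alb : - c <= a i.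
    have := cf_lb cf Dei; rewrite Hei// (sipZl sL)// Hij// eqxx !mulr1; lra.
  have p0 : 0 < a i + M - b by rewrite /M; have := ler_norm E; lra.
  apply: (mulfI (lt0r_neq0 p0)); rewrite mulr0; lra.
have eqw : eigvec L ip D q b w.
  split=> // v Dv; rewrite -Hw// /q' big1 ?mulr0 ?addr0// => i _.
  by rewrite ew mul0r.
exists (fun i => if (i < k)%N then e i else w), (fun i => if (i < k)%N then a i else b).
split=> [i|i j].
  rewrite ltnS leq_eqVlt => /orP[/eqP ->|ik]; first by rewrite ltnn.
  by rewrite ik; exact: He.
rewrite !ltnS leq_eqVlt => /orP[/eqP ->|ik]; rewrite leq_eqVlt => /orP[/eqP ->|jk].
- by rewrite ltnn eqxx.
- rewrite ltnn jk (gtn_eqF jk) (sipC sL)//; last exact: Le.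
  by rewrite (ew (Ordinal jk)).
- by rewrite ltnn ik (ltn_eqF ik) (ew (Ordinal ik)).
- by rewrite ik jk; exact: Hij.
Qed.

(** The min-max principle. With fewer than [k] eigenvectors in hand, a dimension count yields a
    combination of the [t i] orthogonal to all of them; since the [t i] are orthogonal for both
    forms, its Rayleigh quotient is still below [E]. *)
Lemma many_eigen L ip D q c (E : R) m k (t : nat -> X) : closed_form L ip D q c ->
  comp_below L ip D q E m ->
  (forall i, (i < k)%N -> D (t i) /\ q (t i) (t i) < E * ip (t i) (t i)) ->
  (forall i j, (i < k)%N -> (j < k)%N -> i != j ->
    q (t i) (t j) = 0 /\ ip (t i) (t j) = 0) ->
  exists e a, eigfam L D ip q E k e a.
Proof.
move=> cf Hc Ht Hij; have sL := cf_ip cf; have DL := cf_DL cf; have DD := cf_D cf.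
suff H j : (j <= k)%N -> exists e a, eigfam L D ip q E j e a by exact: H.
elim: j => [|j IH] jk; first by exists (fun=> 0), (fun=> 0).
have [e [a He]] := IH (ltnW jk).
have De i : (i < j)%N -> D (e i) by move=> /He.1[_ []].
have [s sn0 sA] := kernel_row (\matrix_(i < k, l < j) ip (e l) (t i)) jk.
have Dt (i : 'I_k) : D (t i) by case: (Ht _ (ltn_ord i)).
have Lt (i : 'I_k) : L (t i) by exact: DL.
pose u := \sum_(i < k) s 0 i *: t i.
have Dst (i : 'I_k) : D (s 0 i *: t i) by exact: (ssZ DD).
have Lst (i : 'I_k) : L (s 0 i *: t i) by exact: DL.
have Du : D u by apply: ss_sum.
have Lu := DL _ Du.
apply: (next_eigen cf Hc He Du) => [i ij|].
  have Lei := DL _ (De _ ij).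
  have /rowP/(_ (Ordinal ij)) := sA; rewrite !mxE => <-.
  rewrite (sipC sL)// /u (sip_suml _ sL)//.
  by apply: eq_bigr => l _; rewrite (sipZl sL)// mxE (sipC sL).
have sN := cf_norm cf.
have diag B : sip D B -> (forall i j, (i < k)%N -> (j < k)%N -> i != j -> B (t i) (t j) = 0) ->
    B u u = \sum_(i < k) (s 0 i) ^+ 2 * B (t i) (t i).
  move=> sB HB; rewrite {1}/u (sip_suml _ sB)//; apply: eq_bigr => i _.
  rewrite (sipC sB)// /u (sip_suml _ sB)//.
  rewrite (bigD1 i)//= big1 ?addr0 => [|l li]; first by rewrite (sip_sqrZ sB).
  by rewrite (sipZl sB) ?(sipZr sB)// HB// !mulr0.
have sLD : sip D ip.
  split; first exact: DD.
  - by move=> ? ? ? *; apply: (sipDl sL); exact: DL.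
  - by move=> ? ? ? *; apply: (sipZl sL); exact: DL.
  - by move=> ? ? *; apply: (sipC sL); exact: DL.
  - by move=> ? *; apply: (sip_ge0 sL); exact: DL.
have d1 := diag _ sLD (fun i j a b c => (Hij i j a b c).2).
have d2 : form_norm ip q c u u = \sum_(i < k) (s 0 i) ^+ 2 * form_norm ip q c (t i) (t i).
  apply: (diag _ sN) => i l ik lk il; rewrite /form_norm.
  by have [-> ->] := Hij _ _ ik lk il; rewrite mulr0 addr0.
have qE : q u u = \sum_(i < k) (s 0 i) ^+ 2 * q (t i) (t i).
  have -> : q u u = form_norm ip q c u u - (c + 1) * ip u u by rewrite /form_norm; ring.
  rewrite d2 d1 mulr_sumr -sumrB; apply: eq_bigr => i _; rewrite /form_norm; ring.
rewrite qE d1 mulr_sumr; have /rV0Pn[i0 si0] := sn0.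
rewrite [X in X < _](bigD1 i0)//= [X in _ < X](bigD1 i0)//=.
apply: ltr_leD.
  rewrite mulrCA ltr_pM2l ?exprn_even_gt0//; exact: (Ht _ (ltn_ord i0)).2.
apply: ler_sum => i _; rewrite mulrCA ler_wpM2l ?sqr_ge0// ltW//.
exact: (Ht _ (ltn_ord i)).2.
Qed.

End closed_forms.

(** * Spectra of complexified operators *)

Section real_eigenvalues.
Context (R : realType) (X : lmodType R).
Variables (L D : X -> Prop) (ip q : X -> X -> R) (c : R).
Hypothesis cf : closed_form L ip D q c.
Let sL := cf_ip cf.
Let LL := sip_ss sL.

Lemma eig_orth a b u v : eigvec L ip D q a u -> eigvec L ip D q b v -> a != b ->
  ip u v = 0.
Proof.
move=> eu ev ab; have [Du _ _] := eu; have [Dv _ _] := ev.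
have Lu := cf_DL cf Du; have Lv := cf_DL cf Dv.
have := opr_sym cf eu ev; rewrite (sipZl sL)// (sipZr sL)// => /eqP.
rewrite -subr_eq0 -mulrBl mulf_eq0 subr_eq0 eq_sym (negbTE ab)/=.
by move=> /eqP.
Qed.

(** Otherwise eigenvalues ever closer to [a] are pairwise distinct and lie below [E]; their
    eigenvectors are orthogonal, and [m + 1] of them exceed the bound of [eigen_count]. *)
Lemma eig_isolated (E a : R) m : comp_below L ip D q E m -> a < E ->
  exists2 d : R, 0 < d & forall b w, eigvec L ip D q b w -> ip w w = 1 ->
    `|b - a| < d -> b = a.
Proof.
move=> Hc aE; apply: contrapT => H.
suff : exists (e : nat -> X) (b : nat -> R) (d : R), [/\ eigfam L D ip q E m.+1 e b,
    0 < d, d <= E - a & forall i, (i < m.+1)%N -> d <= `|b i - a|].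
  move=> [e [b [d [/(eigen_count cf Hc)]]]]; by rewrite ltnn.
elim: m.+1 => [|k [e [b [d [[He Hij] d0 dE db]]]]].
  exists (fun=> 0), (fun=> 0), (E - a).
  by split; [split|rewrite subr_gt0| |].
have [b' [w [ew w1 b'a ba]]] : exists b' w, [/\ eigvec L ip D q b' w, ip w w = 1,
    `|b' - a| < d & b' != a].
  apply: contrapT => H'; apply: H; exists d => // b' w ew w1 b'a.
  by apply/eqP; apply: contrapT => /negP ne; apply: H'; exists b', w.
have bb' i : (i < k)%N -> b i != b'.
  by move=> ik; apply: contraTneq b'a => <-; rewrite -leNgt db.
exists (fun i => if (i < k)%N then e i else w), (fun i => if (i < k)%N then b i else b'),
  `|b' - a|; split.
- split=> [i|i j].
    rewrite ltnS leq_eqVlt => /orP[/eqP ->|ik]; last by rewrite ik; exact: He.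
    rewrite ltnn; split=> //; have := lt_le_trans b'a dE.
    by move=> /ltr_normlW; rewrite ltrBlDr subrK.
  rewrite !ltnS leq_eqVlt => /orP[/eqP ->|ik]; rewrite leq_eqVlt => /orP[/eqP ->|jk].
  + by rewrite ltnn eqxx.
  + rewrite ltnn jk (gtn_eqF jk); apply: eig_orth ew (He _ jk).2 _.
    by rewrite eq_sym bb'.
  + by rewrite ltnn ik (ltn_eqF ik); apply: eig_orth (He _ ik).2 ew _; exact: bb'.
  + by rewrite ik jk; exact: Hij.
- by rewrite normr_gt0 subr_eq0.
- exact: le_trans (ltW b'a) dE.
- move=> i; rewrite ltnS leq_eqVlt => /orP[/eqP ->|ik]; first by rewrite ltnn.
  by rewrite ik; apply: le_trans (ltW b'a) (db _ ik).
Qed.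

(** An orthonormal family of eigenvectors of maximal length, which exists by [eigen_count], spans
    the eigenspace up to null vectors: a nonzero remainder would extend it. *)
Lemma eig_finite (E a : R) m : comp_below L ip D q E m -> a < E ->
  exists (k : nat) (e : nat -> X), eigfam L D ip q E k e (fun=> a) /\
    forall v, eigvec L ip D q a v ->
      ip (v - \sum_(i < k) ip (e i) v *: e i) (v - \sum_(i < k) ip (e i) v *: e i) = 0.
Proof.
move=> Hc aE.
pose P (k : nat) := `[< exists e, eigfam L D ip q E k e (fun=> a) >].
have exP : exists k, P k by exists 0%N; apply/asboolP; exists (fun=> 0).
have bP k : P k -> (k <= m)%N by move=> /asboolP[e He]; exact: (eigen_count cf Hc He).
have [k /asboolP[e He] kmax] := ex_maxnP exP bP.
exists k, e; split=> // v ev; apply/eqP; apply: contrapT => /negP rn0.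
have [He1 Hij] := He.
have [Dv _ _] := ev; have Lv := cf_DL cf Dv.
have Le (i : 'I_k) : L (e i) by have [_ [/(cf_DL cf)]] := He1 _ (ltn_ord i).
set r := v - _ in rn0.
have er : eigvec L ip D q a r.
  have := oprB cf ev (opr_sum cf (index_enum 'I_k)
    (fun i : 'I_k => oprZ cf (ip (e i) v) (He1 _ (ltn_ord i)).2)).
  rewrite /eigvec (_ : a *: r = a *: v - \sum_(i < k) ip (e i) v *: (a *: e i))//.
  rewrite /r scalerBr scaler_sumr; congr (_ - _).
  by apply: eq_bigr => i _; rewrite !scalerA mulrC.
have Lr : L r by have [/(cf_DL cf)] := er.
have ore i : (i < k)%N -> ip (e i) r = 0.
  move=> ik; pose i' := Ordinal ik.
  have LS : L (\sum_(j < k) ip (e j) v *: e j).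
    by apply: ss_sum => // j; apply: (ssZ LL).
  change (ip (e i') r = 0); rewrite /r (sipBr sL (Le i') Lv LS) (sipC sL (Le i') LS).
  rewrite (sip_suml _ sL) ?(Le i')//; last by move=> j; apply: (ssZ LL).
  rewrite (bigD1 i')//= big1 ?addr0 => [|j ji].
    by rewrite (sipZl sL _ (Le i') (Le i')) Hij// eqxx mulr1 subrr.
  rewrite (sipZl sL _ (Le j) (Le i')) Hij// (_ : (_ == _ :> nat) = false) ?mulr0//.
  exact: negbTE.
have [w ew w1] := eig_normalize cf er rn0.
have [Dr _ _] := er.
have rp : 0 < ip r r by rewrite lt_neqAle eq_sym rn0 (sip_ge0 sL).
pose w' := (Num.sqrt (ip r r))^-1 *: r.
have ew' : eigvec L ip D q a w'.
  by rewrite /eigvec scalerA mulrC -scalerA; exact: (oprZ cf _ er).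
have w'1 : ip w' w' = 1 by rewrite (sip_sqrZ sL)// exprVn sqr_sqrtr ?mulVf// ltW.
have ow i : (i < k)%N -> ip (e i) w' = 0.
  by move=> ik; rewrite (sipZr sL) ?ore ?mulr0//; exact: (Le (Ordinal ik)).
suff /kmax : P k.+1 by rewrite ltnn.
apply/asboolP; exists (fun i => if (i < k)%N then e i else w'); split=> [i|i j].
  rewrite ltnS leq_eqVlt => /orP[/eqP ->|ik]; first by rewrite ltnn.
  by rewrite ik; exact: He1.
rewrite !ltnS leq_eqVlt => /orP[/eqP ->|ik]; rewrite leq_eqVlt => /orP[/eqP ->|jk].
- by rewrite ltnn eqxx.
- rewrite ltnn jk (gtn_eqF jk) (sipC sL) ?ow//; last exact: (Le (Ordinal jk)).
  exact: (ssZ LL).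
- by rewrite ltnn ik (ltn_eqF ik) ow.
- by rewrite ik jk; exact: Hij.
Qed.

End real_eigenvalues.

(** * From a real form to the spectrum of the complex operator *)

Section complexification.
Context d (T : measurableType d) (R : realType) (mu : {measure set T -> \bar R}).
Variables (D : (T -> R) -> Prop) (q : (T -> R) -> (T -> R) -> R) (c : R).
Hypothesis cf : closed_form (sq mu) (dot mu) D q c.
Variable A : operator T R.
Local Notation re f := (fun x => complex.Re (f x)).
Local Notation im f := (fun x => complex.Im (f x)).
Local Notation oprq := (opr (sq mu) (dot mu) D q).
Local Notation eigq := (eigvec (sq mu) (dot mu) D q).
Local Notation lower a b := (lower_at (sq mu) (dot mu) D q a b).
Local Notation comp E m := (comp_below (sq mu) (dot mu) D q E m).
Hypothesis AH : forall u f, A u f <-> oprq (re u) (re f) /\ oprq (im u) (im f).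
Implicit Types (u f g h : T -> R[i]).
Let sL := sq_sip mu.
Let LL := sq_subspace mu.

Lemma L2P f : L2 mu f <-> sq mu (re f) /\ sq mu (im f).
Proof. by split=> -[/LfunP2 a /LfunP2 b]. Qed.

Lemma sqnormE f : L2 mu f -> sqnorm mu f = dot mu (re f) (re f) + dot mu (im f) (im f).
Proof.
move=> /L2P[s1 s2]; rewrite /sqnorm /inner /cintegral /= -rintE -rintD; try exact: sq_mul.
by apply: rint_ext => x; case: (f x) => a b /=; ring.
Qed.

Lemma shift_opP (a b : R) u g : shift_op A (a +i* b) u g <-> exists f1 f2 : T -> R,
  [/\ oprq (re u) f1, oprq (im u) f2,
     re g = f1 - a *: re u + b *: im u & im g = f2 - a *: im u - b *: re u].
Proof.
split=> [[f /AH[p1 p2] ->]|[f1 [f2 [p1 p2 e1 e2]]]].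
  exists (re f), (im f); split=> //; apply/funext => x; rewrite !fctE /=;
  by case: (u x) => u1 u2; case: (f x) => x1 x2 /=; rewrite /GRing.scale/=; ring.
exists (fun x => f1 x +i* f2 x); first by apply/AH.
apply/funext => x; apply/eqP; rewrite eq_complex.
have := congr1 (fun h : T -> R => h x) e1; have := congr1 (fun h : T -> R => h x) e2.
rewrite !fctE /GRing.scale/= => -> ->.
by case: (u x) => u1 u2 /=; apply/andP; split; apply/eqP; ring.
Qed.

Lemma ae0_norm u : L2 mu u -> sqnorm mu u <= 0 -> u = (fun=> 0) %[ae mu].
Proof.
move=> Lu; rewrite sqnormE//; have [s1 s2] := (L2P u).1 Lu.
have h1 := dot_ge0 mu (re u); have h2 := dot_ge0 mu (im u) => h.
have /(dot_eq0 s1) e1 : dot mu (re u) (re u) = 0 by apply/eqP; rewrite eq_le h1 andbT; lra.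
have /(dot_eq0 s2) e2 : dot mu (im u) (im u) = 0 by apply/eqP; rewrite eq_le h2 andbT; lra.
apply: filterS2 e1 e2 => x /= e1 e2 _; apply/eqP.
by rewrite eq_complex /= e1// e2// eqxx.
Qed.

Lemma norm_ae0 g : L2 mu g -> g = (fun=> 0) %[ae mu] -> sqnorm mu g = 0.
Proof.
move=> Lg g0; rewrite sqnormE//; have [s1 s2] := (L2P g).1 Lg.
have s0 := ss0 LL.
have e1 : re g = 0 %[ae mu] by apply: filterS g0 => x /= h /h ->.
have e2 : im g = 0 %[ae mu] by apply: filterS g0 => x /= h /h ->.
by rewrite (dot_ae s1 s0 s1 e1) (dot_ae s2 s0 s2 e2) !(sip0l sL)// addr0.
Qed.

(** By symmetry of the real operator the cross terms cancel in [|(A - a - i b) (u1 + i u2)|^2],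
    which leaves the sum of [|(A - a) uj|^2 + b^2 |uj|^2]. *)
Lemma resolventP (a b : R) : lower a b -> resolvent_set mu A (a +i* b).
Proof.
move=> Hl; have [r r0 Hr] := Hl.
have key u g : shift_op A (a +i* b) u g ->
    [/\ L2 mu u, L2 mu g & sqnorm mu u <= r^-1 * sqnorm mu g].
  move=> /shift_opP[f1 [f2 [p1 p2 e1 e2]]].
  have [D1 S1 _] := p1; have [D2 S2 _] := p2.
  have s1 := cf_DL cf D1; have s2 := cf_DL cf D2.
  set u1 := re u in p1 D1 s1 e1 e2; set u2 := im u in p2 D2 s2 e1 e2.
  have F1 := ssB LL S1 (ssZ LL a s1); have F2 := ssB LL S2 (ssZ LL a s2).
  have b1 := ssZ LL b s1; have b2 := ssZ LL b s2.
  have sg1 : sq mu (re g) by rewrite e1; exact: (ssD LL F1 b2).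
  have sg2 : sq mu (im g) by rewrite e2; exact: (ssB LL F2 b1).
  have Lu : L2 mu u by exact/L2P.
  have Lg : L2 mu g by exact/L2P.
  split=> //; rewrite !sqnormE// e1 e2 -/u1 -/u2.
  rewrite (sip_sqrD sL F1 b2) (sip_sqrB sL F2 b1) !(sip_sqrZ sL)// !(sipZr sL)//.
  rewrite (sipBl sL S1 (ssZ LL a s1) s2) (sipBl sL S2 (ssZ LL a s2) s1).
  rewrite !(sipZl sL)// (dotC mu u2 u1) -(opr_sym cf p1 p2) (dotC mu f2 u1).
  have := Hr _ _ p1; have := Hr _ _ p2.
  rewrite -/u1 -/u2; set X1 := dot mu (f1 - _) _; set X2 := dot mu (f2 - _) _.
  by move=> h1 h2; rewrite ler_pdivlMl//; lra.
split.
- move=> u g /key[Lu Lg h] g0; apply: ae0_norm => //.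
  by rewrite (le_trans h)// norm_ae0// mulr0.
- move=> h /L2P[s1 s2].
  have [w1 [f1 [p1 O1]]] := opr_square_surj cf Hl s1.
  have [w2 [f2 [p2 O2]]] := opr_square_surj cf Hl s2.
  set F1 := f1 - a *: w1 in O1; set F2 := f2 - a *: w2 in O2.
  (* [u = (A - a + i b) w], where [w] solves [((A - a)^2 + b^2) w = h]. *)
  pose u x := (F1 - b *: w2) x +i* (F2 + b *: w1) x.
  have P1 := oprB cf O1 (oprZ cf b p2); have P2 := oprD cf O2 (oprZ cf b p1).
  exists u, h; split; last by apply: aeW.
  apply/shift_opP; do 2 eexists; split; [exact: P1|exact: P2| |].
  + apply/funext => x; rewrite /u /F1 /F2 !fctE /GRing.scale/=; ring.
  + apply/funext => x; rewrite /u /F1 /F2 !fctE /GRing.scale/=; ring.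
- by exists r^-1 => u g /key[].
Qed.

Lemma resolvent_nonreal (a b : R) : b != 0 -> resolvent_set mu A (a +i* b).
Proof.
move=> b0; apply: resolventP; exists (b ^+ 2); first by rewrite exprn_even_gt0.
by move=> u f [Du Sf _]; rewrite lerDr; exact: dot_ge0.
Qed.

Lemma spectrum_real z : spectrum mu A z -> exists a : R, z = a%:C.
Proof.
case: z => a b h; exists a; congr (_ +i* _); apply/eqP; apply: contrapT => /negP b0.
by apply: h; exact: resolvent_nonreal.
Qed.

Lemma spectrum_lower (a : R) : spectrum mu A a%:C <-> ~ lower a 0.
Proof.
split=> [h /resolventP|h [_ surj [M HM]]]; first exact: h.
apply: h; exists (`|M| + 1)^-1; first by rewrite invr_gt0 ltr_wpDl.
move=> u f ouf; have [Du Sf _] := ouf; have Su := cf_DL cf Du.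
have S0 := ss0 LL; have o0 := oprq0 cf.
pose U x := u x +i* (0 : R); pose G x := (f - a *: u) x +i* (0 : R).
have SG := ssB LL Sf (ssZ LL a Su).
have : shift_op A (a%:C) U G.
  apply/shift_opP; exists f, 0; split=> //.
    by apply/funext => x; change (f x - a * u x = f x - a * u x + 0 * 0); ring.
  by apply/funext => x; change (0 = 0 - a * 0 - 0 * u x); ring.
move=> /HM; rewrite !sqnormE; try by apply/L2P.
rewrite /= expr0n/= mul0r addr0.
have -> : dot mu (fun=> 0) (fun=> 0) = 0 :> R by exact: (sip0l sL S0).
rewrite !addr0 => h; rewrite mulrC ler_pdivrMr ?ltr_wpDl// mulrC.
apply: (le_trans h); apply: ler_wpM2r; first exact: dot_ge0.
by rewrite (le_trans (ler_norm M))// lerDl.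
Qed.

Lemma weyl_spectrum (a : R) : (forall e : R, 0 < e -> exists2 u : T -> R, D u &
    (dot mu u u > 0 /\ forall v : T -> R, D v ->
      (q u v - a * dot mu u v) ^+ 2 <= e * dot mu u u * form_norm (dot mu) q c v v)) ->
  spectrum mu A a%:C.
Proof.
move=> H; apply/spectrum_lower => /(weyl_bound cf)[C C0 HC].
have [|u Du [u0 Hu]] := H ((C + 1)^-1); first by rewrite invr_gt0 ltr_wpDl.
have := HC u ((C + 1)^-1 * dot mu u u) Du _ Hu.
rewrite mulr_ge0 ?invr_ge0 ?addr_ge0// ?dot_ge0// => /(_ isT).
rewrite mulrA ler_pMl// ler_pdivlMr ?ltr_wpDl// mul1r leNgt => /negP; apply.
by rewrite ltrDl.
Qed.

Lemma eigenspace_real (a : R) u : Defs.eigenspace mu A a%:C u -> eigq a (re u) /\ eigq a (im u).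
Proof.
move=> [f /AH[[D1 S1 H1] [D2 S2 H2]] fu].
have s1 := cf_DL cf D1; have s2 := cf_DL cf D2.
split; split=> //; try exact: (ssZ LL).
- move=> v Dv; rewrite H1//; apply: dot_ae => //; [exact: (ssZ LL)|exact: (cf_DL cf)|].
  apply: filterS fu => x /= h /h ->; change (complex.Re (a%:C * u x) = a * complex.Re (u x)).
  by case: (u x) => u1 u2 /=; ring.
- move=> v Dv; rewrite H2//; apply: dot_ae => //; [exact: (ssZ LL)|exact: (cf_DL cf)|].
  apply: filterS fu => x /= h /h ->; change (complex.Im (a%:C * u x) = a * complex.Im (u x)).
  by case: (u x) => u1 u2 /=; ring.
Qed.

(** Below [E] every spectral point is an eigenvalue by [comp_eigen], so isolation in the spectrum
    reduces to isolation among eigenvalues. *)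
Lemma discrete_below (E a : R) m : comp E m -> a < E -> spectrum mu A a%:C ->
  discrete_spectrum mu A a%:C.
Proof.
move=> Hc aE sa.
have nl := (spectrum_lower a).1 sa.
have [//|[w ew w1]] := comp_eigen cf Hc aE.
split.
- have [r r0 Hr] := eig_isolated cf Hc aE.
  split; first by rewrite inE.
  (* The second radius keeps all points of the ball that lie in the spectrum below [E], hence among
     the eigenvalues. *)
  pose r' := Num.min r (E - a).
  have r'0 : 0 < r' by rewrite lt_min r0 subr_gt0.
  exists (ball (a%:C : R[i]^o) r'%:C).
    by apply: nbhsx_ballx; rewrite -[0]/(0%:C) ltcR.
  apply/seteqP; split=> [z [bz sz]|_ ->].
    have [b zb] := spectrum_real sz; rewrite zb in bz sz *.
    move: bz; rewrite -ball_normE /= normc_def ltcR /= subrr expr0n addr0 sqrtr_sqr.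
    rewrite distrC lt_min => /andP[ar bE].
    have {}bE : b < E by have := ltr_normlW bE; rewrite ltrBlDr subrK.
    have nlb := (spectrum_lower b).1 sz.
    have [//|[v ev v1]] := comp_eigen cf Hc bE.
    by rewrite (Hr b v).
  by split=> //; apply: ballxx; rewrite -[0]/(0%:C) ltcR.
- exists (fun x => (w x)%:C).
    exists (fun x => (a * w x)%:C); first by apply/AH; split=> //; exact: oprq0 cf.
    by apply: aeW => x _; rewrite rmorphM.
  move=> w0; have Dw : D w by case: ew.
  have Sw := cf_DL cf Dw; have S0 := ss0 LL.
  have : w = 0 %[ae mu] by apply: filterS w0 => x /= h /h [].
  by move=> /(dot_ae Sw S0 Sw); rewrite w1 (sip0l sL)// => /eqP; rewrite oner_eq0.
- have [k [e [He Hv]]] := eig_finite cf Hc aE.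
  exists k, (fun i x => (e i x)%:C) => u /eigenspace_real[e1 e2].
  exists (fun i => dot mu (e i) (re u) +i* dot mu (e i) (im u)).
  have Se (i : 'I_k) : sq mu (e i) by have [_ [/(cf_DL cf)]] := He.1 _ (ltn_ord i).
  have ae v : eigq a v -> v = (fun x => \sum_(i < k) dot mu (e i) v * e i x) %[ae mu].
    move=> ev; have [Dv _ _] := ev; have Sv := cf_DL cf Dv.
    have SS : sq mu (v - \sum_(i < k) dot mu (e i) v *: e i).
      by apply: (ssB LL) => //; apply: ss_sum => // i; exact: (ssZ LL).
    have := dot_eq0 SS (Hv v ev); apply: filterS => x /= h /h /eqP.
    rewrite !fctE subr_eq0 => /eqP ->; rewrite fct_sumE.
    by apply: eq_bigr => i _.
  have := ae _ e2; have := ae _ e1; apply: filterS2 => x h1 h2 _.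
  apply/eqP; rewrite eq_complex !raddf_sum /= h1// h2//.
  by apply/andP; split; apply/eqP/eq_bigr => i _; ring.
Qed.

Section essential.
Variable E0 : R.
Hypothesis ray : forall a, E0 <= a -> spectrum mu A a%:C.

Lemma ray_not_discrete (a : R) : E0 <= a -> ~ discrete_spectrum mu A a%:C.
Proof.
move=> Ea [[_ [V /nbhs_ballP[e /= e0 eV] VA]] _ _].
(* The radius of a complex ball is itself a complex number; positivity forces its imaginary part to
   vanish. *)
case: e e0 eV => e1 e2; rewrite ltcE /= => /andP[/eqP h e0] eV.
have {}h : e2 = 0 by rewrite h.
rewrite h in eV.
have : (V `&` spectrum mu A) (a + e1 / 2)%:C.
  split; last by apply: ray; rewrite (le_trans Ea)// lerDl divr_ge0// ltW.
  apply: eV; rewrite -ball_normE /= normc_def -[_ +i* _]/(e1%:C) ltcR /=.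
  rewrite subrr expr0n addr0 sqrtr_sqr opprD addNKr normrN gtr0_norm ?divr_gt0//.
  by rewrite ltr_pdivrMr// ltr_pMr// ltr1n.
rewrite VA /= => -[] /eqP; rewrite -subr_eq0 addrAC subrr add0r mulf_eq0 invr_eq0.
by rewrite (gt_eqF e0) pnatr_eq0.
Qed.

Lemma essential_ray : (forall E, E < E0 -> exists m, comp E m) ->
  essential_spectrum mu A = [set x%:C | x in `[E0, +oo[].
Proof.
move=> Hc; apply/seteqP; split=> [z [sz dz]|z [a /= Ea <-]]; last first.
  move: Ea; rewrite in_itv/= andbT => Ea; split; first exact: ray.
  exact: ray_not_discrete.
have [a za] := spectrum_real sz; exists a => //=; rewrite in_itv/= andbT leNgt.
apply/negP => aE; apply: dz; rewrite za in sz *.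
have [|m Hm] := Hc ((a + E0) / 2); first by lra.
by apply: (discrete_below Hm) => //; lra.
Qed.

Lemma discrete_empty : (forall u : T -> R, D u -> E0 * dot mu u u <= q u u) ->
  discrete_spectrum mu A = set0.
Proof.
move=> H; apply/seteqP; split=> // z dz.
have sz : spectrum mu A z by case: dz => /isolatedS.
have [a za] := spectrum_real sz; rewrite za in sz dz.
have [Ea|aE] := leP E0 a; first exact: (ray_not_discrete Ea).
by have /spectrum_lower := sz; apply; exact: (coercive_lower cf aE H).
Qed.

(** A finite-rank bound is available only strictly below [E0]. If the discrete spectrum were finite,
    its part below [E0] would lie below some [E1 < E0], and the bound at [E1] would limit the number
    of orthonormal eigenvectors, while the trial vectors provide arbitrarily many. *)
Lemma infinite_discrete : (forall E, E < E0 -> exists m, comp E m) ->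
  (forall k : nat, exists t : nat -> T -> R,
    (forall i, (i < k)%N -> D (t i) /\ q (t i) (t i) < E0 * dot mu (t i) (t i)) /\
    (forall i j, (i < k)%N -> (j < k)%N -> i != j ->
      q (t i) (t j) = 0 /\ dot mu (t i) (t j) = 0)) ->
  infinite_set (discrete_spectrum mu A).
Proof.
move=> Hc Ht fin.
have fams k : exists E e a, E < E0 /\ eigfam (sq mu) D (dot mu) q E k e a.
  have [t [Ht1 Ht2]] := Ht k.
  (* Finitely many strict inequalities leave room to lower the threshold; it depends on [k]. *)
  have [E [EE0 HE]] : exists E, E < E0 /\ forall i, (i < k)%N ->
      q (t i) (t i) < E * dot mu (t i) (t i).
    elim: k {Ht2} Ht1 => [|k IH] Ht1; first by exists (E0 - 1); split=> //; lra.
    have [i ik|E [EE0 HE]] := IH; first by apply: Ht1; rewrite ltnS ltnW.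
    have [Dk qk] := Ht1 k (ltnSn k).
    have n0 := dot_ge0 mu (t k).
    have np : 0 < dot mu (t k) (t k) + 1 by rewrite ltr_wpDl.
    pose e := (E0 * dot mu (t k) (t k) - q (t k) (t k)) / (dot mu (t k) (t k) + 1) / 2.
    have e0 : 0 < e by rewrite !divr_gt0// subr_gt0.
    exists (Num.max E (E0 - e)); split; first by rewrite gt_max EE0/= ltrBlDr ltrDl.
    move=> i; rewrite ltnS leq_eqVlt => /orP[/eqP ->|ik]; last first.
      apply: (lt_le_trans (HE i ik)); apply: ler_wpM2r; first exact: dot_ge0.
      by rewrite le_max lexx.
    apply: (@lt_le_trans _ _ ((E0 - e) * dot mu (t k) (t k))); last first.
      by apply: ler_wpM2r => //; rewrite le_max lexx orbT.
    have : e * (dot mu (t k) (t k) + 1) = (E0 * dot mu (t k) (t k) - q (t k) (t k)) / 2.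
      by rewrite /e; field; rewrite gt_eqF.
    move: qk; nra.
  have [m Hm] := Hc E EE0.
  have [e [a He]] := many_eigen cf Hm (fun i ik => conj (Ht1 i ik).1 (HE i ik)) Ht2.
  by exists E, e, a.
have eigd E e a k i : E < E0 -> eigfam (sq mu) D (dot mu) q E k e a -> (i < k)%N ->
    discrete_spectrum mu A (a i)%:C /\ a i < E0.
  move=> EE0 [He Hij] ik; have [aE ei] := He i ik.
  have [m Hm] := Hc E EE0; split; last exact: lt_trans aE EE0.
  apply: (discrete_below Hm aE); apply/spectrum_lower => -[r r0 Hr].
  have := Hr _ _ ei; rewrite subrr Hij// eqxx mulr1 expr0n/= mul0r addr0.
  by rewrite (sip0l sL (ss0 LL)) leNgt r0.
have [E1 [E1E0 HE1]] : exists E1, E1 < E0 /\ forall a : R,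
    discrete_spectrum mu A a%:C -> a < E0 -> a < E1.
  have /finite_seqP[s sE] := fin.
  have : forall a : R, discrete_spectrum mu A a%:C -> a%:C \in s.
    by move=> a; rewrite sE.
  elim: s {sE} (discrete_spectrum mu A) => [|z s IH] P HP.
    by exists (E0 - 1); split=> [|a /HP//]; lra.
  have [|E1 [E1E0 HE1]] := IH [set z' | P z' /\ z' \in s]; first by move=> a [].
  have [zE|zE] := ltP (complex.Re z) E0; last first.
    exists E1; split=> // a Pa aE; apply: HE1 => //; split=> //.
    by have := HP _ Pa; rewrite inE => /orP[/eqP za|//]; move: zE; rewrite -za/= leNgt aE.
  exists (Num.max E1 ((complex.Re z + E0) / 2)); split.
    by rewrite gt_max E1E0/=; lra.
  move=> a Pa aE; rewrite lt_max.
  have := HP _ Pa; rewrite inE => /orP[/eqP za|as_]; last by rewrite HE1.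
  by apply/orP; right; rewrite -za/=; move: zE; rewrite -za/=; lra.
have [m Hm] := Hc E1 E1E0.
have [E [e [a [EE0 He]]]] := fams m.+1.
have : eigfam (sq mu) D (dot mu) q E1 m.+1 e a.
  split; last exact: He.2.
  move=> i ik; have [d1 d2] := eigd _ _ _ _ _ EE0 He ik.
  by split; [exact: HE1|exact: (He.1 i ik).2].
by move=> /(eigen_count cf Hm); rewrite ltnn.
Qed.

End essential.
End complexification.

(** * Powers of the positive part *)

Section pos.
Context {R : realType}.

(** Powers of [pos] with exponent at least 2 are C1 with an explicit derivative. They give
    polynomial cutoffs whose integrals obey algebraic recursions, and C1 is all that trial functions
    need. *)
Definition pos (x : R) : R := Num.max 0 x.

Lemma pos_ge0 x : 0 <= pos x. Proof. by rewrite le_max lexx. Qed.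

Lemma posE x : 0 <= x -> pos x = x. Proof. by move=> /max_idPr. Qed.

Lemma pos0 x : x <= 0 -> pos x = 0. Proof. by move=> /max_idPl. Qed.

Lemma cont_pos : continuous pos.
Proof.
move=> x; apply: (@continuous_max R R^o (fun=> 0) id); first exact: cst_continuous.
exact: cvg_id.
Qed.

Lemma is_derive_posX k (x : R) :
  is_derive x 1 (fun y => pos y ^+ k.+2) (k.+2%:R * pos x ^+ k.+1).
Proof.
have [x0|x0|->] := ltgtP x 0.
- rewrite (pos0 (ltW x0)) expr0n /= mulr0.
  apply: (near_eq_is_derive _ (is_derive_cst (0 : R) x (1 : R))).
  near=> y; rewrite pos0 ?expr0n//.
  by apply/ltW; near: y; exact: lt_nbhsl.
- rewrite (posE (ltW x0)).
  have h : is_derive x 1 (fun y : R => y ^+ k.+2) (k.+2%:R * x ^+ k.+1).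
    rewrite (_ : (fun y : R => y ^+ k.+2) = @id R ^+ k.+2); last by apply/funext => y; rewrite fctE.
    by apply: is_derive_eq; rewrite /GRing.scale/= mulr1 mulr_natl.
  apply: near_eq_is_derive h.
  near=> y; rewrite posE//.
  by apply/ltW; near: y; exact: lt_nbhsr.
rewrite (pos0 (lexx _)) expr0n /= mulr0.
have L : (fun h : R => h^-1 *: (((fun y => pos y ^+ k.+2) \o shift 0) (h *: 1) -
    pos 0 ^+ k.+2)) @ 0^' --> (0 : R).
  apply/cvgrPdist_le => e e0; near=> h.
  rewrite sub0r normrN /= addr0 [h *: 1]mulr1 (pos0 (lexx _)) expr0n/= subr0 /GRing.scale/=.
  have [h0|h0] := leP h 0; first by rewrite (pos0 h0) expr0n/= mulr0 normr0 ltW.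
  rewrite posE ?(ltW h0)// exprS mulrA mulVf ?gt_eqF// mul1r normrX.
  have h1 : `|h| <= 1 by near: h; exact: dnbhs0_le.
  rewrite exprS (le_trans (ler_piMr _ _))// ?exprn_ile1//.
  by near: h; exact: dnbhs0_le.
split; first by apply/cvg_ex; exists 0.
by apply: cvg_lim.
Unshelve. all: by end_near. Qed.

Lemma cont_posX k (a : R) : continuous (fun y => a * pos y ^+ k).
Proof.
elim: k => [|k IH].
  rewrite (_ : (fun y => _) = cst a); first exact: cst_continuous.
  by apply/funext => y; rewrite expr0 mulr1.
move=> x; under eq_fun do rewrite exprSr mulrA.
by apply: cvgM; [exact: IH|exact: cont_pos].
Qed.

End pos.

(** * Correlation of a square-integrable function with a test function *)

Section C1_more.
Context {R : realType} (n : nat).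
Local Notation leb := (lebesgue_rV R n).
Implicit Types f g u : 'rV[R]_n -> R.

Lemma C1_posX k f : C1 f -> C1 (fun x => pos (f x) ^+ k.+2) /\
  forall i x, 'D_('e_i) (fun x => pos (f x) ^+ k.+2) x =
    k.+2%:R * pos (f x) ^+ k.+1 * 'D_('e_i) f x.
Proof.
move=> cf; apply: (C1_comp (p := fun y => pos y ^+ k.+2) (p' := fun y => k.+2%:R * pos y ^+ k.+1) cf).
  by move=> x; exact: is_derive_posX.
by move=> x; exact: (@cont_posX _ k.+1 k.+2%:R (f x)).
Qed.

Lemma rint_cont_eq0 f : continuous f -> (forall x, 0 <= f x) -> intg leb f ->
  rint leb f = 0 -> forall x, f x = 0.
Proof.
move=> cf f0 If rf x; apply/eqP; apply: contrapT => /negP fx.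
have fp : 0 < f x by rewrite lt_neqAle eq_sym fx f0.
have /nbhs_ballP[e /= e0 eB] : \forall y \near x, 0 < f y by exact: cvgr_gt (cf x) _ fp.
have [N [mN N0 sN]] := rint_eq0 f0 If rf.
have : (leb (cube x (e / 2)) <= leb N)%E.
  apply: le_measure; rewrite ?inE//; first exact: measurable_cube.
  move=> y yx; apply: sN => /= h; have : 0 < f y.
    apply: eB; split=> // i j; rewrite (ord1 i) /ball /= distrC (le_lt_trans (yx j))//.
    by rewrite ltr_pdivrMr// ltr_pMr// ltr1n.
  by rewrite h// ltxx.
have e2 : 0 <= e / 2 by rewrite divr_ge0// ltW.
rewrite N0 (leb_cube x e2) lee_fin leNgt => /negP; apply.
by rewrite exprn_gt0// mulr_gt0// divr_gt0.
Qed.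

(** Dominated convergence speaks of sequences, so continuity of parameter integrals is obtained
    through sequential continuity. *)
Lemma seq_continuous f (x : 'rV[R]_n) : (forall s : nat -> 'rV[R]_n, s k @[k --> \oo] --> x ->
  f (s k) @[k --> \oo] --> f x) -> {for x, continuous f}.
Proof.
move=> H; apply: contrapT => nc.
have [e e0 He] : exists2 e : R, 0 < e & forall k : nat, exists y,
    ball x k.+1%:R^-1 y /\ e <= `|f x - f y|.
  apply: contrapT => nH; apply: nc; apply/(@cvgrPdist_lt _ _ _ (nbhs x)) => e e0.
  apply: contrapT => nn; apply: nH; exists e => // k.
  apply: contrapT => nk; apply: nn; apply/nbhs_ballP.
  exists k.+1%:R^-1 => /=; first by rewrite invr_gt0.
  by move=> y xy; rewrite ltNge; apply/negP => h; apply: nk; exists y.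
have [s sP] := choice He.
have sx : s k @[k --> \oo] --> x.
  apply/cvg_ballP => r r0; have [N _ HN] := near_infty_natSinv_lt (PosNum r0).
  exists N => // k /= Nk; apply: le_ball (sP k).1.
  by apply/ltW/HN.
have /cvgrPdist_lt/(_ e e0)[N _ /(_ N (leqnn _))] := H s sx.
by rewrite ltNge (sP N).2.
Qed.

Definition shiftv (x : 'rV[R]_n) f (y : 'rV[R]_n) := f (y - x).

Lemma shift_C1 x f : C1 f -> C1 (shiftv x f) /\
  forall i y, 'D_('e_i) (shiftv x f) y = 'D_('e_i) f (y - x).
Proof.
have cs : continuous (fun y : 'rV[R]_n => y - x).
  apply: continuous_rV => i; under eq_fun do rewrite !mxE.
  by apply: contD; [exact: cont_coord|exact: cont_cst].
move=> cf; apply: C1_intro => [|i y|i].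
- exact: (cont_compT cs (C1_cont cf)).
- apply/is_derive_line; have /is_derive_line := C1_der i (y - x) cf.
  by congr is_derive; apply/funext => t; rewrite /shiftv addrA.
- exact: (cont_compT cs (@C1_dcont _ _ f i cf)).
Qed.

Lemma bm_meas f : bm f -> measurable_fun setT f. Proof. by case. Qed.

Lemma csupp_shift x f : csupp f -> csupp (shiftv x f).
Proof.
move=> [M HM]; exists (M + \sum_i `|x 0 i|) => y i h; apply: (HM _ i).
rewrite !mxE; have := ler_distD 0 (y 0 i) (x 0 i); rewrite !subr0 sub0r normrN => h2.
have h3 : `|x 0 i| <= \sum_i `|x 0 i| by rewrite (bigD1 i)//= lerDl sumr_ge0.
have := ler_normB (y 0 i - x 0 i) (- x 0 i); rewrite opprK subrK normrN.
lra.
Qed.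

Lemma test_shift x f : test_function f -> test_function (shiftv x f).
Proof.
move=> /test_csupp[sf cf]; apply/test_csupp; split; last exact: csupp_shift.
apply: (smooth_coind (P := fun g => exists2 h, smooth h & g = shiftv x h)); last by exists f.
move=> _ [h sh ->]; have [c1 dE] := shift_C1 x (smooth_C1 sh).
split=> // i; exists (fun y => 'D_('e_i) h y); first exact: smooth_d.
by apply/funext => y; rewrite dE.
Qed.

Lemma bm_shift x f : bm f -> bm (shiftv x f).
Proof.
move=> [mf [B fB] sf]; split; last exact: csupp_shift.
  apply: (measurableT_comp mf); apply: measurable_fun_rVP => i.
  rewrite (_ : _ \o _ = fun y : 'rV[R]_n => rV_coord i y - x 0 i).
    by apply: measurable_funB => //; exact: measurable_rV_coord.
  by apply/funext => y; rewrite /rV_coord /= !mxE.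
by exists B => y; exact: fB.
Qed.

(** The convolution of [u] with the reflection of [f]: derivatives fall on [f], with a sign, and the
    value at 0 is the pairing of [u] with [f]. *)
Definition corr u f (x : 'rV[R]_n) := dot leb u (shiftv x f).

Lemma corr_bound f : bm f -> exists2 K : R, 0 <= K &
  forall x, rint leb (fun y => `|f (y - x)|) <= K /\
    rint leb (fun y => `|f (x - y)|) <= K.
Proof.
move=> [mf [B fB] /csupp_cube[M M0 fM]].
exists (`|B| * (2 * M) ^+ n) => [|x]; first by rewrite mulr_ge0// exprn_ge0// mulr_ge0.
have E : rint leb (\1_(cube x M)) = (2 * M) ^+ n.
  rewrite rintE /Rintegral integral_indic ?setIT//; last exact: measurable_cube.
  by rewrite [X in fine X](leb_cube x M0).
have b (y z : 'rV[R]_n) : (forall i, `|z 0 i| <= M -> `|y 0 i - x 0 i| <= M) ->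
    `|f z| <= `|B| * \1_(cube x M) y.
  move=> h; rewrite indicE; have [_|/negP] := boolP (y \in cube x M).
    by rewrite mulr1 (le_trans (fB z))// ler_norm.
  rewrite inE mulr0 => nc; rewrite fM ?normr0// => cz; apply: nc => i.
  by apply: h; have := cz i; rewrite mxE subr0.
have mle g : measurable_fun setT g ->
    (forall y, `|g y| <= `|B| * \1_(cube x M) y) ->
    rint leb (fun y => `|g y|) <= `|B| * (2 * M) ^+ n.
  move=> mg gb; have I1 := intgZ `|B| (intg_indic_cube x M).
  rewrite -E -rintZ; last exact: intg_indic_cube.
  apply: rint_le => //; apply: (intg_dom _ _ I1).
    by apply: measurableT_comp mg; exact: normr_measurable.
  by move=> y; rewrite normr_id.
have mc (s : 'rV[R]_n -> 'rV[R]_n) : (forall i, measurable_fun setT (fun y => s y 0 i)) ->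
    measurable_fun setT (fun y => f (s y)).
  by move=> ms; apply: (measurableT_comp mf); apply: measurable_fun_rVP => i; exact: ms.
split; apply: mle.
- apply: mc => i; under eq_fun do rewrite !mxE.
  by apply: measurable_funB => //; exact: (measurable_rV_coord i).
- by move=> y; apply: b => i; rewrite !mxE.
- apply: mc => i; under eq_fun do rewrite !mxE.
  by apply: measurable_funB => //; exact: (measurable_rV_coord i).
- by move=> y; apply: b => i; rewrite !mxE distrC.
Qed.

Lemma corr_cont u f : sq leb u -> bm f -> continuous f -> continuous (corr u f).
Proof.
move=> su bf cf x; apply: seq_continuous => s sx.
have [mf [B fB] /csupp_cube[M M0 fM]] := bf.
have [N _ HN] : \forall k \near \oo, ball x 1 (s k).
  by move/cvg_ballP : sx; apply.
rewrite -(cvg_shiftn N) /=.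
have I1 : intg leb (fun y => `|B| * (\1_(cube x (M + 1)) y + u y ^+ 2) : R).
  by apply: intgZ; apply: intgD; [exact: intg_indic_cube|exact: su.2].
apply: (rint_dct _ _ I1 _).2.
- move=> k; exact: (measurable_funM (sq_meas su) (bm_meas (bm_shift (s (k + N)%N) bf))).
- move=> y; apply: cvgM; first exact: cvg_cst.
  apply: continuous_cvg; first exact: cf.
  apply: cvgB; first exact: cvg_cst.
  by rewrite (cvg_shiftn N).
- move=> k y; rewrite /shiftv normrM indicE.
  have [_|/negP] := boolP (y \in cube x (M + 1)).
    have h := fB (y - s (k + N)%N); have B0 := le_trans (normr_ge0 _) h.
    rewrite (ger0_norm B0) mulrC ler_pM//=.
    by rewrite ler_norml; have := sqr_ge0 (u y - 1); have := sqr_ge0 (u y + 1);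
        move=> ? ?; apply/andP; split; nra.
  rewrite inE => nc; rewrite fM ?normr0 ?mulr0 ?mulr_ge0 ?addr_ge0 ?sqr_ge0// => cz.
  apply: nc => i; have := cz i; rewrite !mxE subr0 => h1.
  have [_ /(_ 0 i) h2] := HN (k + N)%N (leq_addl _ _).
  move: h2; rewrite /ball /= distrC => h2.
  have := ler_distD (s (k + N)%N 0 i) (y 0 i) (x 0 i).
  move: h1 h2; lra.
Qed.

Lemma corr_derive u f i x : sq leb u -> C1 f -> csupp f ->
  is_derive x 'e_i (corr u f) (- corr u (fun y => 'D_('e_i) f y) x).
Proof.
move=> su cf sf; apply/is_derive_line.
have bd := bm_d i cf sf; have bf := bm_cont (C1_cont cf) sf.
have [md [B dB] /csupp_cube[M M0 dM]] := bd.
pose F (t : R) (y : 'rV[R]_n) := u y * f (y - (t *: 'e_i + x)).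
(* The cube of half-width [M + 1] contains the supports of all translates with [|t| < 1], and
   [|u| <= 1 + u ^ 2]. *)
pose G (y : 'rV[R]_n) := `|B| * (\1_(cube x (M + 1)) y + u y ^+ 2) : R.
have IG : intg leb G by apply: intgZ; apply: intgD; [exact: intg_indic_cube|exact: su.2].
have G0 y : 0 <= G y by rewrite /G mulr_ge0// addr_ge0 ?sqr_ge0// indicE.
have dF t y : is_derive t (1 : R) (F ^~ y) (- (u y * 'D_('e_i) f (y - (t *: 'e_i + x)))).
  have /is_derive_line h := C1_der i (y - (t *: 'e_i + x)) cf.
  set g := (fun s : R => _) in h.
  have h2 : is_derive t (1 : R) (g \o (fun s => t - s))
      ('D_('e_i) f (y - (t *: 'e_i + x)) * (-1)).
    apply: is_derive1_comp; first by rewrite subrr.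
    have h3 := @is_deriveB _ _ _ (cst t) (@id R) t 1 0 1 (is_derive_cst t t 1) (is_derive_id t 1).
    by rewrite sub0r in h3.
  have := @is_deriveZ _ _ _ _ (u y) _ _ _ h2; congr is_derive.
    apply/funext => s; rewrite /F /g fctE /GRing.scale/=; congr (_ * f _).
    by apply/rowP => j; rewrite !mxE; ring.
  by rewrite /GRing.scale/= mulrN1 mulrN.
have IF t : `]-1, 1[%classic t -> leb.-integrable setT (EFin \o F t).
  by move=> _; apply: (sq_mul su); apply: bm_sq; exact: (bm_shift (t *: 'e_i + x) bf).
have t0 : `]-1, 1[%classic (0 : R) by rewrite /= in_itv/= ltrN10 ltr01.
have p1 t y : partial1of2 F t y = - (u y * 'D_('e_i) f (y - (t *: 'e_i + x))).
  by rewrite partial1of2E; exact: derive_val.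
have derF t y : `]-1, 1[%classic t -> setT y -> derivable (F ^~ y) t 1.
  by move=> _ _; exact: ex_derive.
have Gub t y : `]-1, 1[%classic t -> setT y -> `|partial1of2 F t y| <= G y.
  rewrite /= in_itv/= => /andP[t1 t2] _; rewrite p1 normrN normrM /G indicE.
  have [_|/negP] := boolP (y \in cube x (M + 1)).
    have h := dB (y - (t *: 'e_i + x)); have B0 := le_trans (normr_ge0 _) h.
    rewrite (ger0_norm B0) mulrC ler_pM//=.
    by rewrite ler_norml; have := sqr_ge0 (u y - 1); have := sqr_ge0 (u y + 1);
        move=> ? ?; apply/andP; split; nra.
  rewrite inE => nc; rewrite dM ?normr0 ?mulr0 ?mulr_ge0 ?addr_ge0 ?sqr_ge0// => cz.
  apply: nc => j; have := cz j; rewrite !mxE subr0 eqxx/=.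
  have tj : `|t * (j == i)%:R| <= 1.
    by case: (j == i); rewrite ?mulr1 ?mulr0 ?normr0// ler_norml (ltW t1) ltW.
  have := ler_distD (y 0 j - t * (j == i)%:R) (y 0 j) (x 0 j).
  rewrite opprB addrCA subrr addr0 opprD addrA.
  lra.
have h1 := differentiation_under_integral measurableT t0 IF derF G0 IG Gub.
have h2 := derivable_under_integral measurableT t0 IF derF G0 IG Gub.
have E : (fun t : R => corr u f (t *: 'e_i + x)) =
    (fun t : R => \int[leb]_(y in setT) F t y).
  by apply/funext => t; rewrite /corr /dot rintE.
rewrite E; split=> //; rewrite -derive1E h1 -rintE.
rewrite (_ : partial1of2 F 0 = fun y => - (u y * shiftv x (fun y => 'D_('e_i) f y) y)).
  by rewrite rintN//; exact: (sq_mul su (bm_sq (bm_shift x bd))).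
by apply/funext => y; rewrite p1 scale0r add0r.
Qed.

Lemma corr_C1 u f : sq leb u -> C1 f -> csupp f -> C1 (corr u f) /\
  forall i x, 'D_('e_i) (corr u f) x = - corr u (fun y => 'D_('e_i) f y) x.
Proof.
move=> su cf sf; apply: C1_intro => [|i x|i].
- by apply: corr_cont => //; [exact: bm_cont (C1_cont cf) sf|exact: C1_cont].
- exact: corr_derive.
- apply: contN; apply: corr_cont => //; first exact: bm_d.
  exact: C1_dcont.
Qed.

End C1_more.

Lemma contX (R : realType) (T : topologicalType) (f : T -> R) k : continuous f ->
  continuous (fun x => f x ^+ k).
Proof.
move=> cf; elim: k => [|k IH]; first by under eq_fun do rewrite expr0; exact: cont_cst.
rewrite (_ : (fun x => _) = fun x => f x ^+ k * f x); first exact: contM.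
by apply/funext => x; rewrite exprSr.
Qed.

Ltac ctac := first [ assumption | lazymatch goal with
  | |- forall y, @continuous_at _ _ y (fun x => (@?f x + @?g x)%R) => apply: contD; ctac
  | |- forall y, @continuous_at _ _ y (fun x => (@?f x * @?g x)%R) => apply: contM; ctac
  | |- forall y, @continuous_at _ _ y (fun x => (- @?f x)%R) => apply: contN; ctac
  | |- forall y, @continuous_at _ _ y (fun x => (@?f x ^+ ?k)%R) => apply: contX; ctac
  | |- forall y, @continuous_at _ _ y (fun x => @fun_of_matrix _ _ _ x _ ?j) => apply: cont_coord
  | |- _ => first [solve [apply: C1_cont; assumption] | solve [apply: C1_dcont; assumption] | exact: cont_cst | idtac] end ].

Lemma csuppX (R : realType) n (f : 'rV[R]_n -> R) k : csupp f -> csupp (fun x => f x ^+ k.+1).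
Proof. by move=> [M H]; exists M => x i /H ->; rewrite expr0n. Qed.

(** * Vanishing of bounded solutions of F = div grad F *)

Section helmholtz.
Context {R : realType} (n : nat).
Local Notation leb := (lebesgue_rV R n).
Implicit Types f g u F z : 'rV[R]_n -> R.

(* Test F = div (grad F) against z^2 F and complete the square. *)
Lemma caccioppoli F z : C1 F -> (forall i, C1 (fun x => 'D_('e_i) F x)) ->
  (forall x, F x = \sum_i 'D_('e_i) (fun y => 'D_('e_i) F y) x) ->
  C1 z -> csupp z ->
  rint leb (fun x => (z x * F x) ^+ 2) <=
  rint leb (fun x => \sum_i ('D_('e_i) z x * F x) ^+ 2).
Proof.
move=> cF cG FE cz sz.
have cw : C1 (fun x => z x * (z x * F x)) by apply: C1M => //; exact: C1M.
have sw : csupp (fun x => z x * (z x * F x)) by exact: csuppM.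
have sdz i : csupp (fun x => 'D_('e_i) z x) by exact: csupp_d.
have I1 i : intg leb (fun x => 'D_('e_i) (fun y => 'D_('e_i) F y) x * (z x * (z x * F x))).
  by apply/intg_bm/bm_cont; [exact: (contM (C1_dcont (cG i)) (C1_cont cw))|exact: csuppMr].
have I2 i : intg leb (fun x => 'D_('e_i) F x * 'D_('e_i) (fun x => z x * (z x * F x)) x).
  by apply/intg_bm/bm_cont; [exact: (contM (C1_dcont cF) (C1_dcont cw))|apply: csuppMr; exact: csupp_d].
have I3 i : intg leb (fun x => ('D_('e_i) z x * F x) ^+ 2).
  by apply/intg_bm/bm_cont; [ctac|apply: csuppM; exact: csuppM].
rewrite (_ : rint leb _ = rint leb (fun x => \sum_i
    'D_('e_i) (fun y => 'D_('e_i) F y) x * (z x * (z x * F x)))); last first.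
  apply: rint_ext => x; rewrite -mulr_suml -FE; ring.
rewrite !rint_sum//; apply: ler_sum => i _.
have := rint_ibp i (cG i) cw sw; have := I2 i; have := I3 i.
move: (I1 i) => J1 J3 J2 E.
rewrite -[X in X <= _]opprK -E -rintN//; apply: rint_le => //; first exact: intgN.
move=> x; rewrite dM//; last exact: C1M.
rewrite dM//.
have := sqr_ge0 (z x * 'D_('e_i) F x + 'D_('e_i) z x * F x); nra.
Qed.

Let par (r : R) (x : 'rV[R]_n) : R := 1 - r * \sum_i x 0 i ^+ 2.

Let par_C1 r : C1 (par r) /\ forall i x, 'D_('e_i) (par r) x = - (r * (2 * x 0 i)).
Proof.
have c2 i : C1 (fun x : 'rV[R]_n => x 0 i ^+ 2).
  by apply: C1M; exact: C1_coord.
have cs : C1 (fun x : 'rV[R]_n => \sum_i x 0 i ^+ 2) by exact: C1_sum.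
split=> [|i x]; first by apply: C1B; [exact: C1_cst|exact: C1Z].
rewrite dB ?dcst ?sub0r; last by exact: C1Z.
  have d2 j : 'D_('e_i) (fun y : 'rV[R]_n => y 0 j ^+ 2) x = 2 * ((i == j)%:R * x 0 j).
    have -> : (fun y : 'rV[R]_n => y 0 j ^+ 2) = fun y => y 0 j * y 0 j by [].
    rewrite (dM i x (C1_coord j) (C1_coord j)) !dcoord; ring.
  rewrite dZ// dsum// (bigD1 i)//= big1 => [|j ji].
    by rewrite d2 eqxx addr0 mul1r.
  by rewrite d2 eq_sym (negbTE ji) mul0r mulr0.
exact: C1_cst.
Qed.

Let par_le1 r x : 0 <= r -> par r x <= 1.
Proof. by move=> r0; rewrite gerBl mulr_ge0// sumr_ge0// => i _; exact: sqr_ge0. Qed.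

Let par_out N (x : 'rV[R]_n) i : 0 < N -> N < `|x 0 i| -> pos (par (N ^- 2) x) = 0.
Proof.
move=> N0 h; apply: pos0; rewrite subr_le0 mulrC -ler_pdivrMr ?invr_gt0 ?exprn_gt0// invrK mul1r.
rewrite (bigD1 i)//= (@le_trans _ _ (x 0 i ^+ 2))//; last first.
  by rewrite lerDl sumr_ge0// => j _; exact: sqr_ge0.
by rewrite -[leRHS]real_normK ?num_real// lerXn2r// ?nnegrE// ltW.
Qed.

(** Each use of the Caccioppoli inequality gains a factor [N ^ - 2] on a ball of radius [N]. After
    [n + 1] uses the gain beats the growth [N ^ n] of the volume, so the weighted norm of [F] on the
    unit ball is zero. *)
Lemma bounded_helmholtz F B : C1 F -> (forall i, C1 (fun x => 'D_('e_i) F x)) ->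
  (forall x, F x = \sum_i 'D_('e_i) (fun y => 'D_('e_i) F y) x) ->
  (forall x, `|F x| <= B) -> F 0 = 0.
Proof.
move=> cF cG FE FB.
have cp k r : C1 (fun x => pos (par r x) ^+ k.+2) by case: (C1_posX k (par_C1 r).1).
have cpos r : continuous (fun x => pos (par r x)).
  by apply: (cont_compT (C1_cont (par_C1 r).1)); exact: cont_pos.
pose I k N := rint leb (fun x => (pos (par (N ^- 2) x) ^+ k.+1 * F x) ^+ 2).
have sp k N : 0 < N -> csupp (fun x => pos (par (N ^- 2) x) ^+ k.+1).
  by move=> N0; exists N => x i h; rewrite (par_out N0 h) expr0n.
have cpk k N : continuous (fun x => pos (par (N ^- 2) x) ^+ k.+1).
  by move=> x; case: k => [|k]; [exact: cpos|exact: C1_cont].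
have II k N : 0 < N -> intg leb (fun x => (pos (par (N ^- 2) x) ^+ k.+1 * F x) ^+ 2).
  move=> N0; apply/intg_bm/bm_cont; last by apply: csuppM; apply: csuppM; exact: sp.
  by apply: contM; apply: contM => //; exact: C1_cont.
have I0 N : 0 < N -> I 0%N N <= B ^+ 2 * (2 * N) ^+ n.
  move=> N0; have h := leb_cube (0 : 'rV[R]_n) (ltW N0).
  have E : rint leb (\1_(cube 0 N)) = (2 * N) ^+ n.
    rewrite rintE /Rintegral integral_indic ?setIT//; last exact: measurable_cube.
    by rewrite [X in fine X]h.
  have J := intg_indic_cube (0 : 'rV[R]_n) N.
  rewrite -E -rintZ//; apply: rint_le => [||x]; [exact: II|exact: intgZ|].
  rewrite indicE; have [_|/negP] := boolP (x \in cube 0 N).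
    rewrite mulr1 exprMn -[leRHS]mul1r ler_pM ?sqr_ge0//.
      rewrite exprn_ile1 ?exprn_ile1 ?exprn_ge0 ?pos_ge0//.
      by rewrite ge_max ler01 par_le1// invr_ge0 sqr_ge0.
    by rewrite -real_normK ?num_real// lerXn2r ?nnegrE// (le_trans _ (FB x)).
  rewrite inE mulr0 => nc.
  have [i Hi] : exists i, N < `|x 0 i|.
    apply: contrapT => nex; apply: nc => i; rewrite mxE subr0 leNgt.
    by apply/negP => Hi; apply: nex; exists i.
  by rewrite (par_out N0 Hi) mul0r expr0n.
(* Differentiating the cutoff lowers its exponent by one and produces [N ^ - 2 * x], of square at
   most [N ^ - 2] on the support. *)
have IS k N : 0 < N -> I k.+1 N <= 4 * k.+2%:R ^+ 2 * N ^- 2 * I k N.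
  move=> N0; apply: le_trans (caccioppoli cF cG FE (cp k _) (sp k.+1 _ N0)) _.
  rewrite -rintZ; last exact: II.
  have [_ dE] := C1_posX k (par_C1 (N ^- 2)).1.
  apply: rint_le => [||x]; last 1 first.
  - have [p0|p0] := leP (par (N ^- 2) x) 0.
      rewrite big1 => [|i _]; first by rewrite (pos0 p0) expr0n !mul0r expr0n !mulr0.
      by rewrite dE (pos0 p0) expr0n mulr0 !mul0r expr0n.
    under eq_bigr => i _ do rewrite dE (par_C1 _).2.
    rewrite (eq_bigr (fun i => 4 * k.+2%:R ^+ 2 * N ^- 2 *
      (pos (par (N ^- 2) x) ^+ k.+1 * F x) ^+ 2 * (N ^- 2 * x 0 i ^+ 2))); last first.
      by move=> i _; ring.
    rewrite -mulr_sumr -mulr_sumr -[leRHS]mulr1 ler_wpM2l//.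
      by rewrite mulr_ge0 ?sqr_ge0// mulr_ge0 ?invr_ge0 ?sqr_ge0// mulr_ge0// sqr_ge0.
    by move: p0; rewrite subr_gt0 => /ltW.
  - apply: intg_sum => i; apply/intg_bm/bm_cont.
      have := C1_dcont (i := i) (cp k (N ^- 2)); have := C1_cont cF => c1 c2; ctac.
    by apply: csuppX; apply: csuppM; apply: csupp_d; exact: sp.
  - by apply: intgZ; exact: II.
have [C C0 IC] : exists2 C, 0 <= C & forall N, 0 < N -> I n.+1 N <= C * N ^- 2 ^+ n.+1 * I 0%N N.
  elim: (n.+1) => [|k [C C0 IH]].
    by exists 1 => // N N0; rewrite expr0 !mul1r.
  exists (4 * k.+2%:R ^+ 2 * C) => [|N N0]; first by rewrite !mulr_ge0 ?sqr_ge0.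
  apply: le_trans (IS k N N0) _; rewrite [N ^- 2 ^+ k.+1]exprS.
  rewrite (_ : _ * _ * I 0%N N = 4 * k.+2%:R ^+ 2 * N ^- 2 * (C * N ^- 2 ^+ k * I 0%N N)); last by ring.
  by rewrite ler_wpM2l ?IH// !mulr_ge0 ?sqr_ge0// invr_ge0 sqr_ge0.
have fin N : 1 <= N -> I n.+1 1 <= C * B ^+ 2 * 2 ^+ n / N.
  move=> N1; have N0 : 0 < N by exact: lt_le_trans N1.
  apply: (@le_trans _ _ (I n.+1 N)).
    apply: rint_le => [||x]; [exact: II|exact: II|].
    rewrite ![(_ * F x) ^+ 2]exprMn; apply: ler_wpM2r; first exact: sqr_ge0.
    rewrite lerXn2r ?nnegrE ?exprn_ge0 ?pos_ge0//.
    rewrite lerXn2r ?nnegrE ?pos_ge0// le_max2// lerB// ler_wpM2r//.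
      by rewrite sumr_ge0// => i _; exact: sqr_ge0.
    by rewrite expr1n invr1 invf_le1 ?exprn_gt0// exprn_ege1.
  apply: le_trans (IC N N0) _.
  apply: (@le_trans _ _ (C * N ^- 2 ^+ n.+1 * (B ^+ 2 * (2 * N) ^+ n))).
    by rewrite ler_wpM2l ?I0// mulr_ge0// exprn_ge0// invr_ge0 sqr_ge0.
  have NV : N * N^-1 = 1 by rewrite divff ?gt_eqF.
  have V1 : N^-1 <= 1 by rewrite invf_le1.
  have V0 : 0 <= N^-1 by rewrite invr_ge0 ltW.
  rewrite (_ : _ * (_ * _) = C * B ^+ 2 * 2 ^+ n / N * ((N * N^-1) ^+ n * (N^-1 ^+ n.+1))); last first.
    rewrite -exprVn exprAC [N^-1 ^+ n.+1]exprS [(2 * N) ^+ n]exprMn [(N / N) ^+ n]exprMn.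
    move: (N^-1) => V; move: (N ^+ n) (V ^+ n) (2 ^+ n) => a b c; ring.
  rewrite NV expr1n mul1r ler_piMr//; last exact: exprn_ile1.
  exact: (mulr_ge0 (mulr_ge0 (mulr_ge0 C0 (sqr_ge0 B)) (exprn_ge0 n (ler0n _ 2))) V0).
have Iz : I n.+1 1 = 0.
  apply/eqP; rewrite eq_le rint_ge0 ?andbT => [|x]; last exact: sqr_ge0.
  rewrite leNgt; apply/negP => Ip.
  set A := C * B ^+ 2 * 2 ^+ n in fin.
  have A0 : 0 <= A := mulr_ge0 (mulr_ge0 C0 (sqr_ge0 B)) (exprn_ge0 n (ler0n _ 2)).
  have := fin (1 + A / I n.+1 1).
  have h0 : 0 <= A / I n.+1 1 by rewrite divr_ge0// ltW.
  rewrite lerDl h0 ler_pdivlMr ?ltr_wpDr// mulrDr mulr1 mulrCA divff ?gt_eqF// mulr1.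
  by move/(_ isT); rewrite gerDr leNgt Ip.
have c2 : continuous (fun x => (pos (par (1 ^- 2) x) ^+ n.+2 * F x) ^+ 2).
  by apply: contM; apply: contM => //; exact: C1_cont.
have := rint_cont_eq0 c2 (fun x => sqr_ge0 _) (II n.+1 1 ltr01) Iz 0.
move/eqP; rewrite sqrf_eq0 /par big1 => [|i _]; last by rewrite mxE expr0n.
by rewrite mulr0 subr0 posE// expr1n mul1r => /eqP.
Qed.

(** The correlation [F] of [u] with [s] solves [F = div grad F] in the classical sense and is
    bounded, so its value at 0, which is the pairing of [u] with [s], vanishes. *)
Lemma weak_helmholtz u : sq leb u ->
  (forall s, test_function s ->
    dot leb u s = \sum_i dot leb u (fun x => 'D_('e_i) (fun y => 'D_('e_i) s y) x)) ->
  forall s, test_function s -> dot leb u s = 0.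
Proof.
move=> su H s ts; have C1s := test_C1 ts; have ss := test_supp ts.
have td i := test_d i ts.
have [cF dF] := corr_C1 su C1s ss.
have dE i : (fun x => 'D_('e_i) (corr u s) x) = fun x => - corr u (fun y => 'D_('e_i) s y) x.
  by apply/funext => x; rewrite dF.
have cG i : C1 (fun x => 'D_('e_i) (corr u s) x).
  by rewrite dE; apply: C1N; case: (corr_C1 su (test_C1 (td i)) (test_supp (td i))).
have shd i (t : 'rV[R]_n -> R) x : C1 t -> (fun y => 'D_('e_i) (shiftv x t) y) = shiftv x (fun y => 'D_('e_i) t y).
  by move=> ct; apply/funext => y; rewrite (shift_C1 x ct).2.
have [K K0 HK] := corr_bound (test_bm ts); have [_ [B sB] _] := test_bm ts.
suff : corr u s 0 = 0.
  rewrite /corr (_ : shiftv 0 s = s)//.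
  by apply/funext => y; rewrite /shiftv subr0.
apply: (bounded_helmholtz (B := K + `|B| * dot leb u u) cF cG) => x.
  rewrite /corr H; last exact: test_shift.
  apply: eq_bigr => i _.
  have [cDD dE2] := corr_C1 su (test_C1 (td i)) (test_supp (td i)).
  have E (y : 'rV[R]_n) : 'D_('e_i) (fun y : 'rV[R]_n => 'D_('e_i) (shiftv x s) y) y =
      shiftv x (fun z : 'rV[R]_n => 'D_('e_i) (fun y : 'rV[R]_n => 'D_('e_i) s y) z) y.
    apply: etrans ((shift_C1 x (test_C1 (td i))).2 i y).
    by apply: (congr1 (fun h => derive h y 'e_i)); exact: (shd i s x C1s).
  transitivity (corr u (fun y : 'rV[R]_n => 'D_('e_i) (fun z : 'rV[R]_n => 'D_('e_i) s z) y) x).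
    by apply: rint_ext => y; exact: (congr1 (GRing.mul (u y)) (E y)).
  rewrite dE; apply: esym; apply: (etrans (dN i x cDD)).
  by rewrite -[RHS]opprK; congr (- _); exact: dE2.
have bs := bm_shift x (test_bm ts); have Iu := sq_mul su su.
have I1 := sq_mul su (bm_sq bs).
apply: (le_trans (rint_abs I1)).
apply: (@le_trans _ _ (rint leb (fun y => `|s (y - x)| + `|B| * (u y * u y)))).
  apply: rint_le => [||y]; first exact: intg_norm.
    by apply: intgD; [exact/intg_norm/intg_bm|exact: intgZ].
  rewrite normrM -/(shiftv x s y).
  have h1 : `|shiftv x s y| <= `|B| by rewrite (le_trans (sB _))// ler_norm.
  have h0 := normr_ge0 (shiftv x s y); have h2 := normr_ge0 (u y).
  rewrite -expr2 -(real_normK (num_real (u y))).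
  move: h0 h1 h2; move: `|shiftv x s y| `|B| `|u y| => b c a b0 bc a0.
  have := mulr_ge0 b0 (_ : 0 <= a ^+ 2 - a + 1); have : 0 <= (c - b) * a ^+ 2.
    by rewrite mulr_ge0 ?sqr_ge0// subr_ge0.
  have : 0 <= a ^+ 2 - a + 1 by have := sqr_ge0 (a - 1); nra.
  by move=> h k /(_ h); nra.
rewrite rintD ?rintZ//; last 2 first.
- exact/intg_norm/intg_bm.
- exact: intgZ.
by rewrite lerD2r; case: (HK x).
Qed.

End helmholtz.

(** * Weak derivatives *)

Section weak_derivatives.
Context {R : realType} (n : nat).
Local Notation leb := (lebesgue_rV R n).
Local Notation T := ('rV[R]_n).
Implicit Types f g h u v : T -> R.

Let sL := @sq_sip _ _ R leb.
Let LL := sip_ss sL.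

Definition wp (i : 'I_n) u g := forall s : T -> R, test_function s ->
  dot leb u (fun x => 'D_('e_i) s x) = - dot leb g s.

Definition H1r u := sq leb u /\ forall i, exists2 g, sq leb g & wp i u g.

(** The choice is unique only up to null functions, so [gr] is not linear on the nose; linearity is
    stated for the products [dot leb (gr i u) h]. *)
Definition gr (i : 'I_n) u : T -> R := xget (fun=> 0) [set g | sq leb g /\ wp i u g].

Lemma grP i u : H1r u -> sq leb (gr i u) /\ wp i u (gr i u).
Proof.
move=> [_ /(_ i)[g sg wg]].
by have := @xgetPex _ (fun=> 0) [set g | sq leb g /\ wp i u g]; apply; exists g.
Qed.

Lemma gr_sq i u : H1r u -> sq leb (gr i u). Proof. by move=> /(grP i)[]. Qed.

Lemma gr_wp i u : H1r u -> wp i u (gr i u). Proof. by move=> /(grP i)[]. Qed.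

Lemma H1r_sq u : H1r u -> sq leb u. Proof. by case. Qed.

Lemma test_orth f g : sq leb f -> sq leb g ->
  (forall s, test_function s -> dot leb f s = dot leb g s) -> dot leb (f - g) (f - g) = 0.
Proof.
move=> sf sg H; have sfg := ssB LL sf sg.
apply: du_bois_reymond => // s ts; have := sipBl sL sf sg (test_sq ts).
by rewrite (H s ts) subrr.
Qed.

Lemma dot_null f g h : sq leb f -> sq leb g -> sq leb h ->
  dot leb (f - g) (f - g) = 0 -> dot leb f h = dot leb g h.
Proof.
move=> sf sg sh fg; apply/eqP; rewrite -subr_eq0 -(sipBl sL sf sg sh).
by rewrite (sip_null sL (ssB LL sf sg) sh fg).
Qed.

Lemma gr_dot i u g h : H1r u -> sq leb g -> wp i u g -> sq leb h ->
  dot leb (gr i u) h = dot leb g h.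
Proof.
move=> Hu sg wg sh; have [sgr wgr] := grP i Hu.
apply: dot_null => //; apply: test_orth => // s ts.
by apply: oppr_inj; rewrite -wgr// wg.
Qed.

Lemma wpD i u v f g : sq leb u -> sq leb v -> sq leb f -> sq leb g ->
  wp i u f -> wp i v g -> wp i (u + v) (f + g).
Proof.
move=> su sv sf sg wf wg s ts; have t1 := test_sq (test_d i ts); have t2 := test_sq ts.
by rewrite (sipDl sL su sv t1) (sipDl sL sf sg t2) wf// wg// opprD.
Qed.

Lemma wpZ i a u f : sq leb u -> sq leb f -> wp i u f -> wp i (a *: u) (a *: f).
Proof.
move=> su sf wf s ts; have t1 := test_sq (test_d i ts); have t2 := test_sq ts.
by rewrite (sipZl sL a su t1) (sipZl sL a sf t2) wf// mulrN.
Qed.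

Lemma H1r_subspace : subspace H1r.
Proof.
split.
- split=> [|i]; first exact: ss0 LL.
  exists 0; first exact: ss0 LL.
  by move=> s ts; rewrite (sip0l sL (test_sq (test_d i ts))) (sip0l sL (test_sq ts)) oppr0.
- move=> u v Hu Hv; split=> [|i]; first by apply: (ssD LL); exact: H1r_sq.
  exists (gr i u + gr i v); first by apply: (ssD LL); exact: gr_sq.
  by apply: wpD; [exact: H1r_sq|exact: H1r_sq|exact: gr_sq|exact: gr_sq|exact: gr_wp|exact: gr_wp].
- move=> a u Hu; split=> [|i]; first by apply: (ssZ LL); exact: H1r_sq.
  exists (a *: gr i u); first by apply: (ssZ LL); exact: gr_sq.
  by apply: wpZ; [exact: H1r_sq|exact: gr_sq|exact: gr_wp].
Qed.

Let HS := H1r_subspace.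

Lemma gr_dotD i u v h : H1r u -> H1r v -> sq leb h ->
  dot leb (gr i (u + v)) h = dot leb (gr i u) h + dot leb (gr i v) h.
Proof.
move=> Hu Hv sh; have su := gr_sq i Hu; have sv := gr_sq i Hv.
rewrite (gr_dot (ssD HS Hu Hv) (ssD LL su sv) _ sh); first exact: (sipDl sL su sv sh).
by apply: wpD => //; [exact: H1r_sq|exact: H1r_sq|exact: gr_wp|exact: gr_wp].
Qed.

Lemma gr_dotZ i a u h : H1r u -> sq leb h ->
  dot leb (gr i (a *: u)) h = a * dot leb (gr i u) h.
Proof.
move=> Hu sh; have su := gr_sq i Hu.
rewrite (gr_dot (ssZ HS a Hu) (ssZ LL a su) _ sh); first exact: (sipZl sL a su sh).
by apply: wpZ => //; [exact: H1r_sq|exact: gr_wp].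
Qed.

Lemma gr_null u v : H1r u -> sq leb v -> dot leb (u - v) (u - v) = 0 ->
  H1r v /\ forall i h, sq leb h -> dot leb (gr i u) h = dot leb (gr i v) h.
Proof.
move=> Hu sv uv; have su := H1r_sq Hu.
have w i : wp i v (gr i u).
  move=> s ts; rewrite -(gr_wp i Hu ts); apply/esym; apply: dot_null => //.
  exact: test_sq (test_d i ts).
have Hv : H1r v by split=> // i; exists (gr i u); [exact: gr_sq|exact: w].
by split=> // i h sh; rewrite (gr_dot Hv (gr_sq i Hu) (w i) sh).
Qed.

Definition gdot u v : R := \sum_i dot leb (gr i u) (gr i v).

Definition h1dot u v : R := dot leb u v + gdot u v.

Lemma gdotC u v : gdot u v = gdot v u.
Proof. by apply: eq_bigr => i _; rewrite dotC. Qed.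

Lemma gdot_ge0 u : 0 <= gdot u u.
Proof. by apply: sumr_ge0 => i _; exact: dot_ge0. Qed.

Lemma gdotD u v w : H1r u -> H1r v -> H1r w -> gdot (u + v) w = gdot u w + gdot v w.
Proof.
move=> Hu Hv Hw; rewrite /gdot -big_split/=.
by apply: eq_bigr => i _; rewrite gr_dotD//; exact: gr_sq.
Qed.

Lemma gdotZ a u v : H1r u -> H1r v -> gdot (a *: u) v = a * gdot u v.
Proof.
move=> Hu Hv; rewrite /gdot mulr_sumr.
by apply: eq_bigr => i _; rewrite gr_dotZ//; exact: gr_sq.
Qed.

Lemma h1_sip : sip H1r h1dot.
Proof.
split; first exact: HS.
- move=> u v w Hu Hv Hw; rewrite /h1dot gdotD// addrACA; congr (_ + _).
  by apply: (sipDl sL); exact: H1r_sq.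
- move=> a u v Hu Hv; rewrite /h1dot gdotZ// mulrDr; congr (_ + _).
  by apply: (sipZl sL); exact: H1r_sq.
- by move=> u v _ _; rewrite /h1dot dotC gdotC.
- by move=> u _; rewrite addr_ge0 ?dot_ge0 ?gdot_ge0.
Qed.

Lemma gr_dist i u v f : H1r u -> H1r v -> sq leb f ->
  dot leb (gr i (u - v) - f) (gr i (u - v) - f) =
  dot leb (gr i u - gr i v - f) (gr i u - gr i v - f).
Proof.
move=> Hu Hv sf; have su := gr_sq i Hu; have sv := gr_sq i Hv.
have Huv := ssB HS Hu Hv; have suv := gr_sq i Huv.
have suv' := ssB LL su sv.
have w : wp i (u - v) (gr i u - gr i v).
  rewrite -(scaleN1r v) -(scaleN1r (gr i v)); apply: wpD; [exact: H1r_sq| |exact: su| | |].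
  - by apply: (ssZ LL); exact: H1r_sq.
  - exact: (ssZ LL).
  - exact: gr_wp.
  - by apply: wpZ; [exact: H1r_sq| |exact: gr_wp].
have E h (sh : sq leb h) := gr_dot Huv suv' w sh.
rewrite (sipBl sL suv sf (ssB LL suv sf)) (sipBl sL suv' sf (ssB LL suv' sf)).
rewrite (sipBr sL suv suv sf) (sipBr sL sf suv sf) (sipBr sL suv' suv' sf) (sipBr sL sf suv' sf).
by rewrite (E _ suv) (E _ sf) (dotC _ f) (E _ sf) (dotC _ _ (gr i (u - v))) (E _ suv') (dotC _ f).
Qed.

Lemma dot_lim (s : nat -> T -> R) l h : (forall k, sq leb (s k)) -> sq leb l -> sq leb h ->
  sip_cvg (dot leb) s l -> dot leb (s k) h @[k --> \oo] --> dot leb l h.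
Proof.
move=> ss sl sh sc; apply/cvgrPdist_lt => e e0.
have [N HN] := sc (e ^+ 2 / (dot leb h h + 1)) (divr_gt0 (exprn_gt0 _ e0) (ltr_wpDl (dot_ge0 leb h) ltr01)).
exists N => // k /= /HN; rewrite ltr_pdivlMr ?ltr_wpDl ?dot_ge0// => h1.
rewrite distrC -(sipBl sL (ss k) sl sh) -(@ltr_pXn2r _ 2)//= ?nnegrE ?(ltW e0)//.
rewrite real_normK ?num_real//; apply: le_lt_trans (sip_CS sL (ssB LL (ss k) sl) sh) _.
apply: le_lt_trans h1; rewrite ler_wpM2l// ?dot_ge0//; lra.
Qed.

Lemma h1_complete : sip_complete H1r h1dot.
Proof.
move=> u Hu cu; have su k := H1r_sq (Hu k).
have cau (B : (T -> R) -> (T -> R) -> R) (v : nat -> T -> R) :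
    (forall i j, B (v i - v j) (v i - v j) <= h1dot (u i - u j) (u i - u j)) -> sip_cauchy B v.
  move=> H e /cu[N HN]; exists N => i j Ni Nj; exact: le_lt_trans (H i j) (HN i j Ni Nj).
have [l sl ul] : exists2 l, sq leb l & sip_cvg (dot leb) u l.
  by apply: sq_complete => //; apply: cau => i j; rewrite lerDl gdot_ge0.
have gle i v w : H1r v -> H1r w -> dot leb (gr i v - gr i w) (gr i v - gr i w) <=
    h1dot (v - w) (v - w).
  move=> Hv Hw; have s0 : sq leb 0 := ss0 LL.
  have := gr_dist i Hv Hw s0; rewrite !subr0 => <-.
  by rewrite /h1dot /gdot (bigD1 i)//= addrCA lerDl addr_ge0 ?dot_ge0// sumr_ge0// => j _; exact: dot_ge0.
have /choice[g Hg] i : exists g, sq leb g /\ sip_cvg (dot leb) (fun k => gr i (u k)) g.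
  have [||g sg gg] := @sq_complete _ _ R leb (fun k => gr i (u k)); last by exists g.
    by move=> k; exact: gr_sq.
  by apply: cau => j k; exact: gle.
have w i : wp i l (g i).
  move=> s ts; have t1 := test_sq (test_d i ts); have t2 := test_sq ts.
  have c1 := dot_lim su sl t1 ul.
  have c2 := dot_lim (fun k => gr_sq i (Hu k)) (Hg i).1 t2 (Hg i).2.
  have c3 : dot leb (u k) (fun x => 'D_('e_i) s x) @[k --> \oo] --> - dot leb (g i) s.
    rewrite (_ : (fun k => _) = (fun k => - dot leb (gr i (u k)) s)); first exact: cvgN.
    by apply/funext => k; exact: gr_wp.
  exact: cvg_unique c1 c3.
have Hl : H1r l by split=> // i; exists (g i); [exact: (Hg i).1|exact: w].
exists l => // e e0.
have [N HN] := ul (e / 2) (divr_gt0 e0 (ltr0n _ 2)).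
have e1 : 0 < e / 2 / n.+1%:R by rewrite !divr_gt0.
have /choice[M HM] i := (Hg i).2 _ e1.
exists (maxn N (\max_i M i)) => k; rewrite geq_max => /andP[/HN h1 h2].
rewrite /h1dot (_ : e = e / 2 + e / 2); last by field.
apply: ltr_leD => //.
have -> : e / 2 = n.+1%:R * (e / 2 / n.+1%:R) by rewrite [RHS]mulrC divfK// pnatr_eq0.
apply: (@le_trans _ _ (\sum_(i < n) e / 2 / n.+1%:R)).
  apply: ler_sum => i _; apply/ltW; have Mk : (M i <= k)%N.
    by apply: leq_trans h2; exact: leq_bigmax.
  have s0 : sq leb 0 := ss0 LL.
  have := gr_dist i (Hu k) Hl s0; rewrite !subr0 => ->.
  have sl' := gr_sq i Hl; have [sg _] := Hg i; have sk := gr_sq i (Hu k).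
  have nul : dot leb (gr i l - g i) (gr i l - g i) = 0.
    apply: test_orth => // s ts; apply: (gr_dot Hl sg (w i)); exact: test_sq.
  apply: le_lt_trans (HM i k Mk).
  have E h (sh : sq leb h) := dot_null sl' sg sh nul.
  rewrite (sipBl sL sk sl' (ssB LL sk sl')) (sipBl sL sk sg (ssB LL sk sg)).
  rewrite (sipBr sL sk sk sl') (sipBr sL sl' sk sl') (sipBr sL sk sk sg) (sipBr sL sg sk sg).
  by rewrite (dotC _ (gr i (u k)) (gr i l)) (E _ sk) (E _ sl') (dotC _ _ (gr i l)) (E _ sg) (dotC _ (g i) (gr i (u k))).
by rewrite sumr_const card_ord -[leLHS]mulr_natl; apply: ler_wpM2r; rewrite ?(ltW e1)// ler_nat.
Qed.

Lemma C1_H1r f : C1 f -> csupp f -> H1r f /\ forall i, wp i f (fun x => 'D_('e_i) f x).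
Proof.
move=> cf sf.
have w i : wp i f (fun x => 'D_('e_i) f x).
  by move=> s ts; rewrite /dot (rint_ibp i cf (test_C1 ts) (test_supp ts)).
split=> //; split=> [|i]; first by apply/bm_sq/bm_cont => //; exact: C1_cont.
by exists (fun x => 'D_('e_i) f x) => //; apply/bm_sq/bm_d.
Qed.

Lemma gr_C1 i f h : C1 f -> csupp f -> sq leb h ->
  dot leb (gr i f) h = dot leb (fun x => 'D_('e_i) f x) h.
Proof.
move=> cf sf sh; have [Hf w] := C1_H1r cf sf.
by apply: gr_dot => //; apply/bm_sq/bm_d.
Qed.

Lemma gdot_C1 f g : C1 f -> csupp f -> C1 g -> csupp g ->
  gdot f g = \sum_i dot leb (fun x => 'D_('e_i) f x) (fun x => 'D_('e_i) g x).
Proof.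
move=> cf sf cg sg; apply: eq_bigr => i _.
have [Hg _] := C1_H1r cg sg; rewrite gr_C1//; last exact: gr_sq.
by rewrite dotC gr_C1 1?dotC//; apply/bm_sq/bm_d.
Qed.

Lemma test_H1r s : test_function s -> H1r s.
Proof. by move=> ts; case: (C1_H1r (test_C1 ts) (test_supp ts)). Qed.

Lemma test_subspace : subspace (@test_function R n).
Proof. by split; [exact: test0|exact: testD|exact: testZ]. Qed.

(** Density without truncation and mollification: a vector orthogonal in H^1 to all test functions
    is a weak solution of [u = div grad u], hence null. *)
Lemma test_dense u : H1r u -> sip_closure H1r h1dot (@test_function R n) u.
Proof.
move=> Hu; apply: (sip_dense h1_sip h1_complete test_subspace test_H1r) => // {}u {}Hu H.
have su := H1r_sq Hu.
have : forall s, test_function s -> dot leb u s = 0.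
  apply: weak_helmholtz => // s ts; have := H s ts.
  rewrite /h1dot => /eqP; rewrite addr_eq0 => /eqP ->; rewrite -sumrN; apply: eq_bigr => i _.
  rewrite dotC gr_C1; [|exact: test_C1|exact: test_supp|exact: gr_sq].
  by rewrite dotC (gr_wp i Hu (test_d i ts)).
move=> H0; have u0 := du_bois_reymond su H0.
have z : H1r (0 : T -> R) := ss0 HS.
have [_ E] := gr_null Hu (ss0 LL) (etrans (congr2 _ (subr0 u) (subr0 u)) u0).
rewrite /h1dot u0 add0r /gdot big1// => i _.
rewrite (E i _ (gr_sq i Hu)) dotC (E i _ (gr_sq i z)).
have := @gr_dotZ i 0 0 (gr i 0) z (gr_sq i z); rewrite scale0r mul0r//.
Qed.

Lemma test_dense_sq u : sq leb u -> (forall v, H1r v -> dot leb u v = 0) -> dot leb u u = 0.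
Proof. by move=> su H; apply: du_bois_reymond => // s ts; exact: H (test_H1r ts). Qed.

End weak_derivatives.

(** * Equivalent norms and limits of bounded bilinear forms *)

Section equivalent_norms.
Context (R : realType) (X : lmodType R).
Implicit Types (D : X -> Prop) (B N : X -> X -> R) (u v : X).

Lemma equiv_complete D N B (C : R) : 0 < C -> subspace D -> sip_complete D N ->
  (forall u, D u -> N u u <= C * B u u) -> (forall u, D u -> B u u <= C * N u u) ->
  sip_complete D B.
Proof.
move=> C0 sD cN NB BN u Du cu; have [|l Dl ul] := cN u Du; last first.
  exists l => // e e0; have [N0 HN] := ul (e / C) (divr_gt0 e0 C0).
  exists N0 => k /HN; rewrite ltr_pdivlMr// mulrC; apply: le_lt_trans.
  by apply: BN; exact: (ssB sD).
move=> e e0; have [N0 HN] := cu (e / C) (divr_gt0 e0 C0).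
exists N0 => i j /HN/[apply]; rewrite ltr_pdivlMr// mulrC; apply: le_lt_trans.
by apply: NB; exact: (ssB sD).
Qed.

Lemma bil_cvg D N B (K : R) (s t : nat -> X) u v : sip D N -> 0 <= K ->
  (forall a b c, D a -> D b -> D c -> B (a - b) c = B a c - B b c) ->
  (forall a b c, D a -> D b -> D c -> B a (b - c) = B a b - B a c) ->
  (forall a b, D a -> D b -> (B a b) ^+ 2 <= K * (N a a * N b b)) ->
  (forall k, D (s k)) -> (forall k, D (t k)) -> D u -> D v ->
  sip_cvg N s u -> sip_cvg N t v -> B (s k) (t k) @[k --> \oo] --> B u v.
Proof.
move=> sN K0 Bl Br Bb Ds Dt Du Dv su tv; have sD := sip_ss sN.
have bnd a b (e M : R) : 0 < e -> D a -> D b -> N b b <= M -> 0 <= M ->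
    N a a < e / (K * M + 1) -> `|B a b| ^+ 2 < e /\ `|B b a| ^+ 2 < e.
  move=> e0 Da Db bM M0; rewrite ltr_pdivlMr ?ltr_wpDl ?mulr_ge0// => h.
  have a0 := sip_ge0 sN Da; have b0 := sip_ge0 sN Db.
  have h1 : K * (N a a * N b b) < e.
    apply: le_lt_trans h; have := ler_wpM2l (mulr_ge0 K0 a0) bM; lra.
  rewrite !real_normK ?num_real//; split; apply: le_lt_trans h1; first exact: Bb.
  by rewrite (mulrC (N a a)); exact: Bb.
have [N1 HN1] := tv 1 ltr01.
pose M := 2 * N v v + 2.
have M0 : 0 <= M by rewrite addr_ge0// mulr_ge0// (sip_ge0 sN).
have tM k : (N1 <= k)%N -> N (t k) (t k) <= M.
  move=> /HN1 h; rewrite -(subrK v (t k)).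
  apply: le_trans (sip_sqrD_le sN (ssB sD (Dt k) Dv) Dv) _; rewrite /M; lra.
apply/cvgrPdist_lt => e e0.
have e2 : 0 < (e / 2) ^+ 2 by rewrite exprn_gt0// divr_gt0.
have d0 (L : R) : 0 <= L -> 0 < (e / 2) ^+ 2 / (K * L + 1).
  by move=> L0; rewrite divr_gt0// ltr_wpDl ?mulr_ge0.
have [N2 HN2] := su _ (d0 M M0).
have [N3 HN3] := tv _ (d0 (N u u) (sip_ge0 sN Du)).
exists (maxn N1 (maxn N2 N3)) => // k /=; rewrite !geq_max => /and3P[k1 k2 k3].
have [p1 _] := bnd _ _ _ _ e2 (ssB sD (Ds k) Du) (Dt k) (tM k k1) M0 (HN2 k k2).
have [_ p2] := bnd _ _ _ _ e2 (ssB sD (Dt k) Dv) Du (lexx _) (sip_ge0 sN Du) (HN3 k k3).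
have E : B (s k) (t k) - B u v = B (s k - u) (t k) + B u (t k - v).
  by rewrite Bl// Br// addrA subrK.
have lt2 (x : R) : `|x| ^+ 2 < (e / 2) ^+ 2 -> `|x| < e / 2.
  by rewrite ltr_pXn2r ?nnegrE// divr_ge0// ltW.
rewrite distrC E; apply: le_lt_trans (ler_normD _ _) _.
by have := lt2 _ p1; have := lt2 _ p2; lra.
Qed.

End equivalent_norms.

(** * The gradient form with a bounded drift term *)

Section drift_form.
Context {R : realType} (n : nat) (i : 'I_n) (sg : 'rV[R]_n -> R) (beta : R).
Local Notation leb := (lebesgue_rV R n).
Local Notation T := ('rV[R]_n).
Hypothesis msg : measurable_fun setT sg.
Hypothesis sg1 : forall x, `|sg x| <= 1.
Implicit Types f g h u v : T -> R.

Let sL := @sq_sip _ _ R leb.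
Let LL := sip_ss sL.
Let HS := @H1r_subspace R n.

Definition smul f : T -> R := fun x => sg x * f x.

Lemma sqr_sg x : sg x ^+ 2 <= 1.
Proof. by rewrite -real_normK ?num_real// exprn_ile1. Qed.

Lemma smul_sq f : sq leb f -> sq leb (smul f) /\ dot leb (smul f) (smul f) <= dot leb f f.
Proof.
move=> sf; have mS : measurable_fun setT (smul f) := measurable_funM msg (sq_meas sf).
have le x : smul f x ^+ 2 <= f x ^+ 2 by rewrite exprMn ler_piMl ?sqr_ge0// sqr_sg.
have sS : sq leb (smul f).
  split=> //; apply: (intg_dom _ _ sf.2); first exact: measurable_funX.
  by move=> x; rewrite ger0_norm ?sqr_ge0.
split=> //; apply: rint_le; [exact: sq_mul|exact: sq_mul|].
by move=> x; rewrite -!expr2.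
Qed.

Lemma smulD f g : smul (f + g) = smul f + smul g.
Proof. by apply/funext => x; exact: mulrDr. Qed.

Lemma smulZ a f : smul (a *: f) = a *: smul f.
Proof. by apply/funext => x; exact: mulrCA. Qed.

Lemma dot_smul f g : dot leb (smul f) g = dot leb f (smul g).
Proof. by apply: rint_ext => x; rewrite /smul; ring. Qed.

Lemma dot_smul_le f g (e : R) : 0 < e -> sq leb f -> sq leb g ->
  `|2 * dot leb (smul f) g| <= e * dot leb f f + e^-1 * dot leb g g.
Proof.
move=> e0 sf sg'; have [sS Sle] := smul_sq sf.
have key (t : R) : (t = 1) \/ (t = -1) ->
    2 * t * dot leb (smul f) g <= e * dot leb f f + e^-1 * dot leb g g.
  move=> tt; have t2 : t ^+ 2 = 1 by case: tt => ->; rewrite ?sqrrN expr1n.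
  have := dot_ge0 leb (e *: smul f - t *: g).
  rewrite (sip_sqrB sL (ssZ LL e sS) (ssZ LL t sg')) !(sip_sqrZ sL)// t2.
  rewrite (sipZl sL e sS (ssZ LL t sg')) (sipZr sL t sS sg') => h.
  have := mulr_ge0 (ltW (_ : 0 < e^-1)) h; rewrite invr_gt0 => /(_ e0).
  rewrite (_ : e^-1 * (_ - _ + _) = e * dot leb (smul f) (smul f) -
    2 * t * dot leb (smul f) g + e^-1 * dot leb g g); last first.
    by move: (dot leb _ _) (dot leb _ _) (dot leb _ _) => x y z; field; rewrite gt_eqF.
  have := ler_wpM2l (ltW e0) Sle; lra.
by rewrite ler_norml; have := key 1 (or_introl erefl); have := key (-1) (or_intror erefl);
  move=> ? ?; apply/andP; split; lra.
Qed.

Definition dform u v : R := dot leb (smul (gr i u)) v + dot leb (smul u) (gr i v).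

Lemma dformC u v : dform u v = dform v u.
Proof. by rewrite /dform addrC !dot_smul (dotC _ u) (dotC _ (gr i u)) !dot_smul. Qed.

Lemma dformD u v w : H1r u -> H1r v -> H1r w -> dform (u + v) w = dform u w + dform v w.
Proof.
move=> Hu Hv Hw; have su := H1r_sq Hu; have sv := H1r_sq Hv; have sw := H1r_sq Hw.
rewrite /dform 3!(dot_smul (gr i _)) gr_dotD//; last by case: (smul_sq sw).
by rewrite smulD (sipDl sL (smul_sq su).1 (smul_sq sv).1 (gr_sq i Hw)); ring.
Qed.

Lemma dformZ a u v : H1r u -> H1r v -> dform (a *: u) v = a * dform u v.
Proof.
move=> Hu Hv; have su := H1r_sq Hu; have sv := H1r_sq Hv.
rewrite /dform 2!(dot_smul (gr i _)) gr_dotZ//; last by case: (smul_sq sv).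
by rewrite smulZ (sipZl sL a (smul_sq su).1 (gr_sq i Hv)); ring.
Qed.

Definition qform u v : R := gdot u v + beta * dform u v.

Lemma qformC u v : qform u v = qform v u.
Proof. by rewrite /qform gdotC dformC. Qed.

Lemma qformD u v w : H1r u -> H1r v -> H1r w -> qform (u + v) w = qform u w + qform v w.
Proof. by move=> Hu Hv Hw; rewrite /qform gdotD// dformD//; ring. Qed.

Lemma qformZ a u v : H1r u -> H1r v -> qform (a *: u) v = a * qform u v.
Proof. by move=> Hu Hv; rewrite /qform gdotZ// dformZ//; ring. Qed.

Lemma gr_gdot u : dot leb (gr i u) (gr i u) <= gdot u u.
Proof. by rewrite /gdot (bigD1 i)//= lerDl sumr_ge0// => j _; exact: dot_ge0. Qed.

(** Young's inequality with parameter [1 / (2 |beta|)]: the drift has relative bound 1/2, so the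
    form norm is equivalent to the norm of H^1, which makes the form closed. *)
Lemma dform_le u : H1r u ->
  `|beta * dform u u| <= 2^-1 * gdot u u + 2 * beta ^+ 2 * dot leb u u.
Proof.
move=> Hu; have su := H1r_sq Hu.
have -> : dform u u = 2 * dot leb (smul (gr i u)) u.
  by rewrite /dform dot_smul [X in _ + X]dotC; ring.
have [->|b0] := eqVneq beta 0.
  by rewrite mul0r normr0 expr0n /= mulr0 mul0r addr0 mulr_ge0 ?gdot_ge0// invr_ge0.
have bp : 0 < `|beta| by rewrite normr_gt0.
rewrite normrM.
have e0 : 0 < (2 * `|beta|)^-1 by rewrite invr_gt0 mulr_gt0.
have := ler_wpM2l (ltW bp) (dot_smul_le e0 (gr_sq i Hu) su).
move/le_trans; apply; rewrite mulrDr invrK; have := gr_gdot u.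
rewrite (_ : `|beta| * ((2 * `|beta|)^-1 * _) = 2^-1 * dot leb (gr i u) (gr i u)); last first.
  by field; rewrite gt_eqF.
rewrite -[beta ^+ 2]real_normK ?num_real//; lra.
Qed.

Let c : R := 2 * beta ^+ 2.

Let N := form_norm (dot leb) qform c.

Let c0 : 0 <= c. Proof. by rewrite mulr_ge0 ?sqr_ge0. Qed.

Lemma form_norm_ge u : H1r u -> h1dot u u <= 2 * N u u.
Proof.
move=> Hu; have := dform_le Hu; rewrite ler_norml => /andP[h _].
rewrite /N /form_norm /qform /h1dot -/c in h *.
by have := dot_ge0 leb u; move: c0 h => *; lra.
Qed.

Lemma form_norm_le u : H1r u -> N u u <= (2 * c + 2) * h1dot u u.
Proof.
move=> Hu; have := dform_le Hu; rewrite ler_norml => /andP[_ h].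
rewrite /N /form_norm /qform /h1dot -/c in h *.
have := dot_ge0 leb u; have := gdot_ge0 u; have := mulr_ge0 c0 (gdot_ge0 u).
by move: c0 h => *; lra.
Qed.

Lemma qform_closed : closed_form (sq leb) (dot leb) (@H1r R n) qform c.
Proof.
have C0 : 0 < 2 * c + 2 by have := c0; lra.
split.
- exact: sq_sip.
- exact: sq_complete.
- exact: H1r_subspace.
- exact: H1r_sq.
- exact: test_dense_sq.
- exact: qformD.
- exact: qformZ.
- by move=> *; exact: qformC.
- exact: c0.
- move=> u Hu; have := dform_le Hu; rewrite ler_norml -/c /qform => /andP[h _].
  have := gdot_ge0 u; lra.
- apply: (equiv_complete C0 HS (@h1_complete R n)) => u Hu; last exact: form_norm_le.
  have := form_norm_ge Hu; rewrite -/N; have := c0.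
  have : 0 <= N u u.
    have := form_norm_ge Hu; have := sip_ge0 (@h1_sip R n) Hu; lra.
  move=> h1 h2 h3; apply: (le_trans h3); rewrite ler_wpM2r//; lra.
- by move=> u v Hu sv uv; case: (gr_null Hu sv uv).
- move=> u Hu u0; have su := H1r_sq Hu.
  have [_ E] := gr_null Hu (ss0 LL) (etrans (congr2 _ (subr0 u) (subr0 u)) u0).
  have z : H1r (0 : T -> R) := ss0 HS.
  have g0 h : sq leb h -> dot leb (gr i u) h = 0 /\ forall j, dot leb (gr j u) h = 0.
    move=> sh; have E0 j : dot leb (gr j u) h = 0.
      by rewrite E//; have := gr_dotZ j 0 z sh; rewrite scale0r mul0r.
    by split.
  rewrite /qform /dform /gdot big1 => [|j _]; last exact: (g0 _ (gr_sq j Hu)).2.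
  have -> : dot leb (smul u) (gr i u) = 0.
    by rewrite dotC; exact: (g0 _ (smul_sq su).1).1.
  by rewrite dot_smul (g0 _ (smul_sq su).1).1; ring.
Qed.

Lemma form_norm_sip : sip (@H1r R n) N.
Proof.
split; first exact: HS.
- move=> u v w Hu Hv Hw; rewrite /N /form_norm qformD// (sipDl sL); try exact: H1r_sq.
  by ring.
- move=> a u v Hu Hv; rewrite /N /form_norm qformZ// (sipZl sL); try exact: H1r_sq.
  by ring.
- by move=> u v _ _; rewrite /N /form_norm qformC dotC.
- move=> u Hu; have := form_norm_ge Hu; have := sip_ge0 (@h1_sip R n) Hu; lra.
Qed.

Lemma test_dense_form u : H1r u -> exists s : nat -> T -> R,
  (forall k, test_function (s k)) /\ sip_cvg (@h1dot R n) s u.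
Proof.
move=> Hu; have [_ H] := test_dense Hu.
have /choice[s Hs] (k : nat) : exists s, test_function s /\
    h1dot (s - u) (s - u) < k.+1%:R^-1.
  have [|s ts h] := H k.+1%:R^-1; first by rewrite invr_gt0.
  exists s; split=> //; rewrite -opprB -scaleN1r.
  have Hd := ssB HS Hu (test_H1r ts).
  by rewrite (sip_sqrZ (@h1_sip R n) _ Hd) sqrrN expr1n mul1r.
exists s; split=> [k|e e0]; first by case: (Hs k).
have [M _ HM] := near_infty_natSinv_lt (PosNum e0).
by exists M => k Mk; apply: lt_trans (Hs k).2 _; exact: HM.
Qed.

(** Inequalities between functionals continuous in H^1 need only be proved on test functions. *)
Lemma test_extend (q1 q2 : (T -> R) -> R) :
  (forall u s, H1r u -> (forall k, H1r (s k)) -> sip_cvg (@h1dot R n) s u ->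
    q1 (s k) @[k --> \oo] --> q1 u /\ q2 (s k) @[k --> \oo] --> q2 u) ->
  (forall s, test_function s -> q1 s <= q2 s) -> forall u, H1r u -> q1 u <= q2 u.
Proof.
move=> H Ht u Hu; have [s [ts su]] := test_dense_form Hu.
have [c1 c2] := H u s Hu (fun k => test_H1r (ts k)) su.
by apply: (ler_cvg_to c1 c2); exists 0%N => // k _; exact: Ht.
Qed.

Lemma cvg_dotl f (s : nat -> T -> R) u : sq leb f -> H1r u -> (forall k, H1r (s k)) ->
  sip_cvg (@h1dot R n) s u -> dot leb f (s k) @[k --> \oo] --> dot leb f u.
Proof.
move=> sf Hu Hs su; under eq_fun do rewrite dotC; rewrite dotC.
apply: dot_lim => //; [by move=> k; exact: H1r_sq|exact: H1r_sq|].
move=> e /su[M HM]; exists M => k /HM; apply: le_lt_trans.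
by rewrite lerDl gdot_ge0.
Qed.

Lemma cvg_qform (s t : nat -> T -> R) u v : H1r u -> H1r v ->
  (forall k, H1r (s k)) -> (forall k, H1r (t k)) ->
  sip_cvg (@h1dot R n) s u -> sip_cvg (@h1dot R n) t v ->
  qform (s k) (t k) @[k --> \oo] --> qform u v /\
  dot leb (s k) (t k) @[k --> \oo] --> dot leb u v /\
  dform (s k) (t k) @[k --> \oo] --> dform u v.
Proof.
move=> Hu Hv Hs Ht su tv; have h1s := @h1_sip R n.
have cN : N (s k) (t k) @[k --> \oo] --> N u v.
  have sN := form_norm_sip.
  have NB : forall a, H1r a -> N a a <= (2 * c + 2) * h1dot a a by exact: form_norm_le.
  apply: (bil_cvg h1s (_ : 0 <= (2 * c + 2) ^+ 2)) => //; first exact: sqr_ge0.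
  - by move=> *; rewrite (sipBl sN).
  - by move=> *; rewrite (sipBr sN).
  - move=> a b Ha Hb; apply: le_trans (sip_CS sN Ha Hb) _.
    have := NB a Ha; have := NB b Hb; have := sip_ge0 sN Ha; have := sip_ge0 sN Hb.
    move=> b0 a0 h1 h2; apply: (le_trans (ler_pM a0 b0 h2 h1)).
    by rewrite le_eqVlt; apply/orP; left; apply/eqP; ring.
have cd : dot leb (s k) (t k) @[k --> \oo] --> dot leb u v.
  apply: (bil_cvg h1s ler01) => //.
  - by move=> a b d Ha Hb Hd; apply: (sipBl sL); exact: H1r_sq.
  - by move=> a b d Ha Hb Hd; apply: (sipBr sL); exact: H1r_sq.
  - move=> a b Ha Hb; rewrite mul1r.
    apply: le_trans (sip_CS sL (H1r_sq Ha) (H1r_sq Hb)) _.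
    by apply: ler_pM; rewrite ?dot_ge0// lerDl gdot_ge0.
have cq : qform (s k) (t k) @[k --> \oo] --> qform u v.
  rewrite (_ : qform u v = N u v - (c + 1) * dot leb u v); last first.
    by rewrite /N /form_norm; ring.
  rewrite (_ : (fun k => _) = fun k => N (s k) (t k) - (c + 1) * dot leb (s k) (t k)).
    by apply: cvgB => //; apply: cvgM => //; exact: cvg_cst.
  by apply/funext => k; rewrite /N /form_norm; ring.
split=> //; split=> //.
have db a b : H1r a -> H1r b -> (dform a b) ^+ 2 <= 4 * (h1dot a a * h1dot b b).
  move=> Ha Hb; have sa := H1r_sq Ha; have sb := H1r_sq Hb.
  apply: le_trans (sqrD_le2 _ _) _.
  have g1 w : dot leb (gr i w) (gr i w) <= h1dot w w.
    by rewrite (le_trans (gr_gdot w))// lerDr dot_ge0.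
  have g2 w : dot leb w w <= h1dot w w by rewrite lerDl gdot_ge0.
  have [sS1 Sle1] := smul_sq (gr_sq i Ha); have [sS2 Sle2] := smul_sq sa.
  have p1 := sip_CS sL sS1 sb; have p2 := sip_CS sL sS2 (gr_sq i Hb).
  have q1 : dot leb (smul (gr i a)) (smul (gr i a)) * dot leb b b <= h1dot a a * h1dot b b.
    by apply: ler_pM; rewrite ?dot_ge0// (le_trans Sle1).
  have q2 : dot leb (smul a) (smul a) * dot leb (gr i b) (gr i b) <= h1dot a a * h1dot b b.
    by apply: ler_pM; rewrite ?dot_ge0// (le_trans Sle2).
  lra.
have dB a b d : H1r a -> H1r b -> H1r d -> dform (a - b) d = dform a d - dform b d.
  move=> Ha Hb Hd; rewrite -(scaleN1r b) dformD ?dformZ ?mulN1r//.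
  exact: (ssZ HS).
apply: (bil_cvg h1s (ler0n _ 4)) => //.
by move=> a b d Ha Hb Hd; rewrite !(dformC a) dB.
Qed.

End drift_form.

(** * The trace on the cone *)

Section cone_integral.
Context {R : realType} (n : nat) (theta : R).
Hypothesis n0 : (0 < n)%N.
Hypothesis th : 0 < theta < pi / 2.
Local Notation lebn := (lebesgue_rV R n).
Local Notation leb := (lebesgue_rV R n.+1).
Local Notation leb1 := (@lebesgue_measure R).
Local Notation cm := (@cone_measure R n theta).
Local Notation h := (@cone_height R n theta).
Local Notation gam := (graph_map (@cone_height R n theta)).

Lemma sin_theta_gt0 : 0 < sin theta.
Proof.
by move: th => /andP[t0 t1]; apply: sin_gt0_pi; rewrite t0/=; have := pi_gt0 R; lra.
Qed.

Lemma cos_theta_gt0 : 0 < cos theta.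
Proof.
by move: th => /andP[t0 t1]; apply: cos_gt0_pihalf; apply/andP; split=> //; have := pi_gt0 R; lra.
Qed.

Let s0 := sin_theta_gt0.

Let mgam : measurable_fun setT gam.
Proof. by apply: measurable_graph_map; exact: measurable_cone_height. Qed.

Lemma leb_set1 (x : 'rV[R]_n) : lebn [set x] = 0%E.
Proof.
have -> : [set x] = cube x (0 : R).
  apply/seteqP; split=> y /=; first by move=> -> i; rewrite subrr normr0.
  by move=> H; apply/rowP => i; apply/eqP; rewrite -subr_eq0 -normr_le0; exact: H.
by rewrite leb_cube// mulr0 expr0n eqn0Ngt n0.
Qed.

Lemma area_cone (x : 'rV[R]_n) : x != 0 -> area_element h x = (sin theta)^-1.
Proof.
move=> x0; rewrite area_element_cone// /cot expr_div_n.
rewrite (_ : 1 + _ = (sin theta)^-1 ^+ 2); last first.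
  rewrite exprVn -[RHS]mul1r -{2}(cos2Dsin2 theta).
  by move: s0; move: (sin theta) (cos theta) => a b a0; field; rewrite gt_eqF.
by rewrite sqrtr_sqr ger0_norm// invr_ge0 ltW.
Qed.

(** The area element equals [1 / sin theta] off the apex, a null set since [n] is positive, so the
    surface measure is a multiple of an image of Lebesgue measure. *)
Lemma cone_measureE A : measurable A ->
  cm A = ((sin theta)^-1%:E * lebn (gam @^-1` A))%E.
Proof.
move=> mA; have mB : measurable (gam @^-1` A).
  by rewrite -[X in measurable X]setTI; exact: mgam.
rewrite /= /cone_measure /graph_measure.
rewrite (@ae_eq_integral _ _ _ lebn _ (cst (sin theta)^-1%:E)).
- by rewrite integral_cst.
- exact: mB.
- apply/measurable_EFinP; apply: measurable_funTS; exact: measurable_area_element_cone.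
- exact: measurable_cst.
exists [set 0]; split; [exact: measurable_rV_set1|exact: leb_set1|].
move=> x /= nx; apply: contrapT => /eqP x0; apply: nx => _.
by rewrite area_cone.
Qed.

Lemma ge0_integral_cone (f : 'rV[R]_n.+1 -> \bar R) : measurable_fun setT f ->
  (forall x, 0 <= f x)%E ->
  (\int[cm]_x f x = (sin theta)^-1%:E * \int[lebn]_x f (gam x))%E.
Proof.
move=> mf f0.
have si : 0 <= (sin theta)^-1 by rewrite invr_ge0 ltW.
have E := @ge0_integral_pushforward _ _ _ _ R gam mgam lebn setT f measurableT mf (fun x _ => f0 x).
rewrite preimage_setT in E; rewrite -[X in (_ * X)%E]E.
rewrite -(@ge0_integral_mscale _ _ R _ setT measurableT (NngNum si) f mf (fun x _ => f0 x)).
apply: eq_measure_integral => A mA _; exact: cone_measureE.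
Qed.

Lemma rint_cone (f : 'rV[R]_n.+1 -> R) : measurable_fun setT f ->
  intg lebn (fun x => f (gam x)) ->
  intg cm f /\ rint cm f = (sin theta)^-1 * rint lebn (fun x => f (gam x)).
Proof.
move=> mf If; have mE : measurable_fun setT (EFin \o f) by exact/measurable_EFinP.
pose fg (x : 'rV[R]_n) := f (gam x).
have Ip := integrable_funepos measurableT (If : lebn.-integrable setT (EFin \o fg)).
have In := integrable_funeneg measurableT (If : lebn.-integrable setT (EFin \o fg)).
have mp : measurable_fun setT ((EFin \o f)^\+)%E by exact: measurable_funepos.
have mn : measurable_fun setT ((EFin \o f)^\-)%E by exact: measurable_funeneg.
have Ep := ge0_integral_cone mp (fun x => funepos_ge0 _ x).
have En := ge0_integral_cone mn (fun x => funeneg_ge0 _ x).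
rewrite (_ : (fun x => _) = ((EFin \o fg)^\+)%E) in Ep; last first.
  by apply/funext => x; rewrite !funeposE.
rewrite (_ : (fun x => _) = ((EFin \o fg)^\-)%E) in En; last first.
  by apply/funext => x; rewrite !funenegE.
have Fp := integrable_fin_num measurableT Ip; have Fn := integrable_fin_num measurableT In.
split.
  apply/integrableP; split=> //.
  have mA : measurable_fun setT (fun x => `|(EFin \o f) x|%E) by exact: measurableT_comp.
  rewrite (ge0_integral_cone mA (fun x => abse_ge0 _)).
  rewrite lte_mul_pinfty ?lee_fin ?invr_ge0 ?(ltW s0)//.
  by have /integrableP[_] := If.
have E1 : (\int[cm]_x (f x)%:E = (sin theta)^-1%:E * \int[lebn]_x ((EFin \o fg)^\+)%E x -
    (sin theta)^-1%:E * \int[lebn]_x ((EFin \o fg)^\-)%E x)%E.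
  by rewrite -Ep -En; exact: integralE.
have E2 : (\int[lebn]_x (fg x)%:E = \int[lebn]_x ((EFin \o fg)^\+)%E x -
    \int[lebn]_x ((EFin \o fg)^\-)%E x)%E by exact: integralE.
rewrite rintE [X in _ * X]rintE /Rintegral E1 E2 -(fineK Fp) -(fineK Fn).
by rewrite -!EFinM -!EFinB /=; exact/esym/mulrBr.
Qed.

Definition sgc (x : 'rV[R]_n.+1) : R :=
  if h (rV_unrcons x).1 < x 0 ord_max then 1 else -1.

Lemma sgc_meas : measurable_fun setT sgc.
Proof.
apply: measurable_fun_if => //.
apply: measurable_fun_ltr; last exact: (measurable_rV_coord ord_max).
apply: (measurableT_comp (@measurable_cone_height R n theta)).
exact: (measurableT_comp measurable_fst (@measurable_rV_unrcons R n)).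
Qed.

Lemma sgc_norm x : `|sgc x| = 1.
Proof. by rewrite /sgc; case: ifP; rewrite ?normrN normr1. Qed.

Lemma sgc_le1 x : `|sgc x| <= 1. Proof. by rewrite sgc_norm. Qed.

Lemma half_line_FTC (g g' : R -> R) a : (forall t : R, is_derive t 1 g (g' t)) ->
  continuous g' -> (exists M : R, forall t, M < `|t| -> g t = 0 /\ g' t = 0) ->
  rint leb1 (fun t => (if a < t then 1 else -1) * g' t) = - (2 * g a).
Proof.
move=> dg cg [M0 gM0]; pose M := `|M0| + `|a| + 1.
have gM t : M <= `|t| -> g t = 0 /\ g' t = 0.
  move=> h1; apply: gM0; rewrite (lt_le_trans _ h1)// /M.
  have := ler_norm M0; have := normr_ge0 a; lra.
have aM : a < M by rewrite /M; have := ler_norm a; have := normr_ge0 M0; lra.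
have aM' : - M < a.
  by rewrite /M; have := ler_norm (- a); rewrite normrN; have := normr_ge0 M0; lra.
have M0' : 0 <= M by rewrite !addr_ge0.
have dR x : derivable g x 1 by exact: ex_derive.
have cvg_g : continuous g.
  by move=> x; apply: differentiable_continuous; exact/derivable1_diffP.
have FTC (b c : R) : b < c -> (\int[leb1]_(x in `[b, c]) (g' x)%:E = (g c)%:E - (g b)%:E)%E.
  move=> bc; apply: continuous_FTC2 => //.
  - by apply: continuous_subspaceT.
  - split=> [x _//||].
    + by apply: cvg_at_right_filter; exact: cvg_g.
    + by apply: cvg_at_left_filter; exact: cvg_g.
  - by move=> x _; rewrite derive1E (@derive_val _ _ _ _ _ _ _ (dg x)).
have mg : measurable_fun setT g' by exact: continuous_measurable_fun.
have [B gB] : exists B : R, forall t, `|g' t| <= B.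
  have cc : compact `[- M, M]%classic by exact: segment_compact.
  have /compact_bounded[B [_ HB]] : compact (g' @` `[- M, M]%classic).
    by apply: continuous_compact => //; apply: continuous_subspaceT.
  exists (Num.max (B + 1) 0) => t; have [tM|tM] := leP M `|t|.
    by rewrite (gM t tM).2 normr0 le_max lexx orbT.
  rewrite le_max HB ?ltrDl//=; exists t => //=.
  by move: tM; rewrite in_itv/= ltr_norml => /andP[/ltW -> /ltW ->].
have I b c : intg leb1 (fun t => \1_(`[b, c]%classic : set R) t * g' t).
  have I1 : intg leb1 (fun t => B * \1_(`[b, c]%classic : set R) t).
    apply: intgZ; apply/integrableP; split.
      by apply/measurable_EFinP/measurable_indic.
    under eq_integral do rewrite /= ger0_norm//.
    by rewrite integral_indic//= setIT lebesgue_measure_itv/=; case: ifP; rewrite ?ltry// -EFinB ltry.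
  apply: (intg_dom _ _ I1); first exact: measurable_funM.
  by move=> x; rewrite normrM mulrC ler_pM// ger0_norm.
have E b c : b < c -> rint leb1 (fun t => \1_(`[b, c]%classic : set R) t * g' t) = g c - g b.
  move=> bc; apply: EFin_inj; rewrite -EFin_rint// EFinB -FTC// [RHS]integral_mkcond.
  apply: eq_integral => x _; rewrite patchE indicE; case: ifPn => _; last by rewrite mul0r.
  by rewrite mul1r.
(* On [[- M, M]] the sign is almost everywhere twice the indicator of [[a, M]] minus 1, which
   reduces the integral to two uses of the fundamental theorem. *)
have -> : rint leb1 (fun t => (if a < t then 1 else -1) * g' t) =
    2 * rint leb1 (fun t => \1_(`[a, M]%classic : set R) t * g' t) -
    rint leb1 (fun t => \1_(`[- M, M]%classic : set R) t * g' t).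
  rewrite -rintZ// -rintB//; last exact: intgZ.
  have n1 : leb1 [set a] = 0%E by exact: lebesgue_measure_set1.
  apply: (rint_ae _ _ _).2.
  - by apply: intgB => //; exact: intgZ.
  - apply: measurable_funM => //; apply: measurable_fun_if => //.
    by apply: measurable_fun_ltr.
  exists [set a]; split=> //; move=> t /= nt; apply: contrapT => ta; apply: nt => _.
  rewrite !indicE !mem_setE !in_itv/=.
  have [tM|tM] := leP M `|t|; first by rewrite (gM t tM).2 !mulr0 subrr.
  move: (tM); rewrite ltr_norml => /andP[t1 t2]; rewrite (ltW t1) (ltW t2) !andbT.
  have [at_|ta'] := ltP a t; first by rewrite (ltW at_) /= mulr1n; ring.
  have tla : t < a by rewrite lt_neqAle ta' andbT; apply/eqP.
  by rewrite leNgt tla /= mulr1n mulr0n; ring.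
rewrite !E//; last by lra.
have [g1 _] : g M = 0 /\ g' M = 0 by apply: gM; rewrite ger0_norm.
have [g2 _] : g (- M) = 0 /\ g' (- M) = 0 by apply: gM; rewrite normrN ger0_norm.
by rewrite g1 g2; ring.
Qed.

(** On each vertical line the integral of [sgn * w'] is minus twice the value of [w] at the crossing
    point with the cone; the factor [sin theta] converts Lebesgue measure on the base into surface
    measure. *)
Lemma cone_trace (w : 'rV[R]_n.+1 -> R) : C1 w -> csupp w ->
  intg cm w /\
  rint leb (fun x => sgc x * 'D_('e_ord_max) w x) = - (2 * sin theta) * rint cm w.
Proof.
move=> cw sw; have bw := bm_cont (C1_cont cw) sw; have bd := bm_d ord_max cw sw.
have [mw [B wB] [M wM]] := bw.
have bg : bm (fun x => w (gam x)).
  split; first exact: measurableT_comp mw mgam.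
    by exists B.
  by exists M => x i hx; apply: (wM _ (lift ord_max i)); rewrite /graph_map rcons_lift.
have [I1 E1] := rint_cone mw (intg_bm bg); split=> //.
have bs : bm (fun x => sgc x * 'D_('e_ord_max) w x).
  by apply: bmMr => //; [exact: sgc_meas|exists 1; exact: sgc_le1].
rewrite (rint_rcons bs).2 E1 (_ : _ * (_ * _) = - 2 * rint lebn (fun x => w (gam x))); last first.
  by field; rewrite gt_eqF.
rewrite -rintZ; last exact: intg_bm.
apply: rint_ext => x.
have [N wN] := csupp_d ord_max sw.
have fin : exists M : R, forall t, M < `|t| ->
    w (rV_rcons (x, t)) = 0 /\ 'D_('e_ord_max) w (rV_rcons (x, t)) = 0.
  exists (Num.max M N) => t; rewrite gt_max => /andP[t1 t2].
  by split; [apply: (wM _ ord_max)|apply: (wN _ ord_max)]; rewrite rcons_max.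
rewrite mulNr; apply: etrans (half_line_FTC (h x) _ _ fin).
- by apply: rint_ext => t; rewrite /sgc rV_rconsK /= rcons_max.
- by move=> t; exact: C1_section1.
- apply: (@cont_compT R _ _ (fun y : 'rV[R]_n.+1 => 'D_('e_ord_max) w y)
    (fun t : R => rV_rcons (x, t))); first exact: rcons_contr.
  exact: C1_dcont.
Qed.

End cone_integral.

Section complex_parts.
Context d (T : measurableType d) (R : realType) (mu : {measure set T -> \bar R}).
Local Notation re f := (fun x => complex.Re (f x)).
Local Notation im f := (fun x => complex.Im (f x)).
Implicit Types f g : T -> R[i].

Lemma inner_dot f g : L2 mu f -> L2 mu g -> inner mu f g =
  (dot mu (re f) (re g) + dot mu (im f) (im g)) +i*
  (dot mu (im f) (re g) - dot mu (re f) (im g)).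
Proof.
move=> /L2P[f1 f2] /L2P[g1 g2]; rewrite /inner /cintegral -!rintE.
congr (_ +i* _); rewrite -?rintD -?rintB; try exact: sq_mul.
  by apply: rint_ext => x; case: (f x) => a b; case: (g x) => e h /=; ring.
by apply: rint_ext => x; case: (f x) => a b; case: (g x) => e h /=; ring.
Qed.

End complex_parts.

Lemma sip_cvg0 (R : realType) (X : lmodType R) (B : X -> X -> R) (s : nat -> X) u :
  (forall k, 0 <= B (s k - u) (s k - u)) ->
  sip_cvg B s u <-> (B (s k - u) (s k - u) @[k --> \oo] --> (0 : R)).
Proof.
move=> B0; split=> [H|/cvgrPdist_lt H e e0].
  apply/cvgrPdist_lt => e /H[N HN]; exists N => // k /= /HN.
  by rewrite sub0r normrN ger0_norm.
have [N _ HN] := H e e0; exists N => k /HN /=.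
by rewrite sub0r normrN ger0_norm.
Qed.

Lemma cvg0_le (R : realType) (a b : nat -> R) : (forall k, 0 <= a k <= b k) ->
  b k @[k --> \oo] --> (0 : R) -> a k @[k --> \oo] --> (0 : R).
Proof.
move=> ab b0; apply: (squeeze_cvgr _ (cvg_cst 0) b0).
by near=> k; exact: ab.
Unshelve. all: by end_near. Qed.

Lemma ReB (R : realType) (a b : R[i]) : complex.Re (a - b) = complex.Re a - complex.Re b.
Proof. by case: a b => ? ? []. Qed.

Lemma ImB (R : realType) (a b : R[i]) : complex.Im (a - b) = complex.Im a - complex.Im b.
Proof. by case: a b => ? ? []. Qed.

(** * Existence of traces and the delta form as a volume form *)

Section delta_interaction.
Context {R : realType} (n : nat) (theta alpha : R).
Hypothesis n0 : (0 < n)%N.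
Hypothesis th : 0 < theta < pi / 2.
Local Notation leb := (lebesgue_rV R n.+1).
Local Notation cm := (@cone_measure R n theta).
Local Notation T := ('rV[R]_n.+1).
Local Notation re f := (fun x => complex.Re (f x)).
Local Notation im f := (fun x => complex.Im (f x)).
Local Notation h1 := (@h1dot R n.+1).
Implicit Types u v g h : T -> R.

Let s0 : 0 < sin theta := sin_theta_gt0 th.
Let beta := alpha / (2 * sin theta).
Let sL := @sq_sip _ _ R leb.
Let sC := @sq_sip _ _ R cm.
Let HS := @H1r_subspace R n.+1.

Definition sgn_cone : T -> R := @sgc R n theta.

Lemma sgn_cone_meas : measurable_fun setT sgn_cone. Proof. exact: sgc_meas. Qed.

Lemma sgn_cone_le1 x : `|sgn_cone x| <= 1. Proof. exact: sgc_le1. Qed.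

Definition dfc u v := dform ord_max sgn_cone u v.

Definition qfc u v := qform ord_max sgn_cone beta u v.

Lemma qfc_closed : closed_form (sq leb) (dot leb) (@H1r R n.+1) qfc (2 * beta ^+ 2).
Proof. by apply: qform_closed; [exact: sgn_cone_meas|exact: sgn_cone_le1]. Qed.

Lemma test_sq_cone s : test_function s -> sq cm s.
Proof.
move=> ts; split; first exact: C1_meas (test_C1 ts).
have cs := test_C1 ts; have c2 := C1M cs cs.
by case: (cone_trace n0 th c2 (csuppM _ (test_supp ts))).
Qed.

Lemma C1_dform f g : C1 f -> csupp f -> C1 g -> csupp g ->
  dfc f g = rint leb (fun x => sgn_cone x *
    ('D_('e_ord_max) f x * g x + f x * 'D_('e_ord_max) g x)).
Proof.
move=> cf sf cg sg; have bf := bm_sq (bm_cont (C1_cont cf) sf).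
have bg := bm_sq (bm_cont (C1_cont cg) sg).
have df := bm_sq (bm_d ord_max cf sf); have dg := bm_sq (bm_d ord_max cg sg).
have S h (sh : sq leb h) := (smul_sq sgn_cone_meas sgn_cone_le1 sh).1.
rewrite /dfc /dform dot_smul (gr_C1 ord_max cf sf (S _ bg)) [X in _ + X]dotC.
rewrite (gr_C1 ord_max cg sg (S _ bf)) -rintD; [|exact: (sq_mul df (S _ bg))|exact: (sq_mul dg (S _ bf))].
by apply: rint_ext => x; rewrite /smul; ring.
Qed.

Lemma test_dform s t : test_function s -> test_function t ->
  dfc s t = - (2 * sin theta) * dot cm s t.
Proof.
move=> ts tt; have cs := test_C1 ts; have ct := test_C1 tt.
rewrite C1_dform//; try exact: test_supp.
have [_ <-] := cone_trace n0 th (C1M cs ct) (csuppM _ (test_supp ts)).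
by apply: rint_ext => x; rewrite dM.
Qed.

Lemma dform_h1 u : H1r u -> `|dfc u u| <= h1 u u.
Proof.
move=> Hu; have su := H1r_sq Hu.
have -> : dfc u u = 2 * dot leb (smul sgn_cone (gr ord_max u)) u.
  by rewrite /dfc /dform dot_smul [X in _ + X]dotC; ring.
have := dot_smul_le sgn_cone_meas sgn_cone_le1 ltr01 (gr_sq ord_max Hu) su.
rewrite invr1 !mul1r => /le_trans; apply; rewrite /h1dot addrC lerD2l.
exact: gr_gdot.
Qed.

Definition rtrace u g := sq cm g /\ exists s : nat -> T -> R,
  [/\ forall k, test_function (s k), sip_cvg h1 s u & sip_cvg (dot cm) s g].

(** For a test function, [2 sin theta] times the squared norm on the cone is the absolute value of
    the drift term, which is bounded by the squared norm of H^1. So restrictions of an H^1-Cauchy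
    sequence are Cauchy on the cone. *)
Lemma rtrace_exists u s : H1r u -> (forall k, test_function (s k)) -> sip_cvg h1 s u ->
  exists2 g, sq cm g & sip_cvg (dot cm) s g.
Proof.
move=> Hu ts su.
have Ht k := test_H1r (ts k).
have [||g sg gg] := @sq_complete _ _ R cm s; last by exists g.
  by move=> k; exact: test_sq_cone.
have ch : sip_cauchy h1 s by apply: (sip_cvg_cauchy (@h1_sip R n.+1)) Hu su.
move=> e e0; have e2 : 0 < e * (2 * sin theta) by rewrite !mulr_gt0.
have [N HN] := ch _ e2; exists N => i j Ni Nj.
have tij : test_function (s i - s j).
  by apply: (ssB (@test_subspace R n.+1)); exact: ts.
have := dform_h1 (test_H1r tij); rewrite (test_dform tij tij) mulNr normrN normrM.
rewrite ger0_norm ?mulr_ge0 ?(ltW s0)// ger0_norm ?dot_ge0// => h.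
rewrite -(@ltr_pM2l _ (2 * sin theta)) ?mulr_gt0//; apply: le_lt_trans h _.
by rewrite [X in _ < X]mulrC; exact: HN.
Qed.

Lemma rtrace_dform u v g h : H1r u -> H1r v -> rtrace u g -> rtrace v h ->
  dfc u v = - (2 * sin theta) * dot cm g h.
Proof.
move=> Hu Hv [sg [s [ts su gs]]] [sh [t [tt tv ht]]].
have [_ [_ c1]] := cvg_qform ord_max beta sgn_cone_meas sgn_cone_le1 Hu Hv
  (fun k => test_H1r (ts k)) (fun k => test_H1r (tt k)) su tv.
have c2 : dot cm (s k) (t k) @[k --> \oo] --> dot cm g h.
  apply: (bil_cvg sC ler01) => //.
  - by move=> a b c Ha Hb Hc; exact: (sipBl sC).
  - by move=> a b c Ha Hb Hc; exact: (sipBr sC).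
  - by move=> a b Ha Hb; rewrite mul1r; exact: (sip_CS sC).
  - by move=> k; exact: test_sq_cone.
  - by move=> k; exact: test_sq_cone.
have c3 : dform ord_max sgn_cone (s k) (t k) @[k --> \oo] --> - (2 * sin theta) * dot cm g h.
  rewrite (_ : (fun k => _) = fun k => - (2 * sin theta) * dot cm (s k) (t k)).
    by apply: cvgM => //; exact: cvg_cst.
  by apply/funext => k; exact: test_dform.
exact: cvg_unique c1 c3.
Qed.

Lemma weak_partialP i (U G : T -> R[i]) : L2 leb U -> L2 leb G ->
  weak_partial i U G <-> wp i (re U) (re G) /\ wp i (im U) (im G).
Proof.
move=> /L2P[u1 u2] /L2P[g1 g2].
have E (F : T -> R[i]) (p : T -> R) : cintegral leb (fun x => F x * (p x)%:C) =
    dot leb (re F) p +i* dot leb (im F) p.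
  rewrite /cintegral -!rintE; congr (_ +i* _); apply: rint_ext => x;
  by case: (F x) => a b /=; ring.
have EN (a b : R) : - (a +i* b) = (- a) +i* (- b) by [].
split=> [H|[H1 H2] s ts]; last by rewrite !E EN H1// H2.
by split=> s ts; have := H s ts; rewrite !E EN => -[].
Qed.

Lemma H1P (U : T -> R[i]) : H1 U <-> H1r (re U) /\ H1r (im U).
Proof.
split=> [[LU H]|[[s1 H1] [s2 H2]]].
  have [s1 s2] := (L2P leb U).1 LU.
  split; split=> // i; have [G LG /(weak_partialP i LU LG)[w1 w2]] := H i.
    by exists (re G) => //; case: ((L2P leb G).1 LG).
  by exists (im G) => //; case: ((L2P leb G).1 LG).
have LU : L2 leb U by exact/L2P.
split=> // i; have [g1 sg1 w1] := H1 i; have [g2 sg2 w2] := H2 i.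
have LG : L2 leb (fun x => g1 x +i* g2 x) by exact/L2P.
by exists (fun x => g1 x +i* g2 x) => //; apply/weak_partialP.
Qed.

Lemma wgradP i (U : T -> R[i]) : H1 U -> [/\ L2 leb (wgrad i U),
  forall h, sq leb h -> dot leb (re (wgrad i U)) h = dot leb (gr i (re U)) h &
  forall h, sq leb h -> dot leb (im (wgrad i U)) h = dot leb (gr i (im U)) h].
Proof.
move=> HU; have [LU /(_ i)[G LG wG]] := HU; have [h1 h2] := (H1P U).1 HU.
have [Lg wg] := @xgetPex _ (fun=> 0) [set g | L2 leb g /\ weak_partial i U g]
  (ex_intro _ G (conj LG wG)).
have [w1 w2] := (weak_partialP i LU Lg).1 wg; have [s1 s2] := (L2P leb _).1 Lg.
by split=> // h sh; apply/esym/gr_dot.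
Qed.

Lemma sum_complex (I : Type) (r : seq I) (a b : I -> R) :
  \sum_(i <- r) (a i +i* b i) = (\sum_(i <- r) a i) +i* (\sum_(i <- r) b i).
Proof.
by elim: r => [|i r IH]; rewrite ?big_nil ?big_cons// IH.
Qed.

Lemma inner_wgrad (U V : T -> R[i]) : H1 U -> H1 V ->
  \sum_i inner leb (wgrad i U) (wgrad i V) =
  (gdot (re U) (re V) + gdot (im U) (im V)) +i* (gdot (im U) (re V) - gdot (re U) (im V)).
Proof.
move=> HU HV; have [hu1 hu2] := (H1P U).1 HU; have [hv1 hv2] := (H1P V).1 HV.
rewrite /gdot -big_split -sumrB -sum_complex; apply: eq_bigr => i _.
have [LU U1 U2] := wgradP i HU; have [LV V1 V2] := wgradP i HV.
have [v1 v2] := (L2P leb _).1 LV.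
have A f a b : sq leb f -> (forall h, sq leb h -> dot leb a h = dot leb b h) ->
    dot leb f a = dot leb f b by move=> sf ab; rewrite dotC ab// dotC.
rewrite inner_dot// (U1 _ v1) (U2 _ v2) (U2 _ v1) (U1 _ v2).
by rewrite !(A _ _ _ (gr_sq i hu1) V1) !(A _ _ _ (gr_sq i hu1) V2)
  !(A _ _ _ (gr_sq i hu2) V1) !(A _ _ _ (gr_sq i hu2) V2).
Qed.

Lemma sqnormH1E (U : T -> R[i]) : H1 U ->
  sqnormH1 U = h1 (re U) (re U) + h1 (im U) (im U).
Proof.
move=> HU; have [LU _] := HU; rewrite /sqnormH1 sqnormE// /h1dot addrACA; congr (_ + _).
have /(congr1 (@complex.Re R)) E := inner_wgrad HU HU; apply: etrans E; apply: esym.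
by apply: (big_morph (@complex.Re R)) => // -[a b] [a' b'].
Qed.

Lemma trace_parts (U G : T -> R[i]) : H1 U -> is_trace cm U G ->
  rtrace (re U) (re G) /\ rtrace (im U) (im G).
Proof.
move=> HU [LG [phi [tphi cU cG]]].
have [hu1 hu2] := (H1P U).1 HU; have [g1 g2] := (L2P cm G).1 LG.
have t1 k := (tphi k).1; have t2 k := (tphi k).2.
have r1 k (V : T -> R[i]) : re (fun x => phi k x - V x) = re (phi k) - re V.
  by apply/funext => x; exact: ReB.
have i1 k (V : T -> R[i]) : im (fun x => phi k x - V x) = im (phi k) - im V.
  by apply/funext => x; exact: ImB.
have HD k : H1 (fun x => phi k x - U x).
  by apply/H1P; rewrite r1 i1; split; apply: (ssB HS) => //; exact: test_H1r.
have LD k : L2 cm (fun x => phi k x - G x).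
  by apply/L2P; rewrite r1 i1; split; apply: (ssB (sip_ss sC)) => //; exact: test_sq_cone.
have h1ge u : H1r u -> 0 <= h1 u u by exact: (sip_ge0 (@h1_sip R n.+1)).
have hk1 k := h1ge _ (ssB HS (test_H1r (t1 k)) hu1).
have hk2 k := h1ge _ (ssB HS (test_H1r (t2 k)) hu2).
have c1 k : sqnormH1 (fun x => phi k x - U x) = h1 (re (phi k) - re U) (re (phi k) - re U) +
    h1 (im (phi k) - im U) (im (phi k) - im U) by rewrite sqnormH1E// r1 i1.
have c2 k : sqnorm cm (fun x => phi k x - G x) =
    dot cm (re (phi k) - re G) (re (phi k) - re G) +
    dot cm (im (phi k) - im G) (im (phi k) - im G) by rewrite sqnormE// r1 i1.
split; split=> //.
- exists (fun k => re (phi k)); split=> //.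
    apply/sip_cvg0 => //; apply: (cvg0_le _ cU) => k; rewrite c1 hk1/= lerDl//.
  apply/sip_cvg0 => [k|]; first exact: dot_ge0.
  by apply: (cvg0_le _ cG) => k; rewrite c2 dot_ge0 lerDl dot_ge0.
- exists (fun k => im (phi k)); split=> //.
    apply/sip_cvg0 => //; apply: (cvg0_le _ cU) => k; rewrite c1 hk2/= lerDr//.
  apply/sip_cvg0 => [k|]; first exact: dot_ge0.
  by apply: (cvg0_le _ cG) => k; rewrite c2 dot_ge0 lerDr dot_ge0.
Qed.

Lemma trace_ex (U : T -> R[i]) : H1 U -> exists G, is_trace cm U G.
Proof.
move=> HU; have [hu1 hu2] := (H1P U).1 HU.
have [s1 [t1 c1]] := test_dense_form hu1; have [s2 [t2 c2]] := test_dense_form hu2.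
have [g1 sg1 e1] := rtrace_exists hu1 t1 c1; have [g2 sg2 e2] := rtrace_exists hu2 t2 c2.
pose G x := g1 x +i* g2 x; have LG : L2 cm G by exact/L2P.
exists G; split=> //; exists (fun k x => s1 k x +i* s2 k x).
have r1 k (V : T -> R[i]) : re (fun x => (s1 k x +i* s2 k x) - V x) = s1 k - re V.
  by apply/funext => x; exact: ReB.
have i1 k (V : T -> R[i]) : im (fun x => (s1 k x +i* s2 k x) - V x) = s2 k - im V.
  by apply/funext => x; exact: ImB.
have HD k : H1 (fun x => (s1 k x +i* s2 k x) - U x).
  by apply/H1P; rewrite r1 i1; split; apply: (ssB HS) => //; exact: test_H1r.
have LD k : L2 cm (fun x => (s1 k x +i* s2 k x) - G x).
  by apply/L2P; rewrite r1 i1; split; apply: (ssB (sip_ss sC)) => //; exact: test_sq_cone.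
have h1ge u : H1r u -> 0 <= h1 u u by exact: (sip_ge0 (@h1_sip R n.+1)).
split=> [k||]; first by split; [exact: t1|exact: t2].
- rewrite (_ : (fun k => _) = fun k => h1 (s1 k - re U) (s1 k - re U) +
      h1 (s2 k - im U) (s2 k - im U)); last by apply/funext => k; rewrite sqnormH1E// r1 i1.
  rewrite -(addr0 0); apply: cvgD; apply/sip_cvg0 => // k; apply: h1ge; apply: (ssB HS) => //;
  exact: test_H1r.
- rewrite (_ : (fun k => _) = fun k => dot cm (s1 k - g1) (s1 k - g1) +
      dot cm (s2 k - g2) (s2 k - g2)); last by apply/funext => k; rewrite sqnormE// r1 i1.
  by rewrite -(addr0 0); apply: cvgD; apply/sip_cvg0 => // k; exact: dot_ge0.
Qed.

Lemma traceP (U : T -> R[i]) : H1 U -> [/\ L2 cm (trace cm U),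
  rtrace (re U) (re (trace cm U)) & rtrace (im U) (im (trace cm U))].
Proof.
move=> HU; have [G tG] := trace_ex HU.
have h := @xgetPex _ (fun=> 0) (is_trace cm U) (ex_intro _ G tG).
by have [p1 p2] := trace_parts HU h; split=> //; case: h.
Qed.

Lemma delta_formE (U V : T -> R[i]) : H1 U -> H1 V -> delta_form alpha theta U V =
  (qfc (re U) (re V) + qfc (im U) (im V)) +i* (qfc (im U) (re V) - qfc (re U) (im V)).
Proof.
move=> HU HV; have [hu1 hu2] := (H1P U).1 HU; have [hv1 hv2] := (H1P V).1 HV.
have [LU U1 U2] := traceP HU; have [LV V1 V2] := traceP HV.
have E u v g h : H1r u -> H1r v -> rtrace u g -> rtrace v h ->
    qfc u v = gdot u v - alpha * dot cm g h.
  move=> Hu Hv ug vh; rewrite /qfc /qform -/(dfc u v) (rtrace_dform Hu Hv ug vh) /beta.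
  by field; rewrite gt_eqF.
have W := inner_wgrad HU HV; have I := inner_dot LU LV.
have E11 := E _ _ _ _ hu1 hv1 U1 V1; have E22 := E _ _ _ _ hu2 hv2 U2 V2.
have E21 := E _ _ _ _ hu2 hv1 U2 V1; have E12 := E _ _ _ _ hu1 hv2 U1 V2.
rewrite E11 E22 E21 E12 /delta_form W I.
by apply/eqP; rewrite eq_complex /=; apply/andP; split; apply/eqP; ring.
Qed.

(** The form has real coefficients, so testing the complex equation with real functions alone
    separates it into two real equations. *)
Lemma delta_operatorP (U F : T -> R[i]) : delta_operator R n alpha theta U F <->
  opr (sq leb) (dot leb) (@H1r R n.+1) qfc (re U) (re F) /\
  opr (sq leb) (dot leb) (@H1r R n.+1) qfc (im U) (im F).
Proof.
have cf := qfc_closed; have z : H1r (0 : T -> R) := ss0 HS.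
have q0 u : H1r u -> qfc u 0 = 0.
  by move=> Hu; have := cf_qZ cf 0 z Hu; rewrite scale0r mul0r (cf_qC cf Hu z).
split=> [[HU LF H]|[[hu1 f1 K1] [hu2 f2 K2]]].
  have [hu1 hu2] := (H1P U).1 HU; have [f1 f2] := (L2P leb F).1 LF.
  have K v : H1r v -> qfc (re U) v = dot leb (re F) v /\ qfc (im U) v = dot leb (im F) v.
    move=> Hv; pose V x := v x +i* (0 : R).
    have HV : H1 V by apply/H1P.
    have LV : L2 leb V by case: HV.
    have := H V HV; rewrite delta_formE// inner_dot// -[re V]/v -[im V]/(0 : T -> R).
    rewrite !q0// ![dot leb _ 0]dotC !(sip0l sL)// !addr0 !subr0 => -[-> ->]//.
  by split; split=> // v /K[].
have HU : H1 U by exact/H1P.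
have LF : L2 leb F by exact/L2P.
split=> // V HV; have [hv1 hv2] := (H1P V).1 HV; have [LV _] := HV.
by rewrite delta_formE// (inner_dot LF LV) (K1 _ hv1) (K1 _ hv2) (K2 _ hv1) (K2 _ hv2).
Qed.

End delta_interaction.

(** * Lower bounds *)

Section radial_calculus.
Context {R : realType} (n : nat).
Local Notation leb := (lebesgue_rV R n.+1).
Local Notation T := ('rV[R]_n.+1).
Implicit Types (f g : T -> R) (x : T).

Lemma sum_lift (V : nmodType) (F : 'I_n.+1 -> V) :
  \sum_i F i = F ord_max + \sum_(j < n) F (lift ord_max j).
Proof.
rewrite big_ord_recr/= addrC; congr (_ + _); apply: eq_bigr => j _; congr F.
by apply/esym/val_inj; exact: lift_max.
Qed.

Definition hx x (j : 'I_n) : R := x 0 (lift ord_max j).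

Definition rr x : R := \sum_j hx x j ^+ 2.

(* f depends on |x'| and z only; f1 and f2 are its derivatives with respect to
   |x'|^2 / 2 and z. *)
Definition hd f f1 f2 := C1 f /\ forall x,
  (forall j, 'D_('e_(lift ord_max j)) f x = hx x j * f1 x) /\ 'D_('e_ord_max) f x = f2 x.

Lemma hdE f f1 f2 g1 g2 : hd f f1 f2 -> f1 =1 g1 -> f2 =1 g2 -> hd f g1 g2.
Proof. by move=> h /funext <- /funext <-. Qed.

Lemma hd_C1 f f1 f2 : hd f f1 f2 -> C1 f. Proof. by case. Qed.

Lemma hd_cst (c : R) : hd (fun=> c) (fun=> 0) (fun=> 0).
Proof. by split=> [|x]; [exact: C1_cst|split=> [j|]; rewrite dcst ?mulr0]. Qed.

Lemma hd_z : hd (fun x => x 0 ord_max) (fun=> 0) (fun=> 1).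
Proof.
split=> [|x]; first exact: C1_coord.
by split=> [j|]; rewrite dcoord ?eqxx// eq_sym (negbTE (neq_lift _ _)) mulr0.
Qed.

Lemma hd_D f f1 f2 g g1 g2 : hd f f1 f2 -> hd g g1 g2 ->
  hd (fun x => f x + g x) (fun x => f1 x + g1 x) (fun x => f2 x + g2 x).
Proof.
move=> [cf df] [cg dg]; split=> [|x]; first exact: C1D.
have [df1 df2] := df x; have [dg1 dg2] := dg x.
by split=> [j|]; rewrite dD// ?df1 ?dg1 ?df2 ?dg2 ?mulrDr.
Qed.

Lemma hd_M f f1 f2 g g1 g2 : hd f f1 f2 -> hd g g1 g2 ->
  hd (fun x => f x * g x) (fun x => f1 x * g x + f x * g1 x)
    (fun x => f2 x * g x + f x * g2 x).
Proof.
move=> [cf df] [cg dg]; split=> [|x]; first exact: C1M.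
have [df1 df2] := df x; have [dg1 dg2] := dg x.
by split=> [j|]; rewrite dM// ?df1 ?dg1 ?df2 ?dg2//; ring.
Qed.

Lemma hd_Z (a : R) f f1 f2 : hd f f1 f2 ->
  hd (fun x => a * f x) (fun x => a * f1 x) (fun x => a * f2 x).
Proof.
by move=> hf; apply: (hdE (hd_M (hd_cst a) hf)) => x; rewrite mul0r add0r.
Qed.

Lemma hd_N f f1 f2 : hd f f1 f2 ->
  hd (fun x => - f x) (fun x => - f1 x) (fun x => - f2 x).
Proof.
move=> [cf df]; split=> [|x]; first exact: C1N.
have [df1 df2] := df x.
by split=> [j|]; rewrite dN// ?df1 ?df2 ?mulrN.
Qed.

Lemma hd_comp (p p' : R -> R) f f1 f2 : hd f f1 f2 ->
  (forall x, is_derive (f x) (1 : R) p (p' (f x))) ->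
  (forall x, {for f x, continuous p'}) ->
  hd (fun x => p (f x)) (fun x => p' (f x) * f1 x) (fun x => p' (f x) * f2 x).
Proof.
move=> [cf df] dp cp; have [cc dc] := C1_comp cf dp cp; split=> // x.
have [df1 df2] := df x.
by split=> [j|]; rewrite dc ?df1 ?df2//; ring.
Qed.

Lemma hd_rr : hd rr (fun=> 2) (fun=> 0).
Proof.
have c2 j : C1 (fun x => hx x j ^+ 2) by apply: C1M; exact: C1_coord.
have d2 i j x : 'D_('e_i) (fun y : T => hx y j ^+ 2) x =
    2 * ((i == lift ord_max j)%:R * hx x j).
  have -> : (fun y : T => hx y j ^+ 2) = fun y => hx y j * hx y j by [].
  rewrite (dM i x (C1_coord (lift ord_max j)) (C1_coord (lift ord_max j))).
  rewrite /hx !dcoord; ring.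
split=> [|x]; first exact: C1_sum.
split=> [j|]; rewrite dsum//.
  rewrite (bigD1 j)//= big1 => [|k kj]; rewrite d2 ?eqxx; first by rewrite addr0 mul1r mulrC.
  by rewrite (inj_eq lift_inj) eq_sym (negbTE kj) mul0r mulr0.
by rewrite big1// => j _; rewrite d2 (negbTE (neq_lift _ _)) mul0r mulr0.
Qed.

Lemma rr_ge0 x : 0 <= rr x.
Proof. by apply: sumr_ge0 => j _; exact: sqr_ge0. Qed.

Lemma hd_inv f f1 f2 : hd f f1 f2 -> (forall x, f x != 0) ->
  hd (fun x => (f x)^-1) (fun x => - (f x) ^- 2 * f1 x) (fun x => - (f x) ^- 2 * f2 x).
Proof.
move=> hf fn0; apply: (hd_comp (p := @GRing.inv R) (p' := fun y => - y ^- 2) hf) => x.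
  have := @is_deriveV _ (@id R) (f x) 1 1 (fn0 x) (is_derive_id (f x) 1).
  by rewrite /GRing.scale /= mulr1.
apply: cvgN; apply: cvgV; first by rewrite sqrf_eq0.
by apply: cvgM; exact: cvg_id.
Qed.

Lemma hd_sqrt f f1 f2 : hd f f1 f2 -> (forall x, 0 < f x) ->
  hd (fun x => Num.sqrt (f x)) (fun x => (2 * Num.sqrt (f x))^-1 * f1 x)
    (fun x => (2 * Num.sqrt (f x))^-1 * f2 x).
Proof.
move=> hf f0; apply: (hd_comp (p := Num.sqrt) (p' := fun y => (2 * Num.sqrt y)^-1) hf) => x.
  exact: is_derive1_sqrt.
apply: cvgV; first by rewrite mulf_neq0// gt_eqF// sqrtr_gt0.
by apply: cvgM; [exact: cvg_cst|exact: sqrt_continuous].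
Qed.

Definition rho (d : R) x : R := Num.sqrt (rr x + d ^+ 2).

Lemma rho_sqr d x : rho d x ^+ 2 = rr x + d ^+ 2.
Proof. by rewrite sqr_sqrtr// addr_ge0 ?sqr_ge0 ?rr_ge0. Qed.

Lemma rho_gt0 d x : 0 < d -> 0 < rho d x.
Proof. by move=> d0; rewrite sqrtr_gt0 ltr_wpDl ?rr_ge0// exprn_gt0. Qed.

Lemma rho_ge d x : 0 <= d -> d <= rho d x.
Proof.
by move=> d0; rewrite -{1}(ger0_norm d0) -sqrtr_sqr ler_sqrt ?ler_wpDl ?rr_ge0 ?addr_ge0 ?sqr_ge0 ?rr_ge0.
Qed.

Lemma hd_rho d : 0 < d -> hd (rho d) (fun x => (rho d x)^-1) (fun=> 0).
Proof.
move=> d0; have h := hd_D hd_rr (hd_cst (d ^+ 2)).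
apply: (hdE (hd_sqrt h _)) => x; last by rewrite addr0 mulr0.
  by rewrite ltr_wpDl ?rr_ge0// exprn_gt0.
by rewrite addr0 /rho invfM mulrAC mulVf ?mul1r.
Qed.

Lemma hd_rhoV d : 0 < d -> hd (fun x => (rho d x)^-1) (fun x => - (rho d x)^-1 ^+ 3) (fun=> 0).
Proof.
move=> d0; have rn x : rho d x != 0 by rewrite gt_eqF// rho_gt0.
apply: (hdE (hd_inv (hd_rho d0) rn)) => x; last by rewrite mulr0.
by rewrite -exprVn mulNr -exprSr.
Qed.

(** A smooth sign with algebraic rate; its primitive is the square root, which later smooths the
    absolute value. *)
Definition tauq (y : R) : R := y / Num.sqrt (1 + y ^+ 2).

Lemma tauq_pos (y : R) : 0 < 1 + y ^+ 2. Proof. by rewrite ltr_wpDr ?sqr_ge0. Qed.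

Lemma tauq_le1 y : `|tauq y| <= 1.
Proof.
have h : 0 < Num.sqrt (1 + y ^+ 2) by rewrite sqrtr_gt0 tauq_pos.
rewrite normrM normfV (ger0_norm (ltW h)) ler_pdivrMr// mul1r.
by rewrite -sqrtr_sqr ler_sqrt ?lerDr// addr_ge0 ?sqr_ge0.
Qed.

Lemma hd_tauq f f1 f2 : hd f f1 f2 -> hd (fun x => tauq (f x))
  (fun x => (Num.sqrt (1 + f x ^+ 2))^-1 ^+ 3 * f1 x)
  (fun x => (Num.sqrt (1 + f x ^+ 2))^-1 ^+ 3 * f2 x).
Proof.
move=> hf; have hs := hd_D (hd_cst 1) (hd_M hf hf).
have sp x : 0 < 1 + f x * f x by rewrite -expr2 tauq_pos.
have hq := hd_sqrt hs sp.
have qn x : Num.sqrt (1 + f x * f x) != 0 by rewrite gt_eqF// sqrtr_gt0.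
have e x : Num.sqrt (1 + f x * f x) ^+ 2 = 1 + f x * f x by rewrite sqr_sqrtr// ltW.
have key (q y a b : R) : q != 0 -> q ^+ 2 = 1 + y * y ->
    a * q^-1 + y * (- q ^- 2 * ((2 * q)^-1 * (0 + (a * y + y * a)))) = q^-1 ^+ 3 * a.
  move=> q0 qE; transitivity (q^-1 ^+ 3 * a * (q ^+ 2 - y * y)); first by field.
  by rewrite qE addrK mulr1.
apply: (hdE (hd_M hf (hd_inv hq qn))) => x /=; exact: (key _ _ _ 0 (qn x) (e x)).
Qed.

(** The structure [hd] does not include continuity of [f1]. The divergence involves [f1] only
    through this product, which is the sum of the [x_j D_j f]. *)
Lemma hd_cont1 f f1 f2 : hd f f1 f2 -> continuous (fun x => rr x * f1 x).
Proof.
move=> [cf df]; have -> : (fun x => rr x * f1 x) =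
    fun x => \sum_(j < n) hx x j * 'D_('e_(lift ord_max j)) f x.
  apply/funext => x; rewrite /rr mulr_suml; apply: eq_bigr => j _.
  by rewrite (df x).1; ring.
apply: cont_sum => j; apply: contM; first exact: cont_coord.
exact: C1_dcont.
Qed.

Variable beta : R.

(* 0 <= int |grad w + (K + beta S e_d) w|^2 with K = (x' P, Q). *)
Lemma radial_bound P p1 p2 Q q1 q2 (S w : T -> R) : hd P p1 p2 -> hd Q q1 q2 ->
  continuous S -> C1 w -> csupp w ->
  rint leb (fun x => (n%:R * P x + rr x * p1 x + q2 x - rr x * P x ^+ 2 -
     (Q x + beta * S x) ^+ 2) * w x ^+ 2) <=
  rint leb (fun x => \sum_i ('D_('e_i) w x) ^+ 2) +
  beta * rint leb (fun x => S x * (2 * w x * 'D_('e_ord_max) w x)).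
Proof.
move=> hP hQ cS cw sw.
have [cP dP] := hP; have [cQ dQ] := hQ.
have cPc := C1_cont cP; have cQc := C1_cont cQ; have cwc := C1_cont cw.
have crr := C1_cont (hd_C1 hd_rr).
have cdw i := C1_dcont (i := i) cw.
have sdw i : csupp (fun x => 'D_('e_i) w x) by exact: csupp_d.
pose K i x : R := if unlift ord_max i is Some j then hx x j * P x else Q x.
have Kl j x : K (lift ord_max j) x = hx x j * P x by rewrite /K liftK.
have Km x : K ord_max x = Q x by rewrite /K unlift_none.
have cK i : C1 (K i).
  case: (unliftP ord_max i) => [j|] ->.
    rewrite (_ : K _ = fun x => hx x j * P x); last by apply/funext => x; exact: Kl.
    exact: C1M (C1_coord (lift ord_max j)) cP.
  by rewrite (_ : K _ = Q)//; apply/funext => x; exact: Km.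
(* [beta S e_d] is kept out of [K] and never differentiated: its cross term in the square is exactly
   the drift term of the form, so continuity of [S] suffices. *)
pose F i x : R := K i x + (i == ord_max)%:R * beta * S x.
have cF i : continuous (F i).
  apply: contD; first exact: C1_cont.
  by apply: contM => //; exact: cont_cst.
have w2 : C1 (fun x => w x * w x) by exact: C1M.
have sw2 : csupp (fun x => w x * w x) by exact: csuppM.
have ibp i := rint_ibp i (cK i) w2 sw2.
have I1 i : intg leb (fun x => 'D_('e_i) (K i) x * (w x * w x)).
  apply/intg_bm/bm_cont; last exact: csuppMr.
  by apply: contM; [exact: (C1_dcont (cK i))|exact: C1_cont].
have I2 i : intg leb (fun x => K i x * (2 * w x * 'D_('e_i) w x)).
  apply/intg_bm/bm_cont; last by do 2 apply: csuppMr.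
  apply: contM; first exact: C1_cont (cK i).
  by apply: contM (cdw i); apply: contM => //; exact: cont_cst.
have ibp2 i : rint leb (fun x => K i x * (2 * w x * 'D_('e_i) w x)) =
    - rint leb (fun x => 'D_('e_i) (K i) x * (w x * w x)).
  by rewrite -ibp; apply: rint_ext => x; rewrite dM//; ring.
have I3 : intg leb (fun x => S x * (2 * w x * 'D_('e_ord_max) w x)).
  apply/intg_bm/bm_cont; last by do 2 apply: csuppMr.
  apply: contM => //; apply: contM (cdw ord_max); apply: contM => //; exact: cont_cst.
have I4 : intg leb (fun x => \sum_i ('D_('e_i) w x) ^+ 2).
  apply: intg_sum => i; apply/intg_bm/bm_cont; last exact: csuppX.
  by apply: contX; exact: cdw.
have I5 : intg leb (fun x => \sum_i (F i x * w x) ^+ 2).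
  apply: intg_sum => i; apply/intg_bm/bm_cont; last by apply: csuppX; exact: csuppMr.
  by apply: contX; apply: contM.
have I6 : intg leb (fun x => \sum_i K i x * (2 * w x * 'D_('e_i) w x)) by exact: intg_sum.
have I7 : intg leb (fun x => \sum_i 'D_('e_i) (K i) x * (w x * w x)) by exact: intg_sum.
have h0 : 0 <= rint leb (fun x => \sum_i ('D_('e_i) w x + F i x * w x) ^+ 2).
  by apply: rint_ge0 => x; apply: sumr_ge0 => i _; exact: sqr_ge0.
rewrite (_ : rint leb _ = rint leb (fun x => \sum_i ('D_('e_i) w x) ^+ 2) +
    (rint leb (fun x => \sum_i K i x * (2 * w x * 'D_('e_i) w x)) +
     beta * rint leb (fun x => S x * (2 * w x * 'D_('e_ord_max) w x)) +
     rint leb (fun x => \sum_i (F i x * w x) ^+ 2))) in h0; last first.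
  rewrite -rintZ// -!rintD//; try by [exact: intgZ|apply: intgD => //; exact: intgZ|
    apply: intgD => //; apply: intgD => //; exact: intgZ].
  apply: rint_ext => x.
  have -> : beta * (S x * (2 * w x * 'D_('e_ord_max) w x)) =
      \sum_i (i == ord_max)%:R * beta * S x * (2 * w x * 'D_('e_i) w x).
    rewrite (bigD1 ord_max)//= eqxx big1 => [|i /negbTE ->]; last by rewrite !mul0r.
    by rewrite addr0 mul1r mulrA.
  rewrite -!big_split/=; apply: eq_bigr => i _; rewrite /F; ring.
have e1 : rint leb (fun x => \sum_i K i x * (2 * w x * 'D_('e_i) w x)) =
    - rint leb (fun x => \sum_i 'D_('e_i) (K i) x * (w x * w x)).
  by rewrite !rint_sum// -sumrN; apply: eq_bigr => i _.
rewrite e1 in h0.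
have -> : rint leb (fun x => (n%:R * P x + rr x * p1 x + q2 x - rr x * P x ^+ 2 -
     (Q x + beta * S x) ^+ 2) * w x ^+ 2) =
    rint leb (fun x => \sum_i 'D_('e_i) (K i) x * (w x * w x)) -
    rint leb (fun x => \sum_i (F i x * w x) ^+ 2).
  rewrite -rintB//; apply: rint_ext => x; rewrite !sum_lift /F Km eqxx.
  have -> : 'D_('e_ord_max) (K ord_max) x = q2 x.
    by rewrite (_ : K _ = Q) ?(dQ x).2//; apply/funext => y; exact: Km.
  have -> : \sum_(j < n) 'D_('e_(lift ord_max j)) (K (lift ord_max j)) x * (w x * w x) =
      (n%:R * P x + rr x * p1 x) * (w x * w x).
    rewrite -mulr_suml; congr (_ * _).
    rewrite (eq_bigr (fun j => P x + hx x j ^+ 2 * p1 x)) => [|j _].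
      by rewrite big_split/= sumr_const card_ord -mulr_suml -[P x *+ n]mulr_natl.
    rewrite (_ : K _ = fun y => hx y j * P y); last by apply/funext => y; exact: Kl.
    rewrite (dM _ x (C1_coord (lift ord_max j)) cP) (dP x).1 dcoord eqxx mul1r.
    by rewrite mulrA expr2.
  have -> : \sum_(j < n) ((K (lift ord_max j) x + (lift ord_max j == ord_max)%:R * beta * S x) *
      w x) ^+ 2 = rr x * (P x ^+ 2 * w x ^+ 2).
    rewrite mulr_suml; apply: eq_bigr => j _.
    by rewrite Kl eq_sym (negbTE (neq_lift _ _)) !mul0r addr0; ring.
  by rewrite [true%:R]mulr1n mul1r; ring.
lra.
Qed.

End radial_calculus.

(** * Pointwise inequalities behind the lower bounds *)

Section pointwise_bounds.
Context {R : realType}.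
Variables (a co si : R).
Hypotheses (a0 : 0 < a) (co0 : 0 < co) (si0 : 0 < si) (cs1 : co ^+ 2 + si ^+ 2 = 1).

Let co1 : co <= 1.
Proof. by have := sqr_ge0 si; have := cs1; have := co0; nra. Qed.

(** The difference of the two sides is a sum of two squares divided by [2 A4]. The bound is uniform
    in [y], which stands for an inverse radius and is unbounded near the axis. *)
Lemma quartic_bound (A2 A3 A4 y : R) : 0 < A4 ->
  A2 * y ^+ 2 + A3 * y ^+ 3 - A4 * y ^+ 4 <= (A2 + A3 ^+ 2 / (2 * A4)) ^+ 2 / (2 * A4).
Proof.
move=> A0; set B := A2 + _; set C := (2 * A4)^-1.
have C0 : 0 < C by rewrite invr_gt0 mulr_gt0.
have CE : 2 * A4 * C = 1 by rewrite divff// gt_eqF// mulr_gt0.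
rewrite -subr_ge0 (_ : _ - _ = C * (B - A4 * y ^+ 2) ^+ 2 + C * y ^+ 2 * (A3 - A4 * y) ^+ 2).
  exact: (addr_ge0 (mulr_ge0 (ltW C0) (sqr_ge0 _)) (mulr_ge0 (mulr_ge0 (ltW C0) (sqr_ge0 _)) (sqr_ge0 _))).
rewrite /B /C; field; rewrite gt_eqF//.
Qed.

(** [y] stands for [1 / rho], [r2] for |x'|^2 and [s1] for the axial derivative of the smoothed sign
    [S]. The sign enters the axial component through [S * (r2 * y ^ 2)], so the two terms in [s1]
    cancel in the divergence; [s1] blows up as [S] sharpens and has no other control. All remaining
    errors carry [e = dl^2 y^2], and positive multiples of [e * y ^ 2] absorb them up to
    [O(dl^2)]. *)
Lemma hardy_pointwise (N c S y r2 s1 dl : R) : 3 <= N -> c = (N - 1) / 2 -> `|S| <= 1 ->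
  0 < y -> 0 <= r2 -> r2 * y ^+ 2 = 1 - dl ^+ 2 * y ^+ 2 ->
  - a ^+ 2 - dl ^+ 2 * (((a * co / si) ^+ 2 + (a * N) ^+ 2 / (2 * (2 * c + c ^+ 2))) ^+ 2 /
     (2 * (2 * c + c ^+ 2))) <=
  N * (- (a * co) * (S * y) + c * y ^+ 2) +
  r2 * (- (a * co) * (- (co / si * y * s1) * y + S * (- y ^+ 3)) + c * (- (2 * y ^+ 4))) +
  - (a * co * (co / si)) * (s1 * (r2 * y ^+ 2)) -
  r2 * (- (a * co) * (S * y) + c * y ^+ 2) ^+ 2 -
  (- (a * co * (co / si)) * (S * (r2 * y ^+ 2)) + a / si * S) ^+ 2.
Proof.
move=> N3 cE S1 y0 r20 rE.
set e := dl ^+ 2 * y ^+ 2 in rE.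
have e0 : 0 <= e by rewrite mulr_ge0 ?sqr_ge0.
have e1 : e <= 1.
  by have : 0 <= r2 * y ^+ 2 by [rewrite mulr_ge0 ?sqr_ge0]; rewrite rE; lra.
have si2 : si ^+ 2 = 1 - co ^+ 2 by rewrite -cs1; ring.
have S2 : S ^+ 2 <= 1 by rewrite -real_normK ?num_real// exprn_ile1.
have A4 : 0 < 2 * c + c ^+ 2 by rewrite cE; nra.
have Q := quartic_bound ((a * co / si) ^+ 2) (a * N) y A4.
set Z := _ ^+ 2 / (2 * _) in Q *.
have h1 : - (dl ^+ 2 * Z) <= - e * (a * co / si) ^+ 2 - a * N * e * y + (2 * c + c ^+ 2) * e * y ^+ 2.
  have := ler_wpM2l (sqr_ge0 dl) Q; rewrite /e; lra.
(* [a^2 S^2 W] is the squared length of the part of the field that carries the sign; [W] would be 1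
   without smoothing of the radius. *)
pose W := (1 - e) * co ^+ 2 + (1 - co ^+ 2 * (1 - e)) ^+ 2 / si ^+ 2.
have WE : W <= 1 + e * (co / si) ^+ 2.
  have -> : W = 1 + co ^+ 2 * e + (co ^+ 2 / si) ^+ 2 * e ^+ 2.
    rewrite /W (_ : 1 - co ^+ 2 * (1 - e) = si ^+ 2 + co ^+ 2 * e); last by rewrite si2; ring.
    rewrite (_ : 1 + _ = co ^+ 2 + si ^+ 2 + co ^+ 2 * e); last by rewrite cs1.
    by field; rewrite gt_eqF.
  have -> : (co / si) ^+ 2 = co ^+ 2 + (co ^+ 2 / si) ^+ 2.
    rewrite -[LHS]mul1r -cs1; field; rewrite gt_eqF//.
  have := mulr_ge0 (sqr_ge0 (co ^+ 2 / si)) (mulr_ge0 e0 (_ : 0 <= 1 - e)).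
  by rewrite subr_ge0 => /(_ e1); lra.
have W0 : 0 <= W.
  rewrite addr_ge0// ?divr_ge0 ?sqr_ge0// mulr_ge0 ?sqr_ge0// subr_ge0//.
have h2 : a ^+ 2 * S ^+ 2 * W <= a ^+ 2 * (1 + e * (co / si) ^+ 2).
  rewrite -mulrA ler_wpM2l ?sqr_ge0//; apply: le_trans WE.
  by rewrite ler_piMl.
have h3 : - (a * N * e * y) <= - (a * co * S * y * (N * e)).
  have : co * S <= 1.
    by have := ler_norm S; have := co0; have := co1; nra.
  have N0 : 0 <= N by lra.
  have p := mulr_ge0 (mulr_ge0 (mulr_ge0 (ltW a0) N0) e0) (ltW y0).
  by move=> h; have := ler_wpM2l p h; lra.
have h4 : 0 <= c * (N - 2 - c) * y ^+ 2.
  by rewrite mulr_ge0 ?sqr_ge0// mulr_ge0// cE; lra.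
(* The first term is the mean curvature. Since [1 + 2 c = N], its coefficient is only [N * e]. *)
rewrite [X in _ <= X](_ : _ = - (a * co * S * y * (N - (1 - e) * (1 + 2 * c))) +
    c * (N - 2 - c) * y ^+ 2 + (2 * c + c ^+ 2) * e * y ^+ 2 - a ^+ 2 * S ^+ 2 * W); last first.
  have -> : r2 * (- (a * co) * (- (co / si * y * s1) * y + S * (- y ^+ 3)) + c * (- (2 * y ^+ 4))) =
     (r2 * y ^+ 2) * (a * co * (co / si * s1 + S * y) - 2 * c * y ^+ 2) by ring.
  have -> : r2 * (- (a * co) * (S * y) + c * y ^+ 2) ^+ 2 =
     (r2 * y ^+ 2) * (- (a * co) * S + c * y) ^+ 2 by ring.
  by rewrite rE /W; field; rewrite gt_eqF.
have -> : N - (1 - e) * (1 + 2 * c) = N * e by rewrite cE; field.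
rewrite (_ : (a * co / si) ^+ 2 = a ^+ 2 * (co / si) ^+ 2) in h1; last by rewrite -exprMn mulrA.
lra.
Qed.

(** The case c = 0 with two radii: [y = 1 / rho_R] damps the radial component within distance about
    [Rr] of the axis, while [v = 1 / rho_dl] comes from differentiating [S]. The axial component is
    then completed with [s], a slowly varying sign of the axial coordinate, since [S] in that place
    would leave [s1] uncompensated. The price is [s'], which is small, and [|S - s|] weighted by
    [Rr^2 y^2]. *)
Lemma comp_pointwise (N S s s' y v r2 s1 Rr : R) : 1 <= N -> `|S| <= 1 -> `|s| <= 1 ->
  0 < Rr -> 0 < y -> y <= Rr^-1 -> y <= v -> 0 <= r2 -> r2 * y ^+ 2 = 1 - Rr ^+ 2 * y ^+ 2 ->
  r2 * v ^+ 2 <= 1 -> 0 <= s' ->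
  - (a ^+ 2 + a * N / Rr + co ^+ 2 / si * a * s' +
     a ^+ 2 * (2 + 2 * (co ^+ 2 / si) ^+ 2) * (Rr ^+ 2 * y ^+ 2 * `|S - s|)) <=
  N * (- (a * co) * (S * y)) +
  r2 * (- (a * co) * (- (co / si * v * s1) * y + S * (- y ^+ 3))) +
  (- (a * co * (co / si)) * (s1 * (r2 * (y * v))) + - (co ^+ 2 / si * a) * (s' * (1 - r2 * (y * v)))) -
  r2 * (- (a * co) * (S * y)) ^+ 2 -
  (- (a * co * (co / si)) * (S * (r2 * (y * v))) + - (co ^+ 2 / si * a) * (s * (1 - r2 * (y * v)))
    + a / si * S) ^+ 2.
Proof.
move=> N1 S1 s11 R0 y0 yR yv r20 rE rv s'0.
set k := co ^+ 2 / si; set q := r2 * (y * v); set t := Rr ^+ 2 * y ^+ 2 in rE *.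
have k0 : 0 <= k by rewrite divr_ge0 ?sqr_ge0// ltW.
have t0 : 0 <= t by rewrite mulr_ge0 ?sqr_ge0.
have t1 : t <= 1 by have : 0 <= r2 * y ^+ 2 by [rewrite mulr_ge0 ?sqr_ge0]; rewrite rE; lra.
have q0 : 0 <= q by rewrite !mulr_ge0// ltW// (lt_le_trans y0).
have qt : 1 - t <= q by rewrite -rE /q expr2 ler_wpM2l// ler_wpM2l// ltW.
have q1 : q <= 1.
  rewrite -(@ler_pXn2r _ 2)// ?nnegrE// expr1n.
  rewrite (_ : q ^+ 2 = (r2 * y ^+ 2) * (r2 * v ^+ 2)); last by rewrite /q; ring.
  have z1 : r2 * y ^+ 2 <= 1 by rewrite rE; lra.
  exact: (mulr_ile1 (mulr_ge0 r20 (sqr_ge0 y)) (mulr_ge0 r20 (sqr_ge0 v)) z1 rv).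
set e := 1 - q; have e0 : 0 <= e by rewrite subr_ge0.
have et : e <= t by rewrite /e; lra.
have si2 : si ^+ 2 = 1 - co ^+ 2 by rewrite -cs1; ring.
have S2 : S ^+ 2 <= 1 by rewrite -real_normK ?num_real// exprn_ile1.
(* Here [t] and [e] measure the loss from the two cutoff factors; if [s] were equal to [S], only
   curvature and [s'] would be left besides a term at least [- a^2]. *)
rewrite [X in _ <= X](_ : _ = - (a * co * S * y * (N - (1 - t))) - k * a * (s' * e) -
    a ^+ 2 * S ^+ 2 * (1 - co ^+ 2 * t) -
    a ^+ 2 * (2 * S * (S - s) * co ^+ 2 * e + (S - s) ^+ 2 * k ^+ 2 * e ^+ 2)); last first.
  have -> : r2 * (- (a * co) * (- (co / si * v * s1) * y + S * (- y ^+ 3))) =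
      a * co * (co / si) * s1 * q + a * co * S * y * (r2 * y ^+ 2) by rewrite /q; ring.
  have -> : r2 * (- (a * co) * (S * y)) ^+ 2 = (a * co * S) ^+ 2 * (r2 * y ^+ 2) by ring.
  have -> : - (a * co * (co / si)) * (S * q) + - (k * a) * (s * e) + a / si * S =
      a * (S * si + (S - s) * k * e).
    have -> : a / si * S = a * S * (co ^+ 2 + si ^+ 2) / si by rewrite cs1; ring.
    by rewrite /e /k; field; rewrite gt_eqF.
  rewrite rE; have -> : 1 - co ^+ 2 * t = co ^+ 2 * (1 - t) + si ^+ 2 by rewrite si2; ring.
  by rewrite /k; field; rewrite gt_eqF.
have h1 : a * co * S * y * (N - (1 - t)) <= a * N / Rr.
  have nt : 0 <= N - (1 - t) by lra.
  have u0 := mulr_ge0 (ltW y0) nt.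
  have u1 : y * (N - (1 - t)) <= Rr^-1 * N.
    by apply: ler_pM; [exact: ltW|exact: nt|exact: yR|lra].
  have cS : co * S <= 1 by have := ler_norm S; have := co0; have := co1; nra.
  have := ler_wpM2l (mulr_ge0 (ltW a0) u0) cS.
  have := ler_wpM2l (ltW a0) u1; lra.
have h2 : k * a * (s' * e) <= k * a * s'.
  apply: ler_wpM2l; first exact: (mulr_ge0 k0 (ltW a0)).
  by rewrite ler_piMr//; exact: le_trans et t1.
have c2 : co ^+ 2 <= 1 by have := sqr_ge0 si; lra.
have h3 : a ^+ 2 * S ^+ 2 * (1 - co ^+ 2 * t) <= a ^+ 2.
  rewrite -mulrA ler_piMr ?sqr_ge0//.
  have ct : 0 <= co ^+ 2 * t by rewrite mulr_ge0 ?sqr_ge0.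
  have ct1 : co ^+ 2 * t <= 1 by apply: mulr_ile1 => //; exact: sqr_ge0.
  by apply: mulr_ile1 => //; [exact: sqr_ge0|lra|lra].
set D := `|S - s|.
have D0 : 0 <= D by exact: normr_ge0.
have D2 : D <= 2.
  by rewrite (le_trans (ler_normB _ _))//; lra.
have h4 : 2 * S * (S - s) * co ^+ 2 * e <= 2 * (t * D).
  have p1 : S * (S - s) <= D.
    apply: le_trans (ler_norm _) _; rewrite normrM -/D ler_piMl//.
  have p2 : co ^+ 2 * e <= t by rewrite -[leRHS]mul1r ler_pM ?sqr_ge0.
  have p3 : 0 <= co ^+ 2 * e by rewrite mulr_ge0 ?sqr_ge0.
  have := ler_wpM2r p3 p1; have := ler_wpM2l D0 p2; lra.
have h5 : (S - s) ^+ 2 * k ^+ 2 * e ^+ 2 <= 2 * k ^+ 2 * (t * D).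
  have p1 : (S - s) ^+ 2 <= 2 * D.
    rewrite -real_normK ?num_real// -/D expr2 ler_wpM2r//.
  have p2 : e ^+ 2 <= t by rewrite expr2 -[leRHS]mulr1 ler_pM//; lra.
  have := ler_pM (sqr_ge0 _) (sqr_ge0 _) p1 p2 => p3.
  have := ler_wpM2l (sqr_ge0 k) p3; lra.
have h6 := ler_wpM2l (sqr_ge0 a) (lerD h4 h5).
move: h1 h2 h3 h6; move: (2 * S * _ * _ * _ + _) => X1.
set a2 := a ^+ 2; set P1 := a * co * S * y * _; set P2 := k * a * (s' * e).
set P3 := a2 * S ^+ 2 * _ => h1 h2 h3 h6.
have -> : a2 * (2 + 2 * k ^+ 2) * (t * D) = a2 * (2 * (t * D) + 2 * k ^+ 2 * (t * D)) by ring.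
lra.
Qed.

End pointwise_bounds.

Lemma hd_cont2 (R : realType) n (f f1 f2 : 'rV[R]_n.+1 -> R) : hd f f1 f2 -> continuous f2.
Proof.
move=> [cf df]; have -> : f2 = fun x => 'D_('e_ord_max) f x.
  by apply/funext => x; have [_ ->] := df x.
exact: C1_dcont.
Qed.

Lemma radial_lower (R : realType) n (beta : R) (P p1 p2 Q q1 q2 S w V : 'rV[R]_n.+1 -> R) :
  hd P p1 p2 -> hd Q q1 q2 -> continuous S -> C1 w -> csupp w ->
  intg (lebesgue_rV R n.+1) (fun x => V x * w x ^+ 2) ->
  (forall x, V x <= n%:R * P x + rr x * p1 x + q2 x - rr x * P x ^+ 2 - (Q x + beta * S x) ^+ 2) ->
  rint (lebesgue_rV R n.+1) (fun x => V x * w x ^+ 2) <=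
  rint (lebesgue_rV R n.+1) (fun x => \sum_i ('D_('e_i) w x) ^+ 2) +
  beta * rint (lebesgue_rV R n.+1) (fun x => S x * (2 * w x * 'D_('e_ord_max) w x)).
Proof.
move=> hP hQ cS cw sw IV HV.
apply: (le_trans _ (radial_bound beta hP hQ cS cw sw)).
apply: rint_le => // [|x]; last by rewrite ler_wpM2r ?sqr_ge0.
apply/intg_bm/bm_cont; last by apply: csuppMr; exact: csuppX.
have c1 := C1_cont cw; have cP := C1_cont (hd_C1 hP); have cQ := C1_cont (hd_C1 hQ).
have cr := C1_cont (hd_C1 (@hd_rr R n)); apply: contM; last exact: contX.
apply: contD; last first.
  apply/contN/contX; apply: contD => //; apply: contM => //; exact: cont_cst.
apply: contD; last exact: contN (contM cr (contX (k := 2) cP)).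
apply: contD; last exact: hd_cont2 hQ.
apply: contD; last exact: hd_cont1 hP.
by apply: contM => //; exact: cont_cst.
Qed.

(** * Lower bounds on C1 functions of compact support *)

Section lower_bounds.
Context {R : realType} (n : nat) (theta alpha : R).
Hypothesis n0 : (0 < n)%N.
Hypothesis th : 0 < theta < pi / 2.
Hypothesis alpha0 : 0 < alpha.
Local Notation leb := (lebesgue_rV R n.+1).
Local Notation T := ('rV[R]_n.+1).
Implicit Types (w : T -> R) (x : T) (k : nat).
Local Notation si := (sin theta).
Local Notation co := (cos theta).
Local Notation sgn := (@sgn_cone R n theta).

Let si0 : 0 < si := sin_theta_gt0 th.
Let co0 : 0 < co := cos_theta_gt0 th.
Let a := alpha / 2.
Let a0 : 0 < a. Proof. by rewrite divr_gt0. Qed.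
Let beta := alpha / (2 * si).

Let betaE : beta = a / si.
Proof. by rewrite /beta /a; field; rewrite gt_eqF. Qed.

Definition hgt x := cot theta * Num.sqrt (rr x).

Lemma cot_gt0 : 0 < cot theta. Proof. by rewrite divr_gt0. Qed.

Lemma sgn_coneE x : sgn x = if hgt x < x 0 ord_max then 1 else -1.
Proof.
rewrite /sgn_cone /sgc /hgt /cone_height /enorm; congr (if _ * Num.sqrt _ < _ then _ else _).
by apply: eq_bigr => j _; rewrite mxE.
Qed.

Definition dl k : R := k.+1%:R^-1.

Lemma dl_gt0 k : 0 < dl k. Proof. by rewrite invr_gt0. Qed.

Lemma dl_le1 k : dl k <= 1. Proof. by rewrite invf_le1// ler1n. Qed.

Lemma dl_cvg : dl k @[k --> \oo] --> (0 : R). Proof. exact: cvg_harmonic. Qed.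

(** The shift by [1 / dl] makes the smooth signs converge at every point, the cone included, where
    [sgn] is -1: on and below the cone the argument is at most [- 1 / dl], and strictly above it the
    factor [dl ^ - 2] eventually wins. *)
Definition argk k x : R := (dl k) ^- 2 * (x 0 ord_max - cot theta * rho (dl k) x) - (dl k)^-1.

Definition Sk k x : R := tauq (argk k x).

Definition sk1 k x : R := (Num.sqrt (1 + argk k x ^+ 2))^-1 ^+ 3 * (dl k) ^- 2.

Lemma hd_Sk k : hd (Sk k) (fun x => - (co / si * (rho (dl k) x)^-1 * sk1 k x)) (sk1 k).
Proof.
have h1 := hd_Z (- cot theta) (hd_rho n (dl_gt0 k)).
have h2 := hd_Z ((dl k) ^- 2) (hd_D (@hd_z R n) h1).
have h3 := hd_D h2 (hd_cst n (- (dl k)^-1)).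
have E : (fun x => (dl k) ^- 2 * (x 0 ord_max + - cot theta * rho (dl k) x) + - (dl k)^-1) = argk k.
  by apply/funext => x; rewrite /argk mulNr.
rewrite E in h3; apply: (hdE (hd_tauq h3)) => x; rewrite /sk1 /cot; ring.
Qed.

Lemma Sk_le1 k x : `|Sk k x| <= 1. Proof. exact: tauq_le1. Qed.

Lemma Sk_cont k : continuous (Sk k). Proof. exact: C1_cont (hd_C1 (hd_Sk k)). Qed.

Lemma tauq_near (y m : R) : 0 < m -> m <= y -> `|tauq y - 1| <= m^-1.
Proof.
move=> m0 my; have y0 := lt_le_trans m0 my.
have sq0 : 0 < Num.sqrt (1 + y ^+ 2) by rewrite sqrtr_gt0 tauq_pos.
have le1 : tauq y <= 1 by rewrite (le_trans (ler_norm _))// tauq_le1.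
rewrite distrC ger0_norm ?subr_ge0// lerBlDl -lerBlDr.
have h : Num.sqrt (1 + y ^+ 2) <= 1 + y.
  rewrite -[leRHS]ger0_norm ?addr_ge0 ?(ltW y0)// -sqrtr_sqr ler_sqrt ?sqr_ge0//; nra.
have h2 : y / (1 + y) <= tauq y.
  by rewrite ler_pM2l// lef_pV2// ?posrE ?addr_gt0.
apply: le_trans h2; have -> : y / (1 + y) = 1 - (1 + y)^-1.
  by field; rewrite gt_eqF// addr_gt0.
by rewrite lerB// lef_pV2 ?posrE ?addr_gt0//; lra.
Qed.

Lemma tauqN (y : R) : tauq (- y) = - tauq y.
Proof. by rewrite /tauq sqrrN mulNr. Qed.

Lemma rho_le d x : 0 <= d -> rho d x <= Num.sqrt (rr x) + d.
Proof.
move=> d0; have r0 := sqrtr_ge0 (rr x).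
rewrite -[leRHS]ger0_norm ?addr_ge0// -sqrtr_sqr ler_sqrt ?sqr_ge0//.
rewrite sqrrD sqr_sqrtr ?rr_ge0//.
have := mulr_ge0 r0 d0; lra.
Qed.

Lemma rho_ge_r d x : Num.sqrt (rr x) <= rho d x.
Proof. by rewrite ler_sqrt ?addr_ge0 ?sqr_ge0 ?rr_ge0// lerDl sqr_ge0. Qed.

Lemma Sk_cvg x : Sk k x @[k --> \oo] --> sgn x.
Proof.
have c0 := cot_gt0.
suff H : \forall k \near \oo, `|Sk k x - sgn x| <= dl k.
  apply/cvgrPdist_le => e e0; near=> k; rewrite distrC.
  apply: (@le_trans _ _ (dl k)); first by near: k.
  apply/ltW; near: k; have [M _ HM] := near_infty_natSinv_lt (PosNum e0).
  by exists M => // k Mk; exact: HM.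
rewrite sgn_coneE; have [hz|zh] := ltP (hgt x) (x 0 ord_max).
  set b := x 0 ord_max - hgt x; have b0 : 0 < b by rewrite subr_gt0.
  have e0 : 0 < b / (2 + cot theta) by rewrite divr_gt0// addr_gt0.
  have [M _ HM] := near_infty_natSinv_lt (PosNum e0).
  exists M => // k /= /HM /= hk.
  have d0 := dl_gt0 k; rewrite -[dl k in X in _ <= X]invrK; apply: tauq_near.
    by rewrite invr_gt0.
  have hd : dl k * (2 + cot theta) <= b by rewrite -ler_pdivlMr ?addr_gt0// ltW.
  rewrite /argk lerBrDr -mulr2n -[leLHS]mulr_natl -(@ler_pM2l _ (dl k ^+ 2)) ?exprn_gt0//.
  rewrite [leRHS]mulrA divff ?mul1r ?expf_neq0 ?gt_eqF//.
  have := ler_wpM2l (ltW c0) (rho_le x (ltW d0)).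
  rewrite (_ : _ * (2 / _) = 2 * dl k); last by field; rewrite gt_eqF.
  move: hd; rewrite /b /hgt; lra.
exists 0%N => // k _; have d0 := dl_gt0 k.
have -> : Sk k x - -1 = - (tauq (- argk k x) - 1) by rewrite /Sk tauqN; ring.
rewrite normrN -[dl k in X in _ <= X]invrK; apply: tauq_near; first by rewrite invr_gt0.
rewrite /argk opprB lerDl oppr_ge0 pmulr_rle0 ?invr_gt0 ?exprn_gt0// subr_le0.
by apply: le_trans zh _; rewrite ler_wpM2l ?rho_ge_r// ltW.
Unshelve. all: by end_near. Qed.

Local Notation q := (@qfc R n theta alpha).

Lemma C1_qform f g : C1 f -> csupp f -> C1 g -> csupp g ->
  q f g = rint leb (fun x => \sum_i 'D_('e_i) f x * 'D_('e_i) g x) +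
    beta * rint leb (fun x => sgn x *
      ('D_('e_ord_max) f x * g x + f x * 'D_('e_ord_max) g x)).
Proof.
move=> cf sf cg sg; rewrite /qfc /qform -/(dfc theta f g) C1_dform// gdot_C1//.
rewrite rint_sum// => i.
by apply: sq_mul; apply: bm_sq; exact: bm_d.
Qed.

(** [radial_bound] asks for a continuous sign, so it is applied to this smoothed form, which tends
    to the true one for fixed [w]. *)
Definition qk k w : R := rint leb (fun x => \sum_i ('D_('e_i) w x) ^+ 2) +
  beta * rint leb (fun x => Sk k x * (2 * w x * 'D_('e_ord_max) w x)).

Lemma rint_Sk_cvg (F : (T -> R) -> T -> R) (g : T -> R) (C : R) : intg leb g ->
  (forall k, measurable_fun setT (F (Sk k))) ->
  (forall k x, `|F (Sk k) x| <= C) ->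
  (forall x, F (Sk k) x @[k --> \oo] --> F sgn x) ->
  rint leb (fun x => F (Sk k) x * g x) @[k --> \oo] --> rint leb (fun x => F sgn x * g x).
Proof.
move=> Ig mF bF cF.
apply: (rint_dct (F := fun k x => F (Sk k) x * g x) (g := fun x => C * `|g x|) _ _ _ _).2.
- by move=> k; apply: measurable_funM => //; exact: intg_meas Ig.
- by move=> x; apply: cvgM; [exact: cF|exact: cvg_cst].
- by apply: intgZ; exact: intg_norm.
- by move=> k x; rewrite normrM ler_wpM2r.
Qed.

Lemma qk_cvg w : C1 w -> csupp w -> qk k w @[k --> \oo] --> q w w.
Proof.
move=> cw sw; rewrite C1_qform//.
rewrite (_ : rint leb (fun x => \sum_i 'D_('e_i) w x * 'D_('e_i) w x) =
  rint leb (fun x => \sum_i ('D_('e_i) w x) ^+ 2))//.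
apply: cvgD; first exact: cvg_cst.
apply: cvgM; first exact: cvg_cst.
rewrite (_ : rint leb (fun x => sgn x * _) =
    rint leb (fun x => sgn x * (2 * w x * 'D_('e_ord_max) w x))); last first.
  by apply: rint_ext => x; congr (_ * _); ring.
apply: (rint_Sk_cvg (F := id) (C := 1)) => [|k|k x|x].
- apply/intg_bm/bm_cont; last by apply: csuppMr; exact: csupp_d.
  by have := C1_cont cw; have := C1_dcont (i := ord_max) cw => c1 c2; ctac.
- exact: continuous_meas (@Sk_cont k).
- exact: Sk_le1.
- exact: Sk_cvg.
Qed.

Lemma rr_rhoV d x : 0 < d -> rr x * (rho d x)^-1 ^+ 2 = 1 - d ^+ 2 * (rho d x)^-1 ^+ 2.
Proof.
move=> d0; apply/eqP; rewrite eq_sym subr_eq eq_sym -mulrDl -rho_sqr -exprMn.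
by rewrite divff ?expr1n// gt_eqF// rho_gt0.
Qed.

Let cs1 : co ^+ 2 + si ^+ 2 = 1 := cos2Dsin2 theta.

Lemma hardy_lower w : (3 <= n)%N -> C1 w -> csupp w ->
  - (alpha ^+ 2 / 4) * dot leb w w <= q w w.
Proof.
move=> n3 cw sw.
set c := (n%:R - 1) / 2 : R.
set Z := ((a * co / si) ^+ 2 + (a * n%:R) ^+ 2 / (2 * (2 * c + c ^+ 2))) ^+ 2 /
     (2 * (2 * c + c ^+ 2)).
have Iw : intg leb (fun x => w x ^+ 2) := (bm_sq (bm_cont (C1_cont cw) sw)).2.
have key k : (- a ^+ 2 - (dl k) ^+ 2 * Z) * dot leb w w <= qk k w.
  have d0 := dl_gt0 k; have hV := hd_rhoV n d0.
  have hSV := hd_M (hd_Sk k) hV.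
  (* As [dl] tends to 0, [(x' P, Q + beta S)] tends to [c grad (ln r) + a sgn nu], where [nu] has
     radial component [- cos theta] and axial component [sin theta]. *)
  have hP := hd_D (hd_Z (- (a * co)) hSV) (hd_Z c (hd_M hV hV)).
  have hQ := hd_Z (- (a * co * (co / si))) (hd_M (hd_Sk k) (hd_M (@hd_rr R n) (hd_M hV hV))).
  have cS := @Sk_cont k; have cV := C1_cont (hd_C1 hV); have cr := C1_cont (hd_C1 (@hd_rr R n)).
  have cs := hd_cont2 (hd_Sk k).
  rewrite -rintZ// (_ : (fun x => _) = fun x => (- a ^+ 2 - dl k ^+ 2 * Z) * w x ^+ 2); last first.
    by apply/funext => x; rewrite expr2.
  apply: (radial_lower hP hQ cS cw sw) => [|x].
    exact: intgZ.
  have y0 : 0 < (rho (dl k) x)^-1 by rewrite invr_gt0 rho_gt0.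
  have N3 : 3 <= n%:R :> R by rewrite ler_nat.
  have := hardy_pointwise a0 co0 si0 cs1 (sk1 k x) N3 (erefl c) (Sk_le1 k x) y0 (rr_ge0 x)
    (rr_rhoV x d0).
  rewrite -/Z betaE => /le_trans; apply; rewrite le_eqVlt; apply/orP; left; apply/eqP.
  by move: (rho _ _)^-1 (Sk k x) (sk1 k x) (rr x) => y S s r; ring.
have cl : (- a ^+ 2 - (dl k) ^+ 2 * Z) * dot leb w w @[k --> \oo] -->
    (- a ^+ 2 - 0 ^+ 2 * Z) * dot leb w w.
  apply: cvgM; last exact: cvg_cst.
  apply: cvgB; first exact: cvg_cst.
  by apply: cvgM; [apply: cvgM; exact: dl_cvg|exact: cvg_cst].
apply: (le_trans _ (ler_cvg_to cl (qk_cvg cw sw) (nearW _ key))).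
by rewrite expr0n mul0r subr0 le_eqVlt; apply/orP; left; apply/eqP; rewrite /a; field.
Qed.

Definition sM (M : R) x : R := tauq (M^-1 * x 0 ord_max).

(** Only the sharpness of the sign is sent to its limit. [Rr] and [M] stay fixed, so the defect near
    the axis remains as an explicit bounded potential. *)
Lemma comp_lower (Rr M : R) w : 1 <= Rr -> 0 < M -> C1 w -> csupp w ->
  - rint leb (fun x => (a ^+ 2 + a * n%:R / Rr + co ^+ 2 / si * a / M +
    a ^+ 2 * (2 + 2 * (co ^+ 2 / si) ^+ 2) *
      (Rr ^+ 2 * (rho Rr x)^-1 ^+ 2 * `|sgn x - sM M x|)) * w x ^+ 2) <= q w w.
Proof.
move=> R1 M0 cw sw; have R0 : 0 < Rr by exact: lt_le_trans R1.
have Iw : intg leb (fun x => w x ^+ 2) := (bm_sq (bm_cont (C1_cont cw) sw)).2.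
have hs := hd_tauq (hd_Z M^-1 (@hd_z R n)).
have hR := hd_rhoV n R0.
have cRV := C1_cont (hd_C1 hR); have cr := C1_cont (hd_C1 (@hd_rr R n)).
have csM : continuous (sM M) := C1_cont (hd_C1 hs).
pose pen (S : T -> R) x : R := Rr ^+ 2 * (rho Rr x)^-1 ^+ 2 * `|S x - sM M x|.
pose C1' := a ^+ 2 * (2 + 2 * (co ^+ 2 / si) ^+ 2).
pose C0 := a ^+ 2 + a * n%:R / Rr + co ^+ 2 / si * a / M.
have pen0 S x : 0 <= pen S x := mulr_ge0 (mulr_ge0 (sqr_ge0 _) (sqr_ge0 _)) (normr_ge0 _).
have t1 x : Rr ^+ 2 * (rho Rr x)^-1 ^+ 2 <= 1.
  have := rr_rhoV x R0; have := mulr_ge0 (rr_ge0 x) (sqr_ge0 (rho Rr x)^-1); lra.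
have pen2 S x : `|S x| <= 1 -> `|pen S x| <= 2.
  move=> S1; rewrite ger0_norm// -[2]mul1r; apply: ler_pM => //.
    exact: (mulr_ge0 (sqr_ge0 _) (sqr_ge0 _)).
  rewrite (le_trans (ler_normB _ _))// (_ : 2 = 1 + 1 :> R)// lerD//; exact: tauq_le1.
have cpen k : continuous (pen (Sk k)).
  have cS := @Sk_cont k.
  have cn : continuous (fun x => `|Sk k x - sM M x|).
    by apply: (cont_comp (p := Num.norm)); [ctac|move=> y; exact: norm_continuous].
  by rewrite /pen; ctac.
have key k : - (C0 * rint leb (fun x => w x ^+ 2) + C1' * rint leb (fun x => pen (Sk k) x * w x ^+ 2)) <= qk k w.
  have d0 := dl_gt0 k; have hV := hd_rhoV n d0.
  have hP := hd_Z (- (a * co)) (hd_M (hd_Sk k) hR).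
  have hq := hd_M (@hd_rr R n) (hd_M hR hV).
  have hQ := hd_D (hd_Z (- (a * co * (co / si))) (hd_M (hd_Sk k) hq))
    (hd_Z (- (co ^+ 2 / si * a)) (hd_M hs (hd_D (hd_cst n 1) (hd_N hq)))).
  have cS := @Sk_cont k; have cV := C1_cont (hd_C1 hV).
  have cs := hd_cont2 (hd_Sk k); have cs' := hd_cont2 hs.
  have Ip : intg leb (fun x => pen (Sk k) x * w x ^+ 2).
    apply/intg_bm/bm_cont; last by apply: csuppMr; exact: csuppX.
    by have := C1_cont cw => c1; have := @cpen k => c2; ctac.
  rewrite -!rintZ// -rintD; [|exact: intgZ|exact: intgZ].
  rewrite -rintN; last by apply: intgD; exact: intgZ.
  rewrite (_ : (fun x => _) = fun x => - (C0 + C1' * pen (Sk k) x) * w x ^+ 2); last first.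
    by apply/funext => x; rewrite mulrA -mulrDl -mulNr.
  apply: (radial_lower hP hQ cS cw sw) => [|x].
    rewrite (_ : (fun x => _) = fun x => - (C0 * w x ^+ 2 + C1' * (pen (Sk k) x * w x ^+ 2))).
      by apply: intgN; apply: intgD; exact: intgZ.
    by apply/funext => x; ring.
  have y0 : 0 < (rho Rr x)^-1 by rewrite invr_gt0 rho_gt0.
  have v0 : 0 < (rho (dl k) x)^-1 by rewrite invr_gt0 rho_gt0.
  have N1 : 1 <= n%:R :> R by rewrite ler1n.
  have yR : (rho Rr x)^-1 <= Rr^-1 by rewrite lef_pV2 ?posrE ?rho_gt0// rho_ge// ltW.
  have dR : dl k <= Rr := le_trans (dl_le1 k) R1.
  have yv : (rho Rr x)^-1 <= (rho (dl k) x)^-1.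
    rewrite lef_pV2 ?posrE ?rho_gt0// ler_sqrt ?addr_ge0 ?rr_ge0 ?sqr_ge0//.
    by rewrite lerD2l lerXn2r ?nnegrE// ltW.
  have rv : rr x * (rho (dl k) x)^-1 ^+ 2 <= 1.
    by rewrite (rr_rhoV x d0) gerBl; exact: (mulr_ge0 (sqr_ge0 _) (sqr_ge0 _)).
  pose s' := (Num.sqrt (1 + (M^-1 * x 0 ord_max) ^+ 2))^-1 ^+ 3 * (M^-1 * 1).
  have z1 : (Num.sqrt (1 + (M^-1 * x 0 ord_max) ^+ 2))^-1 ^+ 3 <= 1.
    rewrite exprn_ile1 ?invr_ge0 ?sqrtr_ge0// invf_le1 ?sqrtr_gt0 ?tauq_pos//.
    by rewrite -{1}sqrtr1 ler_sqrt ?lerDl ?sqr_ge0// ltW// tauq_pos.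
  have s'0 : 0 <= s'.
    by rewrite mulr_ge0 ?exprn_ge0 ?invr_ge0 ?sqrtr_ge0// mulr1 invr_ge0 ltW.
  have s'1 : s' <= M^-1 by rewrite /s' mulr1 ler_piMl// invr_ge0 ltW.
  have := comp_pointwise a0 co0 si0 cs1 (sk1 k x) N1 (Sk_le1 k x) (tauq_le1 (M^-1 * x 0 ord_max))
    R0 y0 yR yv (rr_ge0 x) (rr_rhoV x R0) rv s'0.
  move=> hh; apply: le_trans (_ : _ <= - (a ^+ 2 + a * n%:R / Rr + co ^+ 2 / si * a * s' +
     a ^+ 2 * (2 + 2 * (co ^+ 2 / si) ^+ 2) *
     (Rr ^+ 2 * (rho Rr x)^-1 ^+ 2 * `|Sk k x - tauq (M^-1 * x 0 ord_max)|))) _.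
    rewrite lerN2 /C0 /C1' /pen /sM lerD2r lerD2l ler_wpM2l//.
    exact: (mulr_ge0 (divr_ge0 (sqr_ge0 _) (ltW si0)) (ltW a0)).
  apply: le_trans hh _; rewrite betaE /s' le_eqVlt; apply/orP; left; apply/eqP.
  move: (rho _ _)^-1 (rho _ _)^-1 (Sk k x) (sk1 k x) (rr x) => y v S s r.
  move: (tauq _) (_ ^-1 ^+ 3) (a / si) => tt ss as_; ring.
have cp : rint leb (fun x => pen (Sk k) x * w x ^+ 2) @[k --> \oo] -->
    rint leb (fun x => pen sgn x * w x ^+ 2).
  apply: (rint_Sk_cvg (F := pen) (C := 2)) => [//|k|k x|x].
  - exact: continuous_meas (@cpen k).
  - exact: pen2 (Sk_le1 k x).
  - apply: cvgM; first exact: cvg_cst.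
    by apply: cvg_norm; apply: cvgB; [exact: Sk_cvg|exact: cvg_cst].
have cl : - (C0 * rint leb (fun x => w x ^+ 2) + C1' * rint leb (fun x => pen (Sk k) x * w x ^+ 2))
    @[k --> \oo] -->
    - (C0 * rint leb (fun x => w x ^+ 2) + C1' * rint leb (fun x => pen sgn x * w x ^+ 2)).
  apply: cvgN; apply: cvgD; first exact: cvg_cst.
  by apply: cvgM => //; exact: cvg_cst.
have Is : intg leb (fun x => pen sgn x * w x ^+ 2).
  have mp : measurable_fun setT (pen sgn).
    have c1 : continuous (fun x => Rr ^+ 2 * (rho Rr x)^-1 ^+ 2) by ctac.
    apply: (measurable_funM (continuous_meas c1)).
    apply: measurableT_comp; first exact: normr_measurable.
    by apply: measurable_funB; [exact: sgn_cone_meas|exact: continuous_meas csM].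
  apply: (intg_dom _ _ (intgZ 2 Iw)); first by apply: measurable_funM => //; exact: intg_meas Iw.
  move=> x; rewrite normrM (ger0_norm (sqr_ge0 _)) ler_wpM2r ?sqr_ge0//.
  exact: pen2 (sgn_cone_le1 _ x).
apply: (le_trans _ (ler_cvg_to cl (qk_cvg cw sw) (nearW _ key))).
rewrite lerN2 -!rintZ// -rintD; [|exact: intgZ|exact: intgZ].
rewrite le_eqVlt; apply/orP; left; apply/eqP; apply: rint_ext => x.
by rewrite /C0 /C1' /pen; ring.
Qed.

End lower_bounds.

(** * Local compactness *)

Lemma bm_bound (R : realType) n (f : 'rV[R]_n -> R) : bm f -> exists B : R, forall x, `|f x| <= B.
Proof. by case. Qed.

Lemma bm_norm (R : realType) n (f : 'rV[R]_n -> R) : bm f -> bm (fun x => `|f x|).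
Proof.
move=> [mf [B fB] [M fM]]; split; first exact: measurableT_comp.
  by exists B => x; rewrite normr_id.
by exists M => x i /fM ->; rewrite normr0.
Qed.

Section local_compactness.
Context {R : realType}.
Local Notation leb1 := (@lebesgue_measure R).

Definition istep (a b : R) (t : R) : R := (a < t <= b)%R%:R.

Lemma step01 a b t : istep a b t = 0 \/ istep a b t = 1.
Proof. by rewrite /istep; case: (_ && _); [right|left]. Qed.

Lemma istep_ge0 a b t : 0 <= istep a b t. Proof. exact: ler0n. Qed.

Lemma istep_le1 a b t : istep a b t <= 1. Proof. by case: (step01 a b t) => ->. Qed.

Lemma step_meas a b : measurable_fun setT (istep a b).
Proof.
rewrite (_ : istep a b = \1_(`]a, b]%classic : set R)); first exact: measurable_indic.
by apply/funext => t; rewrite indicE mem_setE in_itv.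
Qed.

Lemma step_bm1 a b : bm1 (istep a b).
Proof.
split; first exact: step_meas.
  by exists 1 => t; rewrite ger0_norm ?istep_ge0 ?istep_le1.
exists (`|a| + `|b|) => t h; rewrite /istep; case: andP => // -[at_ tb].
by move: h; rewrite ltNge; case: ler0P at_ tb => *; have := ler_norm b; have := ler_norm (- a);
  rewrite ?normrN; have := normr_ge0 a; have := normr_ge0 b; lra.
Qed.

Lemma rint_step a b : a <= b -> rint leb1 (istep a b) = b - a.
Proof.
move=> ab; rewrite (_ : istep a b = \1_(`]a, b]%classic : set R)); last first.
  by apply/funext => t; rewrite indicE mem_setE in_itv.
rewrite rintE /Rintegral integral_indic//= setIT lebesgue_measure_itv/=.
by case: ltP => [//|ba]; rewrite (le_anti (_ : a <= b <= a)) ?subrr// ab -lee_fin.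
Qed.

Lemma step_split (a h : R) (M : nat) t : 0 <= h ->
  istep a (a + M%:R * h) t = \sum_(j < M) istep (a + j%:R * h) (a + j.+1%:R * h) t.
Proof.
move=> h0; elim: M => [|M IH].
  by rewrite big_ord0 mul0r addr0 /istep; case: ltP => //= at_; rewrite leNgt at_.
rewrite big_ord_recr/= -IH /istep.
have l1 : a <= a + M%:R * h by rewrite lerDl mulr_ge0.
have l2 : a + M%:R * h <= a + M.+1%:R * h by rewrite lerD2l ler_wpM2r// ler_nat.
have [at_|ta] := ltP a t; last first.
  by rewrite [a + _ < t]ltNge (le_trans ta l1)/= addr0.
have [tM|Mt] := leP t (a + M%:R * h); first by rewrite (le_trans tM l2)/= addr0.
by rewrite add0r.
Qed.

Lemma FTC_step (g g' : R -> R) (a b s t : R) : (forall x : R, is_derive x (1 : R) g (g' x)) ->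
  continuous g' -> bm1 g' -> istep a b s = 1 -> istep a b t = 1 ->
  `|g t - g s| <= rint leb1 (fun x => istep a b x * `|g' x|).
Proof.
move=> dg cg bg; have [mg' [B gB] _] := bg.
have mN : measurable_fun setT (fun x => `|g' x|) by exact: measurableT_comp.
have I : intg leb1 (fun x => istep a b x * `|g' x|).
  apply: (intg_dom _ _ (intg_norm (intg_bm1 bg))).
    by apply: measurable_funM => //; exact: step_meas.
  by move=> x; rewrite normrM normr_id ger0_norm ?istep_ge0// ler_piMl// istep_le1.
wlog st : s t / s <= t => [H hs ht|].
  by have [st|/ltW ts] := leP s t; [exact: H|rewrite distrC; exact: H].
have [->|sn] := eqVneq s t.
  by rewrite subrr normr0 => _ _; apply: rint_ge0 => x; rewrite mulr_ge0 ?istep_ge0.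
have stl : s < t by rewrite lt_neqAle sn.
rewrite /istep; case: andP => [[as_ sb] _|_ /eqP]; last by rewrite eq_sym oner_eq0.
case: andP => [[at_ tb] _|_ /eqP]; last by rewrite eq_sym oner_eq0.
have cvg_g : continuous g.
  by move=> x; apply: differentiable_continuous; apply/derivable1_diffP; exact: ex_derive.
have FTC : (\int[leb1]_(x in `[s, t]) (g' x)%:E = (g t)%:E - (g s)%:E)%E.
  apply: continuous_FTC2 => //.
  - by apply: continuous_subspaceT.
  - split=> [x _|| ]; first exact: ex_derive.
    + by apply: cvg_at_right_filter; exact: cvg_g.
    + by apply: cvg_at_left_filter; exact: cvg_g.
  - by move=> x _; rewrite derive1E (@derive_val _ _ _ _ _ _ _ (dg x)).
pose J := \1_(`[s, t]%classic : set R) : R -> R.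
have IJ : intg leb1 (fun x => J x * g' x).
  apply: (intg_dom _ _ (intg_norm (intg_bm1 bg))).
    by apply: measurable_funM => //; exact: measurable_indic.
  move=> x; rewrite normrM ler_piMl// /J indicE.
  by case: (x \in _); rewrite ?normr1 ?normr0.
have -> : g t - g s = rint leb1 (fun x => J x * g' x).
  apply: EFin_inj; rewrite EFinB -FTC -EFin_rint// [LHS]integral_mkcond.
  apply: eq_integral => x _; rewrite patchE /J indicE; case: ifPn => _; last by rewrite mul0r.
  by rewrite mul1r.
apply: le_trans (rint_abs IJ) _; apply: rint_le => //; first exact: intg_norm.
move=> x; rewrite normrM /J indicE mem_setE in_itv/=.
have [/andP[sx xt]|_] := boolP (s <= x <= t); last by rewrite normr0 mul0r mulr_ge0 ?istep_ge0.
by rewrite normr1 /istep (lt_le_trans as_ sx) (le_trans xt tb).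
Qed.

(** On the interval, [g] differs from its mean by at most the oscillation [A]. *)
Lemma step_poincare (g : R -> R) (a b A : R) : a < b -> intg leb1 g ->
  (forall s t, istep a b s = 1 -> istep a b t = 1 -> `|g t - g s| <= A) ->
  intg leb1 (fun t => istep a b t * g t ^+ 2) /\
  rint leb1 (fun t => istep a b t * g t ^+ 2) <=
    2 / (b - a) * (rint leb1 (fun t => istep a b t * g t)) ^+ 2 + 2 * (b - a) * A ^+ 2.
Proof.
move=> ab Ig HA; set h := b - a; have h0 : 0 < h by rewrite subr_gt0.
set m := rint leb1 (fun t => istep a b t * g t); have mg := intg_meas Ig.
have Is := intg_bm1 (step_bm1 a b).
have Isg : intg leb1 (fun t => istep a b t * g t).
  apply: (intg_dom _ _ (intg_norm Ig)); first by apply: measurable_funM => //; exact: step_meas.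
  by move=> x; rewrite normrM ger0_norm ?istep_ge0// ler_piMl// istep_le1.
have key t : istep a b t * g t ^+ 2 <= (2 / h ^+ 2 * m ^+ 2 + 2 * A ^+ 2) * istep a b t.
  have [->|st] := step01 a b t; first by rewrite mul0r mulr0.
  rewrite st mul1r mulr1.
  have d : `|h * g t - m| <= h * A.
    have Ic : intg leb1 (fun s => istep a b s * (g t - g s)).
      rewrite (_ : (fun s => _) = fun s => g t * istep a b s - istep a b s * g s).
        by apply: intgB => //; exact: intgZ.
      by apply/funext => s; ring.
    have -> : h * g t - m = rint leb1 (fun s => istep a b s * (g t - g s)).
      rewrite /h -rint_step ?(ltW ab)// mulrC -rintZ// -rintB//; last exact: intgZ.
      by apply: rint_ext => s; ring.
    apply: le_trans (rint_abs Ic) _; rewrite /h -rint_step ?(ltW ab)// mulrC -rintZ//.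
    apply: rint_le; [exact: intg_norm|exact: intgZ|] => s.
    have [->|ss] := step01 a b s; first by rewrite mul0r mulr0 normr0.
    by rewrite ss mul1r mulr1; exact: HA.
  have h2 : (h * g t) ^+ 2 <= 2 * m ^+ 2 + 2 * (h * A) ^+ 2.
    have -> : h * g t = m + (h * g t - m) by rewrite addrC subrK.
    apply: le_trans (sqrD_le2 _ _) _; rewrite lerD2l ler_wpM2l//.
    rewrite -[leLHS]real_normK ?num_real// lerXn2r ?nnegrE//.
    exact: le_trans (normr_ge0 _) d.
  rewrite -(@ler_pM2l _ (h ^+ 2)) ?exprn_gt0// -exprMn; apply: le_trans h2 _.
  rewrite le_eqVlt; apply/orP; left; apply/eqP; field; rewrite gt_eqF//.
have I2 : intg leb1 (fun t => istep a b t * g t ^+ 2).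
  apply: (intg_dom _ _ (intgZ (2 / h ^+ 2 * m ^+ 2 + 2 * A ^+ 2) Is)).
    by apply: measurable_funM; [exact: step_meas|exact: measurable_funX].
  by move=> t; rewrite ger0_norm//; exact: mulr_ge0 (istep_ge0 _ _ _) (sqr_ge0 _).
split=> //; apply: le_trans (rint_le I2 (intgZ _ Is) key) _.
rewrite rintZ// rint_step ?(ltW ab)// -/h le_eqVlt; apply/orP; left; apply/eqP.
by field; rewrite gt_eqF.
Qed.

Definition box n (N : R) (x : 'rV[R]_n) : R := \prod_i istep (- N) N (x 0 i).

Lemma box01 n N (x : 'rV[R]_n) : 0 <= box N x <= 1.
Proof.
rewrite /box; apply: (big_ind (fun y : R => 0 <= y <= 1)) => [|y z|i _].
- by rewrite ler01 lexx.
- by move=> /andP[y0 y1] /andP[z0 z1]; rewrite mulr_ge0// mulr_ile1.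
- by rewrite istep_ge0 istep_le1.
Qed.

Lemma box_rcons n N (x : 'rV[R]_n) (t : R) :
  box N (rV_rcons (x, t) : 'rV[R]_n.+1) = istep (- N) N t * box N x.
Proof.
rewrite /box big_ord_recr/= mulrC; congr (_ * _); last first.
  by apply: eq_bigr => j _; rewrite (_ : widen_ord _ _ = lift ord_max j) ?rcons_lift//;
    apply/val_inj; rewrite /= /bump leqNgt ltn_ord.
by rewrite rcons_max.
Qed.

Lemma box_meas n N : measurable_fun setT (@box n N).
Proof.
apply: measurable_prod => i _.
apply: (measurableT_comp (step_meas _ _)); exact: measurable_rV_coord.
Qed.

(** Rellich's theorem in the form that [comp_below] consumes: the mass in a cube is at most a small
    multiple of the Dirichlet integral plus finitely many squared functionals. *)
Definition locally_compact n (N e : R) := exists (I : finType) (l : I -> 'rV[R]_n -> R) (K : R),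
  [/\ forall i, bm (l i), 0 <= K & forall w, C1 w -> csupp w ->
    rint (lebesgue_rV R n) (fun x => box N x * w x ^+ 2) <=
    e * rint (lebesgue_rV R n) (fun x => \sum_i ('D_('e_i) w x) ^+ 2) +
    K * \sum_i (rint (lebesgue_rV R n) (fun x => l i x * w x)) ^+ 2].

Lemma local_compact0 N e : locally_compact 0 N e.
Proof.
exists 'I_1, (fun _ _ => 1), 1; split=> // [i|w cw sw].
  by apply: bm_cont; [exact: cont_cst|exists 0 => x -[]].
have E (f : 'rV[R]_0 -> R) : rint (lebesgue_rV R 0) f = f 0.
  rewrite rintE /Rintegral /= integral_dirac//; first by rewrite diracT mul1e.
  have -> : f = fun=> f 0 by apply/funext => x; congr f; apply/rowP => -[].
  exact/measurable_EFinP.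
have E1 := E (fun x => box N x * w x ^+ 2).
have E2 := E (fun x => \sum_i ('D_('e_i) w x) ^+ 2); have E3 := E (fun x => 1 * w x).
by rewrite big_ord_recl big_ord0 E1 E2 E3 /box !big_ord0 mulr0 add0r addr0 !mul1r.
Qed.

(** Apply the bound of dimension n to every slice. It leaves the squares of the functions [g i t],
    the functionals evaluated on slices; cutting the last coordinate into short intervals, each
    square is replaced by squared means, which are the new functionals, and by the derivative in
    that coordinate. *)
Lemma local_compactS n N e : 0 < N -> 0 < e -> locally_compact n N e -> locally_compact n.+1 N e.
Proof.
move=> N0 e0 [I0 [l [K [bl K0 H]]]].
set lebn := lebesgue_rV R n in H; set leb := lebesgue_rV R n.+1.
pose L := \sum_i dot lebn (l i) (l i).
have L0 : 0 <= L by apply: sumr_ge0 => i _; exact: dot_ge0.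
(* With intervals of length [h = 2 N / M0], the Poincare error is [2 K L h^2] times the axial
   Dirichlet integral, and this choice makes the factor at most [e]. *)
have [M0 hM0] : exists M : nat, (0 < M)%N && (2 * K * L * (2 * N) ^+ 2 <= e * M%:R ^+ 2).
  have := archi_boundP (_ : 0 <= 2 * K * L * (2 * N) ^+ 2 / e).
  rewrite divr_ge0 ?(ltW e0)//; last first.
    by rewrite mulr_ge0 ?sqr_ge0// mulr_ge0// mulr_ge0.
  move=> /(_ isT); set m := Num.bound _ => hm.
  exists m.+1; rewrite /=; move: hm; rewrite ltr_pdivrMr// => /ltW/le_trans; apply.
  rewrite mulrC ler_wpM2l ?(ltW e0)// -natrX ler_nat (leq_trans (leqnSn m))//.
  by rewrite expnS leq_pmulr// expn_gt0.
move: hM0 => /andP[Mp hM].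
pose h := 2 * N / M0%:R.
have Mr : 0 < M0%:R :> R by rewrite ltr0n.
have h0 : 0 < h by rewrite divr_gt0// mulr_gt0.
pose aj (j : nat) : R := - N + j%:R * h.
have aM : aj M0 = N by rewrite /aj /h; field; rewrite gt_eqF.
have ajS j : aj j.+1 - aj j = h by rewrite /aj -natr1; ring.
have ajlt j : aj j < aj j.+1 by rewrite -subr_gt0 ajS.
pose chi j := istep (aj j) (aj j.+1).
have chiE t : istep (- N) N t = \sum_(j < M0) chi j t.
  by rewrite -{2}aM /aj step_split ?(ltW h0).
pose lx (i : I0) (x : 'rV[R]_n.+1) := l i (rV_unrcons x).1.
have lxE i x t : lx i (rV_rcons (x, t)) = l i x by rewrite /lx rV_rconsK.
have lxm i : measurable_fun setT (lx i).
  have [ml _ _] := bl i.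
  exact: (measurableT_comp ml (measurableT_comp measurable_fst (@measurable_rV_unrcons R n))).
have lxb i : exists B : R, forall x, `|lx i x| <= B.
  by have [_ [B HB] _] := bl i; exists B => x; exact: HB.
pose lij (i : I0) j (x : 'rV[R]_n.+1) := chi j (x 0 ord_max) * lx i x.
have chim j : measurable_fun setT (fun x : 'rV[R]_n.+1 => chi j (x 0 ord_max)).
  apply: (measurableT_comp (step_meas _ _)); exact: (measurable_rV_coord ord_max).
have lijm i j : measurable_fun setT (lij i j) by exact: measurable_funM.
have lijb i j : exists B : R, forall x, `|lij i j x| <= B.
  have [B HB] := lxb i; exists B => x; rewrite normrM.
  by rewrite ger0_norm ?istep_ge0// (le_trans _ (HB x))// ler_piMl// istep_le1.
have blij i j : bm (lij i j).
  split=> //; have [_ _ [A HA]] := bl i; have [_ _ [A2 HA2]] := step_bm1 (aj j) (aj j.+1).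
  exists (Num.max A A2) => x p; rewrite gt_max => /andP[p1 p2]; rewrite /lij /lx.
  case: (unliftP ord_max p) p1 p2 => [p'|] -> p1 p2; last by rewrite /chi HA2 ?mul0r.
  by rewrite (HA _ p') ?mulr0// mxE.
exists (prod I0 'I_M0 : finType), (fun p : I0 * 'I_M0 => lij p.1 p.2), (K * (2 / h)); split.
- by move=> p; exact: blij.
- by rewrite mulr_ge0// divr_ge0// ltW.
move=> w cw sw.
have SE : \sum_(p : (prod I0 'I_M0 : finType)) (rint leb (fun x => lij p.1 p.2 x * w x)) ^+ 2 =
    \sum_i \sum_(j < M0) (rint leb (fun x => lij i j x * w x)) ^+ 2 by rewrite pair_bigA.
rewrite SE.
have bw := bm_cont (C1_cont cw) sw.
have bw2 : bm (fun x => w x ^+ 2) by apply: bm_cont; [exact: contX (C1_cont cw)|exact: csuppX].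
have bbox : bm (fun x => box N x * w x ^+ 2).
  apply: bmMr => //; first exact: box_meas.
  by exists 1 => x; have /andP[b0 b1] := box01 N x; rewrite ger0_norm.
pose wt t x := w (rV_rcons (x, t)).
have cwt t : C1 (wt t) := (C1_section t cw).1.
have dwt t j x := (C1_section t cw).2 j x.
have swt t : csupp (wt t) by have [] := bm_section t bw.
have bD : bm (fun x => \sum_(j < n) ('D_('e_(lift ord_max j)) w x) ^+ 2).
  apply: bm_cont.
    by apply: cont_sum => j; apply: contX; exact: C1_dcont.
  have [A HA] : csupp (fun x => \sum_i `|'D_('e_i) w x|).
    elim: (index_enum _) => [|i s [A HA]]; first by exists 0 => x i _; rewrite big_nil.
    have [A2 HA2] := csupp_d i sw; exists (Num.max A A2) => x p; rewrite gt_max => /andP[p1 p2].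
    by rewrite big_cons (HA2 _ _ p2) normr0 add0r (HA _ _ p1).
  exists A => x o /HA; rewrite sum_lift => /eqP; rewrite paddr_eq0 ?sumr_ge0// => /andP[_].
  rewrite psumr_eq0// => /allP z; apply: big1 => j _.
  by have := z j (mem_index_enum _); rewrite normr_eq0 => /eqP ->; rewrite expr0n.
have bdt := bm_d ord_max cw sw.
have bdt2 : bm (fun x => ('D_('e_ord_max) w x) ^+ 2).
  by apply: bm_cont; [apply: contX; exact: C1_dcont|apply: csuppX; exact: csupp_d].
pose g i t := rint lebn (fun x => l i x * wt t x).
have blw i : bm (fun x => lx i x * w x) by exact: bmMr.
have Ig i : intg leb1 (g i).
  have [I1 _] := rint_rcons_sym (blw i); move: I1; congr (is_true (intg _ _)).
  by apply/funext => t; apply: rint_ext => x; rewrite lxE.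
have gE i j : rint leb1 (fun t => chi j t * g i t) = rint leb (fun x => lij i j x * w x).
  have bb : bm (fun x => lij i j x * w x) by exact: bmMr.
  rewrite (rint_rcons_sym bb).2; apply: rint_ext => t.
  rewrite /g -rintZ.
    by apply: rint_ext => x; rewrite /lij lxE rcons_max mulrA.
  by apply/intg_bm; exact: bmM (bl i) (C1_meas (cwt t)) (bm_bound (bm_section t bw)).
pose A2 j := rint leb (fun x => chi j (x 0 ord_max) * ('D_('e_ord_max) w x) ^+ 2).
have bA2 j : bm (fun x => chi j (x 0 ord_max) * ('D_('e_ord_max) w x) ^+ 2).
  apply: bmMr => //; exists 1 => x; rewrite ger0_norm ?istep_ge0 ?istep_le1//.
(* The fundamental theorem on slices, then Cauchy-Schwarz on the slab, whose thickness [h] supplies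
   the small factor. *)
have gdiff i j s t : chi j s = 1 -> chi j t = 1 ->
    `|g i t - g i s| <= Num.sqrt (h * dot lebn (l i) (l i) * A2 j).
  move=> hs ht.
  have bll : bm (fun x => lij i j x * `|'D_('e_ord_max) w x|).
    apply: bmMr => //; exact: bm_norm bdt.
  have Il t' : intg lebn (fun x => l i x * wt t' x).
    by apply/intg_bm; exact: bmM (bl i) (C1_meas (cwt t')) (bm_bound (bm_section t' bw)).
  have s1 : `|g i t - g i s| <= rint leb (fun x => `|lij i j x| * `|'D_('e_ord_max) w x|).
    have bll' : bm (fun x => `|lij i j x| * `|'D_('e_ord_max) w x|).
      by have := bm_norm bll; congr bm; apply/funext => x; rewrite normrM normr_id.
    rewrite /g -rintB// (rint_rcons bll').2.
    apply: le_trans (rint_abs (intgB (Il t) (Il s))) _; apply: rint_le.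
    - exact/intg_norm/intgB.
    - exact: (rint_rcons bll').1.
    move=> x; rewrite -mulrBr normrM.
    apply: le_trans (ler_wpM2l (normr_ge0 _) (FTC_step (fun t => C1_section1 x t cw) _ (bm_section1 x bdt) hs ht)) _.
      apply: (@cont_compT R _ _ (fun y : 'rV[R]_n.+1 => 'D_('e_ord_max) w y)
        (fun t : R => rV_rcons (x, t))); first exact: rcons_contr.
      exact: C1_dcont.
    rewrite -rintZ; last first.
      apply: (intg_dom _ _ (intg_norm (intg_bm1 (bm_section1 x bdt)))).
        apply: measurable_funM; first exact: step_meas.
        by apply: measurableT_comp; [exact: normr_measurable|case: (bm_section1 x bdt)].
      by move=> u; rewrite normrM normr_id ger0_norm ?istep_ge0// ler_piMl// istep_le1.
    rewrite le_eqVlt; apply/orP; left; apply/eqP; apply: rint_ext => u.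
    by rewrite /lij lxE rcons_max normrM (ger0_norm (istep_ge0 _ _ _)); ring.
  apply: le_trans s1 _.
  have sl : sq leb (fun x => `|lij i j x|) by apply: bm_sq; exact: bm_norm.
  have sd : sq leb (fun x => chi j (x 0 ord_max) * `|'D_('e_ord_max) w x|).
    apply: bm_sq; apply: bmMr => //; first exact: bm_norm.
    by exists 1 => x; rewrite ger0_norm ?istep_ge0 ?istep_le1.
  have := sip_CS (@sq_sip _ _ R leb) sl sd.
  have -> : dot leb (fun x => `|lij i j x|) (fun x => chi j (x 0 ord_max) * `|'D_('e_ord_max) w x|) =
      rint leb (fun x => `|lij i j x| * `|'D_('e_ord_max) w x|).
    apply: rint_ext => x; rewrite /lij normrM (ger0_norm (istep_ge0 _ _ _)) /chi.
    by case: (step01 (aj j) (aj j.+1) (x 0 ord_max)) => ->; ring.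
  have -> : dot leb (fun x => chi j (x 0 ord_max) * `|'D_('e_ord_max) w x|)
      (fun x => chi j (x 0 ord_max) * `|'D_('e_ord_max) w x|) = A2 j.
    apply: rint_ext => x; rewrite -(real_normK (num_real ('D_('e_ord_max) w x))) /chi.
    by case: (step01 (aj j) (aj j.+1) (x 0 ord_max)) => ->; ring.
  have -> : dot leb (fun x => `|lij i j x|) (fun x => `|lij i j x|) = h * dot lebn (l i) (l i).
    have bb : bm (fun x => lij i j x * lij i j x) by exact: bmM.
    rewrite (_ : dot leb _ _ = rint leb (fun x => lij i j x * lij i j x)); last first.
      by apply: rint_ext => x; rewrite -expr2 real_normK ?num_real// expr2.
    rewrite (rint_rcons_sym bb).2 -(ajS j) -rint_step ?(ltW (ajlt j))// mulrC -rintZ.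
      apply: rint_ext => u.
      transitivity (rint lebn (fun x => chi j u * (l i x * l i x))).
        apply: rint_ext => x; rewrite /lij lxE rcons_max /chi.
        by case: (step01 (aj j) (aj j.+1) u) => ->; ring.
      rewrite rintZ 1?mulrC//.
      by apply: sq_mul; apply: bm_sq; exact: bl.
    exact: intg_bm1 (step_bm1 _ _).
  move=> cs; rewrite -(ger0_norm (_ : 0 <= rint leb _)) -?sqrtr_sqr ?ler_wsqrtr//.
  by apply: rint_ge0 => x; rewrite mulr_ge0.
have A20 j : 0 <= A2 j by apply: rint_ge0 => x; rewrite mulr_ge0 ?istep_ge0 ?sqr_ge0.
have P i j := step_poincare (ajlt j) (Ig i) (fun s t => @gdiff i j s t).
have IH t := H _ (cwt t) (swt t).
have EL : rint leb (fun x => box N x * w x ^+ 2) =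
    rint leb1 (fun t => istep (- N) N t * rint lebn (fun x => box N x * wt t x ^+ 2)).
  rewrite (rint_rcons_sym bbox).2; apply: rint_ext => t.
  rewrite -rintZ.
    by apply: rint_ext => x; rewrite box_rcons mulrA.
  apply/intg_bm; apply: bmMr; last by exists 1 => x; have /andP[b0 b1] := box01 N x; rewrite ger0_norm.
    by apply: bm_cont; [apply: contX; exact: C1_cont|exact: csuppX].
  exact: box_meas.
have ED : rint leb (fun x => \sum_(j < n) ('D_('e_(lift ord_max j)) w x) ^+ 2) =
    rint leb1 (fun t => rint lebn (fun x => \sum_j ('D_('e_j) (wt t) x) ^+ 2)).
  rewrite (rint_rcons_sym bD).2; apply: rint_ext => t; apply: rint_ext => x.
  by apply: eq_bigr => j _; rewrite dwt.
have ID : intg leb1 (fun t => rint lebn (fun x => \sum_j ('D_('e_j) (wt t) x) ^+ 2)).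
  have [I1 _] := rint_rcons_sym bD; move: I1; congr (is_true (intg _ _)).
  apply/funext => t; apply: rint_ext => x; by apply: eq_bigr => j _; rewrite dwt.
have IL : intg leb1 (fun t => istep (- N) N t * rint lebn (fun x => box N x * wt t x ^+ 2)).
  have [I1 _] := rint_rcons_sym bbox; move: I1; congr (is_true (intg _ _)).
  apply/funext => t; rewrite -rintZ.
    by apply: rint_ext => x; rewrite box_rcons mulrA.
  apply/intg_bm; apply: bmMr; last by exists 1 => x; have /andP[b0 b1] := box01 N x; rewrite ger0_norm.
    by apply: bm_cont; [apply: contX; exact: C1_cont|exact: csuppX].
  exact: box_meas.
have IP : intg leb1 (fun t => \sum_i \sum_(j < M0) chi j t * g i t ^+ 2).
  by apply: intg_sum => i; apply: intg_sum => j; exact: (P i j).1.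
have bnd : rint leb (fun x => box N x * w x ^+ 2) <=
    e * rint leb (fun x => \sum_(j < n) ('D_('e_(lift ord_max j)) w x) ^+ 2) +
    K * \sum_i \sum_(j < M0) rint leb1 (fun t => chi j t * g i t ^+ 2).
  rewrite EL ED.
  have -> : \sum_i \sum_(j < M0) rint leb1 (fun t => chi j t * g i t ^+ 2) =
      rint leb1 (fun t => \sum_i \sum_(j < M0) chi j t * g i t ^+ 2).
    rewrite rint_sum => [|i]; last by apply: intg_sum => j; exact: (P i j).1.
    by apply: eq_bigr => i _; rewrite rint_sum// => j; exact: (P i j).1.
  rewrite -!rintZ// -rintD; [|exact: intgZ|exact: intgZ].
  apply: rint_le => //; first by apply: intgD; exact: intgZ.
  move=> t; apply: le_trans (ler_wpM2l (istep_ge0 _ _ _) (IH t)) _.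
  rewrite mulrDr lerD//.
    rewrite mulrCA ler_wpM2l ?(ltW e0)// ler_piMl ?istep_le1//.
    by apply: rint_ge0 => x; apply: sumr_ge0 => j _; exact: sqr_ge0.
  rewrite mulrCA ler_wpM2l// mulr_sumr; apply: ler_sum => i _.
  by rewrite chiE mulr_suml.
apply: le_trans bnd _.
rewrite (_ : rint (lebesgue_rV R n.+1) (fun x => \sum_i ('D_('e_i) w x) ^+ 2) =
    rint leb (fun x => ('D_('e_ord_max) w x) ^+ 2) +
    rint leb (fun x => \sum_(j < n) ('D_('e_(lift ord_max j)) w x) ^+ 2)); last first.
  rewrite -rintD; [|exact: intg_bm|exact: intg_bm].
  by apply: rint_ext => x; rewrite sum_lift.
have sA : \sum_(j < M0) A2 j <= rint leb (fun x => ('D_('e_ord_max) w x) ^+ 2).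
  rewrite -rint_sum => [|j]; last exact: intg_bm.
  apply: rint_le; [by apply: intg_sum => j; exact: intg_bm|exact: intg_bm|].
  by move=> x; rewrite -mulr_suml -chiE ler_piMl ?sqr_ge0// istep_le1.
have sP : \sum_i \sum_(j < M0) rint leb1 (fun t => chi j t * g i t ^+ 2) <=
    2 / h * \sum_i \sum_(j < M0) (rint leb (fun x => lij i j x * w x)) ^+ 2 +
    2 * h ^+ 2 * L * rint leb (fun x => ('D_('e_ord_max) w x) ^+ 2).
  apply: (@le_trans _ _ (\sum_i \sum_(j < M0) (2 / h * (rint leb (fun x => lij i j x * w x)) ^+ 2 +
      2 * h ^+ 2 * (dot lebn (l i) (l i) * A2 j)))).
    apply: ler_sum => i _; apply: ler_sum => j _.
    have := (P i j).2; rewrite gE ajS sqr_sqrtr; last first.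
      by rewrite mulr_ge0// mulr_ge0 ?(ltW h0) ?dot_ge0.
    by move/le_trans; apply; rewrite lerD2l le_eqVlt; apply/orP; left; apply/eqP; ring.
  under eq_bigr => i _ do rewrite big_split/= -!mulr_sumr.
  rewrite big_split/= -!mulr_sumr -mulr_suml -/L lerD2l -[2 * h ^+ 2 * L * _]mulrA.
  apply: ler_wpM2l; first exact: mulr_ge0 (ler0n _ 2) (sqr_ge0 h).
  exact: ler_wpM2l.
have hK : K * (2 * h ^+ 2 * L) <= e.
  rewrite /h -(@ler_pM2r _ (M0%:R ^+ 2)) ?exprn_gt0//; apply: le_trans hM.
  by rewrite le_eqVlt; apply/orP; left; apply/eqP; field; rewrite gt_eqF.
have := ler_wpM2l K0 sP.
have D0 : 0 <= rint leb (fun x => ('D_('e_ord_max) w x) ^+ 2).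
  by apply: rint_ge0 => x; exact: sqr_ge0.
have := ler_wpM2r D0 hK; rewrite !mulrDr.
lra.
Qed.

Lemma local_compact n N e : 0 < N -> 0 < e -> locally_compact n N e.
Proof.
move=> N0 e0; elim: n => [|n IH]; first exact: local_compact0.
exact: local_compactS.
Qed.

End local_compactness.

(** * Lower bounds on the form domain *)

Section form_bounds.
Context {R : realType} (n : nat) (theta alpha : R).
Hypothesis n0 : (0 < n)%N.
Hypothesis th : 0 < theta < pi / 2.
Hypothesis alpha0 : 0 < alpha.
Local Notation leb := (lebesgue_rV R n.+1).
Local Notation T := ('rV[R]_n.+1).
Local Notation si := (sin theta).
Local Notation co := (cos theta).
Local Notation sgn := (@sgn_cone R n theta).
Local Notation q := (@qfc R n theta alpha).

Let si0 : 0 < si := sin_theta_gt0 th.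
Let co0 : 0 < co := cos_theta_gt0 th.
Let beta := alpha / (2 * si).
Let a := alpha / 2.

Lemma hardy_form u : (3 <= n)%N -> H1r u -> - (alpha ^+ 2 / 4) * dot leb u u <= q u u.
Proof.
move=> n3 Hu.
apply: (test_extend (q1 := fun u => - (alpha ^+ 2 / 4) * dot leb u u) (q2 := fun u => q u u)) Hu.
  move=> {}u s Hu Hs su.
  have [c1 [c2 _]] := cvg_qform ord_max beta (@sgn_cone_meas R n theta) (@sgn_cone_le1 R n theta)
    Hu Hu Hs Hs su su.
  by split=> //; apply: cvgM; [exact: cvg_cst|exact: c2].
move=> s ts; apply: hardy_lower => //; [exact: test_C1|exact: test_supp].
Qed.

Lemma box_out m (N : R) (x : 'rV[R]_m) : box N x = 1 \/ exists i, N <= `|x 0 i|.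
Proof.
have [H|H] := pselect (forall i, istep (- N) N (x 0 i) = 1).
  by left; rewrite /box big1.
right; apply: contrapT => nex; apply: H => i; rewrite /istep.
have : `|x 0 i| < N by rewrite ltNge; apply/negP => h; apply: nex; exists i.
by rewrite ltr_norml => /andP[-> /ltW ->].
Qed.

(** The defect is concentrated in a bounded region: far from the axis the weight [Rr^2 / rho^2] is
    small, and near the axis but far from the apex both signs are close to the sign of the axial
    coordinate. *)
Lemma penalty_small (Rr M e : R) : 0 < Rr -> 0 < M -> 0 < e -> exists2 N, 0 < N &
  forall x : T, Rr ^+ 2 * (rho Rr x)^-1 ^+ 2 * `|sgn x - sM M x| <= e + 2 * box N x.
Proof.
move=> R0 M0 e0.
have c0 : 0 < cot theta by rewrite divr_gt0.
pose r0 := 1 + 2 * Rr ^+ 2 / e.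
have z0 : 0 <= 2 * Rr ^+ 2 / e by rewrite divr_ge0 ?(ltW e0)// mulr_ge0 ?sqr_ge0.
have r01 : 1 <= r0 by rewrite lerDl.
have rsq : 2 * Rr ^+ 2 <= e * r0 ^+ 2.
  have h : 2 * Rr ^+ 2 = e * (r0 - 1) by rewrite /r0; field; rewrite gt_eqF.
  rewrite h ler_wpM2l ?(ltW e0)//; have := ler_wpM2l (le_trans ler01 r01) r01; lra.
(* [N] exceeds the radius [r0] beyond which the weight is small, the height of the cone at that
   radius, and the height from which [sM] is within [e] of its limit. *)
pose N := r0 * (1 + cot theta) + M / e.
have rc : 0 <= r0 * cot theta by rewrite mulr_ge0 ?(ltW c0)// (le_trans ler01).
have Me : 0 < M / e by rewrite divr_gt0.
have Nr : r0 <= N by rewrite /N; lra.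
have Nc : cot theta * r0 < N by rewrite /N; lra.
have NM : M / e <= N by rewrite /N; lra.
have N0 : 0 < N by lra.
exists N => // x.
have pos1 : 0 <= Rr ^+ 2 * (rho Rr x)^-1 ^+ 2 := mulr_ge0 (sqr_ge0 _) (sqr_ge0 _).
have t1 : Rr ^+ 2 * (rho Rr x)^-1 ^+ 2 <= 1.
  have := rr_rhoV x R0; have := mulr_ge0 (rr_ge0 x) (sqr_ge0 (rho Rr x)^-1); lra.
have d2 : `|sgn x - sM M x| <= 2.
  rewrite (le_trans (ler_normB _ _))// (_ : 2 = 1 + 1 :> R)// lerD//; [exact: sgn_cone_le1|exact: tauq_le1].
have /andP[b0 _] := box01 N x.
have [->|[i hi]] := box_out N x.
  by rewrite mulr1 -[leLHS]add0r lerD ?(ltW e0)// -[2]mul1r ler_pM.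
suff h : Rr ^+ 2 * (rho Rr x)^-1 ^+ 2 * `|sgn x - sM M x| <= e by rewrite ler_wpDr// mulr_ge0.
have far : r0 ^+ 2 <= rr x -> Rr ^+ 2 * (rho Rr x)^-1 ^+ 2 * `|sgn x - sM M x| <= e.
  move=> hr; apply: (@le_trans _ _ (Rr ^+ 2 * (rho Rr x)^-1 ^+ 2 * 2)); first by rewrite ler_wpM2l.
  rewrite exprVn rho_sqr mulrAC ler_pdivrMr; last by rewrite ltr_wpDl ?rr_ge0// exprn_gt0.
  rewrite mulrC; apply: le_trans rsq _; rewrite ler_wpM2l ?(ltW e0)//.
  by apply: le_trans hr _; rewrite lerDl sqr_ge0.
have near : `|sgn x - sM M x| <= e -> Rr ^+ 2 * (rho Rr x)^-1 ^+ 2 * `|sgn x - sM M x| <= e.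
  by move=> h; rewrite -[leRHS]mul1r ler_pM.
case: (unliftP ord_max i) hi => [j|] -> hi.
  apply: far; rewrite /rr (bigD1 j)//= ler_wpDr//.
    by apply: sumr_ge0 => k _; exact: sqr_ge0.
  rewrite -[leRHS]real_normK ?num_real// lerXn2r ?nnegrE ?(le_trans ler01 r01)//.
  exact: le_trans Nr hi.
have [hr|rh] := leP (r0 ^+ 2) (rr x); first exact: far.
have hg : hgt theta x < N.
  apply: le_lt_trans Nc; rewrite /hgt ler_wpM2l ?(ltW c0)//.
  by rewrite -[leRHS]ger0_norm ?(le_trans ler01 r01)// -sqrtr_sqr ler_wsqrtr// ltW.
have hg0 : 0 <= hgt theta x by rewrite mulr_ge0 ?(ltW c0)// sqrtr_ge0.
have m0 : 0 < e^-1 by rewrite invr_gt0.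
apply: near; rewrite sgn_coneE /sM.
have [z0'|z0'] := leP 0 (x 0 ord_max).
  rewrite ger0_norm// in hi; rewrite (lt_le_trans hg hi) distrC -[leRHS]invrK.
  apply: tauq_near => //; rewrite ler_pdivlMl//; exact: le_trans NM hi.
rewrite ltr0_norm// in hi; rewrite ltNge (le_trans (ltW z0') hg0)/=.
have -> : -1 - tauq (M^-1 * x 0 ord_max) = tauq (M^-1 * - x 0 ord_max) - 1.
  by rewrite mulrN tauqN; ring.
rewrite -[leRHS]invrK; apply: tauq_near => //; rewrite ler_pdivlMl//; exact: le_trans NM hi.
Qed.

(** The gap [g] between the threshold and [E] is shared out: g/6 for the curvature through [Rr], g/6
    for the slow sign through [M], g/3 for the defect outside a cube through [e'], and g/3 for the
    Dirichlet integral created by local compactness through [e], after it is bounded by the form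
    itself. *)
Lemma comp_form E : E < - (alpha ^+ 2 / 4) ->
  exists m, comp_below (sq leb) (dot leb) (@H1r R n.+1) q E m.
Proof.
move=> Ea; set a2 := alpha ^+ 2 / 4 in Ea.
have a20 : 0 <= a2 by rewrite divr_ge0// sqr_ge0.
pose g := - E - a2; have g0 : 0 < g by rewrite /g; lra.
have a0 : 0 < a by rewrite divr_gt0.
pose ka := co ^+ 2 / si * a.
have ka0 : 0 <= ka by rewrite mulr_ge0 ?(ltW a0)// divr_ge0 ?sqr_ge0// ltW.
pose C1' := a ^+ 2 * (2 + 2 * (co ^+ 2 / si) ^+ 2).
have C10 : 0 <= C1'.
  by apply: mulr_ge0; [exact: sqr_ge0|apply: addr_ge0 => //; apply: mulr_ge0 => //; exact: sqr_ge0].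
pose c := 2 * beta ^+ 2; have c0 : 0 <= c by apply: mulr_ge0 => //; exact: sqr_ge0.
have an0 : 0 <= a * n%:R by rewrite mulr_ge0// ltW.
pose Rr := 1 + 6 * (a * n%:R) / g; pose M := 1 + 6 * ka / g.
have zR : 0 <= 6 * (a * n%:R) / g by rewrite divr_ge0 ?(ltW g0)// mulr_ge0.
have zM : 0 <= 6 * ka / g by rewrite divr_ge0 ?(ltW g0)// mulr_ge0.
have R1 : 1 <= Rr by rewrite lerDl.
have M0 : 0 < M by rewrite ltr_wpDr.
have R0 : 0 < Rr by exact: lt_le_trans R1.
have small (v d : R) : 0 <= v -> d = 1 + 6 * v / g -> v / d <= g / 6.
  move=> v0 ->; have d0 : 0 < 1 + 6 * v / g.
    by rewrite ltr_wpDr// divr_ge0 ?(ltW g0)// mulr_ge0.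
  rewrite ler_pdivrMr// (_ : g / 6 * _ = g / 6 + v); last by field; rewrite gt_eqF.
  by rewrite lerDr divr_ge0// ltW.
have sR := small _ Rr an0 erefl; have sMM := small _ M ka0 erefl.
pose e' := g / (3 * (C1' + 1)).
have C1p : 0 < C1' + 1 by rewrite ltr_wpDl.
have e'0 : 0 < e' by rewrite divr_gt0// mulr_gt0.
have Ce' : C1' * e' <= g / 3.
  rewrite /e' mulrA ler_pdivrMr ?mulr_gt0// (_ : g / 3 * _ = C1' * g + g); last by field.
  by rewrite lerDl ltW.
have [N N0 HN] := penalty_small R0 M0 e'0.
pose e := g / (12 * ((C1' + 1) * (c + 1))).
have cp : 0 < c + 1 by rewrite ltr_wpDl.
have e0 : 0 < e by rewrite divr_gt0// mulr_gt0// mulr_gt0.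
have [I [l [K [bl K0 HK]]]] := local_compact n.+1 N0 e0.
have key w : C1 w -> csupp w -> E * dot leb w w <=
    q w w + (2 * C1' * K) * \sum_i (dot leb (l i) w) ^+ 2.
  move=> cw sw; set D := dot leb w w; set S := \sum_i _.
  have D0 : 0 <= D by exact: dot_ge0.
  have S0 : 0 <= S by apply: sumr_ge0 => i _; exact: sqr_ge0.
  have bw := bm_cont (C1_cont cw) sw.
  have Iw : intg leb (fun x => w x ^+ 2) := (bm_sq bw).2.
  have DE : D = rint leb (fun x => w x ^+ 2) by apply: rint_ext => x; rewrite expr2.
  have bb : bm (fun x => box N x * w x ^+ 2).
    apply: bmMr; [|exact: box_meas|].
      by apply: bm_cont; [exact: contX (C1_cont cw)|exact: csuppX].
    by exists 1 => x; have /andP[b0 b1] := box01 N x; rewrite ger0_norm.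
  set B := rint leb (fun x => box N x * w x ^+ 2).
  have h1 : - ((a ^+ 2 + a * n%:R / Rr + ka / M + C1' * e') * D + 2 * C1' * B) <= q w w.
    apply: le_trans (comp_lower n0 th alpha0 R1 M0 cw sw); rewrite lerN2 DE /B -!rintZ//; last exact: intg_bm.
    rewrite -rintD; [|exact: intgZ|by apply: intgZ; exact: intg_bm].
    apply: rint_le.
    - have cRV := C1_cont (hd_C1 (hd_rhoV n R0)).
      have csM : continuous (@sM R n M) := C1_cont (hd_C1 (hd_tauq (hd_Z M^-1 (@hd_z R n)))).
      have mp : measurable_fun setT (fun x : T => Rr ^+ 2 * (rho Rr x)^-1 ^+ 2 * `|sgn x - sM M x|).
        have c1 : continuous (fun x : T => Rr ^+ 2 * (rho Rr x)^-1 ^+ 2) by ctac.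
        apply: (measurable_funM (continuous_meas c1)).
        apply: measurableT_comp; first exact: normr_measurable.
        by apply: measurable_funB; [exact: sgn_cone_meas|exact: continuous_meas csM].
      apply: (intg_dom _ _ (intgZ (`|a ^+ 2 + a * n%:R / Rr + co ^+ 2 / si * a / M| + C1' * (e' + 2)) Iw)).
        apply: measurable_funM; last exact: intg_meas Iw.
        by apply: measurable_funD => //; apply: measurable_funM.
      move=> x; rewrite normrM (ger0_norm (sqr_ge0 _)) ler_wpM2r ?sqr_ge0//.
      apply: le_trans (ler_normD _ _) _; rewrite lerD2l normrM (ger0_norm C10) ler_wpM2l//.
      rewrite ger0_norm; last exact: mulr_ge0 (mulr_ge0 (sqr_ge0 _) (sqr_ge0 _)) (normr_ge0 _).
      apply: le_trans (HN x) _; rewrite lerD2l -[leRHS]mulr1 ler_wpM2l//.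
      by have /andP[] := box01 N x.
    - by apply: intgD; apply: intgZ => //; exact: intg_bm.
    move=> x; rewrite -/a -/C1' -/ka; have := ler_wpM2l C10 (HN x).
    move=> hx; have := ler_wpM2r (sqr_ge0 (w x)) hx; lra.
  have h2 := HK w cw sw; rewrite -/B in h2.
  have Hw : H1r w by case: (C1_H1r cw sw).
  have gE : rint leb (fun x => \sum_i ('D_('e_i) w x) ^+ 2) = gdot w w.
    rewrite gdot_C1// rint_sum.
      by apply: eq_bigr => i _; apply: rint_ext => x; rewrite expr2.
    by move=> i; exact: (bm_sq (bm_d i cw sw)).2.
  rewrite gE -/S in h2.
  have h3 : gdot w w <= 2 * (q w w + c * D).
    have := dform_le ord_max beta (@sgn_cone_meas R n theta) (@sgn_cone_le1 R n theta) Hw.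
    rewrite ler_norml => /andP[hh _]; rewrite /qfc /qform -/beta; rewrite -/c -/D in hh; lra.
  have a2E : a ^+ 2 = a2 by rewrite /a /a2; field.
  have sc : 4 * C1' * e * c <= g / 3.
    have -> : 4 * C1' * e * c = (g / 3) * ((C1' * c) / ((C1' + 1) * (c + 1))).
      by rewrite /e; field; rewrite !gt_eqF.
    rewrite ler_piMr ?divr_ge0 ?(ltW g0)// ler_pdivrMr ?mulr_gt0// mul1r.
    have := mulr_ge0 C10 c0; lra.
  have h4 : (1 + 4 * C1' * e) * q w w >= E * D - 2 * C1' * K * S.
    have p1 := ler_wpM2l (mulr_ge0 (ler0n R 2) C10) h2.
    have p2 := ler_wpM2l (mulr_ge0 (mulr_ge0 (ler0n R 2) C10) (ltW e0)) h3.
    have p3 := ler_wpM2r D0 sc; have p4 := ler_wpM2r D0 sR; have p5 := ler_wpM2r D0 sMM.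
    have p6 := ler_wpM2r D0 Ce'.
    have -> : E = - g - a2 by rewrite /g; ring.
    rewrite a2E in h1; lra.
  have KS : 0 <= 2 * C1' * K * S := mulr_ge0 (mulr_ge0 (mulr_ge0 (ler0n R 2) C10) K0) S0.
  have ED : E * D <= 0 by rewrite mulr_le0_ge0//; lra.
  (* The bound holds for a multiple of [q w w] larger than 1. If [q w w] is nonnegative the claim is
     trivial, as [E] is negative; otherwise the multiple is smaller than [q w w] itself. *)
  have [q0|q0] := leP 0 (q w w); first lra.
  have : 4 * C1' * e * q w w <= 0.
    apply: mulr_ge0_le0; last exact: ltW.
    exact: mulr_ge0 (mulr_ge0 (ler0n R 4) C10) (ltW e0).
  lra.
exists #|I|, (2 * C1' * K), (fun p => l (enum_val p)); split.
- exact: mulr_ge0 (mulr_ge0 (ler0n R 2) C10) K0.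
- by move=> p; apply: bm_sq.
move=> u Hu.
have -> : \sum_(p < #|I|) (dot leb (l (enum_val p)) u) ^+ 2 = \sum_i (dot leb (l i) u) ^+ 2.
  by rewrite [RHS](reindex _ (onW_bij _ (@enum_val_bij I))).
apply: (test_extend (q1 := fun u => E * dot leb u u)
  (q2 := fun u => q u u + (2 * C1' * K) * \sum_i (dot leb (l i) u) ^+ 2)) Hu; last first.
  by move=> s ts; apply: key; [exact: test_C1|exact: test_supp].
move=> {}u s Hu Hs su.
have [c1 [c2 _]] := cvg_qform ord_max beta (@sgn_cone_meas R n theta) (@sgn_cone_le1 R n theta)
  Hu Hu Hs Hs su su.
split; first by apply: cvgM; [exact: cvg_cst|exact: c2].
apply: cvgD => //; apply: cvgM; first exact: cvg_cst.
apply: cvg_big => [|i _]; first exact: add_continuous.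
have cd := cvg_dotl (bm_sq (bl i)) Hu Hs su.
by apply: cvgM; exact: cd.
Qed.

End form_bounds.

(** * Trial functions *)

Section positive_extension.
Context {R : realType}.

(* With w = pos (1 - y): the identity on [1, +oo[ and 1 - w / (1 + w ^ 2) below. *)
Definition lft (y : R) : R := y + pos (1 - y) ^+ 3 * (1 + pos (1 - y) ^+ 2)^-1.

Definition lft1 (y : R) : R := 1 - (3 * pos (1 - y) ^+ 2 * (1 + pos (1 - y) ^+ 2)^-1 -
  2 * pos (1 - y) ^+ 4 * (1 + pos (1 - y) ^+ 2) ^- 2).

Lemma lft_below y : y <= 1 -> 0 < lft y <= 1.
Proof.
move=> y1; rewrite /lft posE ?subr_ge0//; set w := 1 - y; have -> : y = 1 - w by rewrite /w; ring.
have w0 : 0 <= w by rewrite subr_ge0.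
have p0 : 0 < 1 + w ^+ 2 := tauq_pos w.
have -> : 1 - w + w ^+ 3 / (1 + w ^+ 2) = (1 - w + w ^+ 2) / (1 + w ^+ 2).
  by field; rewrite gt_eqF.
rewrite divr_gt0//=; last by have := sqr_ge0 (1 - w); have := sqr_ge0 w; nra.
by rewrite ler_pdivrMr// mul1r; lra.
Qed.

Lemma lft_id y : 1 <= y -> lft y = y /\ lft1 y = 1.
Proof.
by move=> y1; rewrite /lft /lft1 pos0 ?subr_le0// !expr0n/= !mulr0 !mul0r subr0 subr0 addr0.
Qed.

Lemma lft_gt0 y : 0 < lft y.
Proof.
have [y1|/ltW y1] := leP 1 y; last by have /andP[] := lft_below y1.
by rewrite (lft_id y1).1 (lt_le_trans ltr01).
Qed.

End positive_extension.

(** * Radial fields with a regularised radius *)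

Section radial_functions.
Context {R : realType} (n : nat).
Local Notation T := ('rV[R]_n.+1).
Implicit Types (f g : T -> R) (x : T).

Lemma hd_posX k f f1 f2 : hd f f1 f2 -> hd (fun x => pos (f x) ^+ k.+2)
  (fun x => k.+2%:R * pos (f x) ^+ k.+1 * f1 x) (fun x => k.+2%:R * pos (f x) ^+ k.+1 * f2 x).
Proof.
move=> hf; apply: (hd_comp (p := fun y => pos y ^+ k.+2) (p' := fun y => k.+2%:R * pos y ^+ k.+1) hf) => x.
  exact: is_derive_posX.
exact: (@cont_posX _ k.+1 k.+2%:R).
Qed.

Lemma hd_lft f f1 f2 : hd f f1 f2 ->
  hd (fun x => lft (f x)) (fun x => lft1 (f x) * f1 x) (fun x => lft1 (f x) * f2 x).
Proof.
move=> hf; have hw := hd_D (hd_cst n 1) (hd_N hf).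
have p0 x : 1 + pos (1 + - f x) ^+ 2 != 0 by rewrite gt_eqF// tauq_pos.
have h := hd_D hf (hd_M (hd_posX 1 hw) (hd_inv (hd_D (hd_cst n 1) (hd_posX 0 hw)) p0)).
have key (w y : R) : 1 + w ^+ 2 != 0 -> y + (3 * w ^+ 2 * (0 + - y) * (1 + w ^+ 2)^-1 +
    w ^+ 3 * (- (1 + w ^+ 2) ^- 2 * (0 + 2 * w ^+ 1 * (0 + - y)))) =
    (1 - (3 * w ^+ 2 * (1 + w ^+ 2)^-1 - 2 * w ^+ 4 * (1 + w ^+ 2) ^- 2)) * y.
  by move=> w0; field.
by apply: (hdE h) => x; rewrite key.
Qed.

Lemma hd_ln f f1 f2 : hd f f1 f2 -> (forall x, 0 < f x) ->
  hd (fun x => ln (f x)) (fun x => (f x)^-1 * f1 x) (fun x => (f x)^-1 * f2 x).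
Proof.
move=> hf f0; apply: (hd_comp (p := @ln R) (p' := @GRing.inv R) hf) => x.
  exact: is_derive1_ln.
by apply: cvgV; [rewrite gt_eqF|exact: cvg_id].
Qed.

Lemma hd_exp f f1 f2 : hd f f1 f2 ->
  hd (fun x => expR (f x)) (fun x => expR (f x) * f1 x) (fun x => expR (f x) * f2 x).
Proof.
move=> hf; apply: (hd_comp (p := @expR R) (p' := @expR R) hf) => x; exact: continuous_expR.
Qed.

(* The divergence theorem for the vector field v (x' P, Q). *)
Lemma hd_div P p1 p2 Q q1 q2 v : hd P p1 p2 -> hd Q q1 q2 -> csupp P -> csupp Q -> C1 v ->
  let F x := (n%:R * P x + rr x * p1 x + q2 x) * v x +
    (P x * (\sum_j hx x j * 'D_('e_(lift ord_max j)) v x) + Q x * 'D_('e_ord_max) v x) in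
  intg (lebesgue_rV R n.+1) F /\ rint (lebesgue_rV R n.+1) F = 0.
Proof.
move=> [cP dP] [cQ dQ] sP sQ cv F.
have cPj j : C1 (fun x => P x * hx x j) := C1M cP (C1_coord (lift ord_max j)).
have cj j : C1 (fun x => P x * hx x j * v x) by exact: C1M.
have sj j : csupp (fun x => P x * hx x j * v x) by apply: csuppM; exact: csuppM.
have c0 : C1 (fun x => Q x * v x) by exact: C1M.
have s0 : csupp (fun x => Q x * v x) by exact: csuppM.
pose L j := lift ord_max j : 'I_n.+1.
have I0 := intg_bm (bm_d ord_max c0 s0); have Ij j := intg_bm (bm_d (L j) (cj j) (sj j)).
have Is := intg_sum (index_enum 'I_n) Ij.
have -> : F = fun x => 'D_('e_ord_max) (fun y => Q y * v y) x +
    \sum_j 'D_('e_(L j)) (fun y => P y * hx y j * v y) x.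
  apply/funext => x; rewrite (dM ord_max x cQ cv) (dQ x).2.
  rewrite [in RHS](eq_bigr (fun j => (P x * v x + hx x j ^+ 2 * (p1 x * v x)) +
      P x * (hx x j * 'D_('e_(L j)) v x))) => [|j _].
    rewrite !big_split/= sumr_const card_ord -mulr_suml -mulr_sumr -/(rr x) -[(P x * v x) *+ n]mulr_natl.
    by rewrite /F /L; ring.
  rewrite (dM (L j) x (cPj j) cv) (dM (L j) x cP (C1_coord (lift ord_max j))).
  rewrite (dP x).1 /hx dcoord eqxx [true%:R]mulr1n; ring.
split; first exact: intgD I0 Is.
rewrite (rintD I0 Is) (rint_derive ord_max c0 s0) (rint_sum _ Ij) big1 ?addr0// => j _.
exact: rint_derive (cj j) (sj j).
Qed.

(** A positive C1 function that coincides with |x'| wherever it exceeds 1. Trial functions live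
    there, so its shape near the axis never enters their energy, while inverses and logarithms are
    defined everywhere. *)
Definition rad x : R := Num.sqrt (lft (rr x)).

Definition rad1 x : R := lft1 (rr x) / rad x.

Lemma rad_gt0 x : 0 < rad x. Proof. by rewrite sqrtr_gt0 lft_gt0. Qed.

Lemma hd_rad : hd rad rad1 (fun=> 0).
Proof.
apply: (hdE (hd_sqrt (hd_lft (hd_rr n)) _)) => x; first exact: lft_gt0.
  rewrite -/(rad x) /rad1; have := rad_gt0 x => r0; field; rewrite gt_eqF//.
by rewrite !mulr0.
Qed.

Lemma rad_far x : 1 < rad x -> [/\ 1 <= rr x, rad x ^+ 2 = rr x & rad1 x = (rad x)^-1].
Proof.
move=> r1; have y1 : 1 <= rr x.
  rewrite leNgt; apply/negP => y1; move: r1; rewrite ltNge; apply/negP; rewrite negbK.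
  by rewrite -sqrtr1 ler_sqrt//; have /andP[] := lft_below (ltW y1).
have [l0 l1] := lft_id y1; split=> //; last by rewrite /rad1 l1 mul1r.
by rewrite sqr_sqrtr ?l0// (le_trans ler01).
Qed.

(* f is a function of a rad + b z, with derivative f' in that variable. *)
Definition dfun (a b : R) f f' := hd f (fun x => a * rad1 x * f' x) (fun x => b * f' x).

Section dfun.
Variables a b : R.
Local Notation df := (dfun a b).

Lemma dfunE f f' g : df f f' -> f' =1 g -> df f g.
Proof. by move=> h /funext <-. Qed.

Lemma dfun_lin : df (fun x => a * rad x + b * x 0 ord_max) (fun=> 1).
Proof.
by apply: (hdE (hd_D (hd_Z a hd_rad) (hd_Z b (@hd_z R n)))) => x; rewrite ?mulr0; ring.
Qed.

Lemma dfun_cst c : df (fun=> c) (fun=> 0).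
Proof. by apply: (hdE (hd_cst n c)) => x; rewrite mulr0. Qed.

Lemma dfunD f f' g g' : df f f' -> df g g' -> df (fun x => f x + g x) (fun x => f' x + g' x).
Proof. by move=> hf hg; apply: (hdE (hd_D hf hg)) => x; ring. Qed.

Lemma dfunM f f' g g' : df f f' -> df g g' ->
  df (fun x => f x * g x) (fun x => f' x * g x + f x * g' x).
Proof. by move=> hf hg; apply: (hdE (hd_M hf hg)) => x; ring. Qed.

Lemma dfunZ c f f' : df f f' -> df (fun x => c * f x) (fun x => c * f' x).
Proof. by move=> hf; apply: (hdE (hd_Z c hf)) => x; ring. Qed.

Lemma dfun_comp (p p' : R -> R) f f' : df f f' ->
  (forall y, is_derive y (1 : R) p (p' y)) -> continuous p' ->
  df (fun x => p (f x)) (fun x => p' (f x) * f' x).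
Proof. by move=> hf dp cp; apply: (hdE (hd_comp hf (fun x => dp (f x)) (fun x => cp (f x)))) => x; ring. Qed.

Lemma dfun_posX k f f' : df f f' ->
  df (fun x => pos (f x) ^+ k.+2) (fun x => k.+2%:R * pos (f x) ^+ k.+1 * f' x).
Proof. by move=> hf; apply: (hdE (hd_posX k hf)) => x; ring. Qed.

(** The axial derivative of [f] is [b f'] and is continuous. *)
Lemma dfun_cont f f' : b != 0 -> df f f' -> continuous f'.
Proof.
move=> b0 hf; have -> : f' = fun x => b^-1 * (b * f' x).
  by apply/funext => x; rewrite mulKf.
by apply: contM; [exact: cont_cst|exact: hd_cont2 hf].
Qed.

End dfun.

End radial_functions.

Lemma hd_div1 (R : realType) n (P p1 p2 Q q1 q2 : 'rV[R]_n.+1 -> R) :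
  hd P p1 p2 -> hd Q q1 q2 -> csupp P -> csupp Q ->
  rint (lebesgue_rV R n.+1) (fun x => n%:R * P x + rr x * p1 x + q2 x) = 0.
Proof.
move=> hP hQ sP sQ; rewrite -[RHS](hd_div hP hQ sP sQ (@C1_cst _ _ 1)).2.
apply: rint_ext => x; rewrite dcst big1 => [|j _]; last by rewrite dcst mulr0.
by rewrite !mulr0 !addr0 mulr1.
Qed.

(** * The approximate ground state and its divergence identities *)

Section trial_functions.
Context {R : realType} (n : nat) (theta alpha : R).
Hypothesis th : 0 < theta < pi / 2.
Hypothesis alpha0 : 0 < alpha.
Local Notation leb := (lebesgue_rV R n.+1).
Local Notation T := ('rV[R]_n.+1).
Implicit Types (f g h : T -> R) (x : T).
Local Notation si := (sin theta).
Local Notation co := (cos theta).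

Let si0 : 0 < si := sin_theta_gt0 th.
Let co0 : 0 < co := cos_theta_gt0 th.
Let cs1 : co ^+ 2 + si ^+ 2 = 1 := cos2Dsin2 theta.
Let co2 : co ^+ 2 = 1 - si ^+ 2. Proof. by rewrite -cs1 addrK. Qed.
Let a := alpha / 2.
Let c : R := (n%:R - 1) / 2.

(* Signed distance to the cone and arclength along its generators. *)
Definition tc x : R := - co * rad x + si * x 0 ord_max.
Definition sc x : R := si * rad x + co * x 0 ord_max.

Lemma rad_ts x : rad x = si * sc x - co * tc x.
Proof. rewrite /sc /tc; move: (rad x) (x 0 ord_max) => r z; ring: co2. Qed.

Lemma z_ts x : x 0 ord_max = si * tc x + co * sc x.
Proof. rewrite /sc /tc; move: (rad x) (x 0 ord_max) => r z; ring: co2. Qed.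

Local Notation tdf := (@dfun R n (- co) si).
Local Notation sdf := (@dfun R n si co).

Lemma tdf_tc : tdf tc (fun=> 1). Proof. exact: dfun_lin. Qed.
Lemma sdf_sc : sdf sc (fun=> 1). Proof. exact: dfun_lin. Qed.

Section smoothing.
Variable k : nat.
Local Notation d := (@dl R k).

Definition targ x : R := d ^- 2 * tc x - d^-1.
Definition St x : R := tauq (targ x).
(** The primitive of [St] in the variable [tc]: a smoothed absolute value of the signed distance. *)
Definition Tt x : R := d ^+ 2 * Num.sqrt (1 + targ x ^+ 2).
Definition St1 x : R := (Num.sqrt (1 + targ x ^+ 2))^-1 ^+ 3 * d ^- 2.

Let d0 : 0 < d := dl_gt0 k.

Lemma tdf_targ : tdf targ (fun=> d ^- 2).
Proof.
by apply: (dfunE (dfunD (dfunZ (d ^- 2) tdf_tc) (dfun_cst n _ _ (- d^-1)))) => x; ring.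
Qed.

Lemma tdf_St : tdf St St1.
Proof. by apply: (hdE (hd_tauq tdf_targ)) => x; rewrite /St1; ring. Qed.

Lemma tdf_Tt : tdf Tt St.
Proof.
have h := hd_D (hd_cst n 1) (hd_M tdf_targ tdf_targ).
have p x : 0 < 1 + targ x * targ x by rewrite -expr2 tauq_pos.
have key x y : d ^+ 2 * ((2 * Num.sqrt (1 + targ x * targ x))^-1 *
    (0 + (y * d ^- 2 * targ x + targ x * (y * d ^- 2)))) = y * St x.
  rewrite /St /tauq expr2; have : Num.sqrt (1 + targ x * targ x) != 0 by rewrite gt_eqF// sqrtr_gt0.
  by move: (Num.sqrt _) => q q0; field; rewrite q0 gt_eqF.
by apply: (hdE (hd_Z (d ^+ 2) (hd_sqrt h p))) => x; rewrite key.
Qed.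

Lemma St_le1 x : `|St x| <= 1. Proof. exact: tauq_le1. Qed.

Lemma Tt_bounds x : 0 <= Tt x <= `|tc x| + 2.
Proof.
have d1 : d <= 1 := dl_le1 k.
rewrite /Tt mulr_ge0 ?sqr_ge0 ?sqrtr_ge0//=.
have h : Num.sqrt (1 + targ x ^+ 2) <= 1 + `|targ x|.
  have e : `|targ x| ^+ 2 = targ x ^+ 2 by rewrite real_normK ?num_real.
  have p := normr_ge0 (targ x).
  rewrite -[leRHS]ger0_norm ?addr_ge0// -[leRHS]sqrtr_sqr ler_wsqrtr//; move: e p; lra.
apply: (le_trans (ler_wpM2l (sqr_ge0 d) h)).
have -> : d ^+ 2 * (1 + `|targ x|) = d ^+ 2 + `|tc x - d|.
  rewrite mulrDr mulr1 -{2}(ger0_norm (sqr_ge0 d)) -normrM; congr (_ + `|_|).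
  by rewrite /targ; field; rewrite gt_eqF.
have := ler_normB (tc x) d; rewrite (gtr0_norm d0).
have : d ^+ 2 <= 1 by rewrite exprn_ile1// ltW.
lra.
Qed.

(** The loss is uniform in [k], as are the bounds on [Tt]; constants derived from them survive the
    choice of [k] at the end. *)
Lemma St_tc x : `|tc x| - 3 <= St x * tc x.
Proof.
have d1 : d <= 1 := dl_le1 k.
have h y : `|y| - 1 <= tauq y * y :> R.
  have q0 : 0 < Num.sqrt (1 + y ^+ 2) by rewrite sqrtr_gt0 tauq_pos.
  rewrite /tauq mulrAC -expr2 ler_pdivlMr//.
  have q1 : 1 <= Num.sqrt (1 + y ^+ 2) by rewrite -{1}sqrtr1 ler_wsqrtr// lerDl sqr_ge0.
  have q2 : Num.sqrt (1 + y ^+ 2) ^+ 2 = 1 + y ^+ 2 by rewrite sqr_sqrtr// ltW// tauq_pos.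
  have y2 : `|y| ^+ 2 = y ^+ 2 by rewrite real_normK ?num_real.
  move: (Num.sqrt _) q0 q1 q2 => q q0 q1 q2; have := normr_ge0 y => y0.
  have : (q - `|y|) ^+ 2 >= 0 by exact: sqr_ge0.
  nra.
have -> : tc x = d ^+ 2 * targ x + d by rewrite /targ; field; rewrite gt_eqF.
have := ler_wpM2l (sqr_ge0 d) (h (targ x)); rewrite -/(St x) => h1.
have := ler_normD (d ^+ 2 * targ x) d; rewrite normrM (ger0_norm (sqr_ge0 d)) (gtr0_norm d0) => h2.
have d2 : d ^+ 2 <= 1 by rewrite exprn_ile1// ltW.
have : - d <= St x * d.
  by have := St_le1 x; rewrite ler_norml => /andP[h3 _]; rewrite -mulN1r ler_wpM2r// ltW.
lra.
Qed.

Definition psi x : R := expR (- (c * ln (rad x)) - a * Tt x).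

Definition psi1 x : R := psi x * (- (c * ((rad x)^-1 * rad1 x)) + a * co * rad1 x * St x).

Lemma hd_psi : hd psi psi1 (fun x => - (psi x * (a * si * St x))).
Proof.
have h := hd_D (hd_N (hd_Z c (hd_ln (@hd_rad R n) (@rad_gt0 R n)))) (hd_N (hd_Z a tdf_Tt)).
by apply: (hdE (hd_exp h)) => x; rewrite /psi1 /psi; ring.
Qed.

Lemma psi_gt0 x : 0 < psi x. Proof. exact: expR_gt0. Qed.

Lemma psi_le1 x : (0 < n)%N -> 1 <= rad x -> psi x <= 1.
Proof.
move=> n0 r1; rewrite -expR0 ler_expR; have /andP[T0 _] := Tt_bounds x.
have := mulr_ge0 (ltW (divr_gt0 alpha0 (ltr0n R 2))) T0; rewrite -/a => h1.
have c0 : 0 <= c by rewrite divr_ge0// subr_ge0 ler1n.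
have := mulr_ge0 c0 (ln_ge0 r1); lra.
Qed.

End smoothing.

Section support.
Variables M L U : R.
Hypothesis M0 : 0 < M.
Hypothesis far : 2 + M <= si * L.

(** Profiles across the cone ([tf]) and along its generators ([sf]). By the hypothesis [far], a
    product of the two is supported where [rad] is at least 2, hence equal to |x'|. *)
Definition tf f f' := tdf f f' /\ forall x, M <= `|tc x| -> f x = 0 /\ f' x = 0.
Definition sf f f' := sdf f f' /\ forall x, ~~ (L < sc x < U) -> f x = 0 /\ f' x = 0.
Definition om x := `|tc x| < M /\ L < sc x < U.

Let si1 : si <= 1 := sin_le1 theta.
Let co1 : co <= 1 := cos_le1 theta.

Lemma om_rad x : `|tc x| < M -> L < sc x -> 2 <= rad x.
Proof.
move=> t1 s1; rewrite rad_ts; have := ler_norm (tc x).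
have := ltW s1; rewrite -(ler_pM2l si0) => h1 h2.
have : co * tc x <= M.
  have h3 : tc x <= M by rewrite (le_trans h2)// ltW.
  have := ler_wpM2l (ltW co0) h3; have := ler_piMl (ltW M0) co1; lra.
by move: far; lra.
Qed.

Lemma om_far x : `|tc x| < M -> L < sc x -> exists y,
  [/\ 0 < y, y <= 1, rr x * y ^+ 2 = 1, rad1 x = y & (rad x)^-1 = y].
Proof.
move=> t1 s1; have r2 := om_rad t1 s1.
have r1 : 1 < rad x by rewrite (lt_le_trans _ r2)// ltr1n.
have [_ rE rV] := rad_far r1; exists (rad x)^-1; split => //.
- by rewrite invr_gt0 (lt_trans ltr01).
- by rewrite invf_le1 ?ltW// (lt_trans ltr01).
- by rewrite -rE -exprMn divff ?expr1n// gt_eqF// (lt_trans ltr01).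
Qed.

Lemma far_rr x y : 0 < y -> rr x * y ^+ 2 = 1 -> rr x = y ^- 2.
Proof.
move=> y0 ry; have y2 : y ^+ 2 != 0 by rewrite expf_neq0 ?gt_eqF.
by apply: (mulIf y2); rewrite ry mulVf.
Qed.

Lemma om_bound x : om x -> forall i, `|x 0 i| <= M + (`|L| + `|U|).
Proof.
move=> [tM /andP[Ls sU]] i.
have sB : `|sc x| <= `|L| + `|U|.
  rewrite ler_norml; have := ler_norm (- L); have := ler_norm U; rewrite normrN.
  have := normr_ge0 L; have := normr_ge0 U; lra.
have bd (p q : R) : 0 < p -> 0 < q -> p <= 1 -> q <= 1 -> `|p| * `|sc x| + `|q| * `|tc x| <= M + (`|L| + `|U|).
  move=> p0 q0 p1 q1; rewrite (gtr0_norm p0) (gtr0_norm q0) addrC lerD//.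
    by rewrite (le_trans _ (ltW tM))// ler_piMl.
  by rewrite (le_trans _ sB)// ler_piMl.
case: (unliftP ord_max i) => [j|] ->.
  have r1 : 1 < rad x by rewrite (lt_le_trans _ (om_rad tM Ls))// ltr1n.
  have [_ rE _] := rad_far r1.
  apply: (@le_trans _ _ (rad x)).
    rewrite -[leRHS]ger0_norm ?(ltW (rad_gt0 x))// -[in leLHS]sqrtr_sqr -sqrtr_sqr ler_wsqrtr// rE.
    by rewrite /rr (bigD1 j)//= lerDl sumr_ge0// => m _; exact: sqr_ge0.
  apply: (le_trans _ (bd si co si0 co0 si1 co1)).
  by rewrite rad_ts (le_trans (ler_norm _))// (le_trans (ler_normB _ _))// !normrM.
rewrite z_ts addrC; apply: (le_trans _ (bd co si co0 si0 co1 si1)).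
by rewrite (le_trans (ler_normD _ _))// !normrM.
Qed.

Lemma csupp_om f : (forall x, ~ om x -> f x = 0) -> csupp f.
Proof.
move=> H; exists (M + (`|L| + `|U|)) => x i /= hx; apply: H => ox.
by move: hx; rewrite ltNge om_bound.
Qed.

Lemma tf_sf_om f f' h h' x : tf f f' -> sf h h' -> ~ om x ->
  (f x = 0 /\ f' x = 0) \/ (h x = 0 /\ h' x = 0).
Proof.
move=> [_ ft] [_ hs] ox; have [tM|tM] := leP M `|tc x|; first by left; exact: ft.
by right; apply: hs; apply/negP => H; apply: ox.
Qed.

Lemma csupp_tsM f f' h h' : tf f f' -> sf h h' -> csupp (fun x => f x * h x).
Proof.
by move=> hf hh; apply: csupp_om => x /(tf_sf_om hf hh)[[-> _]|[-> _]]; rewrite ?mul0r ?mulr0.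
Qed.

Section streams.
Variable k : nat.
Local Notation S := (St k).
Local Notation psi := (psi k).
Local Notation psi1 := (psi1 k).

Let omP f f' h h' x : tf f f' -> sf h h' ->
  (exists y, [/\ 0 < y, y <= 1, rr x * y ^+ 2 = 1, rad1 x = y & (rad x)^-1 = y]) \/
  ((f x = 0 /\ f' x = 0) \/ (h x = 0 /\ h' x = 0)).
Proof.
move=> hf hh; have [ox|ox] := pselect (om x); last by right; exact: tf_sf_om hf hh ox.
by left; case: ox => tM /andP[Ls _]; exact: om_far.
Qed.

(** Integrate the divergence of [psi^2 f h] times the unit field along the generators. That field
    has divergence [(n - 1) si / r], and [c = (n - 1) / 2] makes the factor [r^(- 2 c)] of [psi^2]
    compensate it, so only [h'] is left. *)
Lemma stream_s f f' h h' : tf f f' -> sf h h' ->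
  rint leb (fun x => psi x ^+ 2 * (f x * h' x)) = 0.
Proof.
move=> hf hh; have hV := hd_inv (@hd_rad R n) (fun x => lt0r_neq0 (rad_gt0 x)).
have hB := hd_M (hd_M (hd_psi k) (hd_psi k)) (hd_M hf.1 hh.1).
have sB : csupp (fun x => psi x * psi x * (f x * h x)).
  by apply: csuppMr; exact: csupp_tsM hf hh.
rewrite -[RHS](hd_div1 (hd_M hB (hd_Z si hV)) (hd_Z co hB)).
- apply: rint_ext => x; have [[y [y0 _ ry r1 rV]]|[[-> ->]|[-> ->]]] := omP x hf hh.
  + rewrite /trial_functions.psi1 r1 rV -exprVn rV /c.
    by rewrite (far_rr y0 ry); field: co2; rewrite gt_eqF.
  + ring.
  + ring.
- exact: csuppM.
- exact: csuppMr.
Qed.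

(** The same with the unit normal field. The curvature is again compensated, and the Gibbs factor
    [exp (- 2 a Tt)] contributes [- 2 a S f]. *)
Lemma stream_t f f' h h' : tf f f' -> sf h h' ->
  rint leb (fun x => psi x ^+ 2 * ((f' x - 2 * a * S x * f x) * h x)) = 0.
Proof.
move=> hf hh; have hV := hd_inv (@hd_rad R n) (fun x => lt0r_neq0 (rad_gt0 x)).
have hB := hd_M (hd_M (hd_psi k) (hd_psi k)) (hd_M hf.1 hh.1).
have sB : csupp (fun x => psi x * psi x * (f x * h x)).
  by apply: csuppMr; exact: csupp_tsM hf hh.
rewrite -[RHS](hd_div1 (hd_M hB (hd_Z (- co) hV)) (hd_Z si hB)).
- apply: rint_ext => x; have [[y [y0 _ ry r1 rV]]|[[-> ->]|[-> ->]]] := omP x hf hh.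
  + by rewrite /trial_functions.psi1 r1 rV -exprVn rV (far_rr y0 ry) /c; field: co2; rewrite gt_eqF.
  + ring.
  + ring.
- exact: csuppM.
- exact: csuppMr.
Qed.

Definition dt v x : R := - co * (rad x)^-1 * (\sum_j hx x j * 'D_('e_(lift ord_max j)) v x) +
  si * 'D_('e_ord_max) v x.

Definition ds v x : R := si * (rad x)^-1 * (\sum_j hx x j * 'D_('e_(lift ord_max j)) v x) +
  co * 'D_('e_ord_max) v x.

(* Where psi = exp (- G) with F = grad G: the components of grad v + v F along
   the normal of the cone and along its generators. *)
Definition ft v x : R := dt v x + (a * S x - c * co * (rad x)^-1) * v x.
Definition fs v x : R := ds v x + si * c * (rad x)^-1 * v x.

Let cV : continuous (fun x : T => (rad x)^-1) :=
  C1_cont (hd_C1 (hd_inv (@hd_rad R n) (fun x => lt0r_neq0 (rad_gt0 x)))).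
Let cc (r : R) : continuous (fun _ : T => r).
Proof. exact: cont_cst. Qed.
Let cS : continuous S := C1_cont (hd_C1 (tdf_St k)).
Let cpsi : continuous psi := C1_cont (hd_C1 (hd_psi k)).

Lemma cont_ft v : C1 v -> continuous (ft v) /\ continuous (fs v).
Proof.
move=> cv; have c1 := C1_cont cv; have c2 := C1_dcont (i := ord_max) cv.
have c3 : continuous (fun x => \sum_j hx x j * 'D_('e_(lift ord_max j)) v x).
  by apply: cont_sum => j; apply: contM; [exact: cont_coord|exact: C1_dcont].
split; apply: contD; rewrite ?/dt ?/ds.
- exact: contD (contM (contM (@cc (- co)) cV) c3) (contM (@cc si) c2).
- exact: contM (contD (contM (@cc a) cS) (contN (contM (@cc (c * co)) cV))) c1.
- exact: contD (contM (contM (@cc si) cV) c3) (contM (@cc co) c2).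
- exact: contM (contM (@cc (si * c)) cV) c1.
Qed.

Lemma trial_C1 f f' h h' : tf f f' -> sf h h' ->
  C1 (fun x => psi x * (f x * h x)) /\ csupp (fun x => psi x * (f x * h x)).
Proof.
move=> hf hh; split; first exact: hd_C1 (hd_M (hd_psi k) (hd_M hf.1 hh.1)).
by apply: csuppMr; exact: csupp_tsM hf hh.
Qed.

(** The two integrands differ by the divergence of [u v (beta S e_d - F)], in which the derivative
    of [S] cancels. Since [grad psi = - psi F], [grad u + u F] is [psi grad (f h)], which explains
    the first product; smoothing costs [a^2 (1 - S^2)]. *)
Lemma ground_state f f' h h' v : tf f f' -> sf h h' -> C1 v ->
  let u x := psi x * (f x * h x) in
  rint leb (fun x => \sum_i 'D_('e_i) u x * 'D_('e_i) v x +
    a / si * (S x * ('D_('e_ord_max) u x * v x + u x * 'D_('e_ord_max) v x)) +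
    a ^+ 2 * (u x * v x)) =
  rint leb (fun x => psi x * (f' x * h x * ft v x + f x * h' x * fs v x) +
    c * (n%:R - 2 - c) * (rad x)^-1 ^+ 2 * (u x * v x) + a ^+ 2 * ((1 - S x ^+ 2) * (u x * v x))).
Proof.
move=> hf hh cv u; have hV := hd_inv (@hd_rad R n) (fun x => lt0r_neq0 (rad_gt0 x)).
have hu := hd_M (hd_psi k) (hd_M hf.1 hh.1).
have su : csupp u by apply: csuppMr; exact: csupp_tsM hf hh.
have hP := hd_M hu (hd_D (hd_Z (- c) (hd_M hV hV)) (hd_Z (a * co) (hd_M (tdf_St k) hV))).
have hQ := hd_Z (a / si - a * si) (hd_M hu (tdf_St k)).
have [Idv dv0] := hd_div hP hQ (csuppM _ su) (csuppMr _ (csuppM _ su)) cv.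
set dv := (fun x => _) in Idv dv0.
set B := (fun x => psi x * _ + _ + _).
have [cft cfs] := cont_ft cv; have c1 := C1_cont cv; have cu := C1_cont (hd_C1 hu).
have cf := C1_cont (hd_C1 hf.1); have ch := C1_cont (hd_C1 hh.1).
have cf' := dfun_cont (lt0r_neq0 si0) hf.1; have ch' := dfun_cont (lt0r_neq0 co0) hh.1.
have IB : intg leb B.
  apply/intg_bm/bm_cont.
    apply: contD; first apply: contD.
    - exact: contM cpsi (contD (contM (contM cf' ch) cft) (contM (contM cf ch') cfs)).
    - exact: contM (contM (@cc (c * (n%:R - 2 - c))) (contX (k := 2) cV)) (contM cu c1).
    - exact: contM (@cc (a ^+ 2)) (contM (contD (@cc 1) (contN (contX (k := 2) cS))) (contM cu c1)).
  apply: csupp_om => x /(tf_sf_om hf hh)[[e1 e2]|[e1 e2]]; rewrite /B /u e1 e2; ring.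
transitivity (rint leb B + rint leb dv); last by rewrite dv0 addr0.
rewrite -(rintD IB Idv); apply: rint_ext => x.
have [_ du] := hu; rewrite sum_lift.
rewrite (eq_bigr (fun j => (psi1 x * (f x * h x) + psi x *
    (- co * rad1 x * f' x * h x + f x * (si * rad1 x * h' x))) *
    (hx x j * 'D_('e_(lift ord_max j)) v x))) => [|j _]; last first.
  by rewrite (du x).1; ring.
rewrite -mulr_sumr (du x).2 /B /dv /u /ft /fs /dt /ds.
move: (\sum_(j < n) _) ('D_('e_ord_max) v x) => X Z.
rewrite /trial_functions.psi1.
have [[y [y0 _ ry r1 rV]]|[[-> ->]|[-> ->]]] := omP x hf hh; [|by ring|by ring].
rewrite r1 -exprVn rV (far_rr y0 ry) /c; field: co2; by rewrite !gt_eqF.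
Qed.

(** Integration by parts along the generators: in [fs] the zeroth-order term is exactly what makes
    the weight [psi] drop out. *)
Lemma stream_w f f' h h' h'' v : tf f f' -> sf h h' -> sf h' h'' -> C1 v ->
  rint leb (fun x => psi x * (f x * h' x * fs v x)) =
  - rint leb (fun x => psi x * (f x * h'' x) * v x).
Proof.
move=> hf hh hh' cv; have hV := hd_inv (@hd_rad R n) (fun x => lt0r_neq0 (rad_gt0 x)).
have hB := hd_M (hd_psi k) (hd_M hf.1 hh'.1).
have sB : csupp (fun x => psi x * (f x * h' x)) by apply: csuppMr; exact: csupp_tsM hf hh'.
have [Idv dv0] := hd_div (hd_M hB (hd_Z si hV)) (hd_Z co hB) (csuppM _ sB) (csuppMr _ sB) cv.
set dv := (fun x => _) in Idv dv0.
set A := (fun x => _ * v x).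
have cf := C1_cont (hd_C1 hf.1); have ch'' := dfun_cont (lt0r_neq0 co0) hh'.1.
have IA : intg leb A.
  apply/intg_bm/bm_cont; first exact: contM (contM cpsi (contM cf ch'')) (C1_cont cv).
  by apply/csuppM/csuppMr/csupp_om => x /(tf_sf_om hf hh')[[-> _]|[_ ->]]; rewrite ?mul0r ?mulr0.
transitivity (rint leb (fun x => - A x) + rint leb dv); last by rewrite dv0 addr0 rintN.
rewrite -(rintD (intgN IA) Idv); apply: rint_ext => x.
rewrite /A /dv /fs /ds; move: (\sum_(j < n) _) ('D_('e_ord_max) v x) => X Z.
rewrite /trial_functions.psi1.
have [[y [y0 _ ry r1 rV]]|[[-> ->]|[-> ->]]] := omP x hf hh'; [|by ring|by ring].
rewrite r1 -exprVn rV (far_rr y0 ry) /c; field: co2; by rewrite !gt_eqF.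
Qed.

Definition Pm x : R := pos (1 - (M^-1 * tc x) ^+ 2).

Lemma Pm_ge0 x : 0 <= Pm x. Proof. exact: pos_ge0. Qed.

Lemma Pm0 x : M <= `|tc x| -> Pm x = 0.
Proof.
move=> Mt; apply: pos0; rewrite subr_le0 -real_normK ?num_real// normrM gtr0_norm ?invr_gt0//.
by rewrite exprn_ege1// ler_pdivlMl// mulr1.
Qed.

(** Trades one power of the cutoff for a factor [(t / M)^2]. *)
Lemma Pm_split j x : Pm x ^+ j.+1 = Pm x ^+ j.+2 + M^-1 ^+ 2 * tc x ^+ 2 * Pm x ^+ j.+1.
Proof.
have [p0|p0] := leP (1 - (M^-1 * tc x) ^+ 2) 0.
  by rewrite /Pm (pos0 p0) !expr0n/= mulr0 addr0.
rewrite [Pm x ^+ j.+2]exprS -mulrDl /Pm posE ?(ltW p0)// -exprMn subrK mul1r//.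
Qed.

Lemma tf_Pm j : tf (fun x => Pm x ^+ j.+2)
  (fun x => - (j.+2%:R * Pm x ^+ j.+1 * (2 * M^-1 ^+ 2 * tc x))).
Proof.
split=> [|x /Pm0 ->]; last by rewrite !expr0n/= mulr0 mul0r oppr0.
have h := dfunZ M^-1 tdf_tc.
have h2 := dfunD (dfun_cst n (- co) si 1) (dfunZ (-1) (dfunM h h)).
have -> : (fun x => Pm x ^+ j.+2) =
    fun x => pos (1 + -1 * (M^-1 * tc x * (M^-1 * tc x))) ^+ j.+2.
  by apply/funext => x; rewrite /Pm mulN1r expr2.
apply: (dfunE (dfun_posX j h2)) => x; rewrite /Pm mulN1r -expr2.
by move: (pos _) => p; ring.
Qed.

Lemma tf_t3Pm j : tf (fun x => tc x ^+ 3 * Pm x ^+ j.+2)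
  (fun x => 3 * tc x ^+ 2 * Pm x ^+ j.+2 -
     tc x ^+ 3 * (j.+2%:R * Pm x ^+ j.+1 * (2 * M^-1 ^+ 2 * tc x))).
Proof.
have [h hv] := tf_Pm j; split=> [|x Mt].
  apply: (dfunE (dfunM (dfunM tdf_tc (dfunM tdf_tc tdf_tc)) h)) => x.
  by move: (Pm x) (tc x) => p t; ring.
by rewrite (Pm0 Mt) !expr0n/= !mulr0 !mul0r mulr0 subr0.
Qed.

Let ctc : continuous tc := C1_cont (hd_C1 tdf_tc).

Lemma cont_Pm : continuous Pm.
Proof.
apply: (@cont_comp _ _ _ (fun x => 1 - (M^-1 * tc x) ^+ 2)) => [|x]; last exact: cont_pos.
exact: contD (@cc 1) (contN (contX (k := 2) (contM (@cc M^-1) ctc))).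
Qed.

Lemma intg_stream f h : continuous f -> continuous h ->
  (forall x, M <= `|tc x| -> f x = 0) -> (forall x, ~~ (L < sc x < U) -> h x = 0) ->
  intg leb (fun x => psi x ^+ 2 * (f x * h x)).
Proof.
move=> cf ch f0 h0; apply/intg_bm/bm_cont; first exact: contM (contX (k := 2) cpsi) (contM cf ch).
apply: csupp_om => x ox; have [tM|tM] := leP M `|tc x|; first by rewrite f0// mul0r mulr0.
by rewrite h0 ?mulr0//; apply/negP => ?; apply: ox.
Qed.

Let A := 2 * a.
Let B := 6 * a + 4.
(** With this constant [2 a |t|^3] dominates [(6 a + 4) t^2 - tail_cst]. Of the coefficient, [6 a]
    pays for the loss in [St_tc], 3 for the derivative of [t^3], and 1 is the term to be
    estimated. *)
Definition tail_cst : R := B ^+ 3 / A ^+ 2.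

Let a0 : 0 < a. Proof. by rewrite divr_gt0. Qed.

Lemma tail_cst_ge0 : 0 <= tail_cst.
Proof. by rewrite divr_ge0 ?sqr_ge0// exprn_ge0// addr_ge0// mulr_ge0// ltW. Qed.

Lemma cubic_bound (t : R) : 0 <= t -> B * t ^+ 2 - tail_cst <= A * t ^+ 3.
Proof.
move=> t0; have A0 : 0 < A by rewrite mulr_gt0.
have B0 : 0 < B by rewrite /B; have := a0; lra.
have [h|h] := leP B (A * t).
  have := ler_wpM2r (sqr_ge0 t) h; have := tail_cst_ge0; lra.
have : t ^+ 2 <= (B / A) ^+ 2.
  by rewrite lerXn2r ?nnegrE ?divr_ge0 ?(ltW A0) ?(ltW B0)// ler_pdivlMr// mulrC ltW.
rewrite -(ler_pM2l B0) => h2.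
have -> : tail_cst = B * (B / A) ^+ 2 by rewrite /tail_cst; field; rewrite gt_eqF.
have := mulr_ge0 (ltW A0) (exprn_ge0 3 t0); lra.
Qed.

(** Exponential decay across the cone, used without explicit integration: [stream_t] applied to
    [t^3 Pm^(j+2)] bounds a second moment in [t] by the mass. *)
Lemma tail_step j h h' : sf h h' -> (forall x, 0 <= h x) ->
  rint leb (fun x => psi x ^+ 2 * (tc x ^+ 2 * Pm x ^+ j.+1 * h x)) <=
  tail_cst * rint leb (fun x => psi x ^+ 2 * (Pm x ^+ j.+2 * h x)).
Proof.
move=> hh h0; have ch := C1_cont (hd_C1 hh.1); have vh x H := (hh.2 x H).1.
have I1 : intg leb (fun x => psi x ^+ 2 * (tc x ^+ 2 * Pm x ^+ j.+1 * h x)).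
  apply: intg_stream => // [|x /Pm0 ->]; last by rewrite expr0n/= mulr0.
  exact: contM (contX (k := 2) ctc) (contX (k := j.+1) cont_Pm).
have I2 : intg leb (fun x => psi x ^+ 2 * (Pm x ^+ j.+2 * h x)).
  apply: intg_stream => // [|x /Pm0 ->]; last by rewrite expr0n.
  exact: contX cont_Pm.
have tf3 := tf_t3Pm j; have := stream_t tf3 hh.
set F := (fun x => psi x ^+ 2 * ((_ - _ - _) * _)) => F0.
have IF : intg leb F.
  apply: (intg_stream (f := fun x => _ - _ - 2 * a * S x * (tc x ^+ 3 * Pm x ^+ j.+2))) => // [|x Mt]; last first.
    by have [-> ->] := tf3.2 x Mt; rewrite mulr0 subr0.
  apply: contD; first exact: dfun_cont (lt0r_neq0 si0) tf3.1.
  exact: contN (contM (contM (@cc (2 * a)) cS) (C1_cont (hd_C1 tf3.1))).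
rewrite -subr_le0 -rintZ// -(rintB I1 (intgZ _ I2)).
rewrite -[leRHS]oppr0 -[in leRHS]F0 -(rintN IF).
apply: rint_le; [exact: intgB I1 (intgZ _ I2)|exact: intgN|move=> x].
rewrite /F; have := Pm_split j x; have := St_tc k x; have := cubic_bound (normr_ge0 (tc x)).
have := Pm_ge0 x; have := h0 x.
have -> : `|tc x| ^+ 2 = tc x ^+ 2 by rewrite real_normK ?num_real.
have := sqr_ge0 (psi x); move: (psi x ^+ 2) (S x) (tc x) (Pm x) (h x) => p s t P y.
move=> p0 y0 P0 cb St Ps.
suff E : t ^+ 2 * P ^+ j.+1 - tail_cst * P ^+ j.+2 <=
   - (3 * t ^+ 2 * P ^+ j.+2 - t ^+ 3 * (j.+2%:R * P ^+ j.+1 * (2 * M^-1 ^+ 2 * t)) -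
     2 * a * s * (t ^+ 3 * P ^+ j.+2)).
  by have := ler_wpM2l (mulr_ge0 p0 y0) E; lra.
have Q1 : 0 <= P ^+ j.+1 by exact: exprn_ge0.
have Q2 : 0 <= P ^+ j.+2 by exact: exprn_ge0.
move: (P ^+ j.+1) (P ^+ j.+2) Ps Q1 Q2 => P1 P2 Ps Q1 Q2.
have e1 : t ^+ 2 * P1 = t ^+ 2 * P2 + M^-1 ^+ 2 * t ^+ 4 * P1 by rewrite {1}Ps; ring.
have e2 : M^-1 ^+ 2 * t ^+ 4 * P1 <= t ^+ 3 * (j.+2%:R * P1 * (2 * M^-1 ^+ 2 * t)).
  have z : 0 <= M^-1 ^+ 2 * t ^+ 4 * P1.
    exact: (mulr_ge0 (mulr_ge0 (sqr_ge0 _) (exprn_even_ge0 (n := 4) t isT)) Q1).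
  have : 1 <= 2 * j.+2%:R :> R by rewrite -natrM ler1n.
  by move=> /(ler_wpM2r z); lra.
have e3 : (t ^+ 2 - tail_cst) * P2 <= (2 * a * (s * t ^+ 3) - 3 * t ^+ 2) * P2.
  apply: ler_wpM2r => //.
  have := ler_wpM2r (sqr_ge0 t) St; have := a0; rewrite /A /B in cb.
  move=> a1 h1; have := ler_wpM2l (ltW a1) h1; move: cb.
  have -> : `|t| ^+ 3 = `|t| * t ^+ 2 by rewrite exprS real_normK ?num_real.
  lra.
lra.
Qed.

(** The left-hand side is the energy of the transverse cutoff [Pm^2]. Two tail steps are needed,
    because the first one yields the power 3 of [Pm] and [Pm_split] restores the power 4. The gain
    [M^(- 4)] suffices for the scales used later. *)
Lemma tail_bound h h' : 1 <= M -> sf h h' -> (forall x, 0 <= h x) ->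
  rint leb (fun x => psi x ^+ 2 * ((2 * Pm x * (2 * M^-1 ^+ 2 * tc x)) ^+ 2 * h x)) <=
  16 * tail_cst * (1 + tail_cst) * M^-1 ^+ 4 * rint leb (fun x => psi x ^+ 2 * (Pm x ^+ 4 * h x)).
Proof.
move=> M1 hh h0; have t1 := tail_step 1 hh h0; have t2 := tail_step 2 hh h0.
have ch := C1_cont (hd_C1 hh.1); have vh x H := (hh.2 x H).1.
have I1 : intg leb (fun x => psi x ^+ 2 * (tc x ^+ 2 * Pm x ^+ 2 * h x)).
  apply: intg_stream => // [|x /Pm0 ->]; last by rewrite expr0n/= mulr0.
  exact: contM (contX (k := 2) ctc) (contX (k := 2) cont_Pm).
have I2 : intg leb (fun x => psi x ^+ 2 * (tc x ^+ 2 * Pm x ^+ 3 * h x)).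
  apply: intg_stream => // [|x /Pm0 ->]; last by rewrite expr0n/= mulr0.
  exact: contM (contX (k := 2) ctc) (contX (k := 3) cont_Pm).
have I3 : intg leb (fun x => psi x ^+ 2 * (Pm x ^+ 4 * h x)).
  apply: intg_stream => // [|x /Pm0 ->]; last by rewrite expr0n.
  exact: contX cont_Pm.
have t3 : rint leb (fun x => psi x ^+ 2 * (Pm x ^+ 3 * h x)) =
    rint leb (fun x => psi x ^+ 2 * (Pm x ^+ 4 * h x)) +
    M^-1 ^+ 2 * rint leb (fun x => psi x ^+ 2 * (tc x ^+ 2 * Pm x ^+ 3 * h x)).
  rewrite -rintZ// -rintD//; last exact: intgZ.
  by apply: rint_ext => x; rewrite [in LHS](Pm_split 2); ring.
have -> : rint leb (fun x => psi x ^+ 2 * ((2 * Pm x * (2 * M^-1 ^+ 2 * tc x)) ^+ 2 * h x)) =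
    16 * M^-1 ^+ 4 * rint leb (fun x => psi x ^+ 2 * (tc x ^+ 2 * Pm x ^+ 2 * h x)).
  by rewrite -rintZ//; apply: rint_ext => x; ring.
have C0 := tail_cst_ge0; rewrite t3 in t1.
set X := rint leb (fun x => psi x ^+ 2 * (Pm x ^+ 4 * h x)) in t1 t2 t3 *.
have m4 : 0 <= 16 * M^-1 ^+ 4 by rewrite mulr_ge0// exprn_ge0// invr_ge0 ltW.
rewrite (_ : 16 * tail_cst * (1 + tail_cst) * M^-1 ^+ 4 * X =
  16 * M^-1 ^+ 4 * (tail_cst * (X + tail_cst * X))); last by ring.
apply: ler_wpM2l => //; apply: le_trans t1 _; apply: ler_wpM2l => //; rewrite lerD2l.
apply: le_trans t2; apply: ler_piMl.
  apply: rint_ge0 => x; rewrite mulr_ge0 ?sqr_ge0// mulr_ge0// mulr_ge0 ?sqr_ge0// exprn_ge0//.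
  exact: Pm_ge0.
by rewrite exprn_ile1 ?invr_ge0 ?invf_le1// ltW.
Qed.

End streams.

End support.

End trial_functions.

(** * Logarithmic cutoffs along the generators *)

Section generator_cutoffs.
Context {R : realType} (n : nat) (theta alpha : R).
Hypothesis th : 0 < theta < pi / 2.
Hypothesis alpha0 : 0 < alpha.
Local Notation leb := (lebesgue_rV R n.+1).
Local Notation T := ('rV[R]_n.+1).
Implicit Types (f g h : T -> R) (x : T).
Local Notation si := (sin theta).
Local Notation co := (cos theta).

Let si0 : 0 < si := sin_theta_gt0 th.
Let co0 : 0 < co := cos_theta_gt0 th.
Let a := alpha / 2.
Let c : R := (n%:R - 1) / 2.

Local Notation sc := (@sc R n theta).
Local Notation tc := (@tc R n theta).
Local Notation sdf := (@dfun R n si co).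

Variables M L w : R.
Hypothesis M0 : 0 < M.
Hypothesis far : 2 + M <= si * L.
Hypothesis w0 : 0 < w.
Hypothesis L1 : 1 <= L.
Let U := L * expR (2 * w).
Local Notation tf := (@tf R n theta M).
Local Notation sf := (@sf R n theta L U).

(* The cutoff in the logarithmic variable ex, which maps ]L, U[ onto ]-1, 1[. *)
Definition Vs x : R := (lft (sc x))^-1.
Definition ex x : R := w^-1 * (ln (lft (sc x)) - ln L - w).
Definition Xs x : R := pos (1 - ex x ^+ 2).

Lemma Xs_ge0 x : 0 <= Xs x. Proof. exact: pos_ge0. Qed.
Lemma Xs_le1 x : Xs x <= 1. Proof. by rewrite ge_max ler01 gerBl sqr_ge0. Qed.

Lemma Xs_supp x : 0 < Xs x -> L < sc x < U.
Proof.
rewrite /Xs /pos lt_max ltxx/= subr_gt0 => e1.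
have L0 : 0 < L := lt_le_trans ltr01 L1.
have : -1 < ex x < 1.
  rewrite -ltr_norml -(@ltr_pXn2r _ 2) ?nnegrE//.
  by rewrite real_normK ?num_real// expr1n.
rewrite /ex mulrC ltr_pdivlMr// ltr_pdivrMr// => /andP[l1 l2].
have lp := lft_gt0 (sc x).
have g1 : ln L < ln (lft (sc x)) by move: l1; lra.
have g2 : ln (lft (sc x)) < ln L + 2 * w by move: l2; lra.
rewrite ltr_ln ?posrE// in g1.
have g3 : lft (sc x) < U.
  by rewrite -ltr_ln ?posrE ?mulr_gt0 ?expR_gt0// lnM ?posrE ?expR_gt0// expRK.
have [s1|/ltW s1] := leP 1 (sc x); first by rewrite -(lft_id s1).1 g1 g3.
by move: g1; rewrite ltNge (le_trans _ L1)//; have /andP[] := lft_below s1.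
Qed.

Lemma Xs_cases x : Xs x = 0 \/
  [/\ L < sc x < U, lft (sc x) = sc x, lft1 (sc x) = 1 & ex x ^+ 2 = 1 - Xs x].
Proof.
have [p0|p0] := leP (Xs x) 0; first by left; apply/eqP; rewrite eq_le p0 Xs_ge0.
have H := Xs_supp p0; have /andP[Ls _] := H; right.
have [l0 l1] := lft_id (le_trans L1 (ltW Ls)); split=> //.
by move: p0; rewrite /Xs /pos lt_max ltxx/= => p1; rewrite (max_idPr (ltW p1)); ring.
Qed.

Lemma Xs0 x : ~~ (L < sc x < U) -> Xs x = 0.
Proof. by move=> /negP H; have [//|[H' _ _ _]] := Xs_cases x. Qed.

Lemma sfM f f' g g' : sf f f' -> sdf g g' ->
  sf (fun x => f x * g x) (fun x => f' x * g x + f x * g' x).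
Proof.
move=> [hf vf] hg; split=> [|x /vf[-> ->]]; first exact: dfunM.
by rewrite !mul0r addr0.
Qed.

Lemma sfE f f' g g' : sf f f' -> f =1 g -> f' =1 g' -> sf g g'.
Proof. by move=> h /funext <- /funext <-. Qed.

Lemma sdf_lft : sdf (fun x => lft (sc x)) (fun x => lft1 (sc x)).
Proof. by apply: (hdE (hd_lft (sdf_sc n theta))) => x; ring. Qed.

Lemma sdf_Vs : sdf Vs (fun x => - Vs x ^+ 2 * lft1 (sc x)).
Proof.
apply: (hdE (hd_inv sdf_lft (fun x => lt0r_neq0 (lft_gt0 (sc x))))) => x; rewrite /Vs exprVn; ring.
Qed.

Lemma sdf_ex : sdf ex (fun x => w^-1 * (Vs x * lft1 (sc x))).
Proof.
have h := hd_Z w^-1 (hd_D (hd_ln sdf_lft (fun x => lft_gt0 (sc x))) (hd_cst n (- ln L - w))).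
have -> : ex = fun x => w^-1 * (ln (lft (sc x)) + (- ln L - w)).
  by apply/funext => x; rewrite /ex addrA.
by apply: (hdE h) => x; rewrite /Vs; ring.
Qed.

Lemma sf_Xs j : sf (fun x => Xs x ^+ j.+2)
  (fun x => - (j.+2%:R * Xs x ^+ j.+1 * (2 * w^-1 * (ex x * Vs x)))).
Proof.
split=> [|x /Xs0 ->]; last by rewrite !expr0n/= mulr0 mul0r oppr0.
have h2 := dfunD (dfun_cst n si co 1) (dfunZ (-1) (dfunM sdf_ex sdf_ex)).
have -> : (fun x => Xs x ^+ j.+2) = fun x => pos (1 + -1 * (ex x * ex x)) ^+ j.+2.
  by apply/funext => x; rewrite /Xs mulN1r expr2.
apply: (dfunE (dfun_posX j h2)) => x; rewrite mulN1r -expr2 -/(Xs x).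
by have [->|[_ _ -> _]] := Xs_cases x; rewrite ?expr0n/=; ring.
Qed.

Lemma sf_exXs j : sf (fun x => ex x * Xs x ^+ j.+2)
  (fun x => w^-1 * Vs x * ((2 * j.+2%:R + 1) * Xs x ^+ j.+2 - 2 * j.+2%:R * Xs x ^+ j.+1)).
Proof.
apply: (sfE (sfM (sf_Xs j) sdf_ex)) => x; first by rewrite mulrC.
have [->|[_ _ -> e2]] := Xs_cases x; first by rewrite !expr0n/=; ring.
have -> : Xs x ^+ j.+2 = (1 - ex x ^+ 2) * Xs x ^+ j.+1 by rewrite e2 exprS; ring.
ring.
Qed.

Lemma cont_Vs : continuous Vs. Proof. exact: C1_cont (hd_C1 sdf_Vs). Qed.

Lemma cont_Xs : continuous Xs.
Proof.
apply: (@cont_comp _ _ _ (fun x => 1 - ex x ^+ 2)) => [|x]; last exact: cont_pos.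
apply: contD; first exact: cont_cst.
exact: contN (contX (k := 2) (C1_cont (hd_C1 sdf_ex))).
Qed.

Section weights.
Variable k : nat.
Local Notation psi := (@psi R n theta alpha k).
Local Notation Pm := (@Pm R n theta M).

(** By [stream_s] the weight behaves as ds / s, that is, as a multiple of Lebesgue measure in the
    variable [ex]; [Wt j] is thus proportional to the integral of (1 - y^2)^j over [-1, 1]. *)
Definition Wt j : R := rint leb (fun x => psi x ^+ 2 * (Pm x ^+ 4 * (Vs x * Xs x ^+ j))).

Lemma intg_Wt j : intg leb (fun x => psi x ^+ 2 * (Pm x ^+ 4 * (Vs x * Xs x ^+ j.+1))).
Proof.
apply: (@intg_stream _ _ _ alpha th M L U M0 far) => [||x /(Pm0 M0) ->|x /Xs0 ->].
- exact: contX (@cont_Pm _ _ _ _).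
- exact: contM cont_Vs (contX (k := j.+1) cont_Xs).
- by rewrite expr0n.
- by rewrite expr0n/= mulr0.
Qed.

Lemma Wt_step j : 2 * j.+2%:R * Wt j.+1 = (2 * j.+2%:R + 1) * Wt j.+2.
Proof.
have := stream_s alpha th M0 far k (tf_Pm n theta M0 2) (sf_exXs j).
set F := (fun x => _) => F0.
apply/eqP; rewrite eq_sym -subr_eq0 /Wt -!rintZ; [|exact: intg_Wt|exact: intg_Wt].
rewrite -rintB; [|exact: intgZ (intg_Wt _)|exact: intgZ (intg_Wt _)].
rewrite (_ : (fun x => _) = fun x => w * F x); last first.
  by apply/funext => x; rewrite /F; field; rewrite gt_eqF.
have [e|e] := pselect (intg leb F); first by rewrite rintZ// F0 mulr0.
case: e; rewrite (_ : F = fun x => w^-1 * ((2 * j.+2%:R + 1) *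
   (psi x ^+ 2 * (Pm x ^+ 4 * (Vs x * Xs x ^+ j.+2))) - 2 * j.+2%:R *
   (psi x ^+ 2 * (Pm x ^+ 4 * (Vs x * Xs x ^+ j.+1))))).
  by apply/intgZ/intgB; apply: intgZ; exact: intg_Wt.
by apply/funext => x; rewrite /F; ring.
Qed.

End weights.

Lemma point_ex (s : R) : (0 < n)%N -> 1 <= si * s -> exists x : T, tc x = 0 /\ sc x = s.
Proof.
move=> n0 s1; pose j0 : 'I_n := Ordinal n0.
pose x : T := \row_i (if i == ord_max then co * s else if i == lift ord_max j0 then si * s else 0).
have rE : rr x = (si * s) ^+ 2.
  rewrite /rr (bigD1 j0)//= big1 ?addr0 => [|j jn0].
    by rewrite /hx mxE eq_sym (negbTE (neq_lift _ _)) eqxx.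
  rewrite /hx mxE eq_sym (negbTE (neq_lift _ _)) (inj_eq lift_inj) (negbTE jn0).
  by rewrite expr0n.
have radE : rad x = si * s.
  have r1 : 1 <= rr x by rewrite rE exprn_ege1.
  by rewrite /rad (lft_id r1).1 rE sqrtr_sqr ger0_norm// (le_trans ler01).
have zE : x 0 ord_max = co * s by rewrite mxE eqxx.
have tE : tc x = - co * rad x + si * x 0 ord_max by [].
have sE : sc x = si * rad x + co * x 0 ord_max by [].
exists x; rewrite tE sE radE zE; split; first ring.
rewrite mulrA -expr2 [co * _]mulrA -expr2 -mulrDl addrC cos2Dsin2 mul1r//.
Qed.

(** Replacing [Tt] by its bound [|tc| + 2] gives a lower bound free of [k]. It lets the smoothing
    error, which tends to 0 with [k], be made small relative to the mass. *)
Lemma Wt_lower j : (0 < n)%N -> exists2 e : R, 0 < e & forall k, e <= Wt k j.+1.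
Proof.
move=> n0; pose ps x : R := expR (- (c * ln (rad x)) - a * (`|tc x| + 2)).
have psk k x : 0 <= ps x <= psi theta alpha k x.
  rewrite expR_ge0/= ler_expR lerD2l lerN2 ler_wpM2l ?divr_ge0 ?(ltW alpha0)//.
  by have /andP[] := Tt_bounds theta k x.
pose F x : R := ps x ^+ 2 * (Pm theta M x ^+ 4 * (Vs x * Xs x ^+ j.+1)).
have V0 x : 0 < Vs x by rewrite invr_gt0 lft_gt0.
have F1 x : 0 <= Pm theta M x ^+ 4 * (Vs x * Xs x ^+ j.+1).
  exact: mulr_ge0 (exprn_ge0 4 (Pm_ge0 _ _ x)) (mulr_ge0 (ltW (V0 x)) (exprn_ge0 _ (Xs_ge0 x))).
have F0 x : 0 <= F x by rewrite mulr_ge0 ?sqr_ge0.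
have Fle k x : F x <= psi theta alpha k x ^+ 2 * (Pm theta M x ^+ 4 * (Vs x * Xs x ^+ j.+1)).
  by rewrite ler_wpM2r//; have /andP[p0 p1] := psk k x; rewrite lerXn2r ?nnegrE// (le_trans p0).
have cF : continuous F.
  apply: contM; last first.
    apply: contM; first exact: contX (@cont_Pm _ _ _ _).
    exact: contM cont_Vs (contX (k := j.+1) cont_Xs).
  apply: contX; apply: (cont_comp (p := @expR R)) => [|y]; last exact: continuous_expR.
  apply: contD; apply: contN; apply: contM; try exact: cont_cst.
    exact: C1_cont (hd_C1 (hd_ln (@hd_rad R n) (@rad_gt0 R n))).
  apply: contD; last exact: cont_cst.
  apply: (cont_comp (p := Num.norm)) => [|y]; last exact: norm_continuous.
  exact: C1_cont (hd_C1 (tdf_tc n theta)).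
have IF : intg leb F.
  by apply: (intg_dom (continuous_meas cF) _ (intg_Wt 0 j)) => x; rewrite ger0_norm.
exists (rint leb F); last by move=> k; apply: rint_le (Fle k); [exact: IF|exact: intg_Wt].
rewrite lt_neqAle rint_ge0// andbT eq_sym; apply/eqP => r0.
have L0 : 0 < L := lt_le_trans ltr01 L1.
have E1 : 1 <= expR w by rewrite -expR0 ler_expR ltW.
have s1 : 1 <= si * (L * expR w).
  rewrite mulrA; apply: (@le_trans _ _ (si * L)); first by move: far M0; lra.
  by rewrite ler_peMr// mulr_ge0 ?ltW.
have [x [t0 sE]] := point_ex n0 s1.
have Ls : 1 <= L * expR w by rewrite mulr_ege1.
have e0 : ex x = 0.
  by rewrite /ex sE (lft_id Ls).1 lnM ?posrE ?expR_gt0// expRK; field; rewrite gt_eqF.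
have := rint_cont_eq0 cF F0 IF r0 x; apply/eqP; rewrite gt_eqF//.
rewrite /F mulr_gt0 ?exprn_gt0 ?expR_gt0//.
rewrite /Pm t0 mulr0 expr0n/= subr0 posE// expr1n mul1r.
by rewrite /Xs e0 expr0n/= subr0 posE// expr1n mulr1.
Qed.

End generator_cutoffs.

(** * Cauchy-Schwarz and elementary inequalities *)

Lemma rint_CS d (X : measurableType d) (R : realType) (mu : {measure set X -> \bar R})
    (F W V : X -> R) : intg mu F -> intg mu W -> intg mu V -> (forall x, 0 <= W x) ->
  (forall x, 0 <= V x) -> (forall x, F x ^+ 2 <= W x * V x) ->
  (rint mu F) ^+ 2 <= rint mu W * rint mu V.
Proof.
move=> IF IW IV W0 V0 H; apply: quad_disc; [exact: rint_ge0|exact: rint_ge0|move=> t].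
rewrite -[2 * t * _]rintZ// -rintB//; last exact: intgZ.
rewrite -rintZ// -rintD; [|exact: intgB IW (intgZ _ IF)|exact: intgZ].
apply: rint_ge0 => x; have := H x; have := W0 x; have := V0 x.
move: (W x) (V x) (F x) => p q r q0 p0 h.
have [p00|pn0] := eqVneq p 0.
  move: h; rewrite p00 mul0r => h; have -> : r = 0.
    by apply/eqP; rewrite -sqrf_eq0 eq_le h sqr_ge0.
  by rewrite mulr0 subr0 add0r mulr_ge0 ?sqr_ge0.
have pp : 0 < p by rewrite lt_neqAle eq_sym pn0.
rewrite -(pmulr_rge0 _ pp); have := sqr_ge0 (p - t * r); have := ler_wpM2l (sqr_ge0 t) h; lra.
Qed.

Lemma sum_CS (R : realType) (I : finType) (p r : I -> R) :
  (\sum_i p i * r i) ^+ 2 <= (\sum_i p i ^+ 2) * \sum_i r i ^+ 2.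
Proof.
apply: quad_disc; [by apply: sumr_ge0 => i _; exact: sqr_ge0..|move=> t].
rewrite !mulr_sumr -sumrB -big_split/=; apply: sumr_ge0 => i _.
by have := sqr_ge0 (p i - t * r i); lra.
Qed.

Section real_inequalities.
Context {R : realDomainType}.
Implicit Types p r t : R.

Lemma le_trans2 p r t : p <= 2 * r -> r <= t -> 2 * p <= 4 * t.
Proof. by move=> h1 h2; lra. Qed.

Lemma le_add2 p r t : p <= t -> r <= t -> 2 * r + 2 * p <= 4 * t.
Proof. by move=> h1 h2; lra. Qed.

Lemma sqr_le8 p r : 0 <= p -> 0 <= r -> r <= 2 -> p <= 2 * r -> p ^+ 2 <= 8 * r.
Proof.
move=> p0 r0 r2 pr; have := ler_pM p0 p0 pr pr; have := ler_wpM2l r0 r2.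
by rewrite expr2; lra.
Qed.

Lemma weak_sum (C1 C3 C4 C5 W1 W2 W3 W4 V z1 z2 z3 z4 z5 : R) :
  0 <= C1 -> 0 <= C3 -> 0 <= C4 -> 0 <= C5 -> 0 <= V ->
  0 <= W1 -> 0 <= W2 -> 0 <= W3 -> 0 <= W4 ->
  z1 <= C1 * W1 * V -> z2 <= W2 * V -> z3 <= C3 * W3 * V -> z4 <= C4 * W4 * V ->
  z5 <= 2 * (C5 * W4 * V) ->
  2 * (z1 + z2 + z3 + z4) + z5 <= 2 * ((C1 + 1 + C3 + C4 + C5) * (W1 + W2 + W3 + W4) * V).
Proof.
move=> c1 c3 c4 c5 v0 w1 w2 w3 w4.
have V1' := mulr_ge0 w1 v0; have V2' := mulr_ge0 w2 v0.
have V3' := mulr_ge0 w3 v0; have V4' := mulr_ge0 w4 v0.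
have g1 := mulr_ge0 c1 V2'; have g2 := mulr_ge0 c1 V3'; have g3 := mulr_ge0 c1 V4'.
have g4 := mulr_ge0 c3 V1'; have g5 := mulr_ge0 c3 V2'; have g6 := mulr_ge0 c3 V4'.
have g7 := mulr_ge0 c4 V1'; have g8 := mulr_ge0 c4 V2'; have g9 := mulr_ge0 c4 V3'.
have h1 := mulr_ge0 c5 V1'; have h2 := mulr_ge0 c5 V2'; have h3 := mulr_ge0 c5 V3'.
lra.
Qed.

Lemma sqr_sum5 (z1 z2 z3 z4 z5 : R) : (z1 + z2 + z3 + z4 + z5) ^+ 2 <=
  3 * (2 * (z1 ^+ 2 + z2 ^+ 2 + z3 ^+ 2 + z4 ^+ 2) + z5 ^+ 2).
Proof.
have := sqr_ge0 (z1 - z2); have := sqr_ge0 (z1 - z3); have := sqr_ge0 (z1 - z4).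
have := sqr_ge0 (2 * z1 - z5); have := sqr_ge0 (z2 - z3); have := sqr_ge0 (z2 - z4).
have := sqr_ge0 (2 * z2 - z5); have := sqr_ge0 (z3 - z4); have := sqr_ge0 (2 * z3 - z5).
have := sqr_ge0 (2 * z4 - z5); have := sqr_ge0 z1; have := sqr_ge0 z2; have := sqr_ge0 z3.
have := sqr_ge0 z4; lra.
Qed.

End real_inequalities.

(** * Energy and dual norm of the trial functions *)

Section trial_energy.
Context {R : realType} (n : nat) (theta alpha : R).
Hypothesis n0 : (0 < n)%N.
Hypothesis th : 0 < theta < pi / 2.
Hypothesis alpha0 : 0 < alpha.
Local Notation leb := (lebesgue_rV R n.+1).
Local Notation T := ('rV[R]_n.+1).
Implicit Types (f g h v : T -> R) (x : T).
Local Notation si := (sin theta).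
Local Notation co := (cos theta).

Let si0 : 0 < si := sin_theta_gt0 th.
Let co0 : 0 < co := cos_theta_gt0 th.
Let cs1 : co ^+ 2 + si ^+ 2 = 1 := cos2Dsin2 theta.
Let co2 : co ^+ 2 = 1 - si ^+ 2. Proof. by rewrite -cs1 addrK. Qed.
Let a := alpha / 2.
Let a0 : 0 < a. Proof. by rewrite divr_gt0. Qed.
Let c : R := (n%:R - 1) / 2.
Local Notation q := (@qfc R n theta alpha).
Local Notation sgn := (@sgn_cone R n theta).

Let c_ge0 : 0 <= c.
Proof. by rewrite divr_ge0// subr_ge0 ler1n. Qed.

Lemma sgn_sqr x : sgn x ^+ 2 = 1.
Proof. by rewrite sgn_coneE; case: ifP => _; rewrite ?sqrrN expr1n. Qed.

Lemma St_cvg x : 1 < rad x -> St theta k x @[k --> \oo] --> sgn x.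
Proof.
move=> /rad_far[r1 r2 _]; have rE : rad x = Num.sqrt (rr x).
  by rewrite -r2 sqrtr_sqr ger0_norm// ltW// rad_gt0.
suff H : \forall k \near \oo, `|St theta k x - sgn x| <= dl k.
  apply/cvgrPdist_le => e e0; near=> k; rewrite distrC.
  apply: (@le_trans _ _ (dl k)); first by near: k.
  apply/ltW; near: k; have [K _ HK] := near_infty_natSinv_lt (PosNum e0).
  by exists K => // k Kk; exact: HK.
have tE : tc theta x = si * (x 0 ord_max - hgt theta x).
  by rewrite /tc rE /hgt /cot; field; rewrite gt_eqF.
rewrite sgn_coneE; have [hz|zh] := ltP (hgt theta x) (x 0 ord_max).
  have b0 : 0 < tc theta x by rewrite tE mulr_gt0// subr_gt0.
  have e0 : 0 < tc theta x / 2 by rewrite divr_gt0.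
  have [K _ HK] := near_infty_natSinv_lt (PosNum e0).
  exists K => // k /= /HK /=; rewrite -/(dl k) => hk.
  have d0 : 0 < dl k :> R := dl_gt0 k; rewrite -[dl k in X in _ <= X]invrK; apply: tauq_near.
    by rewrite invr_gt0.
  rewrite /targ lerBrDr -(@ler_pM2l _ (dl k ^+ 2)) ?exprn_gt0//.
  rewrite [leRHS]mulrA divff ?mul1r ?expf_neq0 ?gt_eqF//.
  rewrite (_ : _ * (_ + _) = 2 * dl k); last by field; rewrite gt_eqF.
  by move: hk; rewrite ltr_pdivlMr// mulrC => /ltW.
exists 0%N => // k _; have d0 : 0 < dl k :> R := dl_gt0 k.
have -> : St theta k x - -1 = - (tauq (- targ theta k x) - 1) by rewrite /St tauqN; ring.
rewrite normrN -[dl k in X in _ <= X]invrK; apply: tauq_near; first by rewrite invr_gt0.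
rewrite /targ opprB lerDl oppr_ge0 pmulr_rle0 ?invr_gt0 ?exprn_gt0// tE.
by rewrite pmulr_rle0// subr_le0.
Unshelve. all: by end_near. Qed.

(** Controls both ways in which smoothing enters: [sgn - S] in the drift, and [1 - S^2] in the
    ground-state identity, at most twice the same difference. *)
Definition err k g : R := rint leb (fun x => `|sgn x - St theta k x| * g x ^+ 2).

Let diff2 k x : `|sgn x - St theta k x| <= 2.
Proof.
rewrite (le_trans (ler_normB _ _))// (_ : 2 = 1 + 1 :> R)// lerD//; [exact: sgn_cone_le1|exact: St_le1].
Qed.

Let St_sqr k x : `|1 - St theta k x ^+ 2| <= 2 * `|sgn x - St theta k x|.
Proof.
have -> : 1 - St theta k x ^+ 2 = (sgn x + St theta k x) * (sgn x - St theta k x).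
  by rewrite -(sgn_sqr x); ring.
rewrite normrM ler_wpM2r// (le_trans (ler_normD _ _))// (_ : 2 = 1 + 1 :> R)// lerD//.
  exact: sgn_cone_le1.
exact: St_le1.
Qed.

Let msgn k : measurable_fun setT (fun x => sgn x - St theta k x).
Proof.
apply: measurable_funB; first exact: sgn_cone_meas.
exact: continuous_meas (C1_cont (hd_C1 (tdf_St n theta k))).
Qed.

Let mdiff k : measurable_fun setT (fun x => `|sgn x - St theta k x|).
Proof. exact: measurableT_comp (@normr_measurable R setT) (msgn k). Qed.

Lemma intg_err k g : continuous g -> csupp g ->
  intg leb (fun x => `|sgn x - St theta k x| * g x ^+ 2).
Proof.
move=> cg sg; apply: intg_bm; apply: bmMr; [|exact: mdiff|].
  by apply: bm_cont; [exact: contX|exact: csuppX].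
by exists 2 => x; rewrite normr_id.
Qed.

Lemma err_cvg g : continuous g -> csupp g -> (forall x, g x != 0 -> 1 < rad x) ->
  err k g @[k --> \oo] --> (0 : R).
Proof.
move=> cg sg gr; rewrite -[X in _ --> X](@rint0 _ _ _ leb).
have Ig : intg leb (fun x => g x ^+ 2) := (bm_sq (bm_cont cg sg)).2.
apply: (rint_dct (F := fun k x => `|sgn x - St theta k x| * g x ^+ 2)
  (g := fun x => 2 * g x ^+ 2) _ _ _ _).2.
- by move=> k; exact: intg_meas (intg_err k cg sg).
- move=> x; have [g0|gn0] := eqVneq (g x) 0.
    by under eq_fun do rewrite g0 expr0n/= mulr0; exact: cvg_cst.
  rewrite (_ : 0 = `|sgn x - sgn x| * g x ^+ 2); last by rewrite subrr normr0 mul0r.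
  apply: cvgM; last exact: cvg_cst.
  by apply: cvg_norm; apply: cvgB; [exact: cvg_cst|exact: St_cvg (gr x gn0)].
- exact: intgZ.
- by move=> k x; rewrite normrM normr_id (ger0_norm (sqr_ge0 _)) ler_wpM2r ?sqr_ge0.
Qed.

Variables M L U : R.
Hypothesis M0 : 0 < M.
Hypothesis far : 2 + M <= si * L.
Local Notation tf := (@tf R n theta M).
Local Notation sf := (@sf R n theta L U).
Local Notation om := (@om R n theta M L U).

Section fixed_profile.
Variables f f' h h' : T -> R.
Hypothesis hf : tf f f'.
Hypothesis hh : sf h h'.

(** A bound, independent of [k], for the trial function and its axial derivative, the two quantities
    that meet the smoothing error; [a] comes from differentiating [psi]. *)
Definition envelope x : R := (1 + a) * `|f x * h x| + `|f' x * h x| + `|f x * h' x|.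

Let cf := C1_cont (hd_C1 hf.1).
Let ch := C1_cont (hd_C1 hh.1).
Let cf' := dfun_cont (lt0r_neq0 si0) hf.1.
Let ch' := dfun_cont (lt0r_neq0 co0) hh.1.

Lemma envelope_om x : ~ om x -> envelope x = 0.
Proof.
move=> /(tf_sf_om hf hh)[[e1 e2]|[e1 e2]]; rewrite /envelope e1 e2 ?mul0r ?mulr0 normr0; ring.
Qed.

Lemma envelope_cont : continuous envelope.
Proof.
have nc (w : T -> R) : continuous w -> continuous (fun x : T => `|w x|).
  by move=> cw; apply: (cont_comp (p := Num.norm)) => // y; exact: norm_continuous.
apply: contD; first apply: contD.
- apply: contM; first exact: cont_cst.
  exact: nc (contM cf ch).
- exact: nc (contM cf' ch).
- exact: nc (contM cf ch').
Qed.

Lemma envelope_supp : csupp envelope.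
Proof. exact: (csupp_om th M0 far envelope_om). Qed.

Lemma envelope_far x : envelope x != 0 -> 1 < rad x.
Proof.
move=> gx; have [[tM /andP[Ls _]]|/envelope_om g0] := pselect (om x).
  by rewrite (lt_le_trans _ (om_rad th M0 far tM Ls))// ltr1n.
by rewrite g0 eqxx in gx.
Qed.

Variable k : nat.
Local Notation S := (@St R n theta k).
Local Notation psi := (@psi R n theta alpha k).
Local Notation ftk := (ft theta alpha k).
Local Notation fsk := (@fs R n theta).
Let u x := psi x * (f x * h x).

Let hu := hd_M (hd_psi n theta alpha k) (hd_M hf.1 hh.1).
Let cu := (trial_C1 alpha th M0 far k hf hh).1.
Let su := (trial_C1 alpha th M0 far k hf hh).2.

Let dmu x : 'D_('e_ord_max) u x = - (psi x * (a * si * S x)) * (f x * h x) +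
  psi x * (si * f' x * h x + f x * (co * h' x)).
Proof. exact: (hu.2 x).2. Qed.

Let djum x j : 'D_('e_(lift ord_max j)) u x = hx x j * (psi1 theta alpha k x * (f x * h x) +
  psi x * (- co * rad1 x * f' x * h x + f x * (si * rad1 x * h' x))).
Proof. exact: (hu.2 x).1. Qed.

Lemma trial_vanish x : ~~ (L < sc theta x < U) -> u x = 0 /\ forall i, 'D_('e_i) u x = 0.
Proof.
move=> /hh.2[e1 e2]; split=> [|i]; first by rewrite /u e1 !mulr0.
case: (unliftP ord_max i) => [j|] ->; rewrite ?djum ?dmu e1 e2; ring.
Qed.

Lemma trial_le x : `|u x| <= envelope x /\ `|'D_('e_ord_max) u x| <= envelope x.
Proof.
have [ox|ox] := pselect (om x); last first.
  rewrite envelope_om// /u dmu.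
  by case: (tf_sf_om hf hh ox) => -[-> ->]; rewrite !(mul0r, mulr0, addr0, normr0) lexx.
have [tM /andP[Ls _]] := ox.
have r2 := om_rad th M0 far tM Ls.
have p1 : psi x <= 1 by apply: psi_le1 => //; rewrite (le_trans _ r2)// ler1n.
have p0 := psi_gt0 theta alpha k x.
have z1 := normr_ge0 (f x * h x); have z2 := normr_ge0 (f' x * h x); have z3 := normr_ge0 (f x * h' x).
have az := mulr_ge0 (ltW a0) z1.
have pw w : `|psi x * w| <= `|w| by rewrite normrM (gtr0_norm p0) ler_piMl.
split; first by apply: le_trans (pw _) _; rewrite /envelope; lra.
have -> : 'D_('e_ord_max) u x = psi x * (- (a * (si * S x) * (f x * h x)) + si * (f' x * h x) +
    co * (f x * h' x)) by rewrite dmu; ring.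
apply: le_trans (pw _) _; apply: le_trans (ler_normD _ _) _; rewrite /envelope; apply: lerD; last first.
  by rewrite normrM (gtr0_norm co0) ler_piMl// cos_le1.
apply: le_trans (ler_normD _ _) _; apply: lerD; last first.
  by rewrite normrM (gtr0_norm si0) ler_piMl// sin_le1.
rewrite normrN normrM ler_wpM2r// normrM (gtr0_norm a0).
have : `|si * S x| <= 1.
  by rewrite normrM (gtr0_norm si0) mulr_ile1 ?(ltW si0) ?normr_ge0 ?sin_le1 ?St_le1.
by move/(ler_wpM2l (ltW a0)); lra.
Qed.

Lemma trial_form v : C1 v -> csupp v -> q u v + a ^+ 2 * dot leb u v =
  rint leb (fun x => psi x * (f' x * h x * ftk v x + f x * h' x * fsk v x) +
    c * (n%:R - 2 - c) * (rad x)^-1 ^+ 2 * (u x * v x) + a ^+ 2 * ((1 - S x ^+ 2) * (u x * v x))) +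
  a / si * rint leb (fun x => (sgn x - S x) *
    ('D_('e_ord_max) u x * v x + u x * 'D_('e_ord_max) v x)).
Proof.
move=> cv sv; rewrite C1_qform// -(ground_state alpha th M0 far k hf hh cv).
have cuu : continuous u := C1_cont cu; have cvv := C1_cont cv.
have cS : continuous S := C1_cont (hd_C1 (tdf_St n theta k)).
set D := fun x => 'D_('e_ord_max) u x * v x + u x * 'D_('e_ord_max) v x.
have cD : continuous D.
  exact: contD (contM (C1_dcont (i := ord_max) cu) cvv) (contM cuu (C1_dcont (i := ord_max) cv)).
have bD : bm D by apply: bm_cont => //; apply: csuppD; [exact: csuppMr|exact: csuppM].
have I1 : intg leb (fun x => \sum_i 'D_('e_i) u x * 'D_('e_i) v x).
  by apply: intg_sum => i; apply: sq_mul; apply: bm_sq; exact: bm_d.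
have I2 : intg leb (fun x => S x * D x).
  by apply/intg_bm/bm_cont; [exact: contM|apply: csuppMr; case: bD].
have I3 : intg leb (fun x => (sgn x - S x) * D x).
  by apply: intg_bm; apply: (bmMr bD (msgn k)); exists 2.
have I4 : intg leb (fun x => u x * v x).
  by apply/intg_bm/bm_cont; [exact: contM|exact: csuppM].
rewrite (_ : rint leb (fun x => \sum_i _ + _ + _) =
   rint leb (fun x => \sum_i 'D_('e_i) u x * 'D_('e_i) v x) + a / si * rint leb (fun x => S x * D x) +
   a ^+ 2 * dot leb u v); last first.
  rewrite /dot -!rintZ// -!rintD//; try by [exact: intgZ|apply: intgD => //; exact: intgZ].
rewrite (_ : rint leb (fun x => sgn x * _) = rint leb (fun x => S x * D x) +
   rint leb (fun x => (sgn x - S x) * D x)); last first.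
  by rewrite -rintD//; apply: rint_ext => x; rewrite /D; ring.
have -> : alpha / (2 * si) = a / si by rewrite /a; field; rewrite gt_eqF.
rewrite /D; ring.
Qed.

Lemma trial_energy : q u u + a ^+ 2 * dot leb u u <=
  rint leb (fun x => psi x ^+ 2 * (f' x ^+ 2 * h x ^+ 2)) +
  rint leb (fun x => psi x ^+ 2 * (f x ^+ 2 * h' x ^+ 2)) +
  c * (n%:R - 2 - c) * rint leb (fun x => (rad x)^-1 ^+ 2 * u x ^+ 2) +
  (2 * a ^+ 2 + 2 * (a / si)) * err k envelope.
Proof.
rewrite trial_form//.
have cuu : continuous u := C1_cont cu.
have cS : continuous S := C1_cont (hd_C1 (tdf_St n theta k)).
have cp : continuous psi := C1_cont (hd_C1 (hd_psi n theta alpha k)).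
have cV : continuous (fun x : T => (rad x)^-1) :=
  C1_cont (hd_C1 (hd_inv (@hd_rad R n) (fun x => lt0r_neq0 (rad_gt0 x)))).
have I1 : intg leb (fun x => psi x ^+ 2 * (f' x ^+ 2 * h x ^+ 2)).
  apply: (@intg_stream _ _ _ alpha th M L U M0 far) => [||x /hf.2[_ ->]|x /hh.2[-> _]].
  - exact: contX cf'.
  - exact: contX ch.
  - by rewrite expr0n.
  - by rewrite expr0n.
have I2 : intg leb (fun x => psi x ^+ 2 * (f x ^+ 2 * h' x ^+ 2)).
  apply: (@intg_stream _ _ _ alpha th M L U M0 far) => [||x /hf.2[-> _]|x /hh.2[_ ->]].
  - exact: contX cf.
  - exact: contX ch'.
  - by rewrite expr0n.
  - by rewrite expr0n.
have su2 : csupp (fun x => u x ^+ 2) by exact: csuppX.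
have I3 : intg leb (fun x => (rad x)^-1 ^+ 2 * u x ^+ 2).
  by apply/intg_bm/bm_cont; [exact: contM (contX (k := 2) cV) (contX (k := 2) cuu)|exact: csuppMr].
have c1S : continuous (fun x => 1 - S x ^+ 2).
  by apply: contD; [exact: cont_cst|exact: contN (contX (k := 2) cS)].
have I4 : intg leb (fun x => (1 - S x ^+ 2) * u x ^+ 2).
  by apply/intg_bm/bm_cont; [exact: contM c1S (contX (k := 2) cuu)|exact: csuppMr].
have Ie := intg_err k envelope_cont envelope_supp.
rewrite (_ : rint leb (fun x => psi x * _ + _ + _) =
  rint leb (fun x => psi x ^+ 2 * (f' x ^+ 2 * h x ^+ 2)) +
  rint leb (fun x => psi x ^+ 2 * (f x ^+ 2 * h' x ^+ 2)) +
  c * (n%:R - 2 - c) * rint leb (fun x => (rad x)^-1 ^+ 2 * u x ^+ 2) +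
  a ^+ 2 * rint leb (fun x => (1 - S x ^+ 2) * u x ^+ 2)); last first.
  rewrite -!rintZ// -!rintD//; try by [exact: intgZ|apply: intgD => //; exact: intgZ|
    apply: intgD => //; apply: intgD => //; exact: intgZ|exact: intgD|
    apply: intgD; [exact: intgD|exact: intgZ]].
  apply: rint_ext => x.
  have [ox|/(tf_sf_om hf hh)] := pselect (om x); last first.
    by rewrite /u => -[[-> ->]|[-> ->]]; ring.
  have [tM /andP[Ls _]] := ox.
  have [y [y0 _ ry r1 rV]] := om_far th M0 far tM Ls.
  (* For [v = u] the twisted derivatives only see the profile, as [psi] is annihilated by them. *)
  have e1 : ftk u x = psi x * (f' x * h x) /\ fsk u x = psi x * (f x * h' x).
    rewrite /ft /fs /dt /ds dmu.
    rewrite (eq_bigr (fun j => hx x j ^+ 2 * (psi1 theta alpha k x * (f x * h x) +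
      psi x * (- co * rad1 x * f' x * h x + f x * (si * rad1 x * h' x))))) => [|j _]; last first.
      by rewrite djum mulrA expr2.
    rewrite -mulr_suml -/(rr x) /psi1 /u r1 rV (far_rr y0 ry) /a.
    by split; field: co2; rewrite gt_eqF.
  by rewrite e1.1 e1.2 /u; ring.
have t1 : rint leb (fun x => (1 - S x ^+ 2) * u x ^+ 2) <= 2 * err k envelope.
  rewrite /err -rintZ//; apply: rint_le => // [|x]; first exact: intgZ.
  have [ul _] := trial_le x; have e0 := le_trans (normr_ge0 _) ul.
  have h1 := le_trans (ler_norm _) (St_sqr k x).
  rewrite [leRHS]mulrA; apply: le_trans (ler_wpM2r (sqr_ge0 _) h1) _; apply: ler_wpM2l.
    by rewrite mulr_ge0.
  by rewrite -[leLHS]real_normK ?num_real// lerXn2r ?nnegrE.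
have t2 : rint leb (fun x => (sgn x - S x) *
    ('D_('e_ord_max) u x * u x + u x * 'D_('e_ord_max) u x)) <= 2 * err k envelope.
  rewrite /err -rintZ//; apply: rint_le => [||x].
  - apply: intg_bm; apply: bmMr; [|exact: msgn|by exists 2].
    apply: bm_cont; last by apply: csuppD; [exact: csuppMr|exact: csuppM].
    have cdu := C1_dcont (i := ord_max) cu.
    exact: contD (contM cdu cuu) (contM cuu cdu).
  - exact: intgZ.
  have [ul dl'] := trial_le x.
  apply: le_trans (ler_norm _) _; rewrite normrM [leRHS]mulrCA; apply: ler_wpM2l => //.
  have p := ler_pM (normr_ge0 _) (normr_ge0 _) dl' ul; rewrite -normrM in p.
  apply: le_trans (ler_normD _ _) _; rewrite [u x * _]mulrC; move: p; rewrite expr2; lra.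
have := ler_wpM2l (sqr_ge0 a) t1; have := ler_wpM2l (divr_ge0 (ltW a0) (ltW si0)) t2; lra.
Qed.

Lemma dt_le v x : om x -> (dt theta v x) ^+ 2 <= 2 * \sum_i ('D_('e_i) v x) ^+ 2.
Proof.
move=> [tM /andP[Ls _]]; have [y [y0 _ ry _ rV]] := om_far th M0 far tM Ls.
rewrite /dt rV sum_lift mulrDr addrC; apply: le_trans (sqrD_le2 _ _) _; apply: lerD.
  have s2 : si ^+ 2 <= 1 by rewrite exprn_ile1 ?(ltW si0)// sin_le1.
  by rewrite ler_pM2l// exprMn ler_piMl ?sqr_ge0.
rewrite ler_pM2l//; set X := \sum_(j < n) _ * _.
have X2 := sum_CS (hx x) (fun j => 'D_('e_(lift ord_max j)) v x).
rewrite -/X -/(rr x) in X2; set D := \sum_(j < n) _ ^+ 2 in X2 *.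
have -> : (- co * y * X) ^+ 2 = co ^+ 2 * (y ^+ 2 * X ^+ 2) by ring.
have h1 := ler_wpM2l (sqr_ge0 y) X2.
have -> : D = 1 * (y ^+ 2 * (rr x * D)) by transitivity ((rr x * y ^+ 2) * D); [rewrite ry mul1r|ring].
apply: (ler_pM (sqr_ge0 _) (mulr_ge0 (sqr_ge0 _) (sqr_ge0 _)) _ h1).
by rewrite exprn_ile1 ?(ltW co0)// cos_le1.
Qed.

(** The sum of the constants in the five pointwise estimates of [weak_bound]; 6 is the product of
    the factors 3 of [sqr_sum5] and 2 of [weak_sum]. *)
Definition weak_cst : R := 6 * (4 + 2 * (a + c) ^+ 2 + 1 + (c * (n%:R - 2 - c)) ^+ 2 +
  8 * a ^+ 4 + 4 * (a / si) ^+ 2).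

(** After [stream_w] the defect of [u] as an eigenvector splits into the transverse cutoff, the
    equation [h'' + p2 h = 0] along the generators, the centrifugal potential and the smoothing; a
    weighted Cauchy-Schwarz inequality estimates each against [v]. *)
Lemma weak_bound h'' p2 v : sf h' h'' -> C1 v -> csupp v ->
  (q u v - (p2 - a ^+ 2) * dot leb u v) ^+ 2 <=
  weak_cst * (rint leb (fun x => psi x ^+ 2 * (f' x ^+ 2 * h x ^+ 2)) +
    rint leb (fun x => psi x ^+ 2 * (f x ^+ 2 * (h'' x + p2 * h x) ^+ 2)) +
    rint leb (fun x => (rad x)^-1 ^+ 4 * u x ^+ 2) + err k envelope) *
  rint leb (fun x => v x ^+ 2 + \sum_i ('D_('e_i) v x) ^+ 2).
Proof.
move=> hh' cv sv.
have cuu : continuous u := C1_cont cu; have cvv := C1_cont cv.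
have cS : continuous S := C1_cont (hd_C1 (tdf_St n theta k)).
have cp : continuous psi := C1_cont (hd_C1 (hd_psi n theta alpha k)).
have cV : continuous (fun x : T => (rad x)^-1) :=
  C1_cont (hd_C1 (hd_inv (@hd_rad R n) (fun x => lt0r_neq0 (rad_gt0 x)))).
have ch'' := dfun_cont (lt0r_neq0 co0) hh'.1.
have [cft cfs] := cont_ft theta alpha k cv.
set D := fun x => 'D_('e_ord_max) u x * v x + u x * 'D_('e_ord_max) v x.
have cD : continuous D.
  exact: contD (contM (C1_dcont (i := ord_max) cu) cvv) (contM cuu (C1_dcont (i := ord_max) cv)).
have bD : bm D by apply: bm_cont => //; apply: csuppD; [exact: csuppMr|exact: csuppM].
have om0 := tf_sf_om hf hh.
have I1 : intg leb (fun x => psi x * (f' x * h x * ftk v x)).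
  apply/intg_bm/bm_cont; first exact: contM cp (contM (contM cf' ch) cft).
  by apply: (csupp_om th M0 far) => x /om0[[e1 e2]|[e1 e2]]; rewrite ?e1 ?e2; ring.
have I2 : intg leb (fun x => psi x * (f x * h' x * fsk v x)).
  apply/intg_bm/bm_cont; first exact: contM cp (contM (contM cf ch') cfs).
  by apply: (csupp_om th M0 far) => x /om0[[e1 e2]|[e1 e2]]; rewrite ?e1 ?e2; ring.
have I2' : intg leb (fun x => psi x * (f x * h'' x) * v x).
  apply/intg_bm/bm_cont; first exact: contM (contM cp (contM cf ch'')) cvv.
  exact: csuppMr.
have suv : csupp (fun x => u x * v x) by exact: csuppM.
have I0 : intg leb (fun x => u x * v x) by apply/intg_bm/bm_cont => //; exact: contM.
have I3 : intg leb (fun x => (rad x)^-1 ^+ 2 * (u x * v x)).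
  by apply/intg_bm/bm_cont; [exact: contM (contX (k := 2) cV) (contM cuu cvv)|exact: csuppMr].
have c1S : continuous (fun x => 1 - S x ^+ 2).
  by apply: contD; [exact: cont_cst|exact: contN (contX (k := 2) cS)].
have I4 : intg leb (fun x => (1 - S x ^+ 2) * (u x * v x)).
  by apply/intg_bm/bm_cont; [exact: contM c1S (contM cuu cvv)|exact: csuppMr].
have I5 : intg leb (fun x => (sgn x - S x) * D x).
  by apply: intg_bm; apply: (bmMr bD (msgn k)); exists 2.
set c' := c * (n%:R - 2 - c).
pose F x := psi x * (f' x * h x * ftk v x) + - (psi x * (f x * h'' x) * v x) +
  c' * ((rad x)^-1 ^+ 2 * (u x * v x)) + a ^+ 2 * ((1 - S x ^+ 2) * (u x * v x)) +
  a / si * ((sgn x - S x) * D x) + - p2 * (u x * v x).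
have J12 : intg leb (fun x => psi x * (f' x * h x * ftk v x) + - (psi x * (f x * h'' x) * v x)).
  exact: intgD I1 (intgN I2').
have J123 := intgD J12 (intgZ c' I3).
have J1234 := intgD J123 (intgZ (a ^+ 2) I4).
have J5 := intgD J1234 (intgZ (a / si) I5).
have IF : intg leb F := intgD J5 (intgZ (- p2) I0).
have FE : q u v - (p2 - a ^+ 2) * dot leb u v = rint leb F.
  transitivity (q u v + a ^+ 2 * dot leb u v - p2 * dot leb u v); first ring.
  rewrite trial_form// -/c' (_ : rint leb (fun x => psi x * _ + _ + _) =
    rint leb (fun x => psi x * (f' x * h x * ftk v x)) + rint leb (fun x => psi x * (f x * h' x * fsk v x)) +
    c' * rint leb (fun x => (rad x)^-1 ^+ 2 * (u x * v x)) +
    a ^+ 2 * rint leb (fun x => (1 - S x ^+ 2) * (u x * v x))); last first.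
    rewrite -(rintZ c' I3) -(rintZ (a ^+ 2) I4) -(rintD I1 I2) -(rintD (intgD I1 I2) (intgZ c' I3)).
    rewrite -(rintD (intgD (intgD I1 I2) (intgZ c' I3)) (intgZ (a ^+ 2) I4)).
    by apply: rint_ext => x; ring.
  rewrite (stream_w alpha th M0 far k hf hh hh' cv) -rintN// /F (rintD J5 (intgZ (- p2) I0)).
  rewrite (rintD J1234 (intgZ (a / si) I5)) (rintD J123 (intgZ (a ^+ 2) I4)) (rintD J12 (intgZ c' I3)).
  rewrite (rintD I1 (intgN I2')) (rintZ _ I3) (rintZ _ I4) (rintZ _ I5) (rintZ _ I0) /D /dot; ring.
have K1 : intg leb (fun x => psi x ^+ 2 * (f' x ^+ 2 * h x ^+ 2)).
  apply: (@intg_stream _ _ _ alpha th M L U M0 far) => [||x /hf.2[_ ->]|x /hh.2[-> _]].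
  - exact: contX cf'.
  - exact: contX ch.
  - by rewrite expr0n.
  - by rewrite expr0n.
have K2 : intg leb (fun x => psi x ^+ 2 * (f x ^+ 2 * (h'' x + p2 * h x) ^+ 2)).
  apply: (@intg_stream _ _ _ alpha th M L U M0 far) => [||x /hf.2[-> _]|x xs].
  - exact: contX cf.
  - apply: contX; apply: contD => //; apply: contM => //; exact: cont_cst.
  - by rewrite expr0n.
  - by have [_ ->] := hh'.2 x xs; have [-> _] := hh.2 x xs; rewrite mulr0 addr0 expr0n.
have K3 : intg leb (fun x => (rad x)^-1 ^+ 4 * u x ^+ 2).
  apply/intg_bm/bm_cont; first exact: contM (contX (k := 4) cV) (contX (k := 2) cuu).
  by apply: csuppMr; exact: csuppX.
have K4 := intg_err k envelope_cont envelope_supp.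
have KV : intg leb (fun x => v x ^+ 2 + \sum_i ('D_('e_i) v x) ^+ 2).
  apply: intgD; first exact: (bm_sq (bm_cont cvv sv)).2.
  by apply: intg_sum => i; exact: (bm_sq (bm_d i cv sv)).2.
have KW := intgD (intgD (intgD K1 K2) K3) K4.
rewrite FE /err -(rintD K1 K2) -(rintD (intgD K1 K2) K3) -(rintD (intgD (intgD K1 K2) K3) K4) -(rintZ weak_cst KW).
have y1 x : 0 <= (rad x)^-1 by rewrite invr_ge0 ltW// rad_gt0.
have w1 x : 0 <= psi x ^+ 2 * (f' x ^+ 2 * h x ^+ 2) := mulr_ge0 (sqr_ge0 _) (mulr_ge0 (sqr_ge0 _) (sqr_ge0 _)).
have w2 x : 0 <= psi x ^+ 2 * (f x ^+ 2 * (h'' x + p2 * h x) ^+ 2) := mulr_ge0 (sqr_ge0 _) (mulr_ge0 (sqr_ge0 _) (sqr_ge0 _)).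
have w3 x : 0 <= (rad x)^-1 ^+ 4 * u x ^+ 2 := mulr_ge0 (exprn_ge0 4 (y1 x)) (sqr_ge0 _).
have w4 x : 0 <= `|sgn x - S x| * envelope x ^+ 2 := mulr_ge0 (normr_ge0 _) (sqr_ge0 _).
have k1 : 0 <= 4 + 2 * (a + c) ^+ 2 by rewrite addr_ge0// mulr_ge0 ?sqr_ge0.
have k4 : 0 <= 8 * a ^+ 4 by rewrite mulr_ge0// exprn_ge0// ltW.
have k5 : 0 <= 4 * (a / si) ^+ 2 by rewrite mulr_ge0 ?sqr_ge0.
have k3 := sqr_ge0 c'.
have W0 : 0 <= weak_cst by rewrite /weak_cst -/c'; lra.
have sv0 x : 0 <= \sum_i ('D_('e_i) v x) ^+ 2 by apply: sumr_ge0 => i _; exact: sqr_ge0.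
apply: rint_CS => //; first exact: intgZ.
- by move=> x; apply: (mulr_ge0 W0); rewrite !addr_ge0.
- by move=> x; rewrite addr_ge0 ?sqr_ge0.
move=> x; set V := v x ^+ 2 + _; have V0 : 0 <= V by rewrite addr_ge0 ?sqr_ge0.
have v2V : v x ^+ 2 <= V by rewrite lerDl.
have dV : ('D_('e_ord_max) v x) ^+ 2 <= V.
  rewrite /V (bigD1 ord_max)//= addrCA lerDl addr_ge0 ?sqr_ge0// sumr_ge0// => i _; exact: sqr_ge0.
have b1 : (psi x * (f' x * h x * ftk v x)) ^+ 2 <=
    (4 + 2 * (a + c) ^+ 2) * (psi x ^+ 2 * (f' x ^+ 2 * h x ^+ 2)) * V.
  have -> : (psi x * (f' x * h x * ftk v x)) ^+ 2 = psi x ^+ 2 * (f' x ^+ 2 * h x ^+ 2) * ftk v x ^+ 2 by ring.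
  have [ox|ox] := pselect (om x); last first.
    by have [[_ ->]|[-> _]] := om0 x ox; rewrite expr0n/= !(mul0r, mulr0).
  rewrite [_ * (psi x ^+ 2 * _)]mulrC -[leRHS]mulrA ler_wpM2l//.
  have d2 := dt_le v ox; have [tM /andP[Ls _]] := ox.
  have [y [y0 yl1 _ _ rV]] := om_far th M0 far tM Ls.
  rewrite /ft rV; apply: le_trans (sqrD_le2 _ _) _; rewrite [leRHS]mulrDl; apply: lerD.
    have gV : \sum_i ('D_('e_i) v x) ^+ 2 <= V by rewrite lerDr sqr_ge0.
    exact: le_trans2 d2 gV.
  rewrite -/a -/c exprMn mulrA; apply: ler_pM => //; [by rewrite mulr_ge0 ?sqr_ge0|exact: sqr_ge0|].
  rewrite ler_pM2l// -[leLHS]real_normK ?num_real// lerXn2r ?nnegrE ?addr_ge0 ?(ltW a0) ?c_ge0//.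
  apply: le_trans (ler_normB _ _) _; apply: lerD.
    by rewrite normrM (gtr0_norm a0) ler_piMr ?(ltW a0) ?St_le1.
  have cy0 : 0 <= co * y by rewrite mulr_ge0 ?(ltW co0) ?(ltW y0).
  rewrite -mulrA (ger0_norm (mulr_ge0 c_ge0 cy0)); apply: ler_piMr c_ge0 _.
  by rewrite mulr_ile1 ?(ltW co0) ?(ltW y0) ?cos_le1.
have b2 : (- (psi x * (f x * h'' x) * v x) + - p2 * (u x * v x)) ^+ 2 <=
    psi x ^+ 2 * (f x ^+ 2 * (h'' x + p2 * h x) ^+ 2) * V.
  rewrite [leLHS](_ : _ = psi x ^+ 2 * (f x ^+ 2 * (h'' x + p2 * h x) ^+ 2) * v x ^+ 2).
    exact: ler_wpM2l.
  by rewrite /u; ring.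
have b3 : (c' * ((rad x)^-1 ^+ 2 * (u x * v x))) ^+ 2 <= c' ^+ 2 * ((rad x)^-1 ^+ 4 * u x ^+ 2) * V.
  rewrite [leLHS](_ : _ = c' ^+ 2 * ((rad x)^-1 ^+ 4 * u x ^+ 2) * v x ^+ 2); last by ring.
  by apply: ler_wpM2l => //; exact: mulr_ge0.
have [ul dul] := trial_le x; have G0 := le_trans (normr_ge0 _) ul.
have sq2 (p : R) : `|p| <= envelope x -> p ^+ 2 <= envelope x ^+ 2.
  by move=> hp; rewrite -[leLHS]real_normK ?num_real// lerXn2r ?nnegrE.
have s2 : (sgn x - S x) ^+ 2 <= 2 * `|sgn x - S x|.
  by rewrite -[leLHS]real_normK ?num_real// expr2 ler_wpM2r.
have b4 : (a ^+ 2 * ((1 - S x ^+ 2) * (u x * v x))) ^+ 2 <=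
    8 * a ^+ 4 * (`|sgn x - S x| * envelope x ^+ 2) * V.
  have e1 : (1 - S x ^+ 2) ^+ 2 <= 8 * `|sgn x - S x|.
    rewrite -[leLHS]real_normK ?num_real//; have := St_sqr k x; set p := `|_|; set r := `|_| => pr.
    have p0 : 0 <= p by exact: normr_ge0.
    have r2 : r <= 2 by exact: diff2.
    exact: (sqr_le8 p0 (normr_ge0 _ : 0 <= r) r2 pr).
  rewrite [leLHS](_ : _ = a ^+ 4 * ((1 - S x ^+ 2) ^+ 2 * u x ^+ 2) * v x ^+ 2); last by ring.
  rewrite (_ : 8 * a ^+ 4 * _ = a ^+ 4 * (8 * `|sgn x - S x| * envelope x ^+ 2)); last by ring.
  have a4 : 0 <= a ^+ 4 by rewrite exprn_ge0// ltW.
  apply: ler_pM => //; [apply: mulr_ge0 a4 (mulr_ge0 (sqr_ge0 _) (sqr_ge0 _))|exact: sqr_ge0|].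
  by apply: (ler_wpM2l a4); apply: ler_pM; [exact: sqr_ge0|exact: sqr_ge0|exact: e1|exact: sq2].
have b5 : (a / si * ((sgn x - S x) * D x)) ^+ 2 <=
    2 * (4 * (a / si) ^+ 2 * (`|sgn x - S x| * envelope x ^+ 2) * V).
  have e1 : D x ^+ 2 <= 4 * (envelope x ^+ 2 * V).
    apply: le_trans (sqrD_le2 _ _) _.
    have := ler_pM (sqr_ge0 _) (sqr_ge0 _) (sq2 _ dul) v2V; rewrite -exprMn.
    have := ler_pM (sqr_ge0 _) (sqr_ge0 _) (sq2 _ ul) dV; rewrite -exprMn.
    exact: le_add2.
  rewrite [leLHS](_ : _ = (a / si) ^+ 2 * ((sgn x - S x) ^+ 2 * D x ^+ 2)); last by ring.
  apply: le_trans (ler_wpM2l (sqr_ge0 (a / si)) (ler_pM (sqr_ge0 _) (sqr_ge0 _) s2 e1)) _.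
  by rewrite le_eqVlt; apply/orP; left; apply/eqP; ring.
have -> : F x = psi x * (f' x * h x * ftk v x) + (- (psi x * (f x * h'' x) * v x) + - p2 * (u x * v x)) +
  c' * ((rad x)^-1 ^+ 2 * (u x * v x)) + a ^+ 2 * ((1 - S x ^+ 2) * (u x * v x)) +
  a / si * ((sgn x - S x) * D x) by rewrite /F; ring.
apply: le_trans (sqr_sum5 _ _ _ _ _) _.
rewrite [leRHS](_ : _ = 3 * (2 * ((4 + 2 * (a + c) ^+ 2 + 1 + c' ^+ 2 + 8 * a ^+ 4 + 4 * (a / si) ^+ 2) *
  (psi x ^+ 2 * (f' x ^+ 2 * h x ^+ 2) + psi x ^+ 2 * (f x ^+ 2 * (h'' x + p2 * h x) ^+ 2) +
   (rad x)^-1 ^+ 4 * u x ^+ 2 + `|sgn x - S x| * envelope x ^+ 2) * V))).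
  by rewrite ler_pM2l//; apply: weak_sum.
by rewrite /weak_cst -/c'; ring.
Qed.

End fixed_profile.

End trial_energy.

(** * Choice of scales and a negative direction in dimension three *)

Section trial_families.
Context {R : realType} (n : nat) (theta alpha : R).
Hypothesis n0 : (0 < n)%N.
Hypothesis th : 0 < theta < pi / 2.
Hypothesis alpha0 : 0 < alpha.
Local Notation leb := (lebesgue_rV R n.+1).
Local Notation T := ('rV[R]_n.+1).
Implicit Types (f g h v : T -> R) (x : T).
Local Notation si := (sin theta).
Local Notation co := (cos theta).

Let si0 : 0 < si := sin_theta_gt0 th.
Let co0 : 0 < co := cos_theta_gt0 th.
Let a := alpha / 2.
Let a0 : 0 < a. Proof. by rewrite divr_gt0. Qed.
Let c : R := (n%:R - 1) / 2.
Local Notation q := (@qfc R n theta alpha).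

Section profile.
Variables w N : R.
Hypothesis w0 : 0 < w.
Hypothesis N1 : 1 <= N.
Hypothesis Nsi : 3 <= si * N.

(** With width [M = N^3] and start [L = N^4], [M / L = 1 / N] makes [rad] close to [si * s], and
    [M^(- 4) L^2 = N^(- 4)] makes the transverse cutoff negligible even against a profile of size
    sqrt s. *)
Definition twidth := N ^+ 3.
Definition sstart := N ^+ 4.
Local Notation M := twidth.
Local Notation L := sstart.
Local Notation U := (L * expR (2 * w)).

Lemma tw_ge1 : 1 <= M. Proof. by rewrite exprn_ege1. Qed.
Lemma tw_gt0 : 0 < M. Proof. exact: lt_le_trans tw_ge1. Qed.
Lemma ss_ge1 : 1 <= L. Proof. by rewrite exprn_ege1. Qed.

Lemma si_ss : 3 * M <= si * L.
Proof.
by rewrite /sstart /twidth [N ^+ 4]exprS mulrA ler_wpM2r// exprn_ge0// (le_trans ler01).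
Qed.

Lemma ts_far : 2 + M <= si * L.
Proof. have := si_ss; have := tw_ge1; lra. Qed.

Local Notation tf := (@tf R n theta M).
Local Notation sf := (@sf R n theta L U).
Local Notation om := (@om R n theta M L U).
Local Notation Pm := (@Pm R n theta M).
Local Notation Xs := (@Xs R n theta L w).
Local Notation Vs := (@Vs R n theta).
Local Notation ex := (@ex R n theta L w).
Local Notation scx := (@sc R n theta).
Local Notation Wtk := (@Wt R n theta alpha M L w).

Lemma Vs_gt0 x : 0 < Vs x. Proof. by rewrite invr_gt0 lft_gt0. Qed.

Lemma rad_bounds x : om x -> N <= rad x <= (si + N^-1) * scx x.
Proof.
move=> [tM /andP[Ls sU]]; rewrite (rad_ts theta x).
have ct : `|co * tc theta x| <= M.
  rewrite normrM (gtr0_norm co0); apply: le_trans (ltW tM).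
  by rewrite ler_piMl// cos_le1.
move: ct; rewrite ler_norml => /andP[c1 c2].
have sL : si * L <= si * scx x by rewrite ler_wpM2l ?ltW.
have MN : N <= M by rewrite /twidth exprS ler_peMr ?(le_trans ler01)// exprn_ege1.
have Np : 0 < N by exact: lt_le_trans N1.
have ML : M <= N^-1 * scx x.
  rewrite ler_pdivlMl//; apply: le_trans (ltW Ls); by rewrite /sstart exprS.
apply/andP; split; first by have := si_ss; have := tw_ge1; lra.
rewrite mulrDl; lra.
Qed.

Let hf := tf_Pm n theta tw_gt0 0.
Let f x := Pm x ^+ 2.
Let f' x := - (2%:R * Pm x ^+ 1 * (2 * M^-1 ^+ 2 * tc theta x)).

Section multiplier.
Variables m m1 : T -> R.
Hypothesis hm : @dfun R n si co m m1.
Let h x := Xs x ^+ 4 * m x.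
Let h' x := - (4 * Xs x ^+ 3 * (2 * w^-1 * (ex x * Vs x))) * m x + Xs x ^+ 4 * m1 x.

Lemma mult_sf : sf h h'.
Proof. exact: sfM (sf_Xs n theta w0 ss_ge1 2) hm. Qed.

Variable k : nat.
Local Notation psi := (@psi R n theta alpha k).
Let u x := psi x * (f x * h x).

Lemma dotu : dot leb u u = rint leb (fun x => psi x ^+ 2 * (Pm x ^+ 4 * h x ^+ 2)).
Proof. by apply: rint_ext => x; rewrite /u /f; ring. Qed.

Lemma intg_u2 : intg leb (fun x => psi x ^+ 2 * (Pm x ^+ 4 * h x ^+ 2)).
Proof.
apply: (@intg_stream _ _ _ alpha th M L U tw_gt0 ts_far) => [||x /(Pm0 tw_gt0) ->|x /mult_sf.2[-> _]].
- exact: contX (@cont_Pm _ _ _ _).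
- exact: contX (C1_cont (hd_C1 mult_sf.1)).
- by rewrite expr0n.
- by rewrite expr0n.
Qed.

Lemma mult_tail : rint leb (fun x => psi x ^+ 2 * (f' x ^+ 2 * h x ^+ 2)) <=
  16 * tail_cst alpha * (1 + tail_cst alpha) * M^-1 ^+ 4 * dot leb u u.
Proof.
rewrite dotu; have := tail_bound th alpha0 tw_gt0 ts_far k tw_ge1 (sfM mult_sf mult_sf.1).
move=> /(_ (fun x => sqr_ge0 (h x))); congr (_ <= _).
by apply: rint_ext => x; rewrite /f'; ring.
Qed.

End multiplier.

Variable k : nat.
Local Notation psi := (@psi R n theta alpha k).

Lemma Wt_chain : [/\ Wtk k 7 = 17 / 16 * Wtk k 8, Wtk k 6 = 15 / 14 * (17 / 16) * Wtk k 8 &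
  Wtk k 4 <= 2 * Wtk k 8].
Proof.
have W8 : 0 <= Wtk k 8.
  apply: rint_ge0 => x; apply: mulr_ge0 (sqr_ge0 _) (mulr_ge0 (exprn_ge0 4 (Pm_ge0 _ _ _)) _).
  exact: mulr_ge0 (ltW (Vs_gt0 x)) (exprn_ge0 8 (Xs_ge0 _ _ _ _)).
have st j := Wt_step n alpha th tw_gt0 ts_far w0 ss_ge1 k j.
have := st 2%N; have := st 3%N; have := st 4%N; have := st 5%N; have := st 6%N.
move: (Wtk k 3) (Wtk k 4) (Wtk k 5) (Wtk k 6) (Wtk k 7) (Wtk k 8) W8 => x3 x4 x5 x6 x7 x8 x80.
move=> e6 e5 e4 e3 e2; split; lra.
Qed.

End profile.

(* The strict inequality comes from the Hardy weight 1 / (4 s ^ 2): for n = 2 the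
   centrifugal term gains 1 / (4 r ^ 2) with r close to s sin theta. *)
Lemma negative_trial : n = 2%N -> exists w N0 : R, [/\ 0 < w, 1 <= N0 & forall N, N0 <= N ->
  exists u : T -> R, [/\ C1 u, csupp u, q u u < - (alpha ^+ 2 / 4) * dot leb u u &
    forall x, ~~ (sstart N < sc theta x < sstart N * expR (2 * w)) ->
      u x = 0 /\ forall i, 'D_('e_i) u x = 0]].
Proof.
move=> n2.
have si1 : si < 1.
  rewrite lt_neqAle sin_le1 andbT; apply/eqP => s1.
  have := cos2Dsin2 theta; rewrite s1 expr1n; have := exprn_gt0 2 co0; lra.
(* Any number strictly between [si] and 1 would do: [rad <= s * sc] holds at large scale, and
   [d = s^(- 2) - 1] is the relative excess over the Hardy constant. *)
pose s := (1 + si) / 2; have s0 : 0 < s by rewrite divr_gt0// addr_gt0.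
have s1 : s < 1 by rewrite ltr_pdivrMr// mul1r; lra.
pose d := s ^- 2 - 1; have d0 : 0 < d.
  by rewrite subr_gt0 invf_gt1 ?exprn_gt0// exprn_ilt1// ltW.
(* The logarithmic cutoff costs less than [5 / w^2] (as [64 * 17 / 224 < 5]), which 80 makes at most
   [d / 16]. *)
pose w := 1 + 80 / d; have z0 : 0 < 80 / d by rewrite divr_gt0.
have w1 : 1 <= w by rewrite lerDl ltW.
have w0 : 0 < w by exact: lt_le_trans w1.
have w5 : 5 / w ^+ 2 <= d / 16.
  rewrite ler_pdivrMr ?exprn_gt0//; apply: (@le_trans _ _ (d / 16 * w)).
    rewrite (_ : d / 16 * w = d / 16 + 5); last by rewrite /w; field; rewrite gt_eqF.
    by rewrite lerDr divr_ge0// ltW.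
  by rewrite ler_wpM2l ?divr_ge0 ?(ltW d0)// expr2 ler_peMr// ltW.
pose K := 16 * tail_cst alpha * (1 + tail_cst alpha).
have K0 : 0 <= K.
  have t0 := tail_cst_ge0 alpha0.
  by apply: mulr_ge0; [apply: mulr_ge0|apply: addr_ge0].
pose b := expR (2 * w); have b0 : 0 < b := expR_gt0 _.
pose K1 := 16 * (K * b ^+ 2) / d.
have K10 : 0 <= K1 by rewrite divr_ge0 ?(ltW d0)// mulr_ge0// mulr_ge0// sqr_ge0.
(* The terms serve in turn [1 <= N], the support condition, [si + 1 / N <= s], and the transverse
   energy bound [d / 16]. *)
pose N0 := 1 + 3 / si + 2 / (1 - si) + K1.
have e1 : 0 < 3 / si by rewrite divr_gt0.
have e2 : 0 < 2 / (1 - si) by rewrite divr_gt0// subr_gt0.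
exists w, N0; split=> //; first by rewrite /N0; lra.
move=> N HN; rewrite /N0 in HN.
have N1 : 1 <= N by lra.
have Np : 0 < N by exact: lt_le_trans N1.
have Nsi : 3 <= si * N by rewrite mulrC -ler_pdivrMr//; lra.
have NV : si + N^-1 <= s.
  have : N^-1 <= (1 - si) / 2.
    by rewrite -[(1 - si) / 2]invrK lef_pV2 ?posrE ?invr_gt0 ?divr_gt0 ?subr_gt0// invf_div; lra.
  by rewrite /s; lra.
have far := ts_far N1 Nsi; have M0 := tw_gt0 N1; have L1 := ss_ge1 N1.
pose Qs (x : T) := Num.sqrt (lft (sc theta x)).
have hQ : @dfun R n si co Qs (fun x => (2 * Qs x)^-1 * lft1 (sc theta x)).
  by apply: (hdE (hd_sqrt (sdf_lft n theta) (fun x => lft_gt0 _))) => x; ring.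
have hf := tf_Pm n theta M0 0.
have hh := mult_sf w0 N1 hQ.
set h := (fun x => _ * Qs x) in hh; set h' := (fun x => _ + _) in hh.
set f := (fun x => _ ^+ 2) in hf; set f' := (fun x => - _) in hf.
have EQ x : Qs x ^+ 2 = lft (sc theta x) by rewrite sqr_sqrtr// ltW// lft_gt0.
have [w8 w80 Hw8] := Wt_lower th alpha0 M0 far w0 L1 7 n0.
have ec := err_cvg th (envelope_cont (alpha := alpha) th hf hh) (envelope_supp alpha th M0 far hf hh)
  (@envelope_far _ _ _ alpha th _ _ _ M0 far _ _ _ _ hf hh).
pose Cq := 2 * a ^+ 2 + 2 * (a / si).
have Cq0 : 0 < Cq by apply: addr_gt0; apply: mulr_gt0 => //; [exact: exprn_gt0|exact: divr_gt0].
(* The smoothing is fixed after the profile, against the uniform lower bound [w8] of the mass. *)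
have [k Hk] : exists k, Cq * err theta k (envelope alpha f f' h h') < w8 * (d / 8).
  have tgt : 0 < w8 * (d / 8) / Cq by rewrite divr_gt0// mulr_gt0// divr_gt0.
  have /cvgrPdist_lt/(_ _ tgt)[k0 _ Hk0] := ec; exists k0.
  have := Hk0 k0 (leqnn _); rewrite sub0r normrN => /(le_lt_trans (ler_norm _)).
  by rewrite ltr_pdivlMr// mulrC.
pose u x := psi theta alpha k x * (f x * h x).
have [cu su] := trial_C1 alpha th M0 far k hf hh.
exists u; split=> //; last by move=> x hx; exact: (trial_vanish alpha hf hh k hx).
have W8k := Hw8 k; set W8 := Wt _ _ _ _ _ _ _ _ in W8k.
have W80 : 0 < W8 by exact: lt_le_trans W8k.
have [c7 c6 _] := Wt_chain w0 N1 Nsi k; rewrite -/W8 in c7 c6.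
have := trial_energy n0 th alpha0 M0 far hf hh k; rewrite -/a -/c -/u -/Cq.
set E := q u u; set D := dot leb u u.
set Y1 := rint leb (fun x => _ * (f' x ^+ 2 * _)); set Y2 := rint leb (fun x => _ * (f x ^+ 2 * _)).
set Y3 := rint leb (fun x => _ * u x ^+ 2).
have iW j := intg_Wt n alpha th M0 far w0 L1 k j.
have Pm4 (x : T) : 0 <= psi theta alpha k x ^+ 2 * Pm theta (twidth N) x ^+ 4.
  exact: mulr_ge0 (sqr_ge0 _) (exprn_ge0 4 (Pm_ge0 _ _ _)).
(* The derivative of sqrt s contributes the Hardy term 1/4, the cross term is a stream integral and
   vanishes, and [ex^2 Xs^6 = Xs^6 - Xs^7] turns the cutoff term into
   [Wt 6 - Wt 7 = 17 / 224 * Wt 8]. *)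
have y2 : Y2 = W8 * (4^-1 + 64 / w ^+ 2 * (17 / 224)).
  have hX := sf_Xs n theta w0 L1 6.
  have S0 := stream_s alpha th M0 far k (tf_Pm n theta M0 2) hX.
  set F := (fun x => _) in S0.
  have IF : intg leb F.
    apply: (@intg_stream _ _ _ alpha th _ _ _ M0 far) => [||x /(Pm0 M0) ->|x /hX.2[_ ->]] //.
    - exact: contX (@cont_Pm _ _ _ _).
    - exact: dfun_cont (lt0r_neq0 co0) hX.1.
    - by rewrite expr0n.
  have -> : Y2 = 4^-1 * W8 + 2^-1 * rint leb F + 64 / w ^+ 2 * (Wt n theta alpha (twidth N) (sstart N) w k 6 -
      Wt n theta alpha (twidth N) (sstart N) w k 7).
    rewrite -(rintB (iW _) (iW _)) -(rintZ _ (iW 7)) -(rintZ _ IF) -(rintZ _ (intgB (iW 5) (iW 6))).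
    rewrite -(rintD (intgZ _ (iW 7)) (intgZ _ IF)).
    rewrite -(rintD (intgD (intgZ _ (iW 7)) (intgZ _ IF)) (intgZ _ (intgB (iW 5) (iW 6)))).
    apply: rint_ext => x; rewrite /h' /f /F.
    have [->|[_ l0 l1 x2]] := Xs_cases theta w0 L1 x; first by rewrite !expr0n/=; ring.
    have QV : Vs theta x = Qs x ^- 2 by rewrite EQ.
    have Qn : Qs x != 0 by rewrite gt_eqF// sqrtr_gt0 lft_gt0.
    rewrite l1 QV; move: x2; move: (Xs _ _ _ _) (ex _ _ _ _) (Qs x) Qn => X e Q Qn x2.
    have -> : X ^+ 6 = X ^+ 7 + e ^+ 2 * X ^+ 6 by rewrite x2; ring.
    by field; rewrite Qn gt_eqF.
  rewrite S0 c7 c6; field; rewrite gt_eqF//.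
have y1 : Y1 <= d / 16 * W8.
  apply: le_trans (mult_tail w0 N1 Nsi hQ k) _; rewrite -/K.
  rewrite dotu.
  have h2 : rint leb (fun x => psi theta alpha k x ^+ 2 * (Pm theta (twidth N) x ^+ 4 * (Xs theta (sstart N) w x ^+ 4 * Qs x) ^+ 2)) <=
      (sstart N * b) ^+ 2 * W8.
    rewrite -(rintZ _ (iW 7)); apply: rint_le; [exact: intg_u2 w0 N1 Nsi _ _ hQ k|exact: intgZ|move=> x].
    rewrite mulrA [leRHS](_ : _ = psi theta alpha k x ^+ 2 * Pm theta (twidth N) x ^+ 4 *
       ((sstart N * b) ^+ 2 * (Vs theta x * Xs theta (sstart N) w x ^+ 8))); last by ring.
    apply: ler_wpM2l => //; rewrite exprMn EQ -exprM.
    have [->|[/andP[Ls sU] l0 l1 x2]] := Xs_cases theta w0 L1 x.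
      by rewrite !expr0n/= !(mulr0, mul0r).
    have sp : 0 < sc theta x by rewrite (lt_trans _ Ls)// (lt_le_trans ltr01).
    rewrite mulrA [leLHS]mulrC ler_wpM2r ?exprn_ge0 ?Xs_ge0// /Vs l0 ler_pdivlMr// -expr2.
    by rewrite lerXn2r ?nnegrE ?ltW// (lt_trans sp).
  have m4 : 0 <= K * (twidth N)^-1 ^+ 4.
    by rewrite mulr_ge0// exprn_ge0// invr_ge0 ltW.
  apply: le_trans (ler_wpM2l m4 h2) _; rewrite mulrA ler_wpM2r ?(ltW W80)//.
  have -> : K * (twidth N)^-1 ^+ 4 * (sstart N * b) ^+ 2 = K * b ^+ 2 * N^-1 ^+ 4.
    by rewrite /twidth /sstart; field; rewrite gt_eqF.
  have NN : N^-1 ^+ 4 <= N^-1.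
    by rewrite exprS ler_piMr ?invr_ge0 ?(ltW Np)// exprn_ile1 ?invr_ge0 ?(ltW Np)// invf_le1.
  apply: (@le_trans _ _ (K * b ^+ 2 * N^-1)).
    by rewrite ler_wpM2l// mulr_ge0// sqr_ge0.
  rewrite ler_pdivrMr// -ler_pdivrMl ?divr_gt0// invf_div.
  have -> : 16 / d * (K * b ^+ 2) = K1 by rewrite /K1; field; rewrite gt_eqF.
  lra.
have y3 : s ^- 2 * W8 <= Y3.
  rewrite -(rintZ _ (iW 7)); apply: rint_le; first exact: intgZ.
    have cV : continuous (fun x : T => (rad x)^-1) :=
      C1_cont (hd_C1 (hd_inv (@hd_rad R n) (fun x => lt0r_neq0 (rad_gt0 x)))).
    apply/intg_bm/bm_cont; first exact: contM (contX (k := 2) cV) (contX (k := 2) (C1_cont cu)).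
    by apply: csuppMr; exact: csuppX.
  move=> x; have [ox|/(tf_sf_om hf hh)] := pselect (om theta (twidth N) (sstart N) (sstart N * expR (2 * w)) x); last first.
    have sm : 0 <= s ^- 2 by rewrite invr_ge0 sqr_ge0.
    have rm : 0 <= (rad x)^-1 ^+ 2 * u x ^+ 2 := mulr_ge0 (sqr_ge0 _) (sqr_ge0 _).
    move=> [[e _]|[e _]]; apply: le_trans rm.
      have -> : Pm theta (twidth N) x ^+ 4 = f x ^+ 2 by rewrite /f -exprM.
      by rewrite e expr0n/= !(mul0r, mulr0).
    move: e; rewrite /h => /eqP; rewrite mulf_eq0 [X in _ || X]gt_eqF ?sqrtr_gt0 ?lft_gt0// orbF expf_eq0/= => /eqP ->.
    by rewrite expr0n/= !(mulr0, mul0r).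
  have /andP[_ rs] := rad_bounds N1 Nsi ox.
  have [tM /andP[Ls _]] := ox; have sp : 0 < sc theta x by rewrite (lt_trans _ Ls)// (lt_le_trans ltr01).
  have l0 := (lft_id (le_trans L1 (ltW Ls))).1.
  have rp := rad_gt0 x; have rss : rad x <= s * sc theta x.
    by apply: le_trans rs _; rewrite ler_wpM2r// ltW.
  rewrite [leRHS](_ : _ = psi theta alpha k x ^+ 2 * Pm theta (twidth N) x ^+ 4 *
     ((rad x) ^- 2 * lft (sc theta x) * Xs theta (sstart N) w x ^+ 8)); last first.
    by rewrite -EQ /u /f /h exprVn; ring.
  rewrite [leLHS](_ : _ = psi theta alpha k x ^+ 2 * Pm theta (twidth N) x ^+ 4 *
     (s ^- 2 * Vs theta x * Xs theta (sstart N) w x ^+ 8)); last by ring.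
  apply: ler_wpM2l => //; apply: ler_wpM2r; first exact: exprn_ge0 (Xs_ge0 _ _ _ _).
  rewrite /Vs l0 -ler_pdivrMr// -mulrA -invfM -expr2 -invfM -exprMn lef_pV2 ?posrE ?exprn_gt0 ?(mulr_gt0 s0 sp)//.
  by rewrite lerXn2r ?nnegrE ?(ltW rp) ?(ltW (mulr_gt0 s0 sp)).
(* Balance in units of [W8]: at most [d/16] across the cone, [1/4 + d/16] along it and strictly less
   than [d/8] from smoothing, against a gain of at least [(1 + d) / 4]. *)
have cE : c * (n%:R - 2 - c) = - 4^-1 by rewrite /c n2; field.
rewrite cE y2 => h1.
have h2 := ler_wpM2r (ltW W80) w5.
have h3 : W8 * (64 / w ^+ 2 * (17 / 224)) <= 5 / w ^+ 2 * W8.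
  rewrite mulrC ler_wpM2r ?(ltW W80)// mulrAC ler_wpM2r ?invr_ge0 ?sqr_ge0//; lra.
have h4 : w8 * (d / 8) <= W8 * (d / 8) by rewrite ler_wpM2r// divr_ge0// ltW.
have h5 : s ^- 2 = d + 1 by rewrite /d; ring.
rewrite h5 in y3; have -> : alpha ^+ 2 / 4 = a ^+ 2 by rewrite /a; field.
move: h1 h2 h3 h4 y1 y3 Hk; rewrite -/Cq; move: (Cq * _) => er; rewrite mulNr; lra.
Qed.

End trial_families.

(** * Singular sequences above the threshold *)

Section weyl_sequences.
Context {R : realType} (n : nat) (theta alpha : R).
Hypothesis n0 : (0 < n)%N.
Hypothesis th : 0 < theta < pi / 2.
Hypothesis alpha0 : 0 < alpha.
Local Notation leb := (lebesgue_rV R n.+1).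
Local Notation T := ('rV[R]_n.+1).
Implicit Types (f g h v : T -> R) (x : T).
Local Notation si := (sin theta).
Local Notation co := (cos theta).

Let si0 : 0 < si := sin_theta_gt0 th.
Let co0 : 0 < co := cos_theta_gt0 th.
Let a := alpha / 2.
Local Notation q := (@qfc R n theta alpha).
Local Notation sdf := (@dfun R n si co).

Lemma sfD L U f f' g g' : sf theta L U f f' -> sf theta L U g g' ->
  sf theta L U (fun x => f x + g x) (fun x => f' x + g' x).
Proof.
move=> [hf vf] [hg vg]; split=> [|x Hx]; first exact: dfunD.
by have [-> ->] := vf x Hx; have [-> ->] := vg x Hx; rewrite addr0.
Qed.

Lemma sfZ L U b f f' : sf theta L U f f' -> sf theta L U (fun x => b * f x) (fun x => b * f' x).
Proof.
move=> [hf vf]; split=> [|x Hx]; first exact: dfunZ.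
by have [-> ->] := vf x Hx; rewrite !mulr0.
Qed.

Section fixed_scale.
Variables p N : R.
Hypothesis p0 : 0 <= p.
Hypothesis N1 : 1 <= N.
Hypothesis Nsi : 3 <= si * N.
Local Notation M := (twidth N).
Local Notation L := (sstart N).
Local Notation U := (L * expR (2 * 1)).
Local Notation Xs := (@Xs R n theta L 1).
Local Notation Vs := (@Vs R n theta).
Local Notation ex := (@ex R n theta L 1).
Local Notation Pm := (@Pm R n theta M).
Local Notation W8 k := (Wt n theta alpha M L 1 k 8).

Let far := ts_far N1 Nsi.
Let M0 := tw_gt0 N1.
Let L1 := ss_ge1 N1.
Let w0 : 0 < 1 :> R := ltr01.
Let hf := tf_Pm n theta M0 0.
Let f x := Pm x ^+ 2.
Let f' x := - (2%:R * Pm x ^+ 1 * (2 * M^-1 ^+ 2 * tc theta x)).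

Section multiplier.
Variables m m1 : T -> R.
Hypothesis hm : sdf m m1.
Hypothesis hm1 : sdf m1 (fun x => - p ^+ 2 * m x).
Hypothesis m_le : forall x, `|m x| <= 1.
Hypothesis m1_le : forall x, `|m1 x| <= p.

Let h x := Xs x ^+ 4 * m x.
Let h' x := - (4 * Xs x ^+ 3 * (2 * 1^-1 * (ex x * Vs x))) * m x + Xs x ^+ 4 * m1 x.
Let hh : sf theta L U h h' := mult_sf w0 N1 hm.

Definition wtrial k x : R := psi theta alpha k x * (f x * h x).
Definition wenv : T -> R := envelope alpha f f' h h'.

Let A x := ex x * Xs x ^+ 3 * Vs x.
Let A' x := (1^-1 * Vs x * ((2 * 3%:R + 1) * Xs x ^+ 3 - 2 * 3%:R * Xs x ^+ 2)) * Vs x +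
  ex x * Xs x ^+ 3 * (- Vs x ^+ 2 * lft1 (sc theta x)).
Let h'' x := - p ^+ 2 * h x - 8 * (A' x * m x + 2 * A x * m1 x).

Lemma mult_sf2 : sf theta L U h' h''.
Proof.
have hA : sf theta L U A A' := sfM (sf_exXs n theta w0 L1 1) (sdf_Vs n theta).
have h1 := sfD (sfM (sfZ (-8) hA) hm) (sfM (sf_Xs n theta w0 L1 2) hm1).
by apply: (sfE h1) => x; rewrite /h' /h'' /h /A ?invr1; ring.
Qed.

(** The cutoff varies on the scale of s, so [h'' + p^2 h] is [O(1 / s)]. In [curv_le], 8 is the
    common factor of the cutoff's derivatives, 14 bounds [7 X - 6 - e X], and [2 p] comes from the
    cross term with the derivative of the wave. *)
Definition curv_cst : R := (8 * (14 + 2 * p)) ^+ 2.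

Lemma curv_le x : (h'' x + p ^+ 2 * h x) ^+ 2 <= curv_cst * L^-1 * (Vs x * Xs x ^+ 4).
Proof.
have -> : h'' x + p ^+ 2 * h x = - 8 * (A' x * m x + 2 * A x * m1 x) by rewrite /h''; ring.
have L0 : 0 < L := lt_le_trans ltr01 L1.
rewrite /A /A'; have [->|[/andP[Ls _] l0 l1 x2]] := Xs_cases theta w0 L1 x.
  by rewrite !expr0n/= !(mulr0, mul0r, addr0, subr0) expr0n.
have s0 : 0 < sc theta x by exact: lt_trans Ls.
have V0 : 0 < Vs x := Vs_gt0 _ _.
have VL : Vs x <= L^-1 by rewrite (_ : Vs x = (lft (sc theta x))^-1)// l0 lef_pV2 ?posrE// ltW.
have X0 := Xs_ge0 theta L 1 x; have X1 := Xs_le1 theta L 1 x.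
have e1 : `|ex x| <= 1.
  rewrite -(@ler_pXn2r _ 2)// ?nnegrE// expr1n real_normK ?num_real// x2.
  by rewrite gerBl.
rewrite l1 invr1 mulr1 mul1r; have ml := m_le x; have m1l := m1_le x.
move: (Vs x) (Xs x) (ex x) (m x) (m1 x) V0 VL X0 X1 e1 ml m1l => V X e y z V0 VL X0 X1 e1 ml m1l.
have V1 : V <= 1 by apply: le_trans VL _; rewrite invf_le1.
have XX : 0 <= X ^+ 2 := sqr_ge0 X.
have b1 : `|(7 * X - 6 - e * X) * y| <= 14.
  rewrite normrM -[14]mulr1 ler_pM//; move: e1; rewrite ler_norml => /andP[u1 u2].
  by rewrite ler_norml; apply/andP; split; nra.
have b2 : `|e * X * z| <= p.
  rewrite normrM -[p]mul1r ler_pM// normrM (ger0_norm X0) mulr_ile1//.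
have E : `|V * ((7 * X - 6 - e * X) * y) + 2 * (e * X * z)| <= 14 + 2 * p.
  rewrite (le_trans (ler_normD _ _))// lerD//; last by rewrite normrM ger0_norm// ler_pM2l.
  by rewrite normrM (gtr0_norm V0) -[14]mul1r ler_pM// ltW.
rewrite [leLHS](_ : _ = (8 * (V * ((7 * X - 6 - e * X) * y) + 2 * (e * X * z))) ^+ 2 * (V * (V * X ^+ 4))); last by ring.
rewrite -[leRHS]mulrA; apply: ler_pM.
- exact: sqr_ge0.
- by rewrite mulr_ge0 ?(ltW V0)// mulr_ge0 ?(ltW V0)// exprn_ge0.
- rewrite -[leLHS]real_normK ?num_real// /curv_cst lerXn2r ?nnegrE//.
    by rewrite mulr_ge0// addr_ge0// mulr_ge0.
  by rewrite normrM ger0_norm// ler_pM2l.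
by rewrite ler_wpM2r// mulr_ge0 ?(ltW V0)// exprn_ge0.
Qed.

Lemma wtrial_C1 k : C1 (wtrial k) /\ csupp (wtrial k).
Proof. exact: (trial_C1 alpha th M0 far k hf hh). Qed.

Lemma wenv_cvg : err theta k wenv @[k --> \oo] --> (0 : R).
Proof.
exact: (err_cvg th (envelope_cont (alpha := alpha) th hf hh) (envelope_supp alpha th M0 far hf hh)
  (@envelope_far _ _ _ alpha th _ _ _ M0 far _ _ _ _ hf hh)).
Qed.

(** The transverse and centrifugal errors are [O(1 / N)] relative to the norm; the curvature error
    is kept as a multiple of [W8 / L] and compared with the norm only once the wave is chosen. *)
Lemma wtrial_bound k v : C1 v -> csupp v ->
  (q (wtrial k) v - (p ^+ 2 - a ^+ 2) * dot leb (wtrial k) v) ^+ 2 <=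
  weak_cst n theta alpha * ((16 * tail_cst alpha * (1 + tail_cst alpha) + 1) * N^-1 *
    dot leb (wtrial k) (wtrial k) + 2 * curv_cst * L^-1 * W8 k + err theta k wenv) *
  rint leb (fun x => v x ^+ 2 + \sum_i ('D_('e_i) v x) ^+ 2).
Proof.
move=> cv sv; apply: le_trans (weak_bound n0 th alpha0 M0 far hf hh k (p ^+ 2) mult_sf2 cv sv) _.
have [cu su] := wtrial_C1 k.
have Np : 0 < N by exact: lt_le_trans N1.
have NV0 : 0 <= N^-1 by rewrite invr_ge0 ltW.
have NV1 : N^-1 <= 1 by rewrite invf_le1.
have Npow j : N^-1 ^+ j.+1 <= N^-1 by rewrite exprS ler_piMr// exprn_ile1.
have t0 := tail_cst_ge0 alpha0.
have K0 : 0 <= 16 * tail_cst alpha * (1 + tail_cst alpha).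
  by apply: mulr_ge0; [apply: mulr_ge0|apply: addr_ge0].
have D0 := dot_ge0 leb (wtrial k).
have wc0 : 0 <= weak_cst n theta alpha.
  have e4 : 0 <= (alpha / 2) ^+ 4 by rewrite exprn_ge0// divr_ge0// ltW.
  rewrite /weak_cst; apply: mulr_ge0 => //; rewrite !addr_ge0 ?sqr_ge0//.
  - by rewrite mulr_ge0 ?sqr_ge0.
  - by rewrite mulr_ge0.
  - by rewrite mulr_ge0 ?sqr_ge0.
apply: ler_wpM2r.
  by apply: rint_ge0 => x; rewrite addr_ge0 ?sqr_ge0// sumr_ge0// => i _; exact: sqr_ge0.
apply: ler_wpM2l => //; rewrite -/wenv lerD2r addrAC; apply: lerD; last first.
  have iW := intg_Wt n alpha th M0 far w0 L1 k 3.
  have [_ _ c4] := Wt_chain n alpha th w0 N1 Nsi k.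
  have cc0 : 0 <= curv_cst * L^-1.
    by rewrite mulr_ge0 ?sqr_ge0// invr_ge0 ltW// (lt_le_trans ltr01).
  apply: (@le_trans _ _ (curv_cst * L^-1 * Wt n theta alpha M L 1 k 4)); last first.
    by apply: le_trans (ler_wpM2l cc0 c4) _; rewrite le_eqVlt; apply/orP; left; apply/eqP; ring.
  rewrite /Wt -(rintZ _ iW); apply: rint_le; last 2 first.
  - exact: intgZ.
  - move=> x; rewrite [leRHS]mulrCA; apply: ler_wpM2l; first exact: sqr_ge0.
    rewrite [leRHS]mulrCA /f -exprM; apply: ler_wpM2l; first exact: exprn_ge0 (Pm_ge0 _ _ _).
    exact: curv_le.
  apply: (@intg_stream _ _ _ alpha th M L U M0 far) => [||x /hf.2[-> _]|x xs].
  - exact: contX (C1_cont (hd_C1 hf.1)).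
  - apply: contX; apply: contD; first exact: dfun_cont (lt0r_neq0 co0) mult_sf2.1.
    by apply: contM; [exact: cont_cst|exact: C1_cont (hd_C1 hh.1)].
  - by rewrite expr0n.
  - by have [_ ->] := mult_sf2.2 x xs; have [-> _] := hh.2 x xs; rewrite mulr0 addr0 expr0n.
rewrite [leRHS](_ : _ = 16 * tail_cst alpha * (1 + tail_cst alpha) * N^-1 *
  dot leb (wtrial k) (wtrial k) + N^-1 * dot leb (wtrial k) (wtrial k)); last by ring.
apply: lerD.
  apply: le_trans (mult_tail th alpha0 w0 N1 Nsi hm k) _.
  rewrite ler_wpM2r// ler_wpM2l// /twidth -exprVn -exprM; exact: Npow.
rewrite -(rintZ _ (bm_sq (bm_cont (C1_cont cu) su)).2).
have cV : continuous (fun x : T => (rad x)^-1) :=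
  C1_cont (hd_C1 (hd_inv (@hd_rad R n) (fun x => lt0r_neq0 (rad_gt0 x)))).
apply: rint_le => [||x].
- apply/intg_bm/bm_cont; first exact: contM (contX (k := 4) cV) (contX (k := 2) (C1_cont cu)).
  by apply: csuppMr; exact: csuppX.
- exact: intgZ (bm_sq (bm_cont (C1_cont cu) su)).2.
have [ox|ox] := pselect (om theta M L U x); last first.
  have z0 : wtrial k x = 0.
    by rewrite /wtrial /f; have [[-> _]|[-> _]] := tf_sf_om hf hh ox; rewrite ?mul0r !mulr0.
  by rewrite z0 [leLHS](_ : _ = (rad x)^-1 ^+ 4 * wtrial k x ^+ 2)// z0 expr0n/= !mulr0.
rewrite ler_wpM2r ?sqr_ge0//; have /andP[Nr _] := rad_bounds th N1 Nsi ox.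
apply: le_trans (Npow 3%N); rewrite lerXn2r ?nnegrE ?invr_ge0 ?(ltW (rad_gt0 x)) ?(ltW Np)//.
by rewrite lef_pV2 ?posrE ?rad_gt0.
Qed.

Lemma dot_wtrial k : dot leb (wtrial k) (wtrial k) =
  rint leb (fun x => psi theta alpha k x ^+ 2 * (Pm x ^+ 4 * (Xs x ^+ 4 * m x) ^+ 2)) /\
  intg leb (fun x => psi theta alpha k x ^+ 2 * (Pm x ^+ 4 * (Xs x ^+ 4 * m x) ^+ 2)).
Proof.
split; first by rewrite /wtrial /f /h dotu.
exact: (intg_u2 alpha th w0 N1 Nsi hm k).
Qed.

End multiplier.
End fixed_scale.

Lemma sdf_sin p : sdf (fun x => sin (p * sc theta x)) (fun x => p * cos (p * sc theta x)).
Proof.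
have h := dfun_comp (p := @sin R) (p' := @cos R) (dfunZ p (sdf_sc n theta))
  (@is_derive_sin R) (@continuous_cos R).
by apply: (dfunE h) => x; rewrite mulr1 mulrC.
Qed.

Lemma sdf_cos p : sdf (fun x => cos (p * sc theta x)) (fun x => - p * sin (p * sc theta x)).
Proof.
have cs : continuous (fun y : R => - sin y) := contN (@continuous_sin R).
have h := dfun_comp (p := @cos R) (dfunZ p (sdf_sc n theta)) (@is_derive_cos R) cs.
by apply: (dfunE h) => x; rewrite mulr1; ring.
Qed.

(** The real and imaginary parts of a plane wave of frequency [p = sqrt (E + a^2)] along the
    generators are tried separately. Either could be small in norm on the chosen region, but not
    both. *)
Lemma weyl_trial (E e : R) : - (alpha ^+ 2 / 4) <= E -> 0 < e -> exists u : T -> R,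
  [/\ C1 u, csupp u, 0 < dot leb u u & forall v, C1 v -> csupp v ->
    (q u v - E * dot leb u v) ^+ 2 <= e * dot leb u u *
      rint leb (fun x => v x ^+ 2 + \sum_i ('D_('e_i) v x) ^+ 2)].
Proof.
move=> Ea e0; pose p := Num.sqrt (E + a ^+ 2).
have aE : alpha ^+ 2 / 4 = a ^+ 2 by rewrite /a; field.
have pE : p ^+ 2 - a ^+ 2 = E by rewrite sqr_sqrtr ?addrK// -aE; lra.
have p0 : 0 <= p := sqrtr_ge0 _.
pose W := weak_cst n theta alpha; pose K := 16 * tail_cst alpha * (1 + tail_cst alpha).
have t0 := tail_cst_ge0 alpha0.
have K0 : 0 <= K by apply: mulr_ge0; [apply: mulr_ge0|apply: addr_ge0].
pose C := curv_cst p; have C0 : 0 <= C := sqr_ge0 _.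
have W0 : 0 < W.
  have e4 : 0 <= (alpha / 2) ^+ 4 by rewrite exprn_ge0// divr_ge0// ltW.
  rewrite /W /weak_cst mulr_gt0//.
  set z1 := _ ^+ 2; set z2 := _ ^+ 2; set z3 := _ ^+ 2.
  have : 0 <= z1 /\ 0 <= z2 /\ 0 <= z3 by split; [|split]; exact: sqr_ge0.
  by move=> [q1 [q2 q3]]; lra.
(* With [N >= Z] the errors of order [1 / N] take at most half of [e]; the smoothing error takes the
   other half. *)
pose Z := 2 * W * (K + 1 + 4 * C) / e.
have KC : 0 <= K + 1 + 4 * C by apply: addr_ge0; [exact: addr_ge0|exact: mulr_ge0].
have Z0 : 0 <= Z.
  exact: divr_ge0 (mulr_ge0 (mulr_ge0 (ler0n R 2) (ltW W0)) KC) (ltW e0).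
pose N := 1 + 3 / si + Z.
have s3 : 0 < 3 / si by rewrite divr_gt0.
have N1 : 1 <= N by rewrite /N; lra.
have Np : 0 < N by exact: lt_le_trans N1.
have Nsi : 3 <= si * N by rewrite mulrC -ler_pdivrMr// /N; lra.
have NZ : W * (K + 1 + 4 * C) * N^-1 <= e / 2.
  rewrite ler_pdivrMr//; apply: (@le_trans _ _ (e / 2 * Z)).
    by rewrite /Z le_eqVlt; apply/orP; left; apply/eqP; field; rewrite gt_eqF.
  by rewrite ler_pM2l ?divr_gt0// /N; lra.
have far := ts_far N1 Nsi; have M0 := tw_gt0 N1; have L1 := ss_ge1 N1.
have L0 : 0 < sstart N := lt_le_trans ltr01 L1.
have LN : (sstart N)^-1 <= N^-1.
  by rewrite lef_pV2 ?posrE// /sstart exprS ler_peMr ?(ltW Np)// exprn_ege1.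
have [w8 w80 Hw8] := Wt_lower th alpha0 M0 far ltr01 L1 7 n0.
have pick m m1 (hm : sdf m m1) (hm1 : sdf m1 (fun x => - p ^+ 2 * m x)) k :
    (forall x, `|m x| <= 1) -> (forall x, `|m1 x| <= p) ->
    W * err theta k (wenv N m m1) <= e / 4 * w8 ->
    sstart N * Wt n theta alpha (twidth N) (sstart N) 1 k 8 <= 2 * dot leb (wtrial N m k) (wtrial N m k) ->
    exists u : T -> R, [/\ C1 u, csupp u, 0 < dot leb u u & forall v, C1 v -> csupp v ->
    (q u v - E * dot leb u v) ^+ 2 <= e * dot leb u u *
      rint leb (fun x => v x ^+ 2 + \sum_i ('D_('e_i) v x) ^+ 2)].
  move=> ml m1l He HD; exists (wtrial N m k).
  have [cu su] := wtrial_C1 N1 Nsi hm k.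
  have W8k := Hw8 k; set W8 := Wt _ _ _ _ _ _ _ _ in HD W8k.
  set D := dot leb _ _ in HD *.
  have W80 : 0 < W8 by exact: lt_le_trans W8k.
  have LW : W8 <= sstart N * W8 by rewrite ler_peMl// ltW.
  have D8 : w8 <= 2 * D by lra.
  split=> //; first lra.
  move=> v cv sv; rewrite -pE.
  apply: le_trans (wtrial_bound p0 N1 Nsi hm hm1 ml m1l k cv sv) _; apply: ler_wpM2r.
    by apply: rint_ge0 => x; rewrite addr_ge0 ?sqr_ge0// sumr_ge0// => i _; exact: sqr_ge0.
  rewrite -/K -/C -/W -/D -/W8.
  have h1 : (sstart N)^-1 * W8 <= 2 * N^-1 * D.
    apply: (@le_trans _ _ ((sstart N)^-1 * (2 * D))).
      by rewrite ler_pM2l ?invr_gt0//; apply: le_trans LW HD.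
    rewrite mulrA [_ * 2]mulrC; apply: ler_wpM2r; first lra.
    by rewrite ler_pM2l.
  have h2 := ler_wpM2l (mulr_ge0 (ltW W0) C0) h1.
  have D0 : 0 <= D by lra.
  have h3 := ler_wpM2r D0 NZ; have h4 := ler_wpM2l (ltW e0) D8.
  move: He h2 h3 h4; move: (err _ _ _) => er; move: (N^-1) ((sstart N)^-1) => y l; lra.
have cs1 p' x : `|p' * cos (p * sc theta x)| <= `|p'|.
  by rewrite normrM ler_piMr// cos_max.
have hc1 : sdf (fun x => - p * sin (p * sc theta x)) (fun x => - p ^+ 2 * cos (p * sc theta x)).
  by apply: (dfunE (dfunZ (- p) (sdf_sin p))) => x; ring.
have hs1 : sdf (fun x => p * cos (p * sc theta x)) (fun x => - p ^+ 2 * sin (p * sc theta x)).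
  by apply: (dfunE (dfunZ p (sdf_cos p))) => x; ring.
have ec := wenv_cvg N1 Nsi (sdf_cos p); have es := wenv_cvg N1 Nsi (sdf_sin p).
set Ec := wenv _ _ _ in ec; set Es := wenv _ _ _ in es.
have [k [Hc Hs]] : exists k, W * err theta k Ec <= e / 4 * w8 /\ W * err theta k Es <= e / 4 * w8.
  have tgt : 0 < e / 4 * w8 / W by rewrite divr_gt0// mulr_gt0// divr_gt0.
  have /cvgrPdist_lt/(_ _ tgt)[k1 _ Hk1] := ec; have /cvgrPdist_lt/(_ _ tgt)[k2 _ Hk2] := es.
  exists (maxn k1 k2); have := Hk1 _ (leq_maxl k1 k2); have := Hk2 _ (leq_maxr k1 k2).
  rewrite !sub0r !normrN => /ltW h2 /ltW h1.
  split; rewrite mulrC -ler_pdivlMr//; [apply: le_trans h1|apply: le_trans h2]; exact: ler_norm.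
pose uc := wtrial N (fun x => cos (p * sc theta x)) k.
pose us := wtrial N (fun x => sin (p * sc theta x)) k.
(* [cos^2 + sin^2 = 1] removes the oscillation, and [s > L] on the support turns the weight 1 into
   at least [L / s]. *)
have HD : sstart N * Wt n theta alpha (twidth N) (sstart N) 1 k 8 <= dot leb uc uc + dot leb us us.
  have [-> Ic] := dot_wtrial N1 Nsi (sdf_cos p) k; have [-> Is] := dot_wtrial N1 Nsi (sdf_sin p) k.
  have iW := intg_Wt n alpha th M0 far ltr01 L1 k 7.
  rewrite -(rintD Ic Is) /Wt -(rintZ _ iW); apply: rint_le; [exact: intgZ|exact: intgD|move=> x].
  rewrite [leRHS](_ : _ = psi theta alpha k x ^+ 2 * (Pm theta (twidth N) x ^+ 4 *
     (Xs theta (sstart N) 1 x ^+ 8 * (cos (p * sc theta x) ^+ 2 + sin (p * sc theta x) ^+ 2)))); last by ring.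
  rewrite cos2Dsin2 mulr1 [leLHS]mulrCA ler_wpM2l ?sqr_ge0// [leLHS]mulrCA.
  apply: ler_wpM2l; first exact: exprn_ge0 (Pm_ge0 _ _ _).
  have [->|[/andP[Ls _] l0 _ _]] := Xs_cases theta ltr01 L1 x; first by rewrite expr0n/= !mulr0.
  rewrite mulrA ler_piMl ?exprn_ge0 ?Xs_ge0// /Vs l0 ler_pdivrMr ?mul1r ?(ltW Ls)//.
  exact: lt_trans Ls.
have [hD|hD] := leP (dot leb us us) (dot leb uc uc).
  apply: (pick _ _ (sdf_cos p) hc1 k) => // [x|x|].
  - exact: cos_max.
  - by rewrite normrM normrN (ger0_norm p0) ler_piMr// sin_max.
  - by apply: le_trans HD _; rewrite -/uc; lra.
apply: (pick _ _ (sdf_sin p) hs1 k) => // [x|x|].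
- exact: sin_max.
- by apply: le_trans (cs1 p x) _; rewrite ger0_norm.
- by apply: le_trans HD _; rewrite -/us; lra.
Qed.

End weyl_sequences.

(** * Spectrum of the delta operator *)

Section delta_spectrum.
Context {R : realType} (n : nat) (theta alpha : R).
Hypothesis n0 : (0 < n)%N.
Hypothesis th : 0 < theta < pi / 2.
Hypothesis alpha0 : 0 < alpha.
Local Notation leb := (lebesgue_rV R n.+1).
Local Notation T := ('rV[R]_n.+1).
Local Notation q := (@qfc R n theta alpha).
Local Notation A := (delta_operator R n alpha theta).

Let cf := qfc_closed n theta alpha.
Let AH := delta_operatorP alpha n0 th.

Lemma delta_ray (E : R) : - (alpha ^+ 2 / 4) <= E -> spectrum leb A E%:C.
Proof.
move=> aE; apply: (weyl_spectrum cf AH) => e e0.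
have [|u [cu su D0 Hu]] := weyl_trial n0 th alpha0 aE (_ : 0 < e / 2); first by rewrite divr_gt0.
have [Hru _] := C1_H1r cu su; exists u => //; split=> // v Hv.
have msg := @sgn_cone_meas R n theta; have sg1 := @sgn_cone_le1 R n theta.
set c := 2 * _; pose F w := e * dot leb u u * form_norm (dot leb) q c w w.
apply: (test_extend (q1 := fun w => (q u w - E * dot leb u w) ^+ 2) (q2 := F)) Hv => [{}v s Hv Hs sv|w tw].
  have uu : sip_cvg (@h1dot R n.+1) (fun=> u) u.
    move=> r r0; exists 0%N => i _; rewrite subrr (_ : h1dot 0 0 = 0)//.
    exact: (sip0l (@h1_sip R n.+1) (ss0 (sip_ss (@h1_sip R n.+1)))).
  have [c1 [c2 _]] := cvg_qform ord_max (alpha / (2 * sin theta)) msg sg1 Hru Hv (fun=> Hru) Hs uu sv.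
  have [d1 [d2 _]] := cvg_qform ord_max (alpha / (2 * sin theta)) msg sg1 Hv Hv Hs Hs sv sv.
  have cl : q u (s k) - E * dot leb u (s k) @[k --> \oo] --> q u v - E * dot leb u v.
    by apply: cvgB => //; apply: cvgM => //; exact: cvg_cst.
  split; first exact: (cvgM cl cl).
  apply: cvgM; first exact: cvg_cst.
  by apply: cvgD => //; apply: cvgM => //; exact: cvg_cst.
have cw := test_C1 tw; have sw := test_supp tw; have Hw := test_H1r tw.
apply: le_trans (Hu w cw sw) _.
have -> : rint leb (fun x => w x ^+ 2 + \sum_i ('D_('e_i) w x) ^+ 2) = h1dot w w.
  have Id i : intg leb (fun x => ('D_('e_i) w x) ^+ 2) := (bm_sq (bm_d i cw sw)).2.
  rewrite /h1dot gdot_C1// (rintD (bm_sq (bm_cont (C1_cont cw) sw)).2 (intg_sum _ Id)) (rint_sum _ Id).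
  by [].
have := form_norm_ge ord_max (alpha / (2 * sin theta)) msg sg1 Hw; rewrite -/c -/q => h.
have := ler_wpM2l (mulr_ge0 (ltW e0) (ltW D0)) h; rewrite /F; lra.
Qed.

Lemma delta_essential :
  essential_spectrum leb A = [set x%:C | x in `[- (alpha ^+ 2 / 4), +oo[].
Proof. by apply: (essential_ray cf AH delta_ray) => E; exact: comp_form. Qed.

Lemma delta_discrete0 : (3 <= n)%N -> discrete_spectrum leb A = set0.
Proof. by move=> n3; apply: (discrete_empty cf AH delta_ray) => u; exact: hardy_form. Qed.

Lemma delta_infinite : n = 2%N -> infinite_set (discrete_spectrum leb A).
Proof.
move=> n2; apply: (infinite_discrete cf AH (E0 := - (alpha ^+ 2 / 4))) => [E|k]; first exact: comp_form.
have [w [N0 [w0 N01 HN]]] := negative_trial n0 th alpha0 n2.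
(* The starting points [N^4] grow by [exp (4 w)], more than the ratio [exp (2 w)] of the end points
   of one support interval, so the trial functions have disjoint supports and are orthogonal for
   both forms. *)
pose N (i : nat) : R := N0 * expR (w * i%:R).
have NN i : N0 <= N i.
  by rewrite ler_peMr ?(le_trans ler01 N01)// -expR0 ler_expR mulr_ge0// ltW.
have /choice[t Ht] := fun i => HN (N i) (NN i).
exists t; split=> [i _|i j _ _ ij].
  by have [cu su qu _] := Ht i; split=> //; case: (C1_H1r cu su).
have sep a b (x : T) : (a < b)%N -> sstart (N a) < sc theta x < sstart (N a) * expR (2 * w) ->
    ~~ (sstart (N b) < sc theta x < sstart (N b) * expR (2 * w)).
  move=> ab /andP[_ h]; apply/negP => /andP[h' _]; have := lt_trans h' h; rewrite ltNge => /negP; apply.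
  have E4 i' : sstart (N i') = N0 ^+ 4 * expR (4 * (w * i'%:R)).
    by rewrite /sstart /N exprMn -expRM_natl.
  rewrite !E4 -mulrA ler_wpM2l ?exprn_ge0 ?(le_trans ler01 N01)// -expRD ler_expR.
  have : a.+1%:R <= b%:R :> R by rewrite ler_nat.
  by move=> /(ler_wpM2l (ltW w0)); rewrite -natr1; lra.
have vanish x : (t i x = 0 /\ forall l, 'D_('e_l) (t i) x = 0) \/
    (t j x = 0 /\ forall l, 'D_('e_l) (t j) x = 0).
  have [_ _ _ vi] := Ht i; have [_ _ _ vj] := Ht j.
  have [Hi|Hi] := boolP (sstart (N i) < sc theta x < sstart (N i) * expR (2 * w)); last by left; exact: vi.
  have [ltij|] := ltnP i j; first by right; apply: vj; exact: sep ltij Hi.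
  rewrite leq_eqVlt eq_sym (negbTE ij)/= => ji.
  by right; apply: vj; apply/negP => /(sep _ _ _ ji); rewrite Hi.
have [ci si _ _] := Ht i; have [cj sj _ _] := Ht j; split; last first.
  rewrite /dot -[RHS](@rint0 _ _ _ leb); apply: rint_ext => x.
  by have [[-> _]|[-> _]] := vanish x; rewrite ?mul0r ?mulr0.
rewrite C1_qform// [X in X + _](_ : _ = 0) ?[X in _ * X](_ : _ = 0) ?mulr0 ?addr0//.
- rewrite -[RHS](@rint0 _ _ _ leb); apply: rint_ext => x.
  by have [[-> ->]|[-> ->]] := vanish x; rewrite !(mul0r, mulr0, addr0).
- rewrite -[RHS](@rint0 _ _ _ leb); apply: rint_ext => x; rewrite big1// => l _.
  by have [[_ ->]|[_ ->]] := vanish x; rewrite ?mul0r ?mulr0.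
Qed.

End delta_spectrum.

Theorem theorem1p2 (R : realType) (alpha theta : R)
    (halpha : 0 < alpha) (htheta : 0 < theta < pi / 2) :
  [/\ forall n : nat, (3 <= n.+1)%N ->
        essential_spectrum (lebesgue_rV R n.+1) (delta_operator R n alpha theta)
        = [set x%:C | x in `[- (alpha ^+ 2 / 4), +oo[],
      infinite_set
        (discrete_spectrum (lebesgue_rV R 3) (delta_operator R 2 alpha theta)) &
      forall n : nat, (4 <= n.+1)%N ->
        discrete_spectrum (lebesgue_rV R n.+1) (delta_operator R n alpha theta)
        = set0].
Proof.
split=> [n n3||n n4].
- by apply: delta_essential => //; case: n n3.
- exact: delta_infinite.
- by apply: delta_discrete0 => //; case: n n4.
Qed.
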